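(* Let $n\ge2$ and $\varepsilon>0$. If $Q$ is one of the null forms $$Q_0(\phi,\psi):=\phi_t\psi_t-\nabla\phi\cdot\nabla\psi,\qquad Q_{\alpha\beta}(\phi,\psi):=\partial_\alpha\phi\,\partial_\beta\psi-\partial_\beta\phi\,\partial_\alpha\psi\quad(0\le\alpha,\beta\le n),$$ and $\phi,\psi$ are free waves, then $$\|Q(\phi,\psi)\|_{L^2_{t,x}([0,1]\times\mathbf{R}^n)}\lesssim E\big(\langle D\rangle^{\frac{n-1}{2}+\varepsilon}\phi\big)^{1/2}E(\psi)^{1/2}.$$
   Context: A free wave is a (possibly finite-dimensional vector-valued, complex) solution $\phi(x,t)$ on $\mathbf{R}^{n}\times\mathbf{R}$ of $\Box\phi=(-\partial_t^2+\Delta)\phi=0$ that is Schwartz in $x$ for each $t$. For vector-valued waves, products are read componentwise (all products of components), with constants allowed to depend on the number of components. $\nabla$ is the spatial gradient, $\partial_0=\partial_t$, and $\partial_1,\dots,\partial_n$ are the spatial derivatives. The energy is $E(\phi)=\frac12\int_{\mathbf{R}^n}|\nabla\phi(x,t)|^2+|\phi_t(x,t)|^2\,dx$, independent of $t$ for free waves. $\langle D\rangle$ is the spatial Fourier multiplier with symbol $(1+|\xi|^2)^{1/2}$. $A\lesssim B$ means $A\le CB$ with $C$ depending only on $n$ and $\varepsilon$. *)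

(* Defs.v *)
From HB Require Import structures.
From mathcomp Require Import all_boot all_order all_algebra.
From mathcomp Require Import all_classical all_reals all_analysis.
From mathcomp Require Import complex.

Set Implicit Arguments.
Unset Strict Implicit.
Unset Printing Implicit Defensive.
Import Order.TTheory GRing.Theory Num.Theory.
Import numFieldNormedType.Exports.
Local Open Scope classical_set_scope.
Local Open Scope ring_scope.

(* The library has Lebesgue measure on R and binary products only.  Lebesgue
   measure on R^n is built here by recursion on n, on n.-tuple R with its
   product sigma-algebra: the measure on R^(n+1) is the image of the product
   measure on R * R^n under (t, v) |-> t :: v. *)
Section LebesgueTuple.
Context {R : realType}.

Local Notation RT n := (n.-tuple (measurableTypeR R)).

Definition tcons n (p : measurableTypeR R * RT n) : RT n.+1 :=
  [the n.+1.-tuple (measurableTypeR R) of p.1 :: p.2].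

Lemma measurable_tcons n : measurable_fun setT (@tcons n).
Proof. exact: measurable_cons. Qed.

HB.instance Definition _ n :=
  isMeasurableFun.Build _ _ _ _ (@tcons n) (@measurable_tcons n).

Section Step.
Variables (n : nat) (m : {sigma_finite_measure set (RT n) -> \bar R}).

Definition cons_measure : set (RT n.+1) -> \bar R :=
  pushforward (lebesgue_measure \x m)%E (@tcons n).

Let cons_measure0 : cons_measure set0 = 0%E.
Proof. exact: measure0. Qed.

Let cons_measure_ge0 A : (0 <= cons_measure A)%E.
Proof. exact: measure_ge0. Qed.

Let cons_measure_sigma_additive : semi_sigma_additive cons_measure.
Proof. exact: measure_semi_sigma_additive. Qed.

HB.instance Definition _ := isMeasure.Build _ _ _ cons_measure
  cons_measure0 cons_measure_ge0 cons_measure_sigma_additive.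

Let cons_measure_sigma_finite : sigma_finite setT cons_measure.
Proof.
have /sigma_finiteP[F [TF ndF Foo]] := sigma_finiteT (@lebesgue_measure R).
have /sigma_finiteP[G [TG ndG Goo]] := sigma_finiteT m.
pose g (v : RT n.+1) : measurableTypeR R * RT n :=
  (thead v, [tuple of behead v]).
have mg : measurable_fun setT g.
  apply/measurable_fun_pair; first exact: (measurable_tnth ord0).
  exact: measurable_behead.
have gK : cancel (@tcons n) g.
  by move=> [t v]; rewrite /g /tcons theadE; congr pair; exact/val_inj.
exists (fun k => g @^-1` (F k `*` G k)).
  rewrite -preimage_bigcup [X in g @^-1` X](_ : _ = setT) ?preimage_setT//.
  rewrite -setXTT TF TG predeqE => -[x y]; split.
    by move=> [k _ []/= ? ?]; split; exists k.
  move=> [/= [k _ Fkx] [l _ Gly]]; exists (maxn k l) => //; split.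
    by move: x Fkx; exact/subsetPset/ndF/leq_maxl.
  by move: y Gly; exact/subsetPset/ndG/leq_maxr.
move=> k; have [mF Fk] := Foo k; have [mG Gk] := Goo k.
have mFG : measurable (F k `*` G k) by exact: measurableX.
split; first by rewrite -[X in measurable X]setTI; exact: mg.
rewrite /cons_measure /pushforward -comp_preimage.
rewrite (_ : g \o _ = id); last by apply/funext => p /=; rewrite gK.
rewrite preimage_id product_measure1E// lte_mul_pinfty//.
by rewrite ge0_fin_numE.
Qed.

HB.instance Definition _ := Measure_isSigmaFinite.Build _ _ _ cons_measure
  cons_measure_sigma_finite.

End Step.

Fixpoint lebesgue_tuple n : {sigma_finite_measure set (RT n) -> \bar R} :=
  if n is n'.+1 then cons_measure (lebesgue_tuple n')
  else dirac ([tuple] : RT 0).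

End LebesgueTuple.

Section WaveEquation.
Context {R : realType}.
Local Open Scope complex_scope.
Local Notation C := R[i].
Local Notation re := complex.Re.
Local Notation im := complex.Im.
Local Notation normc := ComplexField.Normc.normc.

Definition vec k (v : k.-tuple (measurableTypeR R)) : 'rV[R]_k :=
  \row_i tnth v i.

Definition dotp k (x y : 'rV[R]_k) : R := \sum_i x 0 i * y 0 i.

Definition enorm k (x : 'rV[R]_k) : R := Num.sqrt (dotp x x).

(* R[i] carries no topology in the libraries: continuity, derivatives and
   integrals of complex functions are taken on real and imaginary parts. *)
Definition ccontinuous k (f : 'rV[R]_k -> C) : Prop :=
  continuous (fun x => re (f x)) /\ continuous (fun x => im (f x)).

Definition cderivable k (f : 'rV[R]_k -> C) (x : 'rV[R]_k) (i : 'I_k) : Prop :=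
  derivable (fun y => re (f y)) x (delta_mx 0 i) /\
  derivable (fun y => im (f y)) x (delta_mx 0 i).

Definition partial k (i : 'I_k) (f : 'rV[R]_k -> C) : 'rV[R]_k -> C := fun x =>
  'D_(delta_mx 0 i) (fun y => re (f y)) x +i*
  'D_(delta_mx 0 i) (fun y => im (f y)) x.

Definition partials k (s : seq 'I_k) (f : 'rV[R]_k -> C) : 'rV[R]_k -> C :=
  foldr (@partial k) f s.

Definition Cdiff k (N : nat) (f : 'rV[R]_k -> C) : Prop :=
  (forall s : seq 'I_k, (size s <= N)%N -> ccontinuous (partials s f)) /\
  (forall (s : seq 'I_k) (i : 'I_k) (x : 'rV[R]_k), (size s < N)%N ->
     cderivable (partials s f) x i).

Definition schwartz k (f : 'rV[R]_k -> C) : Prop :=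
  (forall N, Cdiff N f) /\
  (forall (N : nat) (s : seq 'I_k), exists M : R, forall x : 'rV[R]_k,
     enorm x ^+ N * normc (partials s f x) <= M).

Definition cintegral k (f : 'rV[R]_k -> C) : C :=
  (\int[lebesgue_tuple k]_v re (f (vec v))) +i*
  (\int[lebesgue_tuple k]_v im (f (vec v))).

Definition cis (a : R) : C := cos a +i* sin a.

Definition fourier k (f : 'rV[R]_k -> C) (xi : 'rV[R]_k) : C :=
  cintegral (fun x => f x * cis (- dotp x xi)).

Definition inv_fourier k (g : 'rV[R]_k -> C) (x : 'rV[R]_k) : C :=
  (((2 * pi) ^- k)%:C) * cintegral (fun xi => g xi * cis (dotp x xi)).

Definition multiplier k (a : 'rV[R]_k -> R) (f : 'rV[R]_k -> C) :
    'rV[R]_k -> C :=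
  inv_fourier (fun xi => (a xi)%:C * fourier f xi).

Definition bracket k (xi : 'rV[R]_k) : R := Num.sqrt (1 + enorm xi ^+ 2).

(* Space-time R x R^n is 'rV[R]_(1 + n): coordinate 0 is t, and the spatial
   coordinate x_j is coordinate [rshift 1 j]. *)
Definition event n (t : R) (x : 'rV[R]_n) : 'rV[R]_(1 + n) :=
  row_mx (const_mx t) x.

Definition time n (p : 'rV[R]_(1 + n)) : R := p 0 ord0.

Definition space n (p : 'rV[R]_(1 + n)) : 'rV[R]_n := rsubmx p.

Definition dt n : ('rV[R]_(1 + n) -> C) -> 'rV[R]_(1 + n) -> C :=
  partial ord0.

Definition dx n (j : 'I_n) : ('rV[R]_(1 + n) -> C) -> 'rV[R]_(1 + n) -> C :=
  partial (rshift 1 j).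

Definition box n (f : 'rV[R]_(1 + n) -> C) (p : 'rV[R]_(1 + n)) : C :=
  - dt (dt f) p + \sum_(j < n) dx j (dx j f) p.

(* A C^m-valued function is given by its components. *)
Definition vfield n m := 'I_m -> 'rV[R]_(1 + n) -> C.

Definition free_wave n m (phi : vfield n m) : Prop := forall k : 'I_m,
  [/\ Cdiff 2 (phi k),
      forall p, box (phi k) p = 0
    & forall t, schwartz (fun x => phi k (event t x))].

Definition bracketD n m (s : R) (phi : vfield n m) : vfield n m := fun k p =>
  multiplier (fun xi => bracket xi `^ s)
    (fun x => phi k (event (time p) x)) (space p).

Definition energy n m (phi : vfield n m) (t : R) : \bar R :=
  ((2^-1)%:E * \int[lebesgue_tuple n]_v
     (\sum_(k < m) (\sum_(j < n) normc (dx j (phi k) (event t (vec v))) ^+ 2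
                    + normc (dt (phi k) (event t (vec v))) ^+ 2))%:E)%E.

Inductive null_form n := Q0 | Qab of 'I_(1 + n) & 'I_(1 + n).

Definition null_form_eval n (Q : null_form n) (f g : 'rV[R]_(1 + n) -> C)
    (p : 'rV[R]_(1 + n)) : C :=
  match Q with
  | Q0 => dt f p * dt g p - \sum_(j < n) dx j f p * dx j g p
  | Qab a b => partial a f p * partial b g p - partial b f p * partial a g p
  end.

Definition slab n : set ((1 + n).-tuple (measurableTypeR R)) :=
  [set v | 0 <= time (vec v) <= 1].

(* L^2 norm over [0,1] x R^n of Q(phi, psi), the family of all
   Q(phi_j, psi_k). *)
Definition null_form_L2 n m1 m2 (Q : null_form n)
    (phi : vfield n m1) (psi : vfield n m2) : \bar R :=
  ((\int[lebesgue_tuple (1 + n)]_(v in @slab n)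
     (\sum_(j < m1) \sum_(k < m2)
        normc (null_form_eval Q (phi j) (psi k) (vec v)) ^+ 2)%:E) `^ 2^-1)%E.

End WaveEquation.

(* Main.v *)
Require Import Defs.
From HB Require Import structures.
From mathcomp Require Import all_boot all_order all_algebra.
From mathcomp Require Import all_classical all_reals all_analysis.
From mathcomp Require Import measurable_realfun complex ring lra.

Set Implicit Arguments.
Unset Strict Implicit.
Unset Printing Implicit Defensive.
Import Order.TTheory GRing.Theory Num.Theory.
Import numFieldNormedType.Exports.
Local Open Scope classical_set_scope.
Local Open Scope ring_scope.

(** A free wave is a superposition of half-waves e^(i(x.xi + s t|xi|)) with s = 1
    or -1, whose profiles have L^2 norms controlled by the energy. Therefore
    Q(phi, psi) is a sum over the signs s, s' of superpositions of plane waves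
      int int q(xi, eta) f(xi) g(eta) e^(i z.(P_s(xi) + P_s'(eta))) dxi deta,
    where z = (t, x), P_s(xi) = (s|xi|, xi) and q(xi, eta) is Q evaluated at the
    null vectors P_s(xi)/|xi| and P_s'(eta)/|eta| ([null_form_pairs]). The null
    condition is
      q(xi, eta)^2 <= 2 (1 - s s' cos(angle of xi and eta))
    ([null_symbol_bound]).

    On the slab e^(-|t|) is bounded below. Damping also in x by a weight that
    tends to 1, the square of the space-time norm is a quadratic form in the
    amplitude, whose kernel is a product of Poisson kernels of the frequency
    differences ([gram_identity]). The Schur test [schur_test] reduces its
    boundedness to bounding, uniformly in tau and zeta, the integral over xi of
      (1 - s s' cos(angle of xi and zeta - xi)) <xi>^(-(n-1)-2eps)
        / (1 + (s|xi| + s'|zeta - xi| - tau)^2).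
    This is [row_bound], the heart of the proof. Average over the dilations
    xi -> l xi with 1 <= l <= 2. The derivative in l of the phase
    s|l xi| + s'|zeta - l xi| is s|xi| times the null symbol at l xi
    ([dilated_angle]), so the integral in l is an arctangent divided by |xi|, and
    what remains is the integral of <xi>^(-n-2eps), which is finite. The null
    structure enters only as this Jacobian.

    The representation by half-waves has to be derived from the wave equation.
    The slices of a free wave are Schwartz functions, but nothing is assumed on
    the decay of its time derivative. Uniqueness for the Cauchy problem
    ([wave_uniqueness], by the energy in backward cones) gives the formula of
    d'Alembert, phi(t + h) + phi(t - h) = 2 cos(h|D|) phi(t) ([dalembert]).
    On the Fourier side this functional equation determines phi from its slices
    at the times 0, 1 and sqrt 2: the sines of |xi| and of sqrt 2 |xi| are never
    both small, with a polynomial lower bound ([sin_sqrt2_ge]), hence the profiles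
    decay rapidly ([good_half_profile]). The energy controls the profiles through
    one half of Plancherel's theorem ([plancherel_lower], [profile_energy]). *)

(** * Integration over tuples and affine changes of variables *)

Notation RT R n := (n.-tuple (measurableTypeR R)).
Notation leb R n := (@lebesgue_tuple R n).

Section TupleIntegral.
Context {R : realType}.
Local Notation mu1 := (@lebesgue_measure R).

Lemma measurable_tcons_comp n (f : RT R n.+1 -> \bar R) :
  measurable_fun setT f -> measurable_fun setT (f \o @tcons R n).
Proof. by move=> mf; apply: measurableT_comp => //; exact: measurable_tcons. Qed.

Lemma ge0_integral_tcons_prod n (f : RT R n.+1 -> \bar R) :
  measurable_fun setT f -> (forall v, (0 <= f v)%E) ->
  (\int[leb R n.+1]_v f v = \int[(mu1 \x leb R n)%E]_p f (tcons p))%E.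
Proof.
move=> mf f0 /=; by rewrite /cons_measure ge0_integral_pushforward.
Qed.

Lemma ge0_integral_tcons n (f : RT R n.+1 -> \bar R) :
  measurable_fun setT f -> (forall v, (0 <= f v)%E) ->
  (\int[leb R n.+1]_v f v = \int[mu1]_x \int[leb R n]_v f (tcons (x, v)))%E.
Proof.
move=> mf f0; rewrite ge0_integral_tcons_prod//.
by rewrite -(fubini_tonelli1 (f \o @tcons R n) 
  (measurable_tcons_comp mf) (fun=> f0 _)).
Qed.

Lemma integrable_tcons n (f : RT R n.+1 -> \bar R) :
  (leb R n.+1).-integrable setT f ->
  (mu1 \x leb R n)%E.-integrable setT (f \o @tcons R n).
Proof.
move=> /integrableP[mf foo]; apply/integrableP; split.
  exact: measurable_tcons_comp.
rewrite -(ge0_integral_tcons_prod (f := abse \o f))//.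
- exact: measurableT_comp.
- by move=> v; exact: abse_ge0.
Qed.

Lemma integrable_tcons_inv n (f : RT R n.+1 -> \bar R) :
  measurable_fun setT f ->
  (mu1 \x leb R n)%E.-integrable setT (f \o @tcons R n) ->
  (leb R n.+1).-integrable setT f.
Proof.
move=> mf /integrableP[_ foo]; apply/integrableP; split => //.
rewrite (ge0_integral_tcons_prod (f := abse \o f))//.
- exact: measurableT_comp.
- by move=> v; exact: abse_ge0.
Qed.

Lemma integral_tcons_prod n (f : RT R n.+1 -> \bar R) :
  (leb R n.+1).-integrable setT f ->
  (\int[leb R n.+1]_v f v = \int[(mu1 \x leb R n)%E]_p f (tcons p))%E.
Proof.
move=> fi /=; rewrite /cons_measure integral_pushforward//.
- exact: measurable_int fi.
- exact: integrable_tcons.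
Qed.

Lemma integral_tuple0 (f : RT R 0 -> \bar R) :
  (\int[leb R 0]_v f v = f [tuple])%E.
Proof.
rewrite /= integral_dirac// ?diracT ?mul1e//.
apply: (eq_measurable_fun (cst (f [tuple]))) => // v _.
by rewrite (tuple0 v).
Qed.

(** |a| times the image of Lebesgue measure under the map agrees with Lebesgue
    measure on half-open intervals, and these determine it. *)
Lemma ge0_integral_affine1 (f : R -> \bar R) (a c : R) : a != 0 ->
  measurable_fun setT f -> (forall x, (0 <= f x)%E) ->
  (\int[mu1]_x f (a * x + c)%R = (`|a|^-1)%:E * \int[mu1]_x f x)%E.
Proof.
move=> a0 mf f0.
pose g (x : measurableTypeR R) : measurableTypeR R := a * x + c.
have mg : measurable_fun setT g.
  by apply: measurable_funD => //; exact: measurable_funM.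
have a0' : 0 < `|a| by rewrite normr_gt0.
pose A' : {nonneg R} := NngNum (ltW a0').
have E A : measurable A -> mu1 A = mscale A' (pushforward mu1 g) A.
  move=> mA; apply: (lebesgue_measure_unique
    (mu := mscale A' (pushforward mu1 g))) => // _ [[x y]] _ <-.
  transitivity (`|a|%:E * mu1 (g @^-1` `]x, y]%classic))%E; last by [].
  case: (ltgtP a 0) (a0) => // ha _.
  - rewrite (_ : g @^-1` _ = `[(y - c) / a, (x - c) / a[%classic); last first.
      apply/seteqP; split=> z /=; rewrite /g !in_itv/= => /andP[h1 h2].
        by rewrite ler_ndivrMr// ltr_ndivlMr// lerBrDr ltrBlDr !(mulrC z) h1 h2.
      by move: h1 h2; rewrite ler_ndivrMr// ltr_ndivlMr// lerBrDr
        ltrBlDr !(mulrC z) => -> ->.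
    rewrite !lebesgue_measure_itv/= !lte_fin.
    rewrite ltr_nM2r ?invr_lt0// ltrD2r; case: ifPn => // _; last by rewrite mule0.
    rewrite -!EFinB -EFinM ltr0_norm//; congr (_%:E); field.
    by rewrite lt_eqF.
  - rewrite (_ : g @^-1` _ = `](x - c) / a, (y - c) / a]%classic); last first.
      apply/seteqP; split=> z /=; rewrite /g !in_itv/= => /andP[h1 h2].
        by rewrite ltr_pdivrMr// ler_pdivlMr// ltrBlDr lerBrDr !(mulrC z) h1 h2.
      by move: h1 h2; rewrite ltr_pdivrMr// ler_pdivlMr// ltrBlDr
        lerBrDr !(mulrC z) => -> ->.
    rewrite !lebesgue_measure_itv/= !lte_fin.
    rewrite ltr_pM2r ?invr_gt0// ltrD2r; case: ifPn => // _; last by rewrite mule0.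
    rewrite -!EFinB -EFinM gtr0_norm//; congr (_%:E); field.
    by rewrite gt_eqF.
rewrite [in RHS](eq_measure_integral (mscale A' (pushforward mu1 g))); last first.
  by move=> A mA _; exact: E.
rewrite ge0_integral_mscale//= muleA -EFinM mulVf ?gt_eqF// mul1e.
by rewrite ge0_integral_pushforward.
Qed.
End TupleIntegral.

Section Vec.
Context {R : realType}.
Local Notation mu1 := (@lebesgue_measure R).

Definition unvec n (x : 'rV[R]_n) : RT R n := [tuple x 0 i | i < n].

Lemma vecK n : cancel (@unvec n) (@vec R n).
Proof. by move=> x; apply/rowP => i; rewrite mxE tnth_mktuple. Qed.

Lemma unvecK n : cancel (@vec R n) (@unvec n).
Proof. by move=> v; apply/eq_from_tnth => i; rewrite tnth_mktuple mxE. Qed.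

(** Row vectors carry no sigma-algebra: measurability of a function of a row
    vector is measurability of its composition with [vec], and this lemma
    transfers it to other measurable families of row vectors. *)
Lemma measurable_comp_rv d (T : measurableType d) d' (U : measurableType d') n
    (F : T -> 'rV[R]_n) (g : 'rV[R]_n -> U) :
  (forall i, measurable_fun setT (fun t => F t 0 i)) ->
  measurable_fun setT (g \o @vec R n) -> measurable_fun setT (g \o F).
Proof.
move=> mF mg; rewrite (_ : g \o F = (g \o @vec R n) \o (@unvec n \o F)).
  apply: measurableT_comp => //.
  apply/measurable_fun_tnthP => i.
  rewrite (_ : _ \o _ = fun t => F t 0 i)//; first exact: mF.
  by apply/funext => t /=; rewrite tnth_mktuple.
by apply/funext => t /=; rewrite vecK.
Qed.

Lemma measurable_vec_coord n (i : 'I_n) :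
  measurable_fun setT (fun v : RT R n => vec v 0 i).
Proof.
rewrite (_ : (fun _ => _) = (fun v : RT R n => tnth v i)); last first.
  by apply/funext => v; rewrite mxE.
exact: measurable_tnth.
Qed.

Lemma event0 n t (x : 'rV[R]_n) : event t x 0 ord0 = t.
Proof. by rewrite mxE; case: splitP => k; rewrite ?mxE// => /= /eqP. Qed.

Lemma event_rshift n t (x : 'rV[R]_n) j : event t x 0 (rshift 1 j) = x 0 j.
Proof. exact: row_mxEr. Qed.

Lemma lift0_rshift n (j : 'I_n) : lift ord0 j = rshift 1 j :> 'I_(1 + n).
Proof. exact: val_inj. Qed.

Lemma event_lift n t (x : 'rV[R]_n) (j : 'I_n) : event t x 0 (lift ord0 j) = x 0 j.
Proof. by rewrite lift0_rshift event_rshift. Qed.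

Lemma ord_event_ind n (P : 'I_(1 + n) -> Prop) :
  P ord0 -> (forall j, P (rshift 1 j)) -> forall i, P i.
Proof.
move=> P0 PS i; case: (unliftP ord0 i) => [j ->|->//].
by rewrite lift0_rshift.
Qed.

Lemma vec_tcons n x (v : RT R n) :
  vec (tcons (x, v)) = event x (vec v) :> 'rV[R]_(1 + n).
Proof.
apply/rowP; apply: ord_event_ind => [|j]; rewrite [LHS]mxE.
  by rewrite event0.
by rewrite event_rshift mxE -lift0_rshift tnthS.
Qed.

(** An open set is the countable union of the cubes with rational centre and
    size 1/(m + 1) that it contains. *)
Lemma open_vec_measurable n (U : set 'rV[R]_n) :
  open U -> measurable (@vec R n @^-1` U).
Proof.
move=> oU.
pose D (k : 'rV[rat]_n * nat) : set 'rV[R]_n :=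
  [set x | (forall i, `|x 0 i - ratr (k.1 0 i)| < k.2.+1%:R^-1)].
pose G (k : 'rV[rat]_n * nat) : set (RT R n) :=
  if `[< D k `<=` U >] then @vec R n @^-1` D k else set0.
rewrite (_ : _ @^-1` U = \bigcup_k G k).
  apply: countable_bigcupT_measurable.
    exact: countableP.
  move=> k; rewrite /G; case: ifP => // _.
  rewrite (_ : _ @^-1` D k = \bigcap_(i in [set: 'I_n])
    (fun v : RT R n => `|vec v 0 i - ratr (k.1 0 i)|) @^-1` `]-oo, k.2.+1%:R^-1[%classic); last first.
    apply/seteqP; split => v /=.
      by move=> h i _ /=; rewrite in_itv/=; exact: h.
    by move=> h i; have := h i Logic.I; rewrite /= in_itv.
  apply: fin_bigcap_measurable => // i _.
  rewrite -[X in measurable X]setTI.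
  have mN : measurable_fun setT (fun v : RT R n => `|vec v 0 i - ratr (k.1 0 i)|).
    apply: measurableT_comp => //; apply: measurable_funB => //.
    exact: measurable_vec_coord.
  exact: mN.
apply/seteqP; split => v /=; last first.
  move=> [k _]; rewrite /G; case: ifPn => [/asboolP kU vk|//].
  exact: kU.
move=> Uv; move/(_ _ Uv) : (oU) => /nbhs_ballP[e /= e0 eU].
have [m me] : exists m, m.+1%:R^-1 < e / 2 :> R.
  have e20 : 0 < e / 2 by rewrite divr_gt0.
  by have [m] := ltr_add_invr e20; rewrite add0r => ?; exists m.
have /choice[q Hq] : forall i, exists q : rat, `|vec v 0 i - ratr q| < m.+1%:R^-1.
  move=> i; have /rat_in_itvoo[q] : vec v 0 i < vec v 0 i + m.+1%:R^-1 by rewrite ltrDl.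
  rewrite in_itv/= => /andP[q1 q2]; exists q.
  by rewrite ltr0_norm ?subr_lt0// opprB ltrBlDr addrC.
exists (\row_i q i, m) => //; rewrite /G ifT.
  by move=> i /=; rewrite [X in ratr X]mxE; exact: Hq.
apply/asboolP => x Dx; apply: eU; split => // i j.
rewrite (ord1 i) /ball/=.
have := Dx j; rewrite /= [X in ratr X]mxE => Dxj.
rewrite -(subrK (ratr (q j)) (vec v 0 j)) -addrA.
apply: (le_lt_trans (ler_normD _ _)).
rewrite [ltRHS]splitr ltrD//; first exact: lt_trans (Hq j) me.
by rewrite distrC (lt_trans Dxj me).
Qed.

Lemma continuous_vec_measurable n (f : 'rV[R]_n -> R) :
  continuous f -> measurable_fun setT (f \o @vec R n).
Proof.
move=> cf; apply: (measurability _ (RGenOpens.measurableE R)).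
move=> _ [_ [a [b ->] <-]]; rewrite setTI comp_preimage.
apply: open_vec_measurable.
move/continuousP : cf; apply; exact: interval_open.
Qed.

(** Tonelli peels off one coordinate at a time. *)
Lemma ge0_integral_affine n (g : 'rV[R]_n -> \bar R) (a : R) (c : 'rV[R]_n) : a != 0 ->
  measurable_fun setT (g \o @vec R n) -> (forall x, (0 <= g x)%E) ->
  (\int[leb R n]_v g (a *: vec v + c)%R = (`|a| ^- n)%:E * \int[leb R n]_v g (vec v))%E.
Proof.
move=> a0; elim: n => [|n IH] in g c *.
  move=> mg g0; rewrite !integral_tuple0 expr0 invr1 mul1e.
  by congr g; apply/rowP => -[].
move=> mg g0.
have E x y : a *: event x y + c = event (a * x + c 0 ord0) (a *: y + @Defs.space R n c).
  apply/rowP; apply: ord_event_ind => [|j]; rewrite [LHS]mxE [X in X + _]mxE.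
    by rewrite !event0.
  by rewrite !event_rshift [RHS]mxE [X in _ = X + _]mxE [X in _ = _ + X]mxE.
have ms x : measurable_fun setT ((fun y => g (event x y)) \o @vec R n).
  rewrite (_ : _ \o _ = (g \o @vec R n.+1) \o (fun v => tcons (x, v))).
    apply: measurableT_comp => //.
    by apply: measurableT_comp; [exact: measurable_tcons|exact: pair1_measurable].
  by apply/funext => v /=; rewrite vec_tcons.
have mT : measurable_fun setT (fun v : RT R n.+1 => g (a *: vec v + c)).
  apply: (measurable_comp_rv _ mg) => i.
  rewrite (_ : (fun _ => _) = fun t : RT R n.+1 => a * vec t 0 i + c 0 i).
    by apply: measurable_funD => //; apply: measurable_funM => //;
      exact: measurable_vec_coord.
  by apply/funext => t; rewrite !mxE.
rewrite ge0_integral_tcons//.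
under eq_integral.
  move=> x _.
  under eq_integral do rewrite vec_tcons E.
  rewrite (IH (fun y => g (event (a * x + c 0 ord0) y)))//.
  over.
rewrite ge0_integral_tcons//.
have m2 : measurable_fun setT (fun x => \int[leb R n]_v g (event x (vec v)))%E.
  under eq_fun do under eq_integral do rewrite -vec_tcons.
  apply: (measurable_fun_fubini_tonelli_F ((g \o @vec R n.+1) \o @tcons R n)).
    exact: measurable_tcons_comp.
  by move=> p; exact: g0.
have m3 : measurable_fun setT
    (fun x => \int[leb R n]_v g (event (a * x + c 0 ord0)%R (vec v)))%E.
  apply: (measurableT_comp m2).
  by apply: measurable_funD => //; exact: measurable_funM.
have i0 x : (0 <= \int[leb R n]_v g (event x (vec v)))%E.
  by apply: integral_ge0.
have k0 : 0 <= `|a| ^- n by rewrite invr_ge0 exprn_ge0.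
etransitivity.
  exact: (ge0_integralZl_EFin mu1 measurableT (fun x _ => i0 _) m3 k0).
rewrite (ge0_integral_affine1 (f := fun x => \int[leb R n]_v g (event x (vec v)))%E)//.
rewrite muleA -EFinM -invfM -exprSr.
by under [in RHS]eq_integral do under eq_integral do rewrite vec_tcons.
Qed.

End Vec.

Section Transfer.
Context {R : realType}.
Local Notation mu1 := (@lebesgue_measure R).

Section generic.
Context d (T : measurableType d) (mu : {measure set T -> \bar R}).
Variables (phi : T -> T) (k : R).
Hypothesis mphi : measurable_fun setT phi.
Hypothesis ge0_phi : forall g : T -> \bar R, measurable_fun setT g ->
  (forall x, (0 <= g x)%E) -> (\int[mu]_x g (phi x) = k%:E * \int[mu]_x g x)%E.

Lemma integrable_transfer (f : T -> R) :
  mu.-integrable setT (EFin \o f) -> mu.-integrable setT (EFin \o (f \o phi)).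
Proof.
move=> /integrableP[mf foo]; apply/integrableP; split.
  exact: (measurableT_comp mf).
rewrite (ge0_phi (g := fun x => `|(f x)%:E|%E)) => [|//|//]; last first.
  exact: measurableT_comp.
have fn : (\int[mu]_x `|(f x)%:E|)%E \is a fin_num.
  by rewrite ge0_fin_numE//; exact: integral_ge0.
by rewrite -(fineK fn) -EFinM ltry.
Qed.

(** A change of variables for nonnegative functions extends to integrable ones
    through positive and negative parts. *)
Lemma Rintegral_transfer (f : T -> R) :
  mu.-integrable setT (EFin \o f) ->
  \int[mu]_x f (phi x) = k * \int[mu]_x f x.
Proof.
move=> fi; have mf := measurable_int mu fi.
have e1 := ge0_phi (measurable_funepos mf) (fun x => funepos_ge0 _ x).
have e2 := ge0_phi (measurable_funeneg mf) (fun x => funeneg_ge0 _ x).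
have i1 := integrable_pos_fin_num measurableT fi.
have i2 := integrable_neg_fin_num measurableT fi.
transitivity (fine (\int[mu]_x ((EFin \o f) \o phi) x)%E) => //.
rewrite /Rintegral [in LHS]integralE [in RHS]integralE.
rewrite (funepos_comp (EFin \o f) phi) (funeneg_comp (EFin \o f) phi).
change (fine (\int[mu]_x (EFin \o f)^\+ (phi x) -
  \int[mu]_x (EFin \o f)^\- (phi x))%E = k * fine (\int[mu]_x (EFin \o f)^\+ x -
  \int[mu]_x (EFin \o f)^\- x)%E).
by rewrite e1 e2 -muleBr// ?fin_num_adde_defr// fineM// fin_numB i1.
Qed.
End generic.

Lemma Rintegral_affine1 (f : R -> R) (a c : R) : a != 0 ->
  mu1.-integrable setT (EFin \o f) ->
  \int[mu1]_x f (a * x + c) = `|a|^-1 * \int[mu1]_x f x.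
Proof.
move=> a0; apply: (@Rintegral_transfer _ _ mu1 (fun x => a * x + c)).
by move=> g mg g0; exact: ge0_integral_affine1.
Qed.

Lemma measurable_affine n (a : R) (c : 'rV[R]_n) :
  measurable_fun setT (fun v : RT R n => unvec (a *: vec v + c)).
Proof.
apply/measurable_fun_tnthP => i.
rewrite (_ : _ \o _ = fun v : RT R n => a * vec v 0 i + c 0 i).
  by apply: measurable_funD => //; apply: measurable_funM => //;
    exact: measurable_vec_coord.
by apply/funext => v /=; rewrite tnth_mktuple mxE [X in X + _]mxE.
Qed.

Lemma ge0_integral_affine_unvec n (g : RT R n -> \bar R) (a : R) c : a != 0 ->
  measurable_fun setT g -> (forall x, (0 <= g x)%E) ->
  (\int[leb R n]_v g (unvec (a *: vec v + c)%R) =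
   (`|a| ^- n)%:E * \int[leb R n]_v g v)%E.
Proof.
move=> a0 mg g0.
have gE : (g \o @unvec R n) \o @vec R n = g.
  by apply/funext => v /=; rewrite unvecK.
rewrite (ge0_integral_affine (g := g \o @unvec R n) c a0) ?gE//; last first.
  by move=> x; exact: g0.
by congr (_ * _)%E; apply: eq_integral => v _ /=; rewrite unvecK.
Qed.

Lemma integrable_affine n (f : 'rV[R]_n -> R) (a : R) (c : 'rV[R]_n) : a != 0 ->
  (leb R n).-integrable setT (fun v => (f (vec v))%:E) ->
  (leb R n).-integrable setT (fun v => (f (a *: vec v + c))%:E).
Proof.
move=> a0 /(@integrable_transfer _ _ (leb R n) _ (`|a| ^- n)
  (@measurable_affine n a c) _ (f \o @vec R n)) h.
have {}h := h _.
rewrite (_ : (fun _ => _) = EFin \o ((f \o @vec R n) \o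
  (fun v : RT R n => unvec (a *: vec v + c)))); last first.
  by apply/funext => v /=; rewrite vecK.
by apply: h => g mg g0; exact: ge0_integral_affine_unvec.
Qed.

Lemma Rintegral_affine n (f : 'rV[R]_n -> R) (a : R) (c : 'rV[R]_n) : a != 0 ->
  (leb R n).-integrable setT (fun v => (f (vec v))%:E) ->
  \int[leb R n]_v f (a *: vec v + c) = `|a| ^- n * \int[leb R n]_v f (vec v).
Proof.
move=> a0 /(@Rintegral_transfer _ _ (leb R n)
  (fun v : RT R n => unvec (a *: vec v + c)) (`|a| ^- n) _ (f \o @vec R n)) h.
have {}h := h _.
under eq_Rintegral do rewrite -(vecK (_ + c)).
by apply: h => g mg g0; exact: ge0_integral_affine_unvec.
Qed.

(** Dominated convergence along an exhaustion by segments: this reduces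
    integrals over unbounded domains to the fundamental theorem of calculus. *)
Lemma integral_segments_cvg (D : set R) (f : R -> R) (a b : R^nat) :
  measurable D -> mu1.-integrable D (EFin \o f) ->
  (forall n, `[a n, b n] `<=` D) ->
  (forall x, D x -> \forall n \near \oo, a n <= x <= b n) ->
  \int[mu1]_(x in `[a n, b n]) f x @[n --> \oo] --> \int[mu1]_(x in D) f x.
Proof.
move=> mD fi sub ex.
have mf := measurable_int mu1 fi.
pose g n x : \bar R := ((f \_ `[a n, b n]) x)%:E.
have mg n : measurable_fun D (g n).
  apply/measurable_EFinP.
  apply/(measurable_restrict _ _ mD) => //.
  apply: (measurable_funS mD); first by move=> x [].
  exact/measurable_EFinP.
have [] := @dominated_convergence _ _ R mu1 D mD g (EFin \o f)
   (fun x => `|(f x)%:E|)%E mg mf.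
- apply: aeW => x Dx; apply: cvg_near_cst.
  near=> n; rewrite /g patchE ifT//= inE/= in_itv/=.
  by near: n; exact: ex.
- exact: integrable_abse.
- apply: aeW => x n Dx; rewrite /g patchE; case: ifPn => // _.
  by rewrite abse0.
move=> _ _ h; rewrite /Rintegral.
apply: fine_cvg; rewrite fineK; last exact: integrable_fin_num.
apply: cvg_trans h; apply: near_eq_cvg; apply: nearW => n /=.
rewrite /g -[X in _ = integral _ X _](setIidl (sub n)) setIC integral_mkcondr.
by apply: eq_integral => x _; rewrite restrict_EFin.
Unshelve. all: by end_near. Qed.

End Transfer.

(** * Integrals over the line *)

Section Line.
Context {R : realType}.
Local Notation mu1 := (@lebesgue_measure R).
Implicit Types f F : R -> R.

Lemma is_derive_continuous F f :
  (forall x : R, is_derive x (1 : R) F (f x)) -> continuous F.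
Proof.
by move=> dF x; apply: differentiable_continuous; exact/derivable1_diffP.
Qed.

Lemma Rintegral_segment F f a b : a <= b ->
  (forall x : R, is_derive x (1 : R) F (f x)) -> continuous f ->
  \int[mu1]_(x in `[a, b]) f x = F b - F a.
Proof.
rewrite le_eqVlt => /predU1P[->|ab] dF cf.
  by rewrite subrr set_itv1 Rintegral_set1.
have cF := is_derive_continuous dF.
rewrite /Rintegral (continuous_FTC2 (F := F))//.
- exact: continuous_subspaceT.
- split=> [x _|//|].
  + exact: ex_derive.
  + by apply: cvg_at_right_filter; exact: cF.
  + by apply: cvg_at_left_filter; exact: cF.
- by move=> x _; rewrite derive1E; exact: derive_val.
Qed.

Let cvgNn F (l : R) : F x @[x --> -oo] --> l -> F (- n%:R) @[n --> \oo] --> l.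
Proof.
move=> F1; apply: cvg_comp F1; apply/cvgNrNy; exact: cvgr_idn.
Qed.

Let cvgn F (l : R) : F x @[x --> +oo] --> l -> F n%:R @[n --> \oo] --> l.
Proof. by move=> F2; apply: cvg_comp F2; exact: cvgr_idn. Qed.

Let cvg_sym_segments f : mu1.-integrable setT (EFin \o f) ->
  \int[mu1]_(x in `[(- n%:R)%R, n%:R]) f x @[n --> \oo] --> \int[mu1]_x f x.
Proof.
move=> fi; apply: integral_segments_cvg => // x _.
near=> n; rewrite -ler_norml; near: n; exact: nbhs_infty_ger.
Unshelve. all: by end_near. Qed.

Lemma Rintegral_derive_line F f (l1 l2 : R) :
  (forall x : R, is_derive x (1 : R) F (f x)) -> continuous f ->
  mu1.-integrable setT (EFin \o f) ->
  F x @[x --> -oo] --> l1 -> F x @[x --> +oo] --> l2 ->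
  \int[mu1]_x f x = l2 - l1.
Proof.
move=> dF cf fi F1 F2.
apply: (cvg_unique _ (cvg_sym_segments fi)) => //.
rewrite (_ : (fun _ => _) = fun n => F n%:R - F (- n%:R)); last first.
  apply/funext => n; rewrite (Rintegral_segment (F := F))//.
  by rewrite (@le_trans _ _ 0)// oppr_le0.
by apply: cvgB; [exact: cvgn|exact: cvgNn].
Qed.

(** A function of |x| has one antiderivative on each half-line, and the two
    need not match at 0. *)
Lemma Rintegral_halves f F1 f1 F2 f2 :
  mu1.-integrable setT (EFin \o f) ->
  (forall x : R, is_derive x (1 : R) F1 (f1 x)) -> continuous f1 ->
  (forall x : R, is_derive x (1 : R) F2 (f2 x)) -> continuous f2 ->
  (forall x, 0 <= x -> f x = f1 x) -> (forall x, x <= 0 -> f x = f2 x) ->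
  F1 x @[x --> +oo] --> (0 : R) -> F2 x @[x --> -oo] --> (0 : R) ->
  \int[mu1]_x f x = F2 0 - F1 0.
Proof.
move=> fi d1 c1 d2 c2 e1 e2 l1 l2.
apply: (cvg_unique _ (cvg_sym_segments fi)) => //.
rewrite (_ : (fun _ => _) = fun n => F1 n%:R - F1 0 + (F2 0 - F2 (- n%:R))); last first.
  apply/funext => n.
  have nn : 0 <= n%:R :> R by [].
  have fin D : measurable D -> mu1.-integrable D (EFin \o f).
    by move=> mD; exact: integrableS fi.
  have nn' : - n%:R <= 0 :> R by rewrite oppr_le0.
  have := @Rintegral_itvB _ f (BLeft (- n%:R)) (BRight n%:R) 0.
  rewrite !bnd_simp => /(_ (fin _ (measurable_itv _)) nn' nn) /eqP.
  rewrite subr_eq => /eqP ->.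
  rewrite Rintegral_itv_obnd_cbnd; last exact: fin _ (measurable_itv _).
  congr (_ + _).
    rewrite -(Rintegral_segment nn d1 c1); apply: eq_Rintegral => x.
    by rewrite inE/= in_itv/= => /andP[? _]; exact: e1.
  rewrite -(Rintegral_segment nn' d2 c2); apply: eq_Rintegral => x.
  by rewrite inE/= in_itv/= => /andP[_ ?]; exact: e2.
rewrite (_ : F2 0 - F1 0 = 0 - F1 0 + (F2 0 - 0)); last by rewrite sub0r subr0 addrC.
apply: cvgD; apply: cvgB; by [exact: cvgn|exact: cvg_cst|exact: cvgNn].
Qed.

Lemma Rintegral_odd f : mu1.-integrable setT (EFin \o f) ->
  (forall x, f (- x) = - f x) -> \int[mu1]_x f x = 0.
Proof.
move=> fi of_.
have N1 : (-1 : R) != 0 by rewrite oppr_eq0.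
have := Rintegral_affine1 0 N1 fi.
under eq_Rintegral do rewrite mulN1r addr0 of_ -mulN1r.
rewrite RintegralZl// normrN1 invr1 mul1r mulN1r => /eqP.
by rewrite eq_sym -addr_eq0 -mulr2n mulrn_eq0 /= => /eqP.
Qed.

Lemma integrable_even f : (forall x, 0 <= f x) -> continuous f ->
  f =1 f \o -%R -> mu1.-integrable `[0%R, +oo[ (EFin \o f) ->
  mu1.-integrable setT (EFin \o f).
Proof.
move=> f0 cf ef /integrableP[_ foo]; apply/integrableP; split.
  by apply/measurable_EFinP; exact: continuous_measurable_fun.
under eq_integral do rewrite /= ger0_norm//.
rewrite ge0_symfun_integralT// -set_itvcy.
rewrite lte_mul_pinfty//.
by move: foo; under eq_integral do rewrite /= ger0_norm//.
Qed.

Lemma integrable_ge0_derive F f (l : R) : (forall x, 0 <= x -> 0 <= f x) ->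
  {in `[0, +oo[%classic, continuous f} ->
  (forall x : R, 0 <= x -> is_derive x (1 : R) F (f x)) ->
  F x @[x --> +oo] --> l ->
  mu1.-integrable `[0%R, +oo[ (EFin \o f) /\
  (\int[mu1]_(x in `[0%R, +oo[) (f x)%:E = (l - F 0)%:E)%E.
Proof.
move=> f0 cf dF Fl.
have wcf : {within `[0, +oo[, continuous f} by exact: continuous_in_subspaceT.
have E : (\int[mu1]_(x in `[0%R, +oo[) (f x)%:E = (l - F 0)%:E)%E.
  rewrite (ge0_continuous_FTC2y (F := F) (l := l))//.
  - by move=> x x0; apply: ex_derive; exact: dF (ltW x0).
  - apply: cvg_at_right_filter; apply: differentiable_continuous.
    by apply/derivable1_diffP; have := dF 0 (lexx _) => ?; exact: ex_derive.
  - move=> x; rewrite in_itv/= andbT => x0; rewrite derive1E.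
    by have := dF x (ltW x0) => ?; exact: derive_val.
split => //; apply/integrableP; split.
  apply/measurable_EFinP; apply: subspace_continuous_measurable_fun => //.
rewrite (_ : (\int[_]_(x in _) _)%E = (l - F 0)%:E) ?ltry// -E.
apply: eq_integral => x; rewrite inE/= in_itv/= andbT => x0.
by rewrite ger0_norm// f0.
Qed.

Lemma cauchy_density_integrable : mu1.-integrable setT (fun x => ((1 + x ^+ 2)^-1)%:E).
Proof.
have c : continuous (fun x : R => (1 + x ^+ 2)^-1) by exact: continuous_oneDsqrV.
apply: integrable_even => //.
- by move=> x; rewrite invr_ge0 addr_ge0// sqr_ge0.
- by move=> x /=; rewrite sqrrN.
- apply: (integrable_ge0_derive (F := atan) _ _ _ (@cvgy_atan R)).1 => //.
  by move=> x _; rewrite invr_ge0 addr_ge0// sqr_ge0.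
Qed.

Lemma cauchy_density_integral : \int[mu1]_x (1 + x ^+ 2)^-1 = pi.
Proof.
have c : continuous (fun x : R => (1 + x ^+ 2)^-1) by exact: continuous_oneDsqrV.
rewrite (Rintegral_derive_line (F := atan) (l1 := - (pi / 2)) (l2 := pi / 2))//.
- by field.
- exact: cauchy_density_integrable.
- apply/cvgNy_compNP; rewrite (_ : _ \o _ = fun x => - atan x).
    by apply: cvgN; exact: cvgy_atan.
  by apply/funext => x /=; rewrite atanN.
- exact: cvgy_atan.
Qed.

Lemma cvg_expRM (d : R) : 0 < d -> expR (- (d * x)) @[x --> +oo] --> (0 : R).
Proof.
move=> d0; apply: (cvg_comp (fun x => d * x) (fun y => expR (- y))).
  by apply: gt0_cvgMry => //; exact: cvg_id.
exact: cvgr_expR.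
Qed.

Lemma is_derive_linear (p x : R) : is_derive x (1 : R) (fun y => p * y) p.
Proof.
have := @is_deriveZ _ _ _ id p x (1 : R) 1 (is_derive_id _ _).
by rewrite /GRing.scale/= mulr1.
Qed.

Lemma is_derive_expRM (d x : R) :
  is_derive x (1 : R) (fun y => expR (- (d * y))) (- d * expR (- (d * x))).
Proof.
have h : is_derive x (1 : R) (fun y => - (d * y)) (- d).
  by apply: is_deriveN; exact: is_derive_linear.
have := @is_derive1_comp _ expR (fun y => - (d * y)) x _ _ (is_derive_expR _) h.
by move=> h2; apply: (is_derive_eq h2); rewrite mulrC.
Qed.

Lemma integrable_expR_abs (d : R) : 0 < d ->
  mu1.-integrable setT (fun x => (expR (- (d * `|x|)))%:E).
Proof.
move=> d0.
have c : continuous (fun x : R => expR (- (d * `|x|))).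
  move=> x; apply: (@continuous_comp _ _ _ (fun x : R => - (d * `|x|)) expR).
    apply: continuousN; apply: continuousM; first exact: cst_continuous.
    exact: norm_continuous.
  exact: continuous_expR.
apply: integrable_even => //; first by move=> x /=; rewrite normrN.
have h := @integrable_ge0_derive (fun x => - d^-1 * expR (- (d * x)))
  (fun x => expR (- (d * x))) 0.
have [] := h.
- by move=> x _; exact: expR_ge0.
- move=> x _; apply: is_derive_continuous x => x; exact: is_derive_expRM.
- move=> x _.
  have := @is_deriveZ _ _ _ _ (- d^-1) x (1 : R) _ (is_derive_expRM d x).
  move=> h2; apply: (is_derive_eq h2).
  by rewrite /GRing.scale/= mulrA mulrNN mulVf ?gt_eqF// mul1r.
- rewrite -[X in _ --> X](mulr0 (- d^-1)).
  by apply: cvgM; [exact: cvg_cst|exact: cvg_expRM].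
move=> + _; apply: eq_integrable => // x; rewrite inE/= in_itv/= andbT => x0.
by rewrite ger0_norm.
Qed.

Section poisson_kernel.
Variables (d p : R).
Hypothesis d0 : 0 < d.

Let D := d ^+ 2 + p ^+ 2.
Let D0 : D != 0.
Proof. by rewrite gt_eqF// ltr_wpDr ?sqr_ge0// exprn_gt0. Qed.

(* the antiderivative on x >= 0, found by integrating by parts twice *)
Let F1 x := D^-1 * (expR (- (d * x)) * (p * sin (p * x) - d * cos (p * x))).

Lemma is_derive_cosM x : is_derive x (1 : R) (fun y => cos (p * y)) (- p * sin (p * x)).
Proof.
have h2 := @is_derive1_comp _ cos _ x _ _ (is_derive_cos _) (is_derive_linear p x).
by apply: (is_derive_eq h2); rewrite mulNr mulNr mulrC.
Qed.

Lemma is_derive_sinM x : is_derive x (1 : R) (fun y => sin (p * y)) (p * cos (p * x)).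
Proof.
have h2 := @is_derive1_comp _ sin _ x _ _ (is_derive_sin _) (is_derive_linear p x).
by apply: (is_derive_eq h2); rewrite mulrC.
Qed.

Let dF1 x : is_derive x (1 : R) F1 (expR (- (d * x)) * cos (p * x)).
Proof.
have e := is_derive_expRM d x.
have c := is_derive_cosM x.
have s := is_derive_sinM x.
rewrite /F1.
have h : is_derive x (1 : R) (fun y => p * sin (p * y) - d * cos (p * y))
    (p * (p * cos (p * x)) - d * (- p * sin (p * x))).
  by apply: is_deriveB; exact: is_deriveZ.
have h2 := is_deriveM e h.
have h3 := @is_deriveZ _ _ _ _ D^-1 x (1 : R) _ h2.
apply: (is_derive_eq h3); rewrite /GRing.scale/=.
by rewrite /D; field.
Qed.

Let c1 : continuous (fun x => expR (- (d * x)) * cos (p * x)).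
Proof.
move=> x; apply: cvgM.
  by apply: (is_derive_continuous _) x => x; exact: is_derive_expRM.
by apply: (is_derive_continuous _) x => x; exact: is_derive_cosM.
Qed.

Let F1cvg : F1 x @[x --> +oo] --> (0 : R).
Proof.
have h : `|D^-1| * (expR (- (d * x)) * (`|p| + `|d|)) @[x --> +oo] --> (0 : R).
  rewrite -[X in _ --> X](mulr0 `|D^-1|).
  apply: cvgM; first exact: cvg_cst.
  rewrite -[X in _ --> X](mul0r (`|p| + `|d|)).
  by apply: cvgM; [exact: cvg_expRM|exact: cvg_cst].
apply: norm_cvg0; apply: (squeeze_cvgr _ (cvg_cst 0) h).
apply: nearW => x; rewrite normr_ge0/= /F1 !normrM.
rewrite ler_wpM2l// (ger0_norm (expR_ge0 _)) ler_wpM2l ?expR_ge0//.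
apply: (le_trans (ler_normB _ _)); rewrite !normrM.
by rewrite lerD// ler_piMr// ler_norml ?(sin_geN1, sin_le1, cos_geN1, cos_le1).
Qed.

Lemma integrable_expR_abs_cos :
  mu1.-integrable setT (fun x => (expR (- (d * `|x|)) * cos (p * x))%:E).
Proof.
apply: (le_integrable measurableT _ _ (integrable_expR_abs d0)).
  apply/measurable_EFinP; apply: measurable_funM.
    by have /integrableP[/measurable_EFinP] := integrable_expR_abs d0.
  apply: continuous_measurable_fun.
  by apply: is_derive_continuous => x; exact: is_derive_cosM.
move=> x _; rewrite lee_fin normrM ler_piMr//.
by rewrite ler_norml cos_geN1 cos_le1.
Qed.

Lemma integrable_expR_abs_sin :
  mu1.-integrable setT (fun x => (expR (- (d * `|x|)) * sin (p * x))%:E).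
Proof.
apply: (le_integrable measurableT _ _ (integrable_expR_abs d0)).
  apply/measurable_EFinP; apply: measurable_funM.
    by have /integrableP[/measurable_EFinP] := integrable_expR_abs d0.
  apply: continuous_measurable_fun.
  by apply: is_derive_continuous => x; exact: is_derive_sinM.
move=> x _; rewrite lee_fin normrM ler_piMr//.
by rewrite ler_norml sin_geN1 sin_le1.
Qed.

Lemma integral_expR_abs_cos :
  \int[mu1]_x (expR (- (d * `|x|)) * cos (p * x)) = 2 * d / D.
Proof.
pose F2 x := - F1 (- x).
have dF2 x : is_derive x (1 : R) F2 (expR (- (d * - x)) * cos (p * - x)).
  have h := @is_derive1_comp _ F1 (fun y : R => - y) x _ _ (dF1 _) (is_deriveNid _ _).
  by have := is_deriveN h => h2; apply: (is_derive_eq h2); rewrite mulrN1 opprK.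
rewrite (Rintegral_halves (F1 := F1) (F2 := F2) integrable_expR_abs_cos dF1 c1 dF2)//.
- rewrite /F2 /F1 oppr0 !mulr0 oppr0 expR0 sin0 cos0 mulr0 mul1r /D.
  by field.
- move=> x; apply: (@continuous_comp _ _ _ (fun y : R => - y)
    (fun x => expR (- (d * x)) * cos (p * x))); last exact: c1.
  exact: oppr_continuous.
- by move=> x x0; rewrite ger0_norm.
- by move=> x x0; rewrite ler0_norm// [p * - x]mulrN cosN.
- rewrite -oppr0 /F2; apply: cvgN.
  by apply/cvgNy_compNP; under eq_fun do rewrite /= opprK.
Qed.

Lemma integral_expR_abs_sin :
  \int[mu1]_x (expR (- (d * `|x|)) * sin (p * x)) = 0.
Proof.
apply: Rintegral_odd; first exact: integrable_expR_abs_sin.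
by move=> x; rewrite normrN mulrN sinN mulrN.
Qed.
End poisson_kernel.

Definition powweight (b x : R) := (1 + x ^+ 2) `^ (- b).

Lemma oneDsq_gt0 (x : R) : 0 < 1 + x ^+ 2.
Proof. by rewrite ltr_pwDl// sqr_ge0. Qed.

Lemma powweight_gt0 b x : 0 < powweight b x.
Proof. by rewrite powR_gt0// oneDsq_gt0. Qed.

Lemma cvgy_powR_onep (c : R) : 0 < c -> (1 + x) `^ (- c) @[x --> +oo] --> (0 : R).
Proof.
move=> c0.
have h : expR (- (c * ln (1 + x))) @[x --> +oo] --> (0 : R).
  apply: (cvg_comp (fun x => ln (1 + x)) (fun y => expR (- (c * y)))); last first.
    exact: cvg_expRM.
  apply/cvgryPge => A; near=> x.
  have x0 : 0 <= x by near: x; apply: nbhs_pinfty_ge; exact: num_real.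
  have xA : expR A <= x by near: x; apply: nbhs_pinfty_ge; exact: num_real.
  rewrite -[A]expRK ler_ln ?posrE ?expR_gt0 ?ltr_pwDl//.
  by rewrite (le_trans xA)// lerDr.
apply: cvg_trans h; apply: near_eq_cvg.
near=> x.
have x0 : 0 <= x by near: x; apply: nbhs_pinfty_ge; exact: num_real.
by rewrite /powR gt_eqF ?mulNr// ltr_pwDl.
Unshelve. all: by end_near. Qed.

Lemma is_derive_powR_onep (c x : R) : 0 <= x ->
  is_derive x (1 : R) (fun y => (1 + y) `^ c) (c * (1 + x) `^ (c - 1)).
Proof.
move=> x0.
have x1 : 0 < 1 + x by rewrite ltr_pwDl.
have h : is_derive x (1 : R) (fun y => 1 + y) 1.
  have h := is_deriveD (is_derive_cst (1 : R) x (1 : R)) (is_derive_id x (1 : R)).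
  by apply: (is_derive_eq h); rewrite add0r.
have := @is_derive1_comp _ (fun y => y `^ c) (fun y => 1 + y) x _ _
  (is_derive1_powR c x1) h.
by rewrite mulr1.
Qed.

(** For x >= 0, (1 + x)^2 <= 2 (1 + x^2), so the weight is at most
    2^b (1 + x)^(-2b), whose antiderivative is explicit. *)
Lemma integrable_powweight (b : R) : 2^-1 < b ->
  mu1.-integrable setT (fun x => (powweight b x)%:E).
Proof.
move=> b2.
have b0 : 0 < b by apply: lt_trans b2.
have c0 : 0 < 2 * b - 1 by rewrite subr_gt0 -ltr_pdivrMl// mulr1.
have cw : continuous (powweight b).
  rewrite /powweight => x.
  apply: (@continuous_comp _ _ _ (fun x : R => 1 + x ^+ 2) (fun y : R => y `^ (- b))).
    exact: continuous_oneDsqr.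
  apply: differentiable_continuous; apply/derivable1_diffP.
  by have := is_derive1_powR (- b) (oneDsq_gt0 x) => ?; exact: ex_derive.
apply: integrable_even => //.
- by move=> x; exact: ltW (powweight_gt0 _ _).
- by move=> x; rewrite /powweight /= sqrrN.
pose K := 2 `^ b.
have h := @integrable_ge0_derive
  (fun x => - (K / (2 * b - 1)) * (1 + x) `^ (- (2 * b - 1)))
  (fun x => K * (1 + x) `^ (- (2 * b))) 0
  (fun x _ => mulr_ge0 (powR_ge0 _ _) (powR_ge0 _ _)).
have [] := h.
- move=> x; rewrite inE/= in_itv/= andbT => x0.
  suff : {for x, continuous (fun y : R => K * (1 + y) `^ (- (2 * b)))} by [].
  apply: continuousM; first exact: cst_continuous.
  apply: differentiable_continuous; apply/derivable1_diffP.
  by have := is_derive_powR_onep (- (2 * b)) x0 => ?; exact: ex_derive.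
- move=> x x0.
  have := @is_deriveZ _ _ _ _ (- (K / (2 * b - 1))) x (1 : R) _
    (is_derive_powR_onep (- (2 * b - 1)) x0).
  move=> hd; apply: (is_derive_eq hd); rewrite /GRing.scale/=.
  rewrite mulrA mulrNN divfK ?gt_eqF//.
  by congr (_ * _ `^ _); ring.
- rewrite -[X in _ --> X](mulr0 (- (K / (2 * b - 1)))).
  by apply: cvgM; [exact: cvg_cst|exact: cvgy_powR_onep].
move=> {}h _; apply: (le_integrable _ _ _ h) => //.
  by apply/measurable_EFinP/measurable_funTS; exact: continuous_measurable_fun.
move=> x /=; rewrite in_itv/= andbT => x0; rewrite lee_fin.
rewrite !ger0_norm ?mulr_ge0 ?powR_ge0//.
have x1 : 0 < 1 + x by rewrite ltr_pwDl.
rewrite /powweight !powRN ler_pdivlMr ?powR_gt0// ler_pdivrMl ?powR_gt0 ?oneDsq_gt0//.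
have s0 := oneDsq_gt0 x.
rewrite powRrM powR_mulrn; last exact: ltW.
rewrite /K -powRM; [|exact: ltW|by []].
rewrite ge0_ler_powR ?nnegrE ?sqr_ge0 ?mulr_ge0 ?(ltW b0) ?(ltW s0)//.
by have := sqr_ge0 (1 - x); nra.
Qed.

End Line.

(** * A product weight with positive Fourier transform *)

Section Products.
Context {R : realType}.
Local Notation mu1 := (@lebesgue_measure R).

Section prodM.
Context d1 d2 (T1 : measurableType d1) (T2 : measurableType d2).
Variables (m1 : {sigma_finite_measure set T1 -> \bar R})
          (m2 : {sigma_finite_measure set T2 -> \bar R}).
Variables (f : T1 -> R) (g : T2 -> R).
Hypotheses (fi : m1.-integrable setT (EFin \o f))
           (gi : m2.-integrable setT (EFin \o g)).

Let mfg : measurable_fun setT (fun p : T1 * T2 => f p.1 * g p.2).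
Proof.
apply: measurable_funM.
  apply: measurableT_comp => //.
  by have /integrableP[/measurable_EFinP] := fi.
apply: measurableT_comp => //.
by have /integrableP[/measurable_EFinP] := gi.
Qed.

Lemma integrable_prodM :
  (m1 \x m2)%E.-integrable setT (fun p => (f p.1 * g p.2)%:E).
Proof.
apply/(integrable12ltyP _).
  exact/measurable_EFinP.
have /integrableP[mf foo] := fi; have /integrableP[mg goo] := gi.
have ng0 : (\int[m2]_y `|(g y)%:E| \is a fin_num)%E.
  by rewrite ge0_fin_numE// integral_ge0.
rewrite (_ : (fun x => _) =
  (fun x => `|(f x)%:E| * \int[m2]_y `|(g y)%:E|)%E); last first.
  apply/funext => x; rewrite -ge0_integralZl//; last exact: measurableT_comp.
  by apply: eq_integral => y _; rewrite /= normrM EFinM.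
rewrite -(fineK ng0) ge0_integralZr//; last 2 first.
- exact: measurableT_comp.
- by rewrite lee_fin fine_ge0// integral_ge0.
have nf0 : (\int[m1]_y `|(f y)%:E| \is a fin_num)%E.
  by rewrite ge0_fin_numE// integral_ge0.
by rewrite -(fineK nf0) -EFinM ltry.
Qed.

Lemma Rintegral_prodM :
  \int[(m1 \x m2)%E]_p (f p.1 * g p.2) = (\int[m1]_x f x) * \int[m2]_y g y.
Proof.
rewrite {1}/Rintegral -(integral12_prod_meas1 integrable_prodM) /fubini_F /=.
have gn := integrable_fin_num measurableT gi.
under eq_integral => x _.
  under eq_integral do rewrite EFinM.
  rewrite integralZl// -(fineK gn).
  over.
rewrite integralZr// fineM//; exact: (integrable_fin_num measurableT fi).
Qed.

End prodM.

Lemma integrable_tuple_prodM n (w : 'I_n -> R -> R) :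
  (forall i, mu1.-integrable setT (EFin \o w i)) ->
  (leb R n).-integrable setT (fun v => (\prod_i w i (vec v 0 i))%:E).
Proof.
elim: n w => [|n IH] w wi.
  apply/integrableP; split.
    by apply/measurable_EFinP; under eq_fun do rewrite big_ord0; exact: measurable_cst.
  by rewrite integral_tuple0 /= big_ord0 normr1 ltry.
apply: integrable_tcons_inv.
  apply/measurable_EFinP; apply: measurable_prod => i _.
  apply: (measurableT_comp (f := w i)).
    by have /integrableP[/measurable_EFinP] := wi i.
  exact: measurable_vec_coord.
have := integrable_prodM (wi ord0) (IH (fun i => w (lift ord0 i)) (fun i => wi _)).
apply: eq_integrable => // p _ /=; rewrite big_ord_recl; case: p => x v /=.
rewrite vec_tcons event0; congr ((_ * _)%:E).
by apply: eq_bigr => i _; rewrite event_lift.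
Qed.

(** This weight replaces the usual Gaussian: it is integrable, tends to 1 as
    [d] tends to 0, and its Fourier transform [poisK d], a product of Poisson
    kernels, is positive and explicit. *)
Definition poisW n (d : 'I_n -> R) (x : 'rV[R]_n) : R :=
  \prod_i expR (- (d i * `|x 0 i|)).

Definition poisK n (d : 'I_n -> R) (p : 'rV[R]_n) : R :=
  \prod_i (2 * d i / (d i ^+ 2 + p 0 i ^+ 2)).

Lemma dotp_event n x (y : 'rV[R]_n) (p : 'rV[R]_(1 + n)) :
  dotp (event x y) p = x * p 0 ord0 + dotp y (Defs.space p).
Proof.
rewrite /dotp big_ord_recl event0; congr (_ + _).
by apply: eq_bigr => i _; rewrite event_lift lift0_rshift mxE.
Qed.

Lemma poisW_ge0 n (d : 'I_n -> R) x : 0 <= poisW d x.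
Proof. by apply: prodr_ge0 => i _; exact: expR_ge0. Qed.

Lemma poisW_event n (d : 'I_n.+1 -> R) x (y : 'rV[R]_n) :
  poisW d (event x y) = expR (- (d ord0 * `|x|)) * poisW (fun i => d (lift ord0 i)) y.
Proof.
rewrite /poisW big_ord_recl event0; congr (_ * _).
by apply: eq_bigr => i _; rewrite event_lift.
Qed.

Lemma integrable_poisW n (d : 'I_n -> R) : (forall i, 0 < d i) ->
  (leb R n).-integrable setT (fun v => (poisW d (vec v))%:E).
Proof.
by move=> d0; apply: (@integrable_tuple_prodM _ (fun i x => expR (- (d i * `|x|))));
  move=> i; exact: integrable_expR_abs.
Qed.

Lemma measurable_dotp d (T : measurableType d) n (F G : T -> 'rV[R]_n) :
  (forall i, measurable_fun setT (fun t => F t 0 i)) ->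
  (forall i, measurable_fun setT (fun t => G t 0 i)) ->
  measurable_fun setT (fun t => dotp (F t) (G t)).
Proof.
move=> mF mG; rewrite /dotp.
by apply: measurable_sum => i; exact: measurable_funM.
Qed.

Section poisson_cos.

Lemma integrable_poisW_trig n (d : 'I_n -> R) (h : R -> R) p : (forall i, 0 < d i) ->
  measurable_fun setT h -> (forall x, `|h x| <= 1) ->
  (leb R n).-integrable setT (fun v => (poisW d (vec v) * h (dotp (vec v) p))%:E).
Proof.
move=> d0 mh h1; apply: (le_integrable measurableT _ _ (integrable_poisW d0)).
  apply/measurable_EFinP; apply: measurable_funM.
    by have /integrableP[/measurable_EFinP] := integrable_poisW d0.
  apply: measurableT_comp => //; apply: measurable_dotp => // i.
  exact: measurable_vec_coord.
by move=> v _; rewrite lee_fin normrM ler_piMr.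
Qed.

Lemma measurable_cos : measurable_fun setT (@cos R).
Proof. by apply: continuous_measurable_fun; exact: continuous_cos. Qed.

Lemma measurable_sin : measurable_fun setT (@sin R).
Proof. by apply: continuous_measurable_fun; exact: continuous_sin. Qed.

Lemma cos_norm_le1 (x : R) : `|cos x| <= 1.
Proof. by rewrite ler_norml cos_geN1 cos_le1. Qed.

Lemma sin_norm_le1 (x : R) : `|sin x| <= 1.
Proof. by rewrite ler_norml sin_geN1 sin_le1. Qed.

Lemma integrable_poisW_cos n (d : 'I_n -> R) p : (forall i, 0 < d i) ->
  (leb R n).-integrable setT (fun v => (poisW d (vec v) * cos (dotp (vec v) p))%:E).
Proof.
by move=> d0; apply: integrable_poisW_trig => //; [exact: measurable_cos|exact: cos_norm_le1].
Qed.

Lemma integrable_poisW_sin n (d : 'I_n -> R) p : (forall i, 0 < d i) ->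
  (leb R n).-integrable setT (fun v => (poisW d (vec v) * sin (dotp (vec v) p))%:E).
Proof.
by move=> d0; apply: integrable_poisW_trig => //; [exact: measurable_sin|exact: sin_norm_le1].
Qed.

(** The addition formulas split off one coordinate; the one-dimensional sine
    integral vanishes by parity. *)
Lemma poisW_cos_sin n (d : 'I_n -> R) p : (forall i, 0 < d i) ->
  \int[leb R n]_v (poisW d (vec v) * cos (dotp (vec v) p)) = poisK d p /\
  \int[leb R n]_v (poisW d (vec v) * sin (dotp (vec v) p)) = 0.
Proof.
elim: n d p => [|n IH] d p d0.
  rewrite /Rintegral !integral_tuple0 /poisW /poisK /dotp !big_ord0.
  by rewrite cos0 sin0 mulr0 mulr1.
have [IHc IHs] := IH (fun i => d (lift ord0 i)) (Defs.space (p : 'rV_(1 + n))) (fun i => d0 _).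
set d' := fun i => d (lift ord0 i) in IHc IHs.
have d'0 i : 0 < d' i by exact: d0.
pose p' := Defs.space (p : 'rV_(1 + n)).
have ec := integrable_expR_abs_cos (p 0 ord0) (d0 ord0).
have es := integrable_expR_abs_sin (p 0 ord0) (d0 ord0).
have Wc := integrable_poisW_cos p' d'0.
have Ws := integrable_poisW_sin p' d'0.
have cc := integrable_prodM ec Wc.
have ss := integrable_prodM es Ws.
have sc := integrable_prodM es Wc.
have cs := integrable_prodM ec Ws.
split; rewrite {1}/Rintegral integral_tcons_prod.
- pose F1 (q : R * RT R n) := expR (- (d ord0 * `|q.1|)) * cos (p 0 ord0 * q.1) *
      (poisW d' (vec q.2) * cos (dotp (vec q.2) p')).
  pose F2 (q : R * RT R n) := expR (- (d ord0 * `|q.1|)) * sin (p 0 ord0 * q.1) *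
      (poisW d' (vec q.2) * sin (dotp (vec q.2) p')).
  transitivity (\int[(mu1 \x leb R n)%E]_q (F1 q - F2 q)).
    apply: congr1; apply: eq_integral => -[x v] _.
    rewrite vec_tcons poisW_event dotp_event cosD /F1 /F2 /= -/d' -/p' (mulrC x).
    by congr (_%:E); ring.
  rewrite RintegralB// (Rintegral_prodM ec Wc) (Rintegral_prodM es Ws).
  rewrite IHc IHs mulr0 subr0 integral_expR_abs_cos// /poisK big_ord_recl.
  by congr (_ * _); apply: eq_bigr => i _; rewrite /Defs.space mxE -lift0_rshift.
- exact: integrable_poisW_cos.
- pose F1 (q : R * RT R n) := expR (- (d ord0 * `|q.1|)) * sin (p 0 ord0 * q.1) *
      (poisW d' (vec q.2) * cos (dotp (vec q.2) p')).
  pose F2 (q : R * RT R n) := expR (- (d ord0 * `|q.1|)) * cos (p 0 ord0 * q.1) *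
      (poisW d' (vec q.2) * sin (dotp (vec q.2) p')).
  transitivity (\int[(mu1 \x leb R n)%E]_q (F1 q + F2 q)).
    apply: congr1; apply: eq_integral => -[x v] _.
    rewrite vec_tcons poisW_event dotp_event sinD /F1 /F2 /= -/d' -/p' (mulrC x).
    by congr (_%:E); ring.
  rewrite RintegralD// (Rintegral_prodM es Wc) (Rintegral_prodM ec Ws).
  by rewrite IHs mulr0 integral_expR_abs_sin// mul0r addr0.
- exact: integrable_poisW_sin.
Qed.

End poisson_cos.

End Products.

Local Open Scope complex_scope.

(** * Complex-valued integrals *)

Local Open Scope complex_scope.
Notation re := complex.Re.
Notation im := complex.Im.
Notation normc := ComplexField.Normc.normc.

Section ComplexFacts.
Context {R : realType}.
Local Notation C := R[i].
Implicit Types x y : C.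

Lemma reD x y : re (x + y) = re x + re y. Proof. by case: x y => [? ?] []. Qed.
Lemma imD x y : im (x + y) = im x + im y. Proof. by case: x y => [? ?] []. Qed.
Lemma reN x : re (- x) = - re x. Proof. by case: x. Qed.
Lemma imN x : im (- x) = - im x. Proof. by case: x. Qed.
Lemma reM x y : re (x * y) = re x * re y - im x * im y.
Proof. by case: x y => [? ?] []. Qed.
Lemma imM x y : im (x * y) = re x * im y + im x * re y.
Proof. by case: x y => [? ?] []. Qed.
Lemma re_rc (r : R) : re r%:C = r. Proof. by []. Qed.
Lemma im_rc (r : R) : im r%:C = 0. Proof. by []. Qed.
Lemma eqC x y : re x = re y -> im x = im y -> x = y.
Proof. by case: x y => [? ?] [? ?] /= -> ->. Qed.

Lemma re_sum (I : Type) (r : seq I) (P : pred I) (F : I -> C) :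
  re (\sum_(i <- r | P i) F i) = \sum_(i <- r | P i) re (F i).
Proof. by elim/big_rec2 : _ => [//|i y z _ <-]; rewrite reD. Qed.

Lemma im_sum (I : Type) (r : seq I) (P : pred I) (F : I -> C) :
  im (\sum_(i <- r | P i) F i) = \sum_(i <- r | P i) im (F i).
Proof. by elim/big_rec2 : _ => [//|i y z _ <-]; rewrite imD. Qed.

Lemma normc_ge0 x : 0 <= normc x. Proof. by case: x => a b; exact: sqrtr_ge0. Qed.

Lemma normc_sqr x : normc x ^+ 2 = re x ^+ 2 + im x ^+ 2.
Proof. by case: x => a b /=; rewrite sqr_sqrtr// addr_ge0// sqr_ge0. Qed.

Lemma re_le_normc x : `|re x| <= normc x.
Proof.
rewrite -(@ler_pXn2r _ 2) ?nnegrE ?normc_ge0// real_normK ?num_real// normc_sqr.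
by rewrite lerDl sqr_ge0.
Qed.

Lemma im_le_normc x : `|im x| <= normc x.
Proof.
rewrite -(@ler_pXn2r _ 2) ?nnegrE ?normc_ge0// real_normK ?num_real// normc_sqr.
by rewrite lerDr sqr_ge0.
Qed.

Lemma normc_le_reim x : normc x <= `|re x| + `|im x|.
Proof.
rewrite -(@ler_pXn2r _ 2) ?nnegrE ?normc_ge0 ?addr_ge0// normc_sqr sqrrD.
by rewrite !real_normK ?num_real// lerD2r lerDl mulrn_wge0// mulr_ge0.
Qed.

Lemma normc_rc (r : R) : normc r%:C = `|r|.
Proof. by rewrite /= expr0n/= addr0 sqrtr_sqr. Qed.

Lemma normc_i : normc ('i : C) = 1.
Proof. by rewrite /= expr0n/= add0r expr1n sqrtr1. Qed.

Lemma normc_cis (a : R) : normc (cis a) = 1.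
Proof. by rewrite /= cos2Dsin2 sqrtr1. Qed.

Lemma cisD (a b : R) : cis (a + b) = cis a * cis b.
Proof. by apply: eqC; rewrite ?reM ?imM /= ?cosD ?sinD// addrC mulrC. Qed.

Lemma normc_conj x : normc x^* = normc x.
Proof. by case: x => a b /=; rewrite sqrrN. Qed.

End ComplexFacts.

Section ComplexIntegral.
Context {R : realType}.
Local Notation C := R[i].

Definition Cmeas d (T : measurableType d) (f : T -> C) :=
  measurable_fun setT (fun x => re (f x)) /\ measurable_fun setT (fun x => im (f x)).

(** Complex integrals are taken on real and imaginary parts, like the
    [cintegral] that occurs in the Fourier transform. *)
Definition Cint d (T : measurableType d) (mu : {measure set T -> \bar R})
  (f : T -> C) : C := (\int[mu]_x re (f x)) +i* (\int[mu]_x im (f x)).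

Definition Cintegrable d (T : measurableType d) (mu : {measure set T -> \bar R})
    (f : T -> C) :=
  mu.-integrable setT (fun x => (re (f x))%:E) /\
  mu.-integrable setT (fun x => (im (f x))%:E).

Section generic.
Context d (T : measurableType d) (mu : {measure set T -> \bar R}).
Implicit Types f g : T -> C.

Lemma Cintegrable_meas f : Cintegrable mu f -> Cmeas f.
Proof.
by move=> [/integrableP[/measurable_EFinP ? _] /integrableP[/measurable_EFinP ? _]].
Qed.

Lemma Cmeas_normc f : Cmeas f -> measurable_fun setT (fun x => normc (f x)).
Proof.
move=> [mr mi].
rewrite (_ : (fun x => _) = fun x => Num.sqrt (re (f x) ^+ 2 + im (f x) ^+ 2)).
  apply: (measurableT_comp (f := @Num.sqrt R)).
    by apply: continuous_measurable_fun; exact: sqrt_continuous.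
  by apply: measurable_funD; exact: measurable_funX.
by apply/funext => x; case: (f x).
Qed.

Lemma CmeasM f g : Cmeas f -> Cmeas g -> Cmeas (fun x => f x * g x).
Proof.
move=> [fr fi] [gr gi]; split.
  by under eq_fun do rewrite reM; apply: measurable_funB; exact: measurable_funM.
by under eq_fun do rewrite imM; apply: measurable_funD; exact: measurable_funM.
Qed.

Lemma CmeasD f g : Cmeas f -> Cmeas g -> Cmeas (fun x => f x + g x).
Proof.
move=> [fr fi] [gr gi]; split.
  by under eq_fun do rewrite reD; exact: measurable_funD.
by under eq_fun do rewrite imD; exact: measurable_funD.
Qed.

Lemma Cmeas_cst (c : C) : Cmeas (fun _ : T => c).
Proof. by split; exact: measurable_cst. Qed.

Lemma Cmeas_rc (f : T -> R) : measurable_fun setT f -> Cmeas (fun x => (f x)%:C).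
Proof. by move=> mf; split => //=; exact: measurable_cst. Qed.

Lemma Cmeas_cis (f : T -> R) : measurable_fun setT f -> Cmeas (fun x => cis (f x)).
Proof.
move=> mf; split => /=.
  by apply: (measurableT_comp (f := @cos R)) => //; exact: measurable_cos.
by apply: (measurableT_comp (f := @sin R)) => //; exact: measurable_sin.
Qed.

Lemma Cmeas_conj f : Cmeas f -> Cmeas (fun x => (f x)^*).
Proof.
move=> [fr fi]; split.
  by rewrite (_ : (fun x => _) = fun x => re (f x))//; apply/funext => x; case: (f x).
rewrite (_ : (fun x => _) = fun x => - im (f x)); first exact: measurable_funN.
by apply/funext => x; case: (f x).
Qed.

Lemma Cintegrable_le f (g : T -> R) : Cmeas f ->
  mu.-integrable setT (EFin \o g) -> (forall x, normc (f x) <= g x) ->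
  Cintegrable mu f.
Proof.
move=> [mr mi] ig fg; split; apply: (le_integrable measurableT _ _ ig);
  try (by apply/measurable_EFinP).
- move=> x _; rewrite lee_fin (le_trans (re_le_normc _))//.
  by rewrite (le_trans (fg x))// ler_norm.
- move=> x _; rewrite lee_fin (le_trans (im_le_normc _))//.
  by rewrite (le_trans (fg x))// ler_norm.
Qed.

Lemma Cintegrable_normc f : Cintegrable mu f ->
  mu.-integrable setT (fun x => (normc (f x))%:E).
Proof.
move=> fi; have [mr mi] := Cintegrable_meas fi; case: fi => fr fi.
have h := integrableD measurableT (integrable_abse fr) (integrable_abse fi).
apply: (le_integrable measurableT _ _ h).
  by apply/measurable_EFinP; apply: Cmeas_normc.
move=> x _ /=; rewrite lee_fin ger0_norm ?normc_ge0// ger0_norm ?addr_ge0//.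
exact: normc_le_reim.
Qed.

Lemma Cintegrable_mulbd f g (M : R) : Cintegrable mu f -> Cmeas g ->
  (forall x, normc (g x) <= M) -> Cintegrable mu (fun x => g x * f x).
Proof.
move=> fi mg gM.
apply: (@Cintegrable_le _ (fun x => M * normc (f x))).
- by apply: CmeasM => //; exact: Cintegrable_meas fi.
- have := integrableZl measurableT M (Cintegrable_normc fi).
  by apply: eq_integrable => // x _; rewrite /= EFinM.
- by move=> x; rewrite ComplexField.Normc.normcM ler_wpM2r ?normc_ge0.
Qed.

Lemma CintegrableD f g : Cintegrable mu f -> Cintegrable mu g ->
  Cintegrable mu (fun x => f x + g x).
Proof.
move=> [fr fi] [gr gi]; split.
  have := integrableD measurableT fr gr.
  by apply: eq_integrable => // x _; rewrite reD.
have := integrableD measurableT fi gi.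
by apply: eq_integrable => // x _; rewrite imD.
Qed.

Lemma CintegrableZl (c : C) f : Cintegrable mu f -> Cintegrable mu (fun x => c * f x).
Proof. by move=> fi; apply: (@Cintegrable_mulbd f (fun=> c) (normc c)) => //; exact: Cmeas_cst. Qed.

Lemma CintD f g : Cintegrable mu f -> Cintegrable mu g ->
  Cint mu (fun x => f x + g x) = Cint mu f + Cint mu g.
Proof.
move=> [fr fi] [gr gi]; apply: eqC; rewrite ?reD ?imD /=.
  by under eq_Rintegral do rewrite reD; rewrite RintegralD.
by under eq_Rintegral do rewrite imD; rewrite RintegralD.
Qed.

Lemma CintZl (c : C) f : Cintegrable mu f ->
  Cint mu (fun x => c * f x) = c * Cint mu f.
Proof.
move=> [fr fi].
have zr r : mu.-integrable setT (fun x => (r * re (f x))%:E).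
  by have := integrableZl measurableT r fr; apply: eq_integrable => // x _; rewrite /= EFinM.
have zi r : mu.-integrable setT (fun x => (r * im (f x))%:E).
  by have := integrableZl measurableT r fi; apply: eq_integrable => // x _; rewrite /= EFinM.
apply: eqC; rewrite ?reM ?imM /=.
  by under eq_Rintegral do rewrite reM; 
    rewrite (RintegralB measurableT (zr _) (zi _)) !RintegralZl.
by under eq_Rintegral do rewrite imM; 
  rewrite (RintegralD measurableT (zi _) (zr _)) !RintegralZl.
Qed.

Lemma Cintegrable_sum n (F : 'I_n -> T -> C) : (forall i, Cintegrable mu (F i)) ->
  Cintegrable mu (fun x => \sum_i F i x).
Proof.
elim: n F => [|n IH] F hF.
  under eq_fun do rewrite big_ord0.
  by split; exact: integrable0.
under eq_fun do rewrite big_ord_recl.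
by apply: CintegrableD => //; exact: IH.
Qed.

Lemma Cint_sum n (F : 'I_n -> T -> C) : (forall i, Cintegrable mu (F i)) ->
  Cint mu (fun x => \sum_i F i x) = \sum_i Cint mu (F i).
Proof.
elim: n F => [|n IH] F hF.
  rewrite big_ord0; under eq_fun do rewrite big_ord0.
  by rewrite /Cint Rintegral_cst// mul0r.
under eq_fun do rewrite big_ord_recl.
by rewrite big_ord_recl CintD ?IH//; exact: Cintegrable_sum.
Qed.

(** Bounding the real and the imaginary part separately costs a factor 2,
    which is harmless below. *)
Lemma normc_Cint_le f : Cintegrable mu f ->
  normc (Cint mu f) <= 2 * \int[mu]_x normc (f x).
Proof.
move=> fi; have ni := Cintegrable_normc fi.
apply: (le_trans (normc_le_reim _)); rewrite mulrDl mul1r; case: fi => fr fi.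
apply: lerD.
  apply: (le_trans (le_normr_Rintegral measurableT fr)).
  apply: le_Rintegral => //; first exact: integrable_abse fr.
  by move=> x _; exact: re_le_normc.
apply: (le_trans (le_normr_Rintegral measurableT fi)).
apply: le_Rintegral => //; first exact: integrable_abse fi.
by move=> x _; exact: im_le_normc.
Qed.

End generic.

Section fubini.
Context d1 d2 (T1 : measurableType d1) (T2 : measurableType d2).
Variables (m1 : {sigma_finite_measure set T1 -> \bar R})
          (m2 : {sigma_finite_measure set T2 -> \bar R}).

Lemma Rintegral_fubini1 (f : T1 * T2 -> R) :
  (m1 \x m2)%E.-integrable setT (EFin \o f) ->
  \int[m1]_x \int[m2]_y f (x, y) = \int[(m1 \x m2)%E]_p f p.
Proof.
move=> fi; rewrite {1 3}/Rintegral -(integral12_prod_meas1 fi); congr fine.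
have F := ae_integrable1 fi.
apply: ae_eq_integral => //.
- apply/measurable_EFinP; apply: (measurableT_comp (f := fine)) => //.
  exact: (measurable_fubini_F fi).
- exact: (measurable_fubini_F fi).
apply: filterS F => x h _ /=; rewrite /Rintegral fineK//.
exact: integrable_fin_num.
Qed.

Lemma Rintegral_fubini2 (f : T1 * T2 -> R) :
  (m1 \x m2)%E.-integrable setT (EFin \o f) ->
  \int[m2]_y \int[m1]_x f (x, y) = \int[(m1 \x m2)%E]_p f p.
Proof.
move=> fi; rewrite {1 3}/Rintegral -(integral21_prod_meas1 fi); congr fine.
have F := ae_integrable2 fi.
apply: ae_eq_integral => //.
- apply/measurable_EFinP; apply: (measurableT_comp (f := fine)) => //.
  exact: (measurable_fubini_G fi).
- exact: (measurable_fubini_G fi).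
apply: filterS F => x h _ /=; rewrite /Rintegral fineK//.
exact: integrable_fin_num.
Qed.

Lemma integrable_Rintegral1 (f : T1 * T2 -> R) :
  (m1 \x m2)%E.-integrable setT (EFin \o f) ->
  m1.-integrable setT (fun x => (\int[m2]_y f (x, y))%:E).
Proof.
move=> fi; have h := integrable_fubini_F fi.
have F := ae_integrable1 fi.
have mF : measurable_fun setT (fun x => (\int[m2]_y f (x, y))%:E).
  apply/measurable_EFinP; apply: (measurableT_comp (f := fine)) => //.
  exact: (measurable_fubini_F fi).
apply/integrableP; split => //.
have /integrableP[mh hoo] := h.
rewrite (ae_eq_integral (fun x => `|fubini_F m2 (EFin \o f) x|%E))//.
- exact: measurableT_comp.
- exact: measurableT_comp.
apply: filterS F => x hx _ /=; rewrite /Rintegral.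
rewrite -[X in _ = `|X|%E]fineK//; exact: integrable_fin_num.
Qed.

Lemma Cint_fubini (f : T1 * T2 -> C) : Cintegrable (m1 \x m2)%E f ->
  Cint m1 (fun x => Cint m2 (fun y => f (x, y))) =
  Cint m2 (fun y => Cint m1 (fun x => f (x, y))).
Proof.
move=> [fr fi]; apply: eqC => /=.
  by rewrite (Rintegral_fubini1 fr) (Rintegral_fubini2 fr).
by rewrite (Rintegral_fubini1 fi) (Rintegral_fubini2 fi).
Qed.

Lemma Cintegrable_prodM (f : T1 -> C) (g : T2 -> C) :
  Cintegrable m1 f -> Cintegrable m2 g ->
  Cintegrable (m1 \x m2)%E (fun p => f p.1 * g p.2).
Proof.
move=> [fr fi] [gr gi]; split.
  have := integrableB measurableT (integrable_prodM fr gr) (integrable_prodM fi gi).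
  by apply: eq_integrable => // x _; rewrite reM.
have := integrableD measurableT (integrable_prodM fr gi) (integrable_prodM fi gr).
by apply: eq_integrable => // x _; rewrite imM.
Qed.

Lemma Cint_prodM (f : T1 -> C) (g : T2 -> C) :
  Cintegrable m1 f -> Cintegrable m2 g ->
  Cint (m1 \x m2)%E (fun p => f p.1 * g p.2) = Cint m1 f * Cint m2 g.
Proof.
move=> [fr fi] [gr gi]; apply: eqC; rewrite ?reM ?imM /=.
  rewrite (_ : (fun p => _) = fun p : T1 * T2 =>
    re (f p.1) * re (g p.2) - im (f p.1) * im (g p.2)); last first.
    by apply/funext => p; rewrite reM.
  rewrite (RintegralB measurableT (integrable_prodM fr gr) (integrable_prodM fi gi)).
  by rewrite (Rintegral_prodM fr gr) (Rintegral_prodM fi gi).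
rewrite (_ : (fun p => _) = fun p : T1 * T2 =>
  re (f p.1) * im (g p.2) + im (f p.1) * re (g p.2)); last first.
  by apply/funext => p; rewrite imM.
rewrite (RintegralD measurableT (integrable_prodM fr gi) (integrable_prodM fi gr)).
by rewrite (Rintegral_prodM fr gi) (Rintegral_prodM fi gr).
Qed.

End fubini.

Lemma Rintegral_dct d (T : measurableType d) (mu : {measure set T -> \bar R})
    (f_ : nat -> T -> R) (f : T -> R) (g : T -> R) :
  (forall n, measurable_fun setT (f_ n)) -> measurable_fun setT f ->
  {ae mu, forall x, f_ n x @[n --> \oo] --> f x} ->
  mu.-integrable setT (EFin \o g) ->
  (forall n x, `|f_ n x| <= g x) ->
  \int[mu]_x f_ n x @[n --> \oo] --> \int[mu]_x f x.
Proof.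
move=> mf_ mf ff ig fg.
have [] := @dominated_convergence _ _ R mu setT measurableT
  (fun n => EFin \o f_ n) (EFin \o f) (EFin \o g) _ _ _ ig _.
- by move=> n; exact/measurable_EFinP.
- exact/measurable_EFinP.
- apply: filterS ff => x h _; apply/fine_cvgP; split; first exact: nearW.
  exact: h.
- by apply: aeW => x n _; rewrite lee_fin.
move=> fi _ h; apply: fine_cvg; rewrite fineK//.
exact: integrable_fin_num.
Qed.

End ComplexIntegral.

(** * Superpositions of plane waves *)

Section Oscillatory.
Context {R : realType}.
Local Notation C := R[i].
Local Notation mu1 := (@lebesgue_measure R).

(** Directional derivatives are derivatives along lines, to which one-variable
    calculus applies. *)
Lemma is_derive_line (V : normedModType R) (f : V -> R) (z v : V) (d : R) :
  is_derive (0 : R) (1 : R) (fun h : R => f (h *: v + z)) d -> is_derive z v f d.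
Proof.
move=> h0; have hd := @ex_derive _ _ _ _ _ _ _ h0; have hv := @derive_val _ _ _ _ _ _ _ h0.
have E : (fun h : R => h^-1 *: (((fun h : R => f (h *: v + z)) \o shift (0 : R)) (h *: (1 : R))
           - f (0 *: v + z))) = (fun h => h^-1 *: ((f \o shift z) (h *: v) - f z)).
  by apply/funext => h /=; rewrite addr0 scale0r add0r /GRing.scale /= mulr1.
split.
- by move: hd; rewrite /derivable E.
- by move: hv; rewrite /derive E.
Qed.

Lemma is_derive_line_inv (V : normedModType R) (f : V -> R) (z v : V) (d : R) :
  is_derive z v f d -> is_derive (0 : R) (1 : R) (fun h : R => f (h *: v + z)) d.
Proof.
move=> h0; have hd := @ex_derive _ _ _ _ _ _ _ h0; have hv := @derive_val _ _ _ _ _ _ _ h0.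
have E : (fun h : R => h^-1 *: (((fun h : R => f (h *: v + z)) \o shift (0 : R)) (h *: (1 : R))
           - f (0 *: v + z))) = (fun h => h^-1 *: ((f \o shift z) (h *: v) - f z)).
  by apply/funext => h /=; rewrite addr0 scale0r add0r /GRing.scale /= mulr1.
split.
- by rewrite /derivable E.
- by rewrite /derive E.
Qed.

Lemma is_derive_line_at (V : normedModType R) (f : V -> R) (z v : V) (t d : R) :
  is_derive (t *: v + z) v f d -> is_derive t (1 : R) (fun h : R => f (h *: v + z)) d.
Proof.
move=> /is_derive_line_inv h.
apply: is_derive_line.
rewrite (_ : (fun h0 => _) = fun k : R => f (k *: v + (t *: v + z)))//.
apply/funext => k; congr f; rewrite addrA -scalerDl; congr (_ *: _ + _).
by rewrite /GRing.scale/= mulr1.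
Qed.

Lemma continuous_sumR (U : topologicalType) n (F : 'I_n -> U -> R) :
  (forall i, continuous (F i)) -> continuous (fun z => \sum_i F i z).
Proof.
elim: n F => [|n IH] F cF z.
  by under eq_fun do rewrite big_ord0; exact: cvg_cst.
under eq_fun do rewrite big_ord_recl.
apply: (@continuousD _ _ _ (F ord0) (fun z => \sum_i F (lift ord0 i) z)).
  exact: cF.
exact: IH.
Qed.

(** Sequences detect continuity, and dominated convergence is about
    sequences. *)
Lemma seq_continuous (V : normedModType R) (f : V -> R) (p : V) :
  (forall s : nat -> V, s n @[n --> \oo] --> p -> f (s n) @[n --> \oo] --> f p) ->
  {for p, continuous f}.
Proof.
move=> H; apply/cvgrPdist_lt => e e0; apply: contrapT => nf.
have h n : exists x : V, `|p - x| < n.+1%:R^-1 /\ e <= `|f p - f x|.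
  apply: contrapT => /forallNP h; apply: nf.
  apply/nbhs_ballP; exists n.+1%:R^-1 => //= x px.
  have := h x; rewrite -ball_normE /= in px.
  by move=> /not_andP[//|/negP]; rewrite -ltNge.
have /choice[s hs] := h.
have : s n @[n --> \oo] --> p.
  apply/cvgrPdist_lt => d d0; near=> n.
  apply: (lt_trans (hs n).1); near: n.
  exact: near_infty_natSinv_lt (PosNum d0).
move=> /H /cvgrPdist_lt /(_ _ e0) [n _] /(_ n (leqnn _)) /=.
by rewrite ltNge (hs n).2.
Unshelve. all: by end_near. Qed.

Section param.
Context d (T : measurableType d) (mu : {measure set T -> \bar R}).

(** Differentiation under the integral sign: the mean value theorem dominates
    the difference quotients at [a] by [g]. *)
Lemma Rintegral_is_derive (f f' : R -> T -> R) (g : T -> R) (a : R) :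
  (forall t, mu.-integrable setT (EFin \o f t)) ->
  (forall t y, is_derive t (1 : R) (f ^~ y) (f' t y)) ->
  mu.-integrable setT (EFin \o g) ->
  (forall t y, `|t - a| < 1 -> `|f' t y| <= g y) ->
  is_derive a (1 : R) (fun t => \int[mu]_y f t y) (\int[mu]_y f' a y).
Proof.
move=> fi df gi fg.
have Ia : `](a - 1), (a + 1)[%classic a.
  by rewrite /= in_itv/= ltrBlDr !ltrDl ltr01.
have d1 t y : partial1of2 f t y = f' t y.
  by rewrite partial1of2E; have := df t y => h; exact: derive_val.
have gub t y : `](a - 1), (a + 1)[%classic t -> setT y -> `|partial1of2 f t y| <= `|g y|.
  rewrite /= in_itv/= => /andP[h1 h2] _; rewrite d1.
  by rewrite (le_trans (fg _ _ _)) ?ler_norm// ltr_norml; apply/andP; split; lra.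
have der t y : `](a - 1), (a + 1)[%classic t -> setT y -> derivable (f ^~ y) t 1.
  by move=> _ _; have := df t y => h; exact: ex_derive.
have ig : mu.-integrable setT (EFin \o (fun y => `|g y|)).
  by have := integrable_abse gi; apply: eq_integrable.
split.
  exact: (derivable_under_integral measurableT Ia (fun t _ => fi t) der (fun y => normr_ge0 _) ig gub).
rewrite -derive1E.
rewrite (differentiation_under_integral measurableT Ia (fun t _ => fi t) der (fun y => normr_ge0 _) ig gub).
by apply: eq_Rintegral => y _; exact: d1.
Qed.

Section transform.
Variable N : nat.
Implicit Types (A : T -> C) (P : T -> 'rV[R]_N).

(** The plane waves z |-> e^(i z.P(y)) superposed with amplitudes A(y). Fourier
    transforms, half-waves and products of two half-waves all have this form. *)
Definition Jt A P (z : 'rV[R]_N) : C := Cint mu (fun y => A y * cis (dotp z (P y))).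

Definition rvmeas (P : T -> 'rV[R]_N) := forall i, measurable_fun setT (fun t => P t 0 i).

Lemma dotpDl (x y p : 'rV[R]_N) : dotp (x + y) p = dotp x p + dotp y p.
Proof.
by rewrite /dotp -big_split; apply: eq_bigr => i _; rewrite mxE mulrDl.
Qed.

Lemma dotpZl a (x p : 'rV[R]_N) : dotp (a *: x) p = a * dotp x p.
Proof. by rewrite /dotp mulr_sumr; apply: eq_bigr => i _; rewrite mxE mulrA. Qed.

Lemma dotpC (x y : 'rV[R]_N) : dotp x y = dotp y x.
Proof. by apply: eq_bigr => i _; rewrite mulrC. Qed.

Lemma dotp_delta i (p : 'rV[R]_N) : dotp (delta_mx 0 i) p = p 0 i.
Proof.
rewrite /dotp (bigD1 i)//= mxE !eqxx mul1r big1 ?addr0// => j ji.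
by rewrite mxE (negbTE ji) mul0r.
Qed.

Lemma dotp_continuous (p : 'rV[R]_N) : continuous (fun z => dotp z p).
Proof.
apply: continuous_sumR => i z.
apply: (@continuousM _ _ (fun z : 'rV[R]_N => z 0 i) (cst (p 0 i))).
  exact: coord_continuous.
exact: cst_continuous.
Qed.

Lemma Jt_integrable A P z : Cintegrable mu A -> rvmeas P ->
  Cintegrable mu (fun y => A y * cis (dotp z (P y))).
Proof.
move=> Ai mP; under eq_fun do rewrite mulrC.
apply: (@Cintegrable_mulbd _ _ _ _ _ _ 1) => //.
  by apply: Cmeas_cis; apply: measurable_dotp => // i; exact: measurable_cst.
by move=> y; rewrite normc_cis.
Qed.

Lemma Jt_bound A P z : Cintegrable mu A -> rvmeas P ->
  normc (Jt A P z) <= 2 * \int[mu]_y normc (A y).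
Proof.
move=> Ai mP; apply: (le_trans (normc_Cint_le (Jt_integrable z Ai mP))).
by under eq_Rintegral do rewrite ComplexField.Normc.normcM normc_cis mulr1.
Qed.

Lemma Jt_continuous A P : Cintegrable mu A -> rvmeas P ->
  continuous (fun z => re (Jt A P z)) /\ continuous (fun z => im (Jt A P z)).
Proof.
move=> Ai mP; have nA := Cintegrable_normc Ai.
have cc y : forall s : nat -> 'rV[R]_N, forall z, s n @[n --> \oo] --> z ->
    cos (dotp (s n) (P y)) @[n --> \oo] --> cos (dotp z (P y)) /\
    sin (dotp (s n) (P y)) @[n --> \oo] --> sin (dotp z (P y)).
  move=> s z sz.
  have dz : dotp (s n) (P y) @[n --> \oo] --> dotp z (P y).
    exact: (cvg_comp _ _ sz (@dotp_continuous (P y) z)).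
  by split; [exact: (cvg_comp _ _ dz (@continuous_cos R _))|
             exact: (cvg_comp _ _ dz (@continuous_sin R _))].
split=> z; apply: seq_continuous => s sz.
- apply: (@Rintegral_dct _ _ _ mu (fun n y => re (A y * cis (dotp (s n) (P y))))
    (fun y => re (A y * cis (dotp z (P y)))) (fun y => normc (A y))) => //.
  + by move=> n; have [] := Cintegrable_meas (Jt_integrable (s n) Ai mP).
  + by have [] := Cintegrable_meas (Jt_integrable z Ai mP).
  + apply: aeW => y; have [c1 c2] := cc y s z sz.
    under eq_fun do rewrite reM; rewrite reM /=.
    by apply: cvgB; (apply: cvgM; first exact: cvg_cst).
  + move=> n y; apply: (le_trans (re_le_normc _)).
    by rewrite ComplexField.Normc.normcM normc_cis mulr1.
- apply: (@Rintegral_dct _ _ _ mu (fun n y => im (A y * cis (dotp (s n) (P y))))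
    (fun y => im (A y * cis (dotp z (P y)))) (fun y => normc (A y))) => //.
  + by move=> n; have [] := Cintegrable_meas (Jt_integrable (s n) Ai mP).
  + by have [] := Cintegrable_meas (Jt_integrable z Ai mP).
  + apply: aeW => y; have [c1 c2] := cc y s z sz.
    under eq_fun do rewrite imM; rewrite imM /=.
    by apply: cvgD; (apply: cvgM; first exact: cvg_cst).
  + move=> n y; apply: (le_trans (im_le_normc _)).
    by rewrite ComplexField.Normc.normcM normc_cis mulr1.
Qed.

Lemma is_derive_cisM (u : C) (p q t : R) :
  is_derive t (1 : R) (fun h => re (u * cis (h * p + q))) (re ('i * p%:C * u * cis (t * p + q))) /\
  is_derive t (1 : R) (fun h => im (u * cis (h * p + q))) (im ('i * p%:C * u * cis (t * p + q))).
Proof.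
have l : is_derive t (1 : R) (fun h => h * p + q) p.
  have h1 := is_derive_linear p t.
  have h2 : is_derive t (1 : R) (fun h => h * p) p.
    by under eq_fun do rewrite mulrC.
  have h3 := is_deriveD h2 (is_derive_cst q t (1 : R)).
  by apply: (is_derive_eq h3); rewrite addr0.
have c : is_derive t (1 : R) (fun h => cos (h * p + q)) (- sin (t * p + q) * p).
  have h := @is_derive1_comp _ cos _ t _ _ (is_derive_cos _) l.
  exact: (is_derive_eq h).
have s : is_derive t (1 : R) (fun h => sin (h * p + q)) (cos (t * p + q) * p).
  have h := @is_derive1_comp _ sin _ t _ _ (is_derive_sin _) l.
  exact: (is_derive_eq h).
split.
  under eq_fun do rewrite reM /=.
  have h := is_deriveB (is_deriveZ (re u) c) (is_deriveZ (im u) s).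
  by apply: (is_derive_eq h); rewrite !(reM, imM) /= /GRing.scale /=; ring.
under eq_fun do rewrite imM /=.
have h := is_deriveD (is_deriveZ (re u) s) (is_deriveZ (im u) c).
by apply: (is_derive_eq h); rewrite !(reM, imM) /= /GRing.scale /=; ring.
Qed.

(** Each derivative brings down a factor i P_i(y). *)
Lemma Jt_is_derive A P i z : Cintegrable mu A -> rvmeas P ->
  Cintegrable mu (fun y => 'i * (P y 0 i)%:C * A y) ->
  is_derive z (delta_mx 0 i) (fun z => re (Jt A P z))
    (re (Jt (fun y => 'i * (P y 0 i)%:C * A y) P z)) /\
  is_derive z (delta_mx 0 i) (fun z => im (Jt A P z))
    (im (Jt (fun y => 'i * (P y 0 i)%:C * A y) P z)).
Proof.
move=> Ai mP PAi; have nA := Cintegrable_normc PAi.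
have E h y : dotp (h *: delta_mx 0 i + z) (P y) = h * P y 0 i + dotp z (P y).
  by rewrite dotpDl dotpZl dotp_delta.
have Ji := Jt_integrable _ Ai mP.
split; apply: is_derive_line.
- have := @Rintegral_is_derive
    (fun h y => re (A y * cis (dotp (h *: delta_mx 0 i + z) (P y))))
    (fun h y => re ('i * (P y 0 i)%:C * A y * cis (dotp (h *: delta_mx 0 i + z) (P y))))
    (fun y => normc ('i * (P y 0 i)%:C * A y)) 0.
  rewrite scale0r add0r; apply.
  + by move=> t; have [] := Ji (t *: delta_mx 0 i + z).
  + move=> t y; rewrite E; under eq_fun do rewrite E.
    exact: (is_derive_cisM _ _ _ _).1.
  + exact: nA.
  + move=> t y _; apply: (le_trans (re_le_normc _)).
    by rewrite ComplexField.Normc.normcM normc_cis mulr1.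
- have := @Rintegral_is_derive
    (fun h y => im (A y * cis (dotp (h *: delta_mx 0 i + z) (P y))))
    (fun h y => im ('i * (P y 0 i)%:C * A y * cis (dotp (h *: delta_mx 0 i + z) (P y))))
    (fun y => normc ('i * (P y 0 i)%:C * A y)) 0.
  rewrite scale0r add0r; apply.
  + by move=> t; have [] := Ji (t *: delta_mx 0 i + z).
  + move=> t y; rewrite E; under eq_fun do rewrite E.
    exact: (is_derive_cisM _ _ _ _).2.
  + exact: nA.
  + move=> t y _; apply: (le_trans (im_le_normc _)).
    by rewrite ComplexField.Normc.normcM normc_cis mulr1.
Qed.

End transform.

End param.

End Oscillatory.

(** * Approximate identities and Fourier inversion *)

Section Poisson.
Context {R : realType}.
Local Notation C := R[i].
Local Notation mu1 := (@lebesgue_measure R).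

Lemma Rintegral_tuple_prodM n (w : 'I_n -> R -> R) :
  (forall i, mu1.-integrable setT (EFin \o w i)) ->
  \int[leb R n]_v (\prod_i w i (vec v 0 i)) = \prod_i \int[mu1]_x w i x.
Proof.
elim: n w => [|n IH] w wi.
  by rewrite /Rintegral integral_tuple0 /= !big_ord0.
rewrite {1}/Rintegral integral_tcons_prod; last exact: integrable_tuple_prodM.
rewrite big_ord_recl -IH; last by move=> i; exact: wi.
rewrite -(Rintegral_prodM (wi ord0) (integrable_tuple_prodM (fun i => wi (lift ord0 i)))).
apply: congr1; apply: eq_integral => -[x v] _ /=.
rewrite big_ord_recl vec_tcons event0; congr ((_ * _)%:E).
by apply: eq_bigr => i _; rewrite event_lift.
Qed.

Variable n : nat.
Implicit Types (x y p : 'rV[R]_n).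

Definition K (d : R) x : R := poisK (fun=> d) x.
Definition W (d : R) x : R := poisW (fun=> d) x.

Lemma K_ge0 d x : 0 < d -> 0 <= K d x.
Proof.
move=> d0; apply: prodr_ge0 => i _.
by rewrite divr_ge0 ?mulr_ge0 ?addr_ge0 ?sqr_ge0// ltW.
Qed.

Lemma KN d x : K d (- x) = K d x.
Proof. by apply: eq_bigr => i _; rewrite mxE sqrrN. Qed.

Lemma K_scale d x : 0 < d -> K d (d *: x) = d ^- n * K 1 x.
Proof.
move=> d0; have -> : d ^- n = \prod_(i < n) d^-1 by rewrite prodr_const card_ord exprVn.
rewrite /K /poisK -big_split /=.
apply: eq_bigr => i _; rewrite mxE expr1n mulr1.
have : 0 < 1 + x 0 i ^+ 2 by exact: oneDsq_gt0.
by move=> h; field; rewrite ?gt_eqF//= ?gt_eqF// exprMn -{1}[d ^+ 2]mulr1 -mulrDr mulr_gt0// exprn_gt0.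
Qed.

Lemma integrable_K1 : (leb R n).-integrable setT (fun v => (K 1 (vec v))%:E).
Proof.
rewrite /K /poisK.
apply: (@integrable_tuple_prodM _ _ (fun i (x : R) => 2 * 1 / (1 ^+ 2 + x ^+ 2))) => i.
have := integrableZl measurableT 2 (@cauchy_density_integrable R).
by apply: eq_integrable => // x _; rewrite /= expr1n mulr1 EFinM.
Qed.

Lemma Rintegral_K1 : \int[leb R n]_v K 1 (vec v) = (2 * pi) ^+ n.
Proof.
rewrite /K /poisK (@Rintegral_tuple_prodM _ (fun i (x : R) => 2 * 1 / (1 ^+ 2 + x ^+ 2))).
  have -> : (2 * pi) ^+ n = \prod_(i < n) (2 * pi) :> R by rewrite prodr_const card_ord.
  apply: eq_bigr => i _.
  under eq_Rintegral do rewrite expr1n mulr1.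
  by rewrite RintegralZl// ?cauchy_density_integral//; exact: cauchy_density_integrable.
move=> i.
have := integrableZl measurableT 2 (@cauchy_density_integrable R).
by apply: eq_integrable => // x _; rewrite /= expr1n mulr1 EFinM.
Qed.

(** The kernel of width [d] is the dilation of the kernel of width 1, with the
    same integral. *)
Lemma Rintegral_K_scale (f : 'rV[R]_n -> R) (d M : R) x0 : 0 < d ->
  measurable_fun setT (f \o @vec R n) -> (forall x, `|f x| <= M) ->
  (leb R n).-integrable setT (fun v => (f (vec v) * K d (vec v - x0))%:E) /\
  \int[leb R n]_v (f (vec v) * K d (vec v - x0)) =
  \int[leb R n]_v (f (d *: vec v + x0) * K 1 (vec v)).
Proof.
move=> d0 mf fM.
pose g y := f (d *: y + x0) * K 1 y.
have gi : (leb R n).-integrable setT (fun v => (g (vec v))%:E).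
  have h := integrableZl measurableT M integrable_K1.
  apply: (le_integrable measurableT _ _ h).
    apply/measurable_EFinP; apply: measurable_funM.
      have -> : (fun v : RT R n => f (d *: vec v + x0)) =
          (f \o @vec R n) \o (fun v => unvec (d *: vec v + x0)).
        by apply/funext => v /=; rewrite vecK.
      by apply: measurableT_comp => //; exact: measurable_affine.
    by have /integrableP[/measurable_EFinP] := integrable_K1.
  move=> v _; rewrite lee_fin !normrM ler_wpM2r//.
  by rewrite (le_trans (fM _))// ler_norm.
have dV0 : d^-1 != 0 by rewrite invr_eq0 gt_eqF.
have i2 := integrable_affine (- (d^-1 *: x0)) dV0 gi.
have e2 := Rintegral_affine (- (d^-1 *: x0)) dV0 gi.
have E v : g (d^-1 *: vec v - d^-1 *: x0) = d ^+ n * (f (vec v) * K d (vec v - x0)).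
  rewrite /g -scalerBr scalerA divff ?gt_eqF// scale1r subrK.
  have := K_scale (d^-1 *: (vec v - x0)) d0.
  rewrite scalerA divff ?gt_eqF// scale1r => ->.
  by rewrite mulrCA mulVKf// expf_neq0// gt_eqF.
have dn0 : d ^+ n != 0 by rewrite expf_neq0// gt_eqF.
have I : (leb R n).-integrable setT (fun v => (f (vec v) * K d (vec v - x0))%:E).
  have := integrableZl measurableT (d ^- n) i2.
  by apply: eq_integrable => // v _; rewrite E -EFinM mulKf.
split => //; apply: (mulfI dn0); rewrite -RintegralZl//.
under eq_Rintegral do rewrite -E.
rewrite e2 ger0_norm ?invr_ge0 ?(ltW d0)// exprVn invrK.
by [].
Qed.

Lemma Rintegral_K (d : R) x0 : 0 < d ->
  (leb R n).-integrable setT (fun v => (K d (vec v - x0))%:E) /\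
  \int[leb R n]_v K d (vec v - x0) = (2 * pi) ^+ n.
Proof.
move=> d0.
have [] := @Rintegral_K_scale (fun=> 1) d 1 x0 d0 (measurable_cst _) _.
  by move=> x; rewrite normr1.
move=> i e; split.
  by move: i; apply: eq_integrable => // v _; rewrite mul1r.
under eq_Rintegral do rewrite -[K _ _]mul1r.
by rewrite e; under eq_Rintegral do rewrite mul1r; exact: Rintegral_K1.
Qed.

Definition dseq (m : nat) : R := m.+1%:R^-1.

Lemma dseq_gt0 m : 0 < dseq m. Proof. by rewrite invr_gt0. Qed.

Lemma dseq_cvg : dseq m @[m --> \oo] --> (0 : R).
Proof.
apply/cvgrPdist_lt => e e0; near=> m.
rewrite sub0r normrN ger0_norm ?(ltW (dseq_gt0 _))//; near: m.
exact: near_infty_natSinv_lt (PosNum e0).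
Unshelve. all: by end_near. Qed.

(** After dilation the kernel is fixed and the function is f (d x + x0), which
    tends to f x0. *)
Lemma approx_identity (f : 'rV[R]_n -> R) (M : R) x0 :
  measurable_fun setT (f \o @vec R n) -> (forall x, `|f x| <= M) ->
  {for x0, continuous f} ->
  \int[leb R n]_v (f (vec v) * K (dseq m) (vec v - x0)) @[m --> \oo] -->
  (2 * pi) ^+ n * f x0.
Proof.
move=> mf fM cf.
under eq_fun => m do rewrite (Rintegral_K_scale x0 (dseq_gt0 m) mf fM).2.
rewrite -Rintegral_K1 -RintegralZr//; last exact: integrable_K1.
have mK : measurable_fun setT (fun v : RT R n => K 1 (vec v)).
  by have /integrableP[/measurable_EFinP] := integrable_K1.
under eq_Rintegral do rewrite mulrC.
apply: (@Rintegral_dct _ _ _ (leb R n)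
   (fun m v => f (dseq m *: vec v + x0) * K 1 (vec v))
   (fun v => f x0 * K 1 (vec v)) (fun v => M * K 1 (vec v))).
- move=> m; apply: measurable_funM => //.
  have -> : (fun v : RT R n => f (dseq m *: vec v + x0)) =
      (f \o @vec R n) \o (fun v => unvec (dseq m *: vec v + x0)).
    by apply/funext => v /=; rewrite vecK.
  by apply: measurableT_comp => //; exact: measurable_affine.
- exact: measurable_funM.
- apply: aeW => v; apply: cvgM; last exact: cvg_cst.
  have h : dseq m *: vec v + x0 @[m --> \oo] --> x0.
    rewrite -[X in _ --> X](add0r x0) -(scale0r (vec v)).
    apply: cvgD; last exact: cvg_cst.
    by apply: cvgZr_tmp; exact: dseq_cvg.
  exact: (cvg_comp _ _ h cf).
- have := integrableZl measurableT M integrable_K1.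
  by apply: eq_integrable => // v _; rewrite /= EFinM.
- by move=> m v; rewrite normrM (ger0_norm (K_ge0 _ _))// ler_wpM2r ?K_ge0.
Qed.

End Poisson.

Section PoissonInversion.
Context {R : realType}.
Local Notation C := R[i].

Lemma poisKN n (d : 'I_n -> R) p : poisK d (- p) = poisK d p.
Proof. by apply: eq_bigr => i _; rewrite mxE sqrrN. Qed.

Lemma poisK_ge0 n (d : 'I_n -> R) p : (forall i, 0 < d i) -> 0 <= poisK d p.
Proof.
move=> d0; apply: prodr_ge0 => i _.
by rewrite divr_ge0 ?mulr_ge0 ?addr_ge0 ?sqr_ge0// ltW.
Qed.

Lemma poisW_le1 n (d : 'I_n -> R) x : (forall i, 0 < d i) -> poisW d x <= 1.
Proof.
move=> d0; apply: prodr_ile1 => i; rewrite expR_ge0 /= -expR0 ler_expR oppr_le0.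
by rewrite mulr_ge0// ltW.
Qed.

Lemma measurable_dotp_vecl n (x : 'rV[R]_n) :
  measurable_fun setT (fun v : RT R n => dotp (vec v) x).
Proof.
apply: measurable_dotp => i; first exact: measurable_vec_coord.
exact: measurable_cst.
Qed.

Lemma measurable_dotp_vecr n (x : 'rV[R]_n) :
  measurable_fun setT (fun v : RT R n => dotp x (vec v)).
Proof.
apply: measurable_dotp => i; first exact: measurable_cst.
exact: measurable_vec_coord.
Qed.

Lemma W_expR n d (x : 'rV[R]_n) : W d x = expR (- (d * \sum_i `|x 0 i|)).
Proof.
rewrite /W /poisW mulr_sumr -sumrN.
by rewrite [RHS](big_morph _ (@expRD R) (@expR0 R)).
Qed.

Lemma W_cvg n (x : 'rV[R]_n) : W (dseq m : R) x @[m --> \oo] --> (1 : R).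
Proof.
under eq_fun do rewrite W_expR.
set S := \sum_i _; have -> : (1 : R) = expR (- (0 * S)) by rewrite mul0r oppr0 expR0.
apply: (cvg_comp _ expR); last exact: continuous_expR.
apply: cvgN; apply: cvgM; last exact: cvg_cst.
exact: dseq_cvg.
Qed.

Lemma W_cvgM n (x : 'rV[R]_n) (r : R) : W (dseq m) x * r @[m --> \oo] --> r.
Proof.
have h := cvgM (W_cvg x) (cvg_cst r).
by rewrite mul1r in h; exact: h.
Qed.

Lemma W_le1 n (d : R) (x : 'rV[R]_n) : 0 < d -> W d x <= 1.
Proof. by move=> d0; exact: poisW_le1. Qed.

Lemma measurable_poisW n (d : 'I_n -> R) :
  measurable_fun setT (fun v : RT R n => poisW d (vec v)).
Proof.
apply: measurable_prod => i _; apply: measurableT_comp => //.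
apply: measurable_funN; apply: measurable_funM => //.
by apply: measurableT_comp => //; exact: measurable_vec_coord.
Qed.

Lemma measurable_poisK n (d : 'I_n -> R) :
  (forall i, 0 < d i) ->
  measurable_fun setT (fun v : RT R n => poisK d (vec v)).
Proof.
move=> d0; apply: measurable_prod => i _; apply: measurable_funM => //.
apply: (measurableT_comp (f := fun y : R => (d i ^+ 2 + y ^+ 2)^-1)); last exact: measurable_vec_coord.
apply: continuous_measurable_fun => y.
apply: (@continuousV _ _ (fun y : R => d i ^+ 2 + y ^+ 2)).
  by rewrite gt_eqF// ltr_pwDl ?sqr_ge0// exprn_gt0.
by apply: continuousD; [exact: cst_continuous|exact: exprn_continuous].
Qed.

Lemma Cint_poisW_cis n (d : 'I_n -> R) p : (forall i, 0 < d i) ->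
  Cintegrable (leb R n) (fun v => (poisW d (vec v))%:C * cis (dotp (vec v) p)) /\
  Cint (leb R n) (fun v => (poisW d (vec v))%:C * cis (dotp (vec v) p)) = (poisK d p)%:C.
Proof.
move=> d0; split.
  split.
    have := integrable_poisW_cos p d0; apply: eq_integrable => // v _.
    by rewrite reM /= mul0r subr0.
  have := integrable_poisW_sin p d0; apply: eq_integrable => // v _.
  by rewrite imM /= mul0r addr0.
have [h1 h2] := poisW_cos_sin p d0.
by apply: eqC => /=; [rewrite -[RHS]h1|rewrite -[RHS]h2]; apply: eq_Rintegral => v _;
  rewrite mul0r ?subr0 ?addr0.
Qed.

Section inversion.
Variables (n : nat) (G : 'rV[R]_n -> C) (s M : R) (x0 : 'rV[R]_n).
Let h (x : 'rV[R]_n) := Cint (leb R n) (fun v => G (vec v) * cis (s * dotp x (vec v))).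
Hypotheses (s2 : s ^+ 2 = 1) (Gi : Cintegrable (leb R n) (G \o @vec R n))
  (GM : forall x, normc (G x) <= M)
  (cr : {for x0, continuous (fun x => re (G x))})
  (ci : {for x0, continuous (fun x => im (G x))})
  (hi : Cintegrable (leb R n) (h \o @vec R n)).

Let mG : Cmeas (G \o @vec R n) := Cintegrable_meas Gi.

Let L (m : nat) := Cint (leb R n) (fun x =>
  (W (dseq m) (vec x))%:C * (h (vec x) * cis (- (s * dotp (vec x) x0)))).

Let LE m : L m = Cint (leb R n) (fun v => G (vec v) * (K (dseq m) (vec v - x0))%:C).
Proof.
have dm := @dseq_gt0 R m.
pose f (p : RT R n * RT R n) : C :=
  (W (dseq m) (vec p.1))%:C * cis (- (s * dotp (vec p.1) x0)) *
   (G (vec p.2) * cis (s * dotp (vec p.1) (vec p.2))).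
have mv1 (i : 'I_n) : measurable_fun setT (fun p : RT R n * RT R n => vec p.1 0 i).
  by apply: (measurableT_comp (@measurable_vec_coord R n i)); exact: measurable_fst.
have mv2 (i : 'I_n) : measurable_fun setT (fun p : RT R n * RT R n => vec p.2 0 i).
  by apply: (measurableT_comp (@measurable_vec_coord R n i)); exact: measurable_snd.
have fi : Cintegrable (leb R n \x leb R n)%E f.
  apply: (@Cintegrable_le _ _ _ _ f (fun p => W (dseq m) (vec p.1) * normc (G (vec p.2)))).
  - apply: CmeasM; apply: CmeasM.
    + apply: Cmeas_rc; apply: (measurableT_comp (measurable_poisW (fun=> dseq m))).
      exact: measurable_fst.
    + apply: Cmeas_cis; apply: measurable_funN; apply: measurable_funM => //.
      by apply: measurable_dotp => // i; exact: measurable_cst.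
    + have [g1 g2] := mG; split.
        by apply: (measurableT_comp g1); exact: measurable_snd.
      by apply: (measurableT_comp g2); exact: measurable_snd.
    + by apply: Cmeas_cis; apply: measurable_funM => //; exact: measurable_dotp.
  - have iW : (leb R n).-integrable setT (EFin \o (fun v => W (dseq m) (vec v))).
      exact: integrable_poisW.
    have iG : (leb R n).-integrable setT (EFin \o (fun v => normc (G (vec v)))).
      exact: (Cintegrable_normc Gi).
    exact: (integrable_prodM iW iG).
  - move=> p; rewrite !ComplexField.Normc.normcM !normc_cis normc_rc !mulr1.
    by rewrite ger0_norm// poisW_ge0.
have F := Cint_fubini fi.
have E1 : L m = Cint (leb R n) (fun x => Cint (leb R n) (fun y => f (x, y))).
  rewrite /L; congr Cint; apply/funext => x; rewrite /f /=.
  rewrite CintZl; first by rewrite /h mulrAC -mulrA.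
  apply: (@Cintegrable_le _ _ _ _ _ (fun v => normc (G (vec v)))).
  - apply: CmeasM; first exact: mG.
    apply: Cmeas_cis; apply: measurable_funM; first exact: measurable_cst.
    exact: measurable_dotp_vecr.
  - exact: Cintegrable_normc.
  - by move=> v; rewrite ComplexField.Normc.normcM normc_cis mulr1.
rewrite E1 F; congr Cint; apply/funext => y; rewrite /f /=.
have [i1 e1] := @Cint_poisW_cis n (fun=> dseq m) (s *: (vec y - x0)) (fun=> dm).
transitivity (G (vec y) * Cint (leb R n)
  (fun v => (poisW (fun=> dseq m) (vec v))%:C * cis (dotp (vec v) (s *: (vec y - x0))))).
  rewrite -(CintZl _ i1); congr Cint; apply/funext => x /=.
  have -> : dotp (vec x) (s *: (vec y - x0)) =
      - (s * dotp (vec x) x0) + s * dotp (vec x) (vec y).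
    rewrite dotpC dotpZl dotpDl -scaleN1r dotpZl !(dotpC _ (vec x)); ring.
  by rewrite cisD /W; ring.
rewrite e1; congr (_ * _%:C); rewrite /K.
apply: eq_bigr => i _; rewrite mxE exprMn s2 mul1r.
by rewrite !mxE.
Qed.

(** With the factor [W d (vec x)] inserted, Fubini turns the left side into the
    integral of G against the Poisson kernel centred at x0; then d tends to 0.
    The sign s covers the Fourier transform and its inverse at once. *)
Lemma Cint_inversion :
  Cint (leb R n) (fun x => h (vec x) * cis (- (s * dotp (vec x) x0))) =
  ((2 * pi) ^+ n)%:C * G x0.
Proof.
have mW m : measurable_fun setT (fun v : RT R n => W (dseq m) (vec v)).
  exact: measurable_poisW.
have mh : Cmeas (fun x : RT R n => h (vec x) * cis (- (s * dotp (vec x) x0))).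
  apply: CmeasM; first exact: Cintegrable_meas hi.
  apply: Cmeas_cis; apply: measurable_funN; apply: measurable_funM.
    exact: measurable_cst.
  exact: measurable_dotp_vecl.
have nh := Cintegrable_normc hi.
have W01 m x : `|W (dseq m) (x : 'rV[R]_n)| <= 1.
  by rewrite ger0_norm ?poisW_ge0// W_le1// dseq_gt0.
apply: eqC.
- have l1 : re (L m) @[m --> \oo] --> re (Cint (leb R n)
      (fun x => h (vec x) * cis (- (s * dotp (vec x) x0)))).
    apply: (@Rintegral_dct _ _ _ (leb R n) (fun m x => re ((W (dseq m) (vec x))%:C *
       (h (vec x) * cis (- (s * dotp (vec x) x0))))) _ (fun x => normc (h (vec x)))).
    + by move=> m; have [] := CmeasM (Cmeas_rc (mW m)) mh.
    + by have [] := mh.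
    + apply: aeW => x; under eq_fun do rewrite reM re_rc im_rc mul0r subr0.
      exact: W_cvgM.
    + exact: nh.
    + move=> m x; apply: (le_trans (re_le_normc _)).
      rewrite !ComplexField.Normc.normcM normc_cis mulr1 normc_rc.
      by rewrite ler_piMl ?normc_ge0.
  have l2 : re (L m) @[m --> \oo] --> re (((2 * pi) ^+ n)%:C * G x0).
    rewrite reM re_rc im_rc mul0r subr0.
    have := @approx_identity R n (fun x => re (G x)) M x0 mG.1
      (fun x => le_trans (re_le_normc _) (GM x)) cr.
    apply: cvg_trans; apply: near_eq_cvg; apply: nearW => m.
    rewrite LE /=; apply: eq_Rintegral => v _; by rewrite reM /= mulr0 subr0.
  exact: (cvg_unique _ l1 l2).
- have l1 : im (L m) @[m --> \oo] --> im (Cint (leb R n)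
      (fun x => h (vec x) * cis (- (s * dotp (vec x) x0)))).
    apply: (@Rintegral_dct _ _ _ (leb R n) (fun m x => im ((W (dseq m) (vec x))%:C *
       (h (vec x) * cis (- (s * dotp (vec x) x0))))) _ (fun x => normc (h (vec x)))).
    + by move=> m; have [] := CmeasM (Cmeas_rc (mW m)) mh.
    + by have [] := mh.
    + apply: aeW => x; under eq_fun do rewrite imM re_rc im_rc mul0r addr0.
      exact: W_cvgM.
    + exact: nh.
    + move=> m x; apply: (le_trans (im_le_normc _)).
      rewrite !ComplexField.Normc.normcM normc_cis mulr1 normc_rc.
      by rewrite ler_piMl ?normc_ge0.
  have l2 : im (L m) @[m --> \oo] --> im (((2 * pi) ^+ n)%:C * G x0).
    rewrite imM re_rc im_rc mul0r addr0.
    have := @approx_identity R n (fun x => im (G x)) M x0 mG.2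
      (fun x => le_trans (im_le_normc _) (GM x)) ci.
    apply: cvg_trans; apply: near_eq_cvg; apply: nearW => m.
    rewrite LE /=; apply: eq_Rintegral => v _.
    by rewrite imM /= mulr0 add0r.
  exact: (cvg_unique _ l1 l2).
Qed.
End inversion.

End PoissonInversion.

(** * Quadratic forms of frequencies and the lower half of Plancherel *)

Section product_sigma_finite.
Context d1 d2 (T1 : measurableType d1) (T2 : measurableType d2) (R : realType).
Variables (m1 : {sigma_finite_measure set T1 -> \bar R})
          (m2 : {sigma_finite_measure set T2 -> \bar R}).

Lemma product_measure_sigma_finiteT : sigma_finite setT (m1 \x m2)%E.
Proof.
have /sigma_finiteP[F [TF ndF Foo]] := sigma_finiteT m1.
have /sigma_finiteP[G [TG ndG Goo]] := sigma_finiteT m2.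
exists (fun n => F n `*` G n).
 rewrite -setXTT TF TG predeqE => -[x y]; split.
    move=> [/= [n _ Fnx] [k _ Gky]]; exists (maxn n k) => //; split.
    - by move: x Fnx; exact/subsetPset/ndF/leq_maxl.
    - by move: y Gky; exact/subsetPset/ndG/leq_maxr.
  by move=> [n _ []/= ? ?]; split; exists n.
move=> k; have [? ?] := Foo k; have [? ?] := Goo k.
split; first exact: measurableX.
by rewrite product_measure1E// lte_mul_pinfty// ge0_fin_numE.
Qed.

(** The product measure under a name that carries its sigma-finiteness, so that
    it can enter [Jt] and products again. *)
Definition prodm : set (T1 * T2) -> \bar R := (m1 \x m2)%E.
HB.instance Definition _ := Measure.on prodm.
HB.instance Definition _ := Measure_isSigmaFinite.Build _ _ _ prodm
  product_measure_sigma_finiteT.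

End product_sigma_finite.

Section QuadraticForm.
Context {R : realType}.
Local Notation C := R[i].

Lemma cvg_le_bound (u : nat -> R) (l b : R) :
  u m @[m --> \oo] --> l -> (forall m, u m <= b) -> l <= b.
Proof.
move=> ul ub; rewrite -(cvg_lim (@Rhausdorff R) ul).
by apply: limr_le; [apply/cvg_ex; exists l|exact: nearW].
Qed.

Lemma cvg_le_ebound (u : nat -> R) (l : R) (b : \bar R) :
  u m @[m --> \oo] --> l -> (forall m, ((u m)%:E <= b)%E) -> (l%:E <= b)%E.
Proof.
case: b => [b| |] ul ub.
- by rewrite lee_fin; apply: cvg_le_bound ul _ => m; rewrite -lee_fin.
- exact: leey.
- by have := ub 0%N.
Qed.

Lemma conjcM (x y : C) : conjc (x * y) = conjc x * conjc y.
Proof. by case: x y => [a b] [c e]; congr (_ +i* _); ring. Qed.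

Lemma normc_sqr_mul (z : C) : normc z ^+ 2 = re (z * conjc z).
Proof. by case: z => a b; rewrite normc_sqr reM /=; ring. Qed.

Lemma Cint_conj d (T : measurableType d) (mu : {measure set T -> \bar R}) (f : T -> C) :
  Cintegrable mu f -> Cint mu (fun y => conjc (f y)) = conjc (Cint mu f).
Proof.
move=> [fr fi]; apply: eqC => /=.
  by apply: eq_Rintegral => y _; case: (f y).
rewrite -mulN1r -(RintegralZl _ measurableT fi).
by apply: eq_Rintegral => y _; rewrite mulN1r; case: (f y).
Qed.

Lemma Cintegrable_conj d (T : measurableType d) (mu : {measure set T -> \bar R}) (f : T -> C) :
  Cintegrable mu f -> Cintegrable mu (fun y => conjc (f y)).
Proof.
move=> fi; apply: (Cintegrable_le _ (Cintegrable_normc fi)).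
  by apply: Cmeas_conj; exact: Cintegrable_meas fi.
by move=> x; rewrite normc_conj.
Qed.

Section identity.
Context d (T : measurableType d) (mu : {sigma_finite_measure set T -> \bar R}).
Variables (N : nat) (A : T -> C) (P : T -> 'rV[R]_N) (w : 'I_N -> R).
Hypotheses (Ai : Cintegrable mu A) (mP : rvmeas P) (w0 : forall i, 0 < w i).

Definition gram (p : T * T) : R :=
  re (A p.1 * conjc (A p.2)) * poisK w (P p.1 - P p.2).

Let AA (p : T * T) : C := A p.1 * conjc (A p.2).

Let AAi : Cintegrable (prodm mu mu) AA.
Proof. exact: (Cintegrable_prodM Ai (Cintegrable_conj Ai)). Qed.

Let dP (p : T * T) : 'rV[R]_N := P p.1 - P p.2.

Let mdP : rvmeas dP.
Proof.
move=> i; rewrite /dP; under eq_fun do rewrite mxE [X in _ + X]mxE.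
apply: measurable_funB.
  by apply: (measurableT_comp (mP i)); exact: measurable_fst.
by apply: (measurableT_comp (mP i)); exact: measurable_snd.
Qed.

Let Phi (q : RT R N * (T * T)) : R :=
  poisW w (vec q.1) * re (AA q.2 * cis (dotp (vec q.1) (dP q.2))).

Let Phii : (leb R N \x prodm mu mu)%E.-integrable setT (EFin \o Phi).
Proof.
have h := integrable_prodM (integrable_poisW w0) (Cintegrable_normc AAi).
apply: (le_integrable measurableT _ _ h).
  apply/measurable_EFinP; apply: measurable_funM.
    by apply: (measurableT_comp (measurable_poisW w)); exact: measurable_fst.
  have mAA : Cmeas (fun q : RT R N * (T * T) => AA q.2).
    have [m1 m2] := Cintegrable_meas AAi; split.
      by apply: (measurableT_comp m1); exact: measurable_snd.
    by apply: (measurableT_comp m2); exact: measurable_snd.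
  have mc : Cmeas (fun q : RT R N * (T * T) => cis (dotp (vec q.1) (dP q.2))).
    apply: Cmeas_cis; apply: measurable_dotp => i.
      by apply: (measurableT_comp (@measurable_vec_coord R N i)); exact: measurable_fst.
    by apply: (measurableT_comp (mdP i)); exact: measurable_snd.
  by have [] := CmeasM mAA mc.
move=> q _; rewrite lee_fin /Phi !normrM.
rewrite ler_wpM2l//; apply: (le_trans (re_le_normc _)).
by rewrite ComplexField.Normc.normcM normc_cis mulr1 ger0_norm ?normc_ge0.
Qed.

Let Jt_sqr z : normc (Jt mu A P z) ^+ 2 =
  \int[(prodm mu mu)]_p re (AA p * cis (dotp z (dP p))).
Proof.
have Ji := Jt_integrable z Ai mP.
rewrite normc_sqr_mul.
pose f y : R[i] := A y * cis (dotp z (P y)).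
have e2 : Cint (prodm mu mu) (fun p => f p.1 * conjc (f p.2)) = Cint mu f * conjc (Cint mu f).
  have e1 : conjc (Cint mu f) = Cint mu (fun y => conjc (f y)) by symmetry; exact: (Cint_conj Ji).
  rewrite e1; exact: (Cint_prodM Ji (Cintegrable_conj Ji)).
transitivity (re (Cint (prodm mu mu) (fun p => f p.1 * conjc (f p.2)))); first by rewrite e2.
rewrite /Cint [re _]/= /f.
apply: eq_Rintegral => p _; congr re.
have -> : dotp z (dP p) = dotp z (P p.1) + - dotp z (P p.2).
  by rewrite /dP dotpC dotpDl -scaleN1r dotpZl mulN1r !(dotpC _ z).
rewrite cisD /AA.
have -> : cis (- dotp z (P p.2)) = conjc (cis (dotp z (P p.2))).
  by rewrite /cis /= cosN sinN.
by rewrite conjcM; ring.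
Qed.

(** Expand the square of the superposition and integrate in z first: the weight
    becomes its Fourier transform at the difference of the two frequencies. *)
Lemma gram_identity :
  (leb R N).-integrable setT
    (fun z => (normc (Jt mu A P (vec z)) ^+ 2 * poisW w (vec z))%:E) /\
  (prodm mu mu).-integrable setT (EFin \o gram) /\
  \int[leb R N]_z (normc (Jt mu A P (vec z)) ^+ 2 * poisW w (vec z)) =
  \int[(prodm mu mu)]_p gram p.
Proof.
have inner z : \int[(prodm mu mu)]_p Phi (z, p) =
    normc (Jt mu A P (vec z)) ^+ 2 * poisW w (vec z).
  rewrite Jt_sqr mulrC -RintegralZl//.
  by have [] := Jt_integrable (vec z) AAi mdP.
have outer p : \int[leb R N]_z Phi (z, p) = gram p.
  have [i e] := @Cint_poisW_cis R N w (dP p) w0.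
  have -> : gram p = re (AA p * (poisK w (dP p))%:C).
    by rewrite reM /= mulr0 subr0.
  rewrite -e -(CintZl _ i) /=; apply: eq_Rintegral => z _.
  by rewrite /Phi !(reM, imM) /=; ring.
split; last split.
- have := integrable_Rintegral1 Phii; apply: eq_integrable => // z _.
  by rewrite inner.
- have h := integrableZl measurableT (poisK w 0) (Cintegrable_normc AAi).
  have wi (i : 'I_N) : 0 < w i by exact: w0.
  apply: (le_integrable measurableT _ _ h).
    apply/measurable_EFinP; apply: measurable_funM.
      by have [] := Cintegrable_meas AAi.
    exact: (measurable_comp_rv mdP (measurable_poisK w0)).
  move=> p _; rewrite lee_fin /gram !normrM mulrC.
  rewrite (ger0_norm (poisK_ge0 _ w0)) (ger0_norm (poisK_ge0 _ w0)).
  apply: ler_pM => //; first exact: poisK_ge0.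
    apply: ler_prod => i _; rewrite divr_ge0 ?mulr_ge0 ?addr_ge0 ?sqr_ge0 ?(ltW (w0 i))//=.
    rewrite ler_wpM2l ?mulr_ge0 ?(ltW (w0 i))//.
    have -> : (0 : 'rV[R]_N) 0 i = 0 by rewrite mxE.
    rewrite expr0n addr0.
    by rewrite lef_pV2 ?posrE ?ltr_wpDr ?sqr_ge0 ?exprn_gt0// lerDl sqr_ge0.
  by apply: (le_trans (re_le_normc _)); rewrite ger0_norm ?normc_ge0.
- under eq_Rintegral do rewrite -inner.
  rewrite (Rintegral_fubini1 Phii) -(Rintegral_fubini2 Phii).
  by apply: eq_Rintegral => p _; exact: outer.
Qed.

End identity.

Section plancherel.
Variables (n : nat) (G : 'rV[R]_n -> C) (M : R).
Hypotheses (Gi : Cintegrable (leb R n) (G \o @vec R n))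
  (GM : forall x, normc (G x) <= M)
  (cG : {ae leb R n, forall v, {for vec v, continuous (fun x => re (G x))} /\
     {for vec v, continuous (fun x => im (G x))}}).

Let F (x : 'rV[R]_n) : C := Jt (leb R n) (G \o @vec R n) (@vec R n) x.

Let mv : @rvmeas R _ (RT R n) n (@vec R n).
Proof. by move=> i; exact: measurable_vec_coord. Qed.

(** In [gram_identity] the kernel is an approximate identity when P is the
    identity, so the left side is the limit of integrals of |F|^2 against weights
    at most 1. *)
Lemma plancherel_lower :
  (((2 * pi) ^+ n * \int[leb R n]_v normc (G (vec v)) ^+ 2)%:E <=
   \int[leb R n]_z (normc (F (vec z)) ^+ 2)%:E)%E.
Proof.
have mF : measurable_fun setT (fun z : RT R n => normc (F (vec z)) ^+ 2).
  apply: measurable_funX; apply: Cmeas_normc.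
  have [c1 c2] := Jt_continuous Gi mv.
  by split; [exact: (continuous_vec_measurable c1)|exact: (continuous_vec_measurable c2)].
have mG := Cintegrable_meas Gi; have nG := Cintegrable_normc Gi.
have M0 : 0 <= M by apply: le_trans (GM 0); exact: normc_ge0.
pose I m := \int[leb R n]_z (normc (F (vec z)) ^+ 2 * W (dseq m) (vec z)).
pose inr m v := re (G (vec v)) * \int[leb R n]_u (re (G (vec u)) * K (dseq m) (vec u - vec v)).
pose ini m v := im (G (vec v)) * \int[leb R n]_u (im (G (vec u)) * K (dseq m) (vec u - vec v)).
have dm m : forall i : 'I_n, 0 < (fun=> dseq m : R) i by move=> i; exact: dseq_gt0.
have rowE m v : \int[leb R n]_u gram (G \o @vec R n) (@vec R n) (fun=> dseq m) (v, u) =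
    inr m v + ini m v.
  have [ir _] := Rintegral_K_scale (vec v) (dseq_gt0 m) mG.1 (fun x => le_trans (re_le_normc _) (GM x)).
  have [ii _] := Rintegral_K_scale (vec v) (dseq_gt0 m) mG.2 (fun x => le_trans (im_le_normc _) (GM x)).
  rewrite /inr /ini -(RintegralZl _ measurableT ir) -(RintegralZl _ measurableT ii).
  have zr := integrableZl measurableT (re (G (vec v))) ir.
  have zi := integrableZl measurableT (im (G (vec v))) ii.
  rewrite -(RintegralD measurableT zr zi); apply: eq_Rintegral => u _.
  rewrite /gram /= -/(K _ _) -KN opprB reM.
  by case: (G (vec v)) (G (vec u)) => a b [a' b'] /=; ring.
have IE m : I m = \int[leb R n]_v (inr m v + ini m v).
  have [_ [g1 g2]] := gram_identity Gi mv (dm m).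
  rewrite /I [LHS]g2 -(Rintegral_fubini1 g1); apply: eq_Rintegral => v _.
  exact: rowE.
have Kb m v (f : 'rV[R]_n -> R) : measurable_fun setT (f \o @vec R n) ->
    (forall x, `|f x| <= M) ->
    `|\int[leb R n]_u (f (vec u) * K (dseq m) (vec u - v))| <= M * (2 * pi) ^+ n.
  move=> mf fM; have [i1 _] := Rintegral_K_scale v (dseq_gt0 m) mf fM.
  have [k1 <-] := Rintegral_K v (dseq_gt0 m).
  apply: (le_trans (le_normr_Rintegral measurableT i1)).
  rewrite -(RintegralZl _ measurableT k1); apply: le_Rintegral => //.
  - by have := integrable_abse i1; apply: eq_integrable.
  - by have := integrableZl measurableT M k1; apply: eq_integrable.
  - move=> u _; rewrite normrM (ger0_norm (K_ge0 _ (dseq_gt0 m))).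
    by rewrite ler_wpM2r// K_ge0// dseq_gt0.
have lim : I m @[m --> \oo] --> \int[leb R n]_v ((2 * pi) ^+ n * normc (G (vec v)) ^+ 2).
  under eq_fun do rewrite IE.
  apply: (@Rintegral_dct _ _ _ (leb R n) (fun m v => inr m v + ini m v) _
    (fun v => (2 * (M * (2 * pi) ^+ n)) * normc (G (vec v)))).
  - move=> m.
    have [_ [g1 _]] := gram_identity Gi mv (dm m).
    have := integrable_Rintegral1 g1 => /integrableP[/measurable_EFinP h _].
    by move: h; apply: eq_measurable_fun => v _; exact: rowE.
  - apply: measurable_funM; first exact: measurable_cst.
    by apply: measurable_funX; apply: Cmeas_normc.
  - apply: filterS cG => v [cr ci].
    have ar := approx_identity mG.1 (fun x => le_trans (re_le_normc _) (GM x)) cr.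
    have ai := approx_identity mG.2 (fun x => le_trans (im_le_normc _) (GM x)) ci.
    have h := cvgD (cvgM (cvg_cst (re (G (vec v)))) ar) (cvgM (cvg_cst (im (G (vec v)))) ai).
    have -> : (2 * pi) ^+ n * normc (G (vec v)) ^+ 2 =
      re (G (vec v)) * ((2 * pi) ^+ n * re (G (vec v))) +
      im (G (vec v)) * ((2 * pi) ^+ n * im (G (vec v))).
      by rewrite normc_sqr; ring.
    exact: h.
  - have := integrableZl measurableT (2 * (M * (2 * pi) ^+ n)) nG.
    by apply: eq_integrable.
  - move=> m v; apply: (le_trans (ler_normD _ _)); rewrite !normrM.
    rewrite -mulrA mulrDl mul1r; apply: lerD; rewrite mulrC; apply: ler_pM => //.
    + exact: (Kb _ _ (fun x => re (G x)) mG.1 (fun x => le_trans (re_le_normc _) (GM x))).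
    + exact: re_le_normc.
    + exact: (Kb _ _ (fun x => im (G x)) mG.2 (fun x => le_trans (im_le_normc _) (GM x))).
    + exact: im_le_normc.
have n2i : (leb R n).-integrable setT (fun v => (normc (G (vec v)) ^+ 2)%:E).
  have h := integrableZl measurableT M nG; apply: (le_integrable _ _ _ h) => //.
    by apply/measurable_EFinP; apply: measurable_funX; apply: Cmeas_normc.
  move=> v _; rewrite lee_fin !ger0_norm ?mulr_ge0 ?exprn_ge0 ?normc_ge0//.
  by rewrite expr2 ler_wpM2r ?normc_ge0.
rewrite -(RintegralZl _ measurableT n2i).
apply: (cvg_le_ebound lim) => m.
have [i1 _] := gram_identity Gi mv (dm m).
rewrite /I /Rintegral fineK; last exact: integrable_fin_num.
apply: ge0_le_integral => //.
- by move=> z _; rewrite lee_fin mulr_ge0 ?exprn_ge0 ?normc_ge0 ?poisW_ge0.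
- exact: measurable_int i1.
- exact/measurable_EFinP.
- move=> z _; rewrite lee_fin ler_piMr ?exprn_ge0 ?normc_ge0//.
  by rewrite W_le1// dseq_gt0.
Qed.
End plancherel.

End QuadraticForm.

(** * A Schur test *)

Section SchurTest.
Context {R : realType}.
Local Notation C := R[i].
Context d (T : measurableType d) (mu : {sigma_finite_measure set T -> \bar R}).
Variables (N : nat) (A : T -> C) (P : T -> 'rV[R]_N) (w : 'I_N -> R).
Hypotheses (Ai : Cintegrable mu A) (mP : rvmeas P) (w0 : forall i, 0 < w i).
Variables (B c : T -> R) (M : R).
Hypotheses (mB : measurable_fun setT B) (mc : measurable_fun setT c)
  (ABc : forall y, normc (A y) <= B y * c y) (M0 : 0 <= M)
  (row : forall y, (\int[mu]_x (c x ^+ 2 * poisK w (P x - P y))%:E <= M%:E)%E).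

Let H (p : T * T) : R := 2^-1 * (B p.1 ^+ 2 * (c p.2 ^+ 2 * poisK w (P p.2 - P p.1))).

Let H' (p : T * T) : R := H (p.2, p.1).

Let mdP : rvmeas (fun p : T * T => P p.2 - P p.1).
Proof.
move=> i; under eq_fun do rewrite mxE [X in _ + X]mxE.
apply: measurable_funB.
  by apply: (measurableT_comp (mP i)); exact: measurable_snd.
by apply: (measurableT_comp (mP i)); exact: measurable_fst.
Qed.

Let mH : measurable_fun setT H.
Proof.
apply: measurable_funM; first exact: measurable_cst.
apply: measurable_funM.
  by apply: measurable_funX; apply: (measurableT_comp mB); exact: measurable_fst.
apply: measurable_funM.
  by apply: measurable_funX; apply: (measurableT_comp mc); exact: measurable_snd.
exact: (measurable_comp_rv mdP (measurable_poisK w0)).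
Qed.

Let mH' : measurable_fun setT H'.
Proof. by apply: (measurableT_comp mH); exact: measurable_swap. Qed.

Let H0 p : 0 <= H p.
Proof.
rewrite /H mulr_ge0 ?invr_ge0// mulr_ge0 ?sqr_ge0// mulr_ge0 ?sqr_ge0//.
exact: poisK_ge0.
Qed.

Let mB2 : measurable_fun setT (fun y => (B y ^+ 2)%:E).
Proof. by apply/measurable_EFinP; exact: measurable_funX. Qed.

Let rowH y : (\int[mu]_x (H (y, x))%:E <= (2^-1 * M)%:E * (B y ^+ 2)%:E)%E.
Proof.
have mK : measurable_fun setT (fun x => (c x ^+ 2 * poisK w (P x - P y))%:E).
  apply/measurable_EFinP; apply: measurable_funM; first exact: measurable_funX.
  apply: (measurable_comp_rv _ (measurable_poisK w0)) => i.
  under eq_fun do rewrite mxE [X in _ + X]mxE.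
  by apply: measurable_funB => //; exact: measurable_cst.
have E x : (H (y, x))%:E = ((2^-1 * B y ^+ 2)%:E * (c x ^+ 2 * poisK w (P x - P y))%:E)%E.
  by rewrite -EFinM /H /= !mulrA.
rewrite (eq_integral (fun x => ((2^-1 * B y ^+ 2)%:E * (c x ^+ 2 * poisK w (P x - P y))%:E)%E)) => [|x _ //].
have b0 : 0 <= 2^-1 * B y ^+ 2 by rewrite mulr_ge0 ?sqr_ge0 ?invr_ge0.
rewrite (ge0_integralZl_EFin _ _ _ mK b0)//; last first.
  by move=> x _; rewrite lee_fin mulr_ge0 ?sqr_ge0// poisK_ge0.
apply: (@le_trans _ _ ((2^-1 * B y ^+ 2)%:E * M%:E)%E).
  by rewrite lee_wpmul2l.
by rewrite -!EFinM lee_fin mulrAC.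
Qed.

Let colH : (\int[prodm mu mu]_p (H p)%:E <= (2^-1 * M)%:E * \int[mu]_y (B y ^+ 2)%:E)%E.
Proof.
have mHE : measurable_fun setT (EFin \o H) by exact/measurable_EFinP.
have H0E p : (0 <= (EFin \o H) p)%E by rewrite /= lee_fin.
rewrite [leLHS](@fubini_tonelli1 _ _ _ _ _ mu mu _ mHE H0E) /fubini_F /=.
have M20 : 0 <= 2^-1 * M by rewrite mulr_ge0 ?invr_ge0.
rewrite -(ge0_integralZl_EFin mu measurableT (fun y _ => _) mB2 M20); last first.
  by move=> y; rewrite lee_fin sqr_ge0.
apply: ge0_le_integral => //.
- by move=> y _; apply: integral_ge0 => x _; rewrite lee_fin.
- by apply: (measurable_fun_fubini_tonelli_F (EFin \o H)) => // p; rewrite /= lee_fin.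
- by apply: emeasurable_funM => //; exact: measurable_cst.
Qed.

Let colH' : (\int[prodm mu mu]_p (H' p)%:E <= (2^-1 * M)%:E * \int[mu]_y (B y ^+ 2)%:E)%E.
Proof.
apply: le_trans colH.
have mHE : measurable_fun setT (EFin \o H) by exact/measurable_EFinP.
have mHE' : measurable_fun setT (EFin \o H') by exact/measurable_EFinP.
have H0E p : (0 <= (EFin \o H) p)%E by rewrite /= lee_fin.
have H0E' p : (0 <= (EFin \o H') p)%E by rewrite /= lee_fin /H'.
rewrite [leRHS](@fubini_tonelli1 _ _ _ _ _ mu mu _ mHE H0E).
by rewrite [leLHS](@fubini_tonelli2 _ _ _ _ _ mu mu _ mHE' H0E').
Qed.

(** In [gram_identity], the product (B c)(x) (B c)(y) is at most the mean of
    B(x)^2 c(y)^2 and B(y)^2 c(x)^2. The kernel is positive and even, so only the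
    row integrals of c^2 enter, and the amplitude keeps its L^2 norm. *)
Lemma schur_test :
  (\int[leb R N]_z (normc (Jt mu A P (vec z)) ^+ 2 * poisW w (vec z))%:E <=
   M%:E * \int[mu]_y (B y ^+ 2)%:E)%E.
Proof.
have [i1 [i2 e]] := gram_identity Ai mP w0.
have -> : (\int[leb R N]_z (normc (Jt mu A P (vec z)) ^+ 2 * poisW w (vec z))%:E)%E =
    (\int[prodm mu mu]_p (gram A P w p)%:E)%E.
  rewrite -(fineK (integrable_fin_num measurableT i1)).
  rewrite -(fineK (integrable_fin_num measurableT i2)).
  by congr EFin; exact: e.
apply: (le_trans (lee_abs _)).
apply: (le_trans (le_abse_integral _ measurableT (measurable_int _ i2))).
have mg : measurable_fun setT (gram A P w).
  by apply/measurable_EFinP; exact: measurable_int i2.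
apply: (@le_trans _ _ (\int[prodm mu mu]_p ((H p)%:E + (H' p)%:E))%E).
  apply: ge0_le_integral => //.
  - by apply/measurable_EFinP; apply: measurableT_comp.
  - by apply: emeasurable_funD; exact/measurable_EFinP.
  move=> -[x y] _; rewrite -EFinD lee_fin /H' /H /gram /=.
  have -> : poisK w (P x - P y) = poisK w (P y - P x) by rewrite -poisKN opprB.
  have K0 : 0 <= poisK w (P y - P x) by exact: poisK_ge0.
  rewrite normrM (ger0_norm K0).
  have Ax := ABc x; have Ay := ABc y.
  have h : `|re (A x * conjc (A y))| <= 2^-1 * (B x ^+ 2 * c y ^+ 2 + B y ^+ 2 * c x ^+ 2).
    apply: (le_trans (re_le_normc _)); rewrite ComplexField.Normc.normcM normc_conj.
    apply: (@le_trans _ _ ((B x * c x) * (B y * c y))).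
      by apply: ler_pM => //; exact: normc_ge0.
    by have := sqr_ge0 (B x * c y - B y * c x); nra.
  by have := ler_wpM2r K0 h; lra.
have HE (G : T * T -> R) : (forall p, 0 <= G p) -> forall p : T * T, setT p -> (0 <= (G p)%:E)%E.
  by move=> G0 p _; rewrite lee_fin.
rewrite (ge0_integralD _ measurableT (HE _ H0) _ (HE _ (fun p => H0 _))); try exact/measurable_EFinP.
apply: (le_trans (leeD colH colH')).
rewrite -ge0_muleDl ?lee_fin ?mulr_ge0 ?invr_ge0// -EFinD.
by rewrite lee_wpmul2r//; [apply: integral_ge0 => y _; rewrite lee_fin sqr_ge0|rewrite lee_fin; lra].
Qed.

End SchurTest.

(** * Weights and rapid decay *)

Section Weights.
Context {R : realType}.
Local Notation C := R[i].

Lemma measurable_invr : measurable_fun [set: R] (fun x : R => x^-1).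
Proof.
have o0 : open [set x : R | x != 0] by exact: open_neq.
rewrite (_ : setT = [set (0:R)] `|` [set x : R | x != 0]); last first.
  apply/seteqP; split => // x _ /=.
  by have [->|x0] := eqVneq x 0; [left|right].
apply/measurable_funU => //; first exact: open_measurable.
split; first exact: measurable_fun_set1.
apply: open_continuous_measurable_fun => // x; rewrite inE /= => x0.
exact: inv_continuous.
Qed.

Lemma enorm_ge0 n (x : 'rV[R]_n) : 0 <= enorm x.
Proof. exact: sqrtr_ge0. Qed.

Lemma dotp_ge0 n (x : 'rV[R]_n) : 0 <= dotp x x.
Proof. by apply: sumr_ge0 => i _; rewrite -expr2 sqr_ge0. Qed.

Lemma enorm_sqr n (x : 'rV[R]_n) : enorm x ^+ 2 = dotp x x.
Proof. by rewrite /enorm sqr_sqrtr// dotp_ge0. Qed.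

Lemma coord_le_enorm n (x : 'rV[R]_n) i : `|x 0 i| <= enorm x.
Proof.
rewrite -(@ler_pXn2r _ 2) ?nnegrE ?enorm_ge0// enorm_sqr real_normK ?num_real//.
rewrite /dotp (bigD1 i)//= -expr2 lerDl.
by apply: sumr_ge0 => j _; rewrite -expr2 sqr_ge0.
Qed.

Lemma enorm_eq0 n (x : 'rV[R]_n) : (enorm x == 0) = (x == 0).
Proof.
apply/eqP/eqP => [x0|->]; last first.
  by rewrite /enorm /dotp big1 ?sqrtr0// => i _; rewrite mxE mul0r.
apply/matrixP => i j; rewrite ord1 mxE; apply/eqP.
by rewrite -normr_le0 -x0 coord_le_enorm.
Qed.

Lemma enorm_gt0 n (x : 'rV[R]_n) : (0 < enorm x) = (x != 0).
Proof. by rewrite lt_neqAle enorm_ge0 andbT eq_sym enorm_eq0. Qed.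

Lemma bracket_sqr n (x : 'rV[R]_n) : bracket x ^+ 2 = 1 + enorm x ^+ 2.
Proof. by rewrite /bracket sqr_sqrtr// addr_ge0// sqr_ge0. Qed.

Lemma bracket_ge1 n (x : 'rV[R]_n) : 1 <= bracket x.
Proof. by rewrite -sqrtr1 ler_wsqrtr// lerDl sqr_ge0. Qed.

Lemma bracket_gt0 n (x : 'rV[R]_n) : 0 < bracket x.
Proof. exact: lt_le_trans (bracket_ge1 x). Qed.

Lemma enorm_le_bracket n (x : 'rV[R]_n) : enorm x <= bracket x.
Proof.
rewrite -(@ler_pXn2r _ 2) ?nnegrE ?enorm_ge0 ?(ltW (bracket_gt0 x))//.
by rewrite bracket_sqr lerDr.
Qed.

Lemma bracket_le n (x : 'rV[R]_n) : bracket x <= 1 + enorm x.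
Proof.
have e0 := enorm_ge0 x.
rewrite -(@ler_pXn2r _ 2) ?nnegrE ?addr_ge0 ?(ltW (bracket_gt0 x))//.
by rewrite bracket_sqr; nra.
Qed.

Lemma enorm_continuous n : continuous (@enorm R n).
Proof.
move=> x; apply: continuous_comp; last exact: sqrt_continuous.
apply: continuous_sumR => i {}x.
have h : {for x, continuous (fun x : 'rV[R]_n => x 0 i)} by exact: coord_continuous.
by apply: continuousM.
Qed.

Lemma bracket_continuous n : continuous (@bracket R n).
Proof.
move=> x; apply: continuous_comp; last exact: sqrt_continuous.
suff : {for x, continuous (fun x : 'rV[R]_n => 1 + enorm x ^+ 2)} by [].
apply: continuousD; first exact: cst_continuous.
have h := @enorm_continuous n x.
by rewrite (_ : (fun x => enorm x ^+ 2) = (fun x => enorm x * enorm x))//; exact: continuousM.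
Qed.

Lemma bracketX_powR n (x : 'rV[R]_n) (s : R) k : s <= k%:R ->
  bracket x `^ s <= bracket x ^+ k.
Proof.
move=> sk; rewrite -powR_mulrn ?(ltW (bracket_gt0 x))//.
by rewrite ler_powR// bracket_ge1.
Qed.

Lemma oneDsq_le_bracket n (x : 'rV[R]_n) i : 1 + x 0 i ^+ 2 <= bracket x ^+ 2.
Proof.
rewrite bracket_sqr lerD2l -(real_normK (num_real (x 0 i))).
by rewrite ler_pXn2r ?nnegrE ?enorm_ge0 ?coord_le_enorm.
Qed.

(** 1 + x_i^2 <= <x>^2 for every coordinate, so a product of one-variable
    weights dominates a negative power of <x>. *)
Lemma bracketN_le n (x : 'rV[R]_n) (b : R) : 0 <= b ->
  bracket x `^ (- (2 * n%:R * b)) <= \prod_i powweight b (x 0 i).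
Proof.
move=> b0; have B0 := bracket_gt0 x.
have -> : bracket x `^ (- (2 * n%:R * b)) = \prod_(i < n) ((bracket x ^+ 2) `^ (- b)).
  rewrite prodr_const card_ord -powR_mulrn ?powR_ge0// -powR_mulrn ?ltW//.
  by rewrite -!powRrM; congr (_ `^ _); ring.
apply: ler_prod => i _; rewrite powR_ge0 /=.
rewrite /powweight !powRN lef_pV2 ?posrE ?powR_gt0 ?oneDsq_gt0 ?exprn_gt0//.
by rewrite ge0_ler_powR ?nnegrE ?(ltW (oneDsq_gt0 _)) ?exprn_ge0 ?(ltW B0)// oneDsq_le_bracket.
Qed.

Lemma measurable_bracket_powR n (s : R) :
  measurable_fun setT (fun v : RT R n => bracket (vec v) `^ s).
Proof.
apply: (measurableT_comp (measurable_powR s)).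
exact: continuous_vec_measurable (@bracket_continuous n).
Qed.

Lemma integrable_bracket n (e : R) : (0 < n)%N -> 0 < e ->
  (leb R n).-integrable setT (fun v => (bracket (vec v) `^ (- (n%:R + e)))%:E).
Proof.
move=> n0 e0; pose b := (n%:R + e) / (2 * n%:R).
have n0' : 0 < n%:R :> R by rewrite ltr0n.
have b2 : 2^-1 < b.
  by rewrite /b ltr_pdivlMr ?mulr_gt0// mulrA mulVf ?pnatr_eq0// mul1r ltrDl.
have h := @integrable_tuple_prodM R n (fun=> powweight b) (fun=> integrable_powweight b2).
apply: (le_integrable measurableT _ _ h).
  by apply/measurable_EFinP; exact: measurable_bracket_powR.
move=> v _; rewrite lee_fin !ger0_norm ?powR_ge0//; last first.
  by apply: prodr_ge0 => i _; rewrite ltW// powweight_gt0.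
have -> : n%:R + e = 2 * n%:R * b by rewrite /b mulrC divfK// mulf_neq0 ?gt_eqF.
by apply: bracketN_le; lra.
Qed.

(** The frequency 0, where the symbols of half-waves are singular, has to be
    negligible. *)
Lemma lebesgue_point0 n : (0 < n)%N ->
  {ae leb R n, forall v, vec v != 0}.
Proof.
case: n => // n _.
exists [set v : RT R n.+1 | vec v 0 ord0 = 0]; split.
- have m0 : measurable_fun setT (fun v : RT R n.+1 => vec v 0 ord0) by exact: measurable_vec_coord.
  have := m0 measurableT _ (measurable_set1 (0 : R)); rewrite setTI; exact.
- transitivity ((lebesgue_measure \x leb R n)%E ([set (0:R)] `*` setT)).
    change ((lebesgue_measure \x leb R n)%E (@tcons R n @^-1` [set v | vec v 0 ord0 = 0]) = (lebesgue_measure \x leb R n)%E ([set (0:R)] `*` setT)).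
    congr ((lebesgue_measure \x leb R n)%E _).
    apply/seteqP; split => -[a b] /=; rewrite !mxE /tcons /tnth /=.
      by [].
    by case.
  rewrite product_measure1E//.
  have h0 := @lebesgue_measure_set1 R 0; rewrite -[RHS](mul0e (leb R n setT)); congr (_ * _)%E; exact: h0.
- move=> v /= /negP; rewrite negbK => /eqP ->.
  by rewrite mxE.
Qed.

Definition rapid n (f : 'rV[R]_n -> C) := forall N : nat, exists2 M : R, 0 <= M &
  forall x, bracket x ^+ N * normc (f x) <= M.

Lemma rapid_le n (f g : 'rV[R]_n -> C) (c : R) k : rapid f ->
  (forall x, normc (g x) <= c * bracket x ^+ k * normc (f x)) -> rapid g.
Proof.
move=> rf gf N; have [M M0 h] := rf (N + k)%N; exists (`|c| * M).
  by rewrite mulr_ge0.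
move=> x; have B0 := bracket_gt0 x.
apply: (@le_trans _ _ (bracket x ^+ N * (`|c| * bracket x ^+ k * normc (f x)))).
  apply: ler_wpM2l; first by rewrite exprn_ge0// ltW.
  apply: (le_trans (gf x)); apply: ler_wpM2r; first exact: normc_ge0.
  by apply: ler_wpM2r; [rewrite exprn_ge0// ltW|exact: ler_norm].
have -> : bracket x ^+ N * (`|c| * bracket x ^+ k * normc (f x)) =
   `|c| * (bracket x ^+ (N + k) * normc (f x)) by rewrite exprD; ring.
by apply: ler_wpM2l.
Qed.

Lemma rapidD n (f g : 'rV[R]_n -> C) : rapid f -> rapid g -> rapid (fun x => f x + g x).
Proof.
move=> rf rg N; have [M M0 h] := rf N; have [M' M0' h'] := rg N.
exists (M + M'); first exact: addr_ge0.
move=> x; apply: le_trans (lerD (h x) (h' x)); rewrite -mulrDr.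
by apply: ler_wpM2l; [rewrite exprn_ge0// ltW// bracket_gt0|exact: le_normcD].
Qed.

Lemma rapid_bounded n (f : 'rV[R]_n -> C) : rapid f ->
  exists2 M : R, 0 <= M & forall x, normc (f x) <= M.
Proof. by move=> /(_ 0%N)[M M0 h]; exists M => // x; rewrite -[leLHS]mul1r; exact: h. Qed.

Lemma rapid_integrable n (f : 'rV[R]_n -> C) : rapid f ->
  Cmeas (f \o @vec R n) -> Cintegrable (leb R n) (f \o @vec R n).
Proof.
move=> rf mf; have [M M0 h] := rf (2 * n)%N.
have wi := @integrable_tuple_prodM R n (fun=> powweight 1) (fun=> integrable_powweight _).
have {}wi := integrableZl measurableT M (wi _).
have h1 : 2^-1 < 1 :> R by lra.
apply: (Cintegrable_le mf (g := fun v => M * \prod_i powweight 1 (vec v 0 i))).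
  by have := wi h1; apply: eq_integrable.
move=> v /=; have B0 := bracket_gt0 (vec v).
apply: (@le_trans _ _ (M * bracket (vec v) `^ (- (2 * n%:R * 1)))).
  rewrite powRN ler_pdivlMr ?powR_gt0// mulrC.
  have -> : 2 * n%:R * 1 = (2 * n)%:R :> R by rewrite mulr1 natrM.
  by rewrite powR_mulrn; [exact: h|exact: ltW].
by apply: ler_wpM2l => //; exact: bracketN_le.
Qed.

Lemma schwartz_rapid n (f : 'rV[R]_n -> C) (s : seq 'I_n) : schwartz f ->
  rapid (partials s f).
Proof.
move=> [_ hf] N; have [M0 h0] := hf 0%N s; have [MN hN] := hf N s.
have pos0 : 0 <= M0.
  by apply: le_trans (h0 0); rewrite mul1r normc_ge0.
have posN : 0 <= MN.
  by apply: le_trans (hN 0); rewrite mulr_ge0 ?normc_ge0// exprn_ge0// enorm_ge0.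
exists (2 ^+ N * (M0 + MN)); first by rewrite mulr_ge0 ?addr_ge0// exprn_ge0.
move=> x; have e0 := enorm_ge0 x; have g0 := normc_ge0 (partials s f x).
apply: (@le_trans _ _ (2 ^+ N * (1 + enorm x ^+ N) * normc (partials s f x))).
  apply: ler_wpM2r => //.
  apply: (@le_trans _ _ ((1 + enorm x) ^+ N)).
    by rewrite lerXn2r ?nnegrE ?addr_ge0 ?(ltW (bracket_gt0 x)) ?bracket_le.
  have [e1|e1] := leP (enorm x) 1.
    apply: (@le_trans _ _ (2 ^+ N)).
      by rewrite lerXn2r ?nnegrE ?addr_ge0//; lra.
    by rewrite ler_peMr ?exprn_ge0// lerDl exprn_ge0.
  apply: (@le_trans _ _ ((2 * enorm x) ^+ N)).
    by rewrite lerXn2r ?nnegrE ?addr_ge0 ?mulr_ge0//; lra.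
  by rewrite exprMn ler_wpM2l ?exprn_ge0// lerDr.
rewrite -mulrA ler_wpM2l ?exprn_ge0// mulrDl mul1r.
by apply: lerD; [have := h0 x; rewrite mul1r|exact: hN].
Qed.
End Weights.

(** * The null symbol as a Jacobian *)

Section RowBound.
Context {R : realType}.
Local Notation mu1 := (@lebesgue_measure R).
Local Notation I12 := (`[1%R : R, 2%R]%classic : set (measurableTypeR R)).

Let mI12 : measurable I12. Proof. exact: measurable_itv. Qed.

Let mu_I12 : mu1 I12 = 1%E.
Proof.
have := @lebesgue_measure_itv R `[1, 2]; rewrite /= lte_fin ltr1n /= => ->.
by rewrite -EFinB; congr EFin; ring.
Qed.

Lemma fatou_le d (T : measurableType d) (mu : {measure set T -> \bar R})
    (f_ : nat -> T -> R) (f : T -> R) (M : \bar R) :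
  (forall k, measurable_fun setT (f_ k)) -> (forall k x, 0 <= f_ k x) ->
  (forall x, f_ k x @[k --> \oo] --> f x) ->
  (forall k, (\int[mu]_x (f_ k x)%:E <= M)%E) -> (\int[mu]_x (f x)%:E <= M)%E.
Proof.
move=> mf f0 cf fM.
have mf' k : measurable_fun setT (fun x => (f_ k x)%:E) by exact/measurable_EFinP.
have f0' k x : setT x -> (0 <= (f_ k x)%:E)%E by rewrite lee_fin.
have := fatou mu measurableT mf' f0'.
have -> : (\int[mu]_x limn_einf (fun k => (f_ k x)%:E) = \int[mu]_x (f x)%:E)%E.
  apply: eq_integral => x _.
  have h : (f_ k x)%:E @[k --> \oo] --> (f x)%:E.
    by apply: cvg_EFin; [exact: nearW|exact: (cf x)].
  by have [-> _] := cvg_limn_einf_sup h.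
move=> h; apply: (le_trans h); rewrite limn_einf_lim.
apply: lime_le; first exact: is_cvg_einfs.
apply: nearW => k; apply: le_trans (fM k).
by apply: ereal_inf_lbound; exists k => /=.
Qed.

Lemma dotp_CS n (x y : 'rV[R]_n) : `|dotp x y| <= enorm x * enorm y.
Proof.
rewrite -(@ler_pXn2r _ 2) ?nnegrE ?mulr_ge0 ?enorm_ge0//.
rewrite exprMn !enorm_sqr real_normK ?num_real//.
have [->|y0] := eqVneq y 0.
  by rewrite [dotp x 0](_ : _ = 0) ?expr0n ?mulr_ge0 ?dotp_ge0// /dotp big1// => i _; rewrite mxE mulr0.
have yy : 0 < dotp y y by rewrite -enorm_sqr exprn_gt0// enorm_gt0.
have := dotp_ge0 (dotp y y *: x + - dotp x y *: y).
rewrite dotpDl !dotpZl [dotp x (_ + _)]dotpC [dotp y (_ + _)]dotpC !dotpDl !dotpZl (dotpC y x).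
set a := dotp x x; set b := dotp y y in yy *; set c := dotp x y.
move=> h; rewrite -subr_ge0 -(pmulr_rge0 _ yy); move: h; congr (0 <= _); ring.
Qed.

(** The integrand is the derivative of 2 atan (p l), however p oscillates. *)
Lemma atan_segment_bound (p dp : R -> R) :
  (forall x : R, is_derive x (1 : R) p (dp x)) -> continuous dp ->
  `|\int[mu1]_(l in `[1, 2]) (dp l * (2 / (1 + p l ^+ 2)))| <= 2 * pi.
Proof.
move=> dpp cdp; have cp := is_derive_continuous dpp.
have D x : is_derive x (1 : R) (fun l => 2 * atan (p l)) (dp x * (2 / (1 + p x ^+ 2))).
  have h := @is_derive1_comp _ atan p x _ _ (is_derive1_atan _) (dpp x).
  have h2 := @is_deriveZ _ _ _ _ (2 : R) x (1 : R) _ h.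
  apply: is_derive_eq h2 _; rewrite /GRing.scale /=; ring.
rewrite (@Rintegral_segment R (fun l => 2 * atan (p l)))//; last 2 first.
- by lra.
- move=> x.
  suff : {for x, continuous (fun l => dp l * (2 * (1 + p l * p l)^-1))} by [].
  apply: continuousM; first exact: cdp.
  apply: continuousM; first exact: cst_continuous.
  apply: continuousV; first by rewrite -expr2 gt_eqF// oneDsq_gt0.
  apply: continuousD; first exact: cst_continuous.
  by apply: continuousM; exact: cp.
have a1 := atan_gtNpi2 (p 1); have a2 := atan_ltpi2 (p 1).
have b1 := atan_gtNpi2 (p 2); have b2 := atan_ltpi2 (p 2).
by rewrite ler_norml; apply/andP; split; lra.
Qed.

(** |x| smoothed at 0: then l |-> |zeta - l x| is differentiable also where it
    vanishes. The smoothing is removed in [row_bound]. *)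
Definition enormd n (d : R) (x : 'rV[R]_n) := Num.sqrt (d ^+ 2 + dotp x x).

Lemma enormd0 n (x : 'rV[R]_n) : enormd 0 x = enorm x.
Proof. by rewrite /enormd expr0n add0r. Qed.

Lemma enormd_ge n (d : R) (x : 'rV[R]_n) : enorm x <= enormd d x.
Proof. by rewrite ler_wsqrtr// lerDr sqr_ge0. Qed.

(** With d = 0 this is 1 - s cos (angle between x and y), where s will be the
    product of the signs of two half-waves. *)
Definition angle n (s d : R) (x y : 'rV[R]_n) := 1 - s * (enorm x * enormd d y)^-1 * dotp x y.

Lemma angle_bound n (s d : R) (x y : 'rV[R]_n) : `|s| = 1 -> 0 <= angle s d x y <= 2.
Proof.
move=> s1.
have h : `|s * (enorm x * enormd d y)^-1 * dotp x y| <= 1.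
  have x0 := enorm_ge0 x; have y0 := enorm_ge0 y; have yd := enormd_ge d y.
  have d0 : 0 <= enormd d y by exact: le_trans yd.
  rewrite -mulrA normrM s1 mul1r normrM ger0_norm ?invr_ge0 ?mulr_ge0//.
  have [z|nz] := eqVneq (enorm x * enormd d y) 0.
    by rewrite z invr0 mul0r ler01.
  rewrite mulrC ler_pdivrMr ?mul1r.
    by apply: (le_trans (dotp_CS x y)); rewrite ler_wpM2l.
  by rewrite lt_neqAle eq_sym nz mulr_ge0.
by move: h; rewrite ler_norml /angle => /andP[? ?]; apply/andP; split; lra.
Qed.

Section fixed.
Variables (n : nat) (e : R).
Hypotheses (n0 : (0 < n)%N) (e0 : 0 < e).
Let a0 : R := n%:R - 1 + 2 * e.

Let a0_ge0 : 0 <= a0.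
Proof. by rewrite addr_ge0 ?subr_ge0 ?ler1n// mulr_ge0// ltW. Qed.

Variables (s s' p0 : R) (zeta : 'rV[R]_n).
Hypotheses (s1 : `|s| = 1) (s1' : `|s'| = 1).

Let ph d (x : 'rV[R]_n) := s * enorm x + s' * enormd d (zeta - x) - p0.

(** The row integrand of the Schur test for a product of two half-waves with
    frequencies x and zeta - x, with [ph] the distance of the time frequency to
    [p0]. *)
Definition rowf d (x : 'rV[R]_n) :=
  angle (s * s') d x (zeta - x) * bracket x `^ (- a0) * (2 / (1 + ph d x ^+ 2)).

Let ss1 : `|s * s'| = 1. Proof. by rewrite normrM s1 s1' mulr1. Qed.

Lemma rowf_ge0 d x : 0 <= rowf d x.
Proof.
have /andP[h _] := angle_bound d x (zeta - x) ss1.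
by rewrite !mulr_ge0 ?powR_ge0 ?invr_ge0// ltW ?oneDsq_gt0.
Qed.

Let rv1 : @rvmeas R _ (RT R n) n (@vec R n).
Proof. by move=> i; exact: measurable_vec_coord. Qed.

Let rv2 : @rvmeas R _ (RT R n) n (fun v => zeta - vec v).
Proof.
move=> i; under eq_fun do rewrite mxE [X in _ + X]mxE.
by apply: measurable_funB; [exact: measurable_cst|exact: measurable_vec_coord].
Qed.

Let menormd d : measurable_fun setT (fun v : RT R n => enormd d (zeta - vec v)).
Proof.
apply: (measurableT_comp (continuous_measurable_fun (@sqrt_continuous R))).
by apply: measurable_funD; [exact: measurable_cst|exact: measurable_dotp].
Qed.

Let menorm : measurable_fun setT (fun v : RT R n => enorm (vec v)).
Proof. exact: continuous_vec_measurable (@enorm_continuous R n). Qed.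

Lemma measurable_rowf d : measurable_fun setT (fun v : RT R n => rowf d (vec v)).
Proof.
apply: measurable_funM; first apply: measurable_funM.
- apply: measurable_funB; first exact: measurable_cst.
  apply: measurable_funM; last exact: measurable_dotp.
  apply: measurable_funM; first exact: measurable_cst.
  apply: (measurableT_comp (@measurable_invr R)).
  exact: measurable_funM.
- exact: measurable_bracket_powR.
- apply: measurable_funM; first exact: measurable_cst.
  apply: (measurableT_comp (@measurable_invr R)).
  apply: measurable_funD; first exact: measurable_cst.
  apply: measurable_funX; apply: measurable_funB; last exact: measurable_cst.
  apply: measurable_funD; apply: measurable_funM => //; exact: measurable_cst.
Qed.

Section dilate.
Variables (d : R) (x : 'rV[R]_n).
Hypotheses (d0 : 0 < d) (x0 : x != 0).

Let q l := d ^+ 2 + dotp (zeta - l *: x) (zeta - l *: x).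

Let qE l : q l = d ^+ 2 + dotp zeta zeta + (- 2 * dotp zeta x) * l + dotp x x * l ^+ 2.
Proof.
rewrite /q -scaleNr dotpDl dotpZl dotpC dotpDl dotpZl [dotp x (_ + _)]dotpC dotpDl dotpZl (dotpC x zeta).
ring.
Qed.

Let q0 l : 0 < q l.
Proof. by rewrite /q ltr_pwDl ?exprn_gt0// dotp_ge0. Qed.

Let dph l : R := s * enorm x + s' * ((- 2 * dotp zeta x + 2 * dotp x x * l) * (2 * Num.sqrt (q l))^-1).

Let ph_derive (l : R) : is_derive l (1 : R) (fun l => s * enorm x * l + s' * Num.sqrt (q l) - p0) (dph l).
Proof.
have dq : is_derive l (1 : R) q (- 2 * dotp zeta x + 2 * dotp x x * l).
  have -> : q = (fun l => (d ^+ 2 + dotp zeta zeta) + (- 2 * dotp zeta x * l + dotp x x * (l * l))).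
    by apply/funext => y; rewrite qE; ring.
  have h1 := is_derive_linear (- 2 * dotp zeta x) l.
  have h2 := @is_deriveM _ _ id id l (1 : R) _ _ (is_derive_id _ _) (is_derive_id _ _).
  have h3 := @is_deriveZ _ _ _ _ (dotp x x) l (1 : R) _ h2.
  have h4 := @is_deriveD _ _ _ _ _ l (1 : R) _ _ h1 h3.
  have h5 := @is_deriveD _ _ _ _ _ l (1 : R) _ _ (is_derive_cst (d ^+ 2 + dotp zeta zeta) l (1 : R)) h4.
  by apply: is_derive_eq h5 _; rewrite /GRing.scale /=; ring.
have hs := @is_derive1_comp _ Num.sqrt q l _ _ (is_derive1_sqrt (q0 l)) dq.
have hs' := @is_deriveZ _ _ _ _ s' l (1 : R) _ hs.
have h1 := is_derive_linear (s * enorm x) l.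
have h2 := @is_deriveD _ _ _ _ _ l (1 : R) _ _ h1 hs'.
have h3 := @is_deriveD _ _ _ _ _ l (1 : R) _ _ h2 (is_derive_cst (- p0) l (1 : R)).
by apply: is_derive_eq h3 _; rewrite /GRing.scale /= /dph; ring.
Qed.

Let dph_cont : continuous dph.
Proof.
move=> l.
suff : {for l, continuous dph} by [].
have cl : {for l, continuous (fun y : R => y)} by exact: cvg_id.
apply: continuousD; first exact: cst_continuous.
apply: continuousM; first exact: cst_continuous.
apply: continuousM.
  apply: continuousD; first exact: cst_continuous.
  by apply: continuousM; [exact: cst_continuous|exact: cl].
apply: continuousV.
  by rewrite mulf_neq0// gt_eqF// sqrtr_gt0.
apply: continuousM; first exact: cst_continuous.
apply: (@continuous_comp _ _ _ q Num.sqrt); last exact: sqrt_continuous.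
have -> : q = (fun l => (d ^+ 2 + dotp zeta zeta) + ((- 2 * dotp zeta x) * l + dotp x x * (l * l))).
  by apply/funext => y; rewrite qE; ring.
suff : {for l, continuous (fun l => (d ^+ 2 + dotp zeta zeta) + ((- 2 * dotp zeta x) * l + dotp x x * (l * l)))} by [].
apply: continuousD; first exact: cst_continuous.
apply: continuousD; first by apply: continuousM; [exact: cst_continuous|exact: cl].
apply: continuousM; first exact: cst_continuous.
by apply: continuousM; exact: cl.
Qed.

Let g l := dph l * (2 / (1 + (s * enorm x * l + s' * Num.sqrt (q l) - p0) ^+ 2)).

(** The key identity: [dph], the derivative of the phase along the ray
    l |-> l x, is s |x| times the null symbol. For the Euclidean norm this is
    x/|x| . d/dx (s|x| + s'|zeta - x|) = s - s' (x/|x|).(zeta - x)/|zeta - x|. *)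
Lemma dilated_angle (l : R) : 0 < l ->
  angle (s * s') d (l *: x) (zeta - l *: x) * (2 / (1 + ph d (l *: x) ^+ 2)) = s / enorm x * g l.
Proof.
move=> l0; have xn : enorm x != 0 by rewrite enorm_eq0.
have El : enorm (l *: x) = l * enorm x.
  rewrite /enorm dotpZl dotpC dotpZl mulrA -expr2 sqrtrM ?sqr_ge0// sqrtr_sqr ger0_norm//.
  exact: ltW.
have Eq : enormd d (zeta - l *: x) = Num.sqrt (q l) by [].
rewrite /g /ph El Eq (_ : s * (l * enorm x) = s * enorm x * l); last by ring.
rewrite [s / _ * _]mulrA; congr (_ * _).
have sq0 : Num.sqrt (q l) != 0 by rewrite gt_eqF// sqrtr_gt0.
have ss : s * s = 1 by rewrite -expr2 -(real_normK (num_real s)) s1 expr1n.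
rewrite /angle /dph El Eq.
have -> : dotp (l *: x) (zeta - l *: x) = l * (dotp zeta x - l * dotp x x).
  by rewrite dotpZl dotpC -scaleNr dotpDl dotpZl; ring.
have -> : s / enorm x * (s * enorm x + s' * ((- 2 * dotp zeta x + 2 * dotp x x * l) / (2 * Num.sqrt (q l)))) =
    s * s + s / enorm x * (s' * ((- 2 * dotp zeta x + 2 * dotp x x * l) / (2 * Num.sqrt (q l)))).
  by field; rewrite xn sq0.
rewrite ss; congr (_ + _); field; rewrite xn sq0 gt_eqF//=.
Qed.

Let c := bracket x `^ (- a0).

Let c0 : 0 <= c. Proof. exact: powR_ge0. Qed.

Let rowf_le (l : R) : 1 <= l -> rowf d (l *: x) <= c * (s / enorm x * g l).
Proof.
move=> l1; have l0 : 0 < l by exact: lt_le_trans l1.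
rewrite -dilated_angle// /rowf mulrAC mulrC [leRHS]mulrC [leRHS]mulrC.
apply: ler_wpM2r.
  have /andP[h _] := angle_bound d (l *: x) (zeta - l *: x) ss1.
  by rewrite !mulr_ge0 ?invr_ge0// ltW ?oneDsq_gt0.
have pos (y : 'rV[R]_n) : bracket y `^ a0 \is Num.pos by rewrite posrE powR_gt0 ?bracket_gt0.
rewrite /c !powRN (lef_pV2 (pos _) (pos _)).
apply: ge0_ler_powR; [exact: a0_ge0|rewrite nnegrE; exact: ltW (bracket_gt0 _)..|].
apply: ler_wsqrtr; rewrite lerD2l !enorm_sqr dotpZl dotpC dotpZl mulrA.
by rewrite ler_peMl ?dotp_ge0// -expr2 exprn_ege1.
Qed.

Let g_int : mu1.-integrable I12 (EFin \o g).
Proof.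
apply: continuous_compact_integrable; first exact: segment_compact.
apply: continuous_subspaceT => l.
suff : {for l, continuous g} by [].
pose p l := s * enorm x * l + s' * Num.sqrt (q l) - p0.
have cp : continuous p by exact: is_derive_continuous ph_derive.
suff : {for l, continuous (fun l => dph l * (2 * (1 + p l * p l)^-1))} by [].
apply: continuousM; first exact: dph_cont.
apply: continuousM; first exact: cst_continuous.
apply: continuousV; first by rewrite -expr2 gt_eqF// oneDsq_gt0.
apply: continuousD; first exact: cst_continuous.
by apply: continuousM; exact: cp.
Qed.

Lemma measurable_rowf_dilate : measurable_fun setT (fun l : R => rowf d (l *: x)).
Proof.
apply: (@measurable_comp_rv R _ _ _ _ n (fun l : measurableTypeR R => l *: x) (rowf d) _ (@measurable_rowf d)) => i.
under eq_fun do rewrite mxE.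
by apply: measurable_funM => //; exact: measurable_cst.
Qed.

(** Along a ray the null symbol is the Jacobian of the phase, so the integral is
    an arctangent over |x|. This gains one power of |x|, equivalent to one power
    of <x> when |x| >= 1; when |x| <= 1 the trivial bound is enough. *)
Lemma segment_rowf :
  (\int[mu1]_(l in `[1%R, 2%R]) (rowf d (l *: x))%:E <= (16 * bracket x `^ (- (n%:R + 2 * e)))%:E)%E.
Proof.
have mrow : measurable_fun (`[1%R : R, 2%R]%classic : set (measurableTypeR R)) (fun l => (rowf d (l *: x))%:E).
  by apply/measurable_EFinP; apply: measurable_funTS; exact: measurable_rowf_dilate.
have row0 l : `[1%R : R, 2%R]%classic l -> (0 <= (rowf d (l *: x))%:E)%E by rewrite lee_fin rowf_ge0.
have r0 : 0 < enorm x by rewrite enorm_gt0.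
have B0 := bracket_gt0 x; have B1 := bracket_le x.
have -> : bracket x `^ (- (n%:R + 2 * e)) = c / bracket x.
  rewrite /c -[X in _ / X]powRr1 ?ltW// -powRN -powRD; last by rewrite (gt_eqF B0) implybT.
  by congr (_ `^ _); rewrite /a0; ring.
have [r1|r1] := leP (enorm x) 1.
  apply: (@le_trans _ _ (\int[mu1]_(l in `[1%R, 2%R]) (c * 4)%:E)%E).
    apply: ge0_le_integral => //.
    move=> l /=; rewrite in_itv /= => /andP[l1 _]; rewrite lee_fin.
    have l0 : 0 < l by exact: lt_le_trans l1.
    apply: (le_trans (rowf_le l1)); rewrite ler_wpM2l// -dilated_angle//.
    have /andP[h h'] := angle_bound d (l *: x) (zeta - l *: x) ss1.
    have -> : 4 = 2 * 2 :> R by ring.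
    apply: ler_pM => //; first by rewrite mulr_ge0 ?invr_ge0// ltW ?oneDsq_gt0.
    by rewrite ler_pdivrMr ?oneDsq_gt0// ler_peMr// lerDl sqr_ge0.
  rewrite integral_cst//= lebesgue_measure_itv/= lte_fin ltr1n/= -EFinB -EFinM lee_fin.
  have -> : 2 - 1 = 1 :> R by ring.
  rewrite mulr1 [leRHS]mulrCA; apply: ler_wpM2l => //; rewrite ler_pdivlMr//; lra.
apply: (@le_trans _ _ (\int[mu1]_(l in `[1%R, 2%R]) (c * (s / enorm x * g l))%:E)%E).
  have gi : mu1.-integrable I12 (fun l => (c * (s / enorm x * g l))%:E).
    have := integrableZl mI12 (c * (s / enorm x)) g_int.
    by apply: eq_integrable => // l _; rewrite /= -EFinM !mulrA.
  apply: ge0_le_integral => //.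
  - exact: measurable_int gi.
  - by move=> l /=; rewrite in_itv /= => /andP[l1 _]; rewrite lee_fin rowf_le.
have E : (\int[mu1]_(l in `[1%R, 2%R]) (c * (s / enorm x * g l))%:E)%E =
    (c * (s / enorm x * \int[mu1]_(l in `[1%R, 2%R]) g l))%:E.
  rewrite mulrA -(RintegralZl _ mI12 g_int) /Rintegral fineK.
    by apply: eq_integral => l _; rewrite mulrA.
  apply: integrable_fin_num => //.
  have := integrableZl mI12 (c * (s / enorm x)) g_int.
  by apply: eq_integrable => // l _; rewrite /= -EFinM !mulrA.
rewrite E lee_fin [leRHS]mulrCA; apply: ler_wpM2l => //.
have h := atan_segment_bound ph_derive dph_cont.
apply: (@le_trans _ _ ((enorm x)^-1 * (2 * pi))).
  apply: (le_trans (ler_norm _)); rewrite normrM normrM s1 mul1r ger0_norm ?invr_ge0 ?(ltW r0)//.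
  by rewrite ler_wpM2l ?invr_ge0 ?(ltW r0).
rewrite mulrC ler_pdivrMr// mulrAC ler_pdivlMr//.
have p4 : pi <= 4 :> R by have := @pihalf_lt2 R; lra.
by have := @pi_ge0 R; nra.
Qed.
End dilate.

Let Wi := integrable_bracket n0 (mulr_gt0 (@ltr0Sn R 1) e0).

Definition rowM : R := 2 ^+ n * 16 * \int[leb R n]_v bracket (vec v) `^ (- (n%:R + 2 * e)).

Lemma rowM_ge0 : 0 <= rowM.
Proof. by rewrite !mulr_ge0 ?exprn_ge0//; apply: Rintegral_ge0 => v _; exact: powR_ge0. Qed.

(** The dilation x |-> l x costs at most 2^n for l in [1, 2]; averaging over
    these l replaces the integrand by its integral over the segment [x, 2x]. *)
Lemma smooth_row_bound d : 0 < d -> (\int[leb R n]_v (rowf d (vec v))%:E <= rowM%:E)%E.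
Proof.
move=> d0.
set I := (X in (X <= _)%E).
pose D : set (measurableTypeR R) := `[1%R : R, 2%R]%classic.
have mD : measurable D by exact: measurable_itv.
pose F (p : measurableTypeR R * RT R n) : \bar R :=
  (\1_D p.1 * (2 ^+ n * rowf d (p.1 *: vec p.2)))%:E.
have F0 p : (0 <= F p)%E by rewrite /F lee_fin indicE mulr_ge0 ?ler0n// mulr_ge0 ?exprn_ge0//; exact: rowf_ge0.
have mF : measurable_fun setT F.
  apply/measurable_EFinP; apply: measurable_funM.
    by apply: (measurableT_comp (measurable_indic mD)); exact: measurable_fst.
  apply: measurable_funM; first exact: measurable_cst.
  apply: (@measurable_comp_rv R _ _ _ _ n (fun p : measurableTypeR R * RT R n => p.1 *: vec p.2) (rowf d) _ (@measurable_rowf d)) => i.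
  under eq_fun do rewrite mxE.
  apply: measurable_funM; first exact: measurable_fst.
  by apply: (measurableT_comp (@measurable_vec_coord R n i)); exact: measurable_snd.
have p2 : 0 <= 2 ^+ n :> R by rewrite exprn_ge0.
have mrowE : measurable_fun setT ((fun x => (rowf d x)%:E) \o @vec R n).
  by apply/measurable_EFinP; exact: measurable_rowf.
have I0 : (0 <= I)%E by apply: integral_ge0 => v _; rewrite lee_fin rowf_ge0.
have IF : (I <= \int[mu1]_l \int[leb R n]_v F (l, v))%E.
  have -> : (I = \int[mu1]_(l in D) cst I l)%E.
    by transitivity (I * mu1 I12)%E; [rewrite mu_I12 mule1|rewrite integral_cst].
  rewrite integral_mkcond; apply: ge0_le_integral => //.
  - by move=> l _; rewrite /patch; case: ifP.
  - by apply/measurable_restrict => //; exact: measurable_cst.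
  - by apply: (measurable_fun_fubini_tonelli_F F).
  move=> l _; rewrite /patch; case: ifPn => lD; last first.
    by apply: integral_ge0 => v _; exact: F0.
  have /andP[l1 l2] : 1 <= l <= 2 by move: lD; rewrite inE /D /= in_itv.
  have l0 : 0 < l by exact: lt_le_trans l1.
  have := @ge0_integral_affine R n (fun x => (rowf d x)%:E) l 0 (lt0r_neq0 l0) mrowE.
  rewrite -/I => h; have {}h := h (fun x => rowf_ge0 d x).
  have mrl : measurable_fun setT (fun v : RT R n => (rowf d (l *: vec v + 0))%:E).
    apply/measurable_EFinP.
    apply: (@measurable_comp_rv R _ _ _ _ n (fun v : RT R n => l *: vec v + 0) (rowf d) _ (@measurable_rowf d)) => i.
    under eq_fun do rewrite addr0 mxE.
    by apply: measurable_funM; [exact: measurable_cst|exact: measurable_vec_coord].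
  have -> : (\int[leb R n]_v F (l, v) = (2 ^+ n)%:E * \int[leb R n]_v (rowf d (l *: vec v + 0))%:E)%E.
    have h0 (v : RT R n) : setT v -> (0 <= (rowf d (l *: vec v + 0))%:E)%E by rewrite lee_fin rowf_ge0.
    rewrite -(ge0_integralZl_EFin (leb R n) measurableT h0 mrl p2).
    by apply: eq_integral => v _; rewrite /F /= indicE lD mul1r addr0.
  rewrite h muleA -EFinM /cst -[leLHS]mul1e; apply: lee_wpmul2r => //.
  rewrite lee_fin ger0_norm ?(ltW l0)// ler_pdivlMr ?exprn_gt0// mul1r.
  by rewrite lerXn2r ?nnegrE ?(ltW l0).
apply: (le_trans IF).
have -> : (\int[mu1]_l \int[leb R n]_v F (l, v) = \int[leb R n]_v \int[mu1]_l F (l, v))%E.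
  exact: (@fubini_tonelli _ _ _ _ _ mu1 (leb R n) F mF F0).
pose G (v : RT R n) : R := 2 ^+ n * (16 * bracket (vec v) `^ (- (n%:R + 2 * e))).
have Gi : (leb R n).-integrable setT (fun v => (G v)%:E).
  have := integrableZl measurableT (2 ^+ n * 16) Wi.
  by apply: eq_integrable => // v _; rewrite /G -EFinM !mulrA.
have -> : rowM%:E = (\int[leb R n]_v (G v)%:E)%E.
  rewrite /rowM -(RintegralZl _ measurableT Wi) /Rintegral fineK.
    by apply: eq_integral => v _; rewrite /G !mulrA.
  apply: integrable_fin_num => //; have := Gi; apply: eq_integrable => // v _.
  by rewrite /G !mulrA.
apply: ae_ge0_le_integral => //.
- by move=> v _; apply: integral_ge0.
- by apply: (measurable_fun_fubini_tonelli_G F).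
- by move=> v _; rewrite lee_fin !mulr_ge0 ?exprn_ge0 ?powR_ge0.
- exact: measurable_int Gi.
apply: filterS (@lebesgue_point0 R n n0) => v v0 _.
have -> : (\int[mu1]_l F (l, v) = (2 ^+ n)%:E * \int[mu1]_(l in D) (rowf d (l *: vec v))%:E)%E.
  have h0 (l : measurableTypeR R) : D l -> (0 <= (rowf d (l *: vec v))%:E)%E by rewrite lee_fin rowf_ge0.
  have mD' : measurable_fun D (fun l => (rowf d (l *: vec v))%:E).
    by apply/measurable_EFinP; apply: measurable_funTS; exact: measurable_rowf_dilate.
  rewrite -(ge0_integralZl_EFin mu1 mD h0 mD' p2).
  rewrite [RHS]integral_mkcond; apply: eq_integral => l _.
  rewrite /F /patch indicE /=; case: ifP => lD; last by rewrite mul0r.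
  by rewrite mul1r.
rewrite /G EFinM; apply: lee_wpmul2l; first by rewrite lee_fin exprn_ge0.
exact: segment_rowf.
Qed.

(** The bound is uniform in the smoothing d, which Fatou's lemma removes. *)
Lemma row_bound : (\int[leb R n]_v (rowf 0 (vec v))%:E <= rowM%:E)%E.
Proof.
apply: (@fatou_le _ _ (leb R n) (fun k v => rowf (dseq k) (vec v))).
- by move=> k; exact: measurable_rowf.
- by move=> k v; exact: rowf_ge0.
- move=> v.
  pose y := zeta - vec v.
  have cy : enormd (dseq k) y @[k --> \oo] --> enormd 0 y.
    apply: (@cvg_comp _ _ _ (fun k => dseq k ^+ 2 + dotp y y) Num.sqrt); last exact: sqrt_continuous.
    apply: cvgD; last exact: cvg_cst.
    by rewrite expr2; apply: cvgM; exact: dseq_cvg.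
  have cph : ph (dseq k) (vec v) @[k --> \oo] --> ph 0 (vec v).
    apply: cvgB; last exact: cvg_cst.
    by apply: cvgD; first exact: cvg_cst; apply: cvgM => //; exact: cvg_cst.
  apply: cvgM; last first.
    apply: cvgM; first exact: cvg_cst.
    apply: cvgV; first by rewrite gt_eqF// oneDsq_gt0.
    apply: cvgD; first exact: cvg_cst.
    by rewrite expr2; exact: cvgM.
  apply: cvgM; last exact: cvg_cst.
  rewrite /angle -/y; have [z|nz] := eqVneq (enorm (vec v) * enormd 0 y) 0.
    have d0 : dotp (vec v) y = 0.
      apply/eqP; rewrite -normr_le0; apply: (le_trans (dotp_CS _ _)).
      by rewrite -(enormd0 y) z.
    by rewrite d0 mulr0; under eq_fun do rewrite mulr0; exact: cvg_cst.
  apply: cvgB; first exact: cvg_cst.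
  apply: cvgM; last exact: cvg_cst.
  apply: cvgM; first exact: cvg_cst.
  apply: cvgV => //.
  by apply: cvgM => //; exact: cvg_cst.
- by move=> k; apply: smooth_row_bound; exact: dseq_gt0.
Qed.
End fixed.

End RowBound.

(** * Fourier transform of Schwartz functions *)

Section SchwartzFourier.
Context {R : realType}.
Local Notation C := R[i].
Variable n : nat.
Implicit Types (f : 'rV[R]_n -> C) (x xi : 'rV[R]_n).

Let rvN : @rvmeas R _ (RT R n) n (fun v => - vec v).
Proof. by move=> i; under eq_fun do rewrite mxE; apply: measurable_funN; exact: measurable_vec_coord. Qed.

Lemma bracket_dom x (a M : R) : 0 <= M -> bracket x ^+ (2 * n) * a <= M ->
  a <= M * \prod_i powweight 1 (x 0 i).
Proof.
move=> M0 h; have B0 := bracket_gt0 x.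
apply: (@le_trans _ _ (M * bracket x `^ (- (2 * n%:R * 1)))).
  rewrite powRN ler_pdivlMr ?powR_gt0// mulrC.
  have -> : 2 * n%:R * 1 = (2 * n)%:R :> R by rewrite mulr1 natrM.
  by rewrite powR_mulrn// ltW.
by apply: ler_wpM2l => //; exact: bracketN_le.
Qed.

Lemma integrable_dom (M : R) : (leb R n).-integrable setT
  (fun v => (M * \prod_i powweight 1 (vec v 0 i))%:E).
Proof.
have h1 : 2^-1 < 1 :> R by lra.
have h := @integrable_tuple_prodM R n (fun=> powweight 1) (fun=> integrable_powweight h1).
by have := integrableZl measurableT M h; apply: eq_integrable.
Qed.

Lemma bracket_translate x (t : R) (i : 'I_n) : `|t| < 1 ->
  bracket x <= 2 * bracket (t *: delta_mx 0 i + x).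
Proof.
move=> t1; set y := _ + x.
have y0 := bracket_gt0 y.
rewrite -(@ler_pXn2r _ 2) ?nnegrE ?mulr_ge0 ?(ltW (bracket_gt0 _))//.
rewrite exprMn !bracket_sqr !enorm_sqr.
have -> : dotp x x = dotp y y - 2 * (t * y 0 i) + t ^+ 2.
  have -> : x = y + (- t) *: delta_mx 0 i by rewrite /y scaleNr addrAC subrr add0r.
  have zi : (y + (- t) *: delta_mx 0 i) 0 i = y 0 i - t.
    by rewrite [LHS]mxE [X in _ + X]mxE [X in _ + _ * X]mxE !eqxx mulr1.
  rewrite {1}dotpDl dotpZl dotp_delta zi dotpC dotpDl dotpZl dotp_delta; ring.
have h : y 0 i ^+ 2 <= dotp y y.
  by rewrite -enorm_sqr -(real_normK (num_real (y 0 i))) ler_pXn2r ?nnegrE ?enorm_ge0 ?coord_le_enorm.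
have /andP[h1 h2] : -1 < t < 1 by rewrite -ltr_norml.
have t2 : t ^+ 2 <= 1 by nra.
by have := sqr_ge0 (t + y 0 i); nra.
Qed.

(** The integral of x |-> g (x + t e_i) does not depend on t; differentiate at
    t = 0. *)
Lemma Rintegral_partial0 (g Dg : 'rV[R]_n -> R) (i : 'I_n) (M : R) :
  (forall x, is_derive x (delta_mx 0 i) g (Dg x)) ->
  measurable_fun setT (g \o @vec R n) ->
  (forall x, bracket x ^+ (2 * n) * `|g x| <= M) ->
  (forall x, bracket x ^+ (2 * n) * `|Dg x| <= M) ->
  \int[leb R n]_v Dg (vec v) = 0.
Proof.
move=> dg mg gM DgM.
have M0 : 0 <= M by apply: le_trans (gM 0); rewrite mulr_ge0// exprn_ge0// ltW// bracket_gt0.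
have gi : (leb R n).-integrable setT (fun v => (g (vec v))%:E).
  apply: (le_integrable measurableT _ _ (integrable_dom M)).
    exact/measurable_EFinP.
  move=> v _; rewrite lee_fin; apply: le_trans (ler_norm _).
  exact: bracket_dom.
have E (t : R) v : g (t *: delta_mx 0 i + vec v) = g (1 *: vec v + t *: delta_mx 0 i).
  by rewrite scale1r addrC.
have := @Rintegral_is_derive R _ _ (leb R n)
  (fun t v => g (t *: delta_mx 0 i + vec v)) (fun t v => Dg (t *: delta_mx 0 i + vec v))
  (fun v => 2 ^+ (2 * n) * M * \prod_i powweight 1 (vec v 0 i)) 0.
have -> : (fun t : R => \int[leb R n]_v g (t *: delta_mx 0 i + vec v)) =
    cst (\int[leb R n]_v g (vec v)).
  apply/funext => t; under eq_Rintegral do rewrite E.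
  by rewrite (Rintegral_affine (t *: delta_mx 0 i) (oner_neq0 R) gi) normr1 expr1n invr1 mul1r.
move=> h.
have {}h : is_derive (0 : R) (1 : R) (cst (\int[leb R n]_v g (vec v))) (\int[leb R n]_v Dg (0 *: delta_mx 0 i + vec v)).
  apply: h.
  - move=> t; have := integrable_affine (t *: delta_mx 0 i) (oner_neq0 R) gi.
    by apply: eq_integrable => // v _; rewrite /= E.
  - by move=> t v; apply: is_derive_line_at; exact: dg.
  - exact: integrable_dom.
  - move=> t v; rewrite subr0 => t1; apply: bracket_dom; first by rewrite mulr_ge0// exprn_ge0.
    have := DgM (t *: delta_mx 0 i + vec v); set y := _ + vec v => hy.
    apply: (@le_trans _ _ ((2 * bracket y) ^+ (2 * n) * `|Dg y|)).
      apply: ler_wpM2r => //; rewrite lerXn2r ?nnegrE ?mulr_ge0 ?(ltW (bracket_gt0 _))//.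
      exact: bracket_translate.
    by rewrite exprMn -mulrA; apply: ler_wpM2l => //; rewrite exprn_ge0.
have v1 := @derive_val _ _ _ _ _ _ _ h.
have v2 := @derive_val _ _ _ _ _ _ _ (is_derive_cst (\int[leb R n]_v g (vec v)) (0 : R) (1 : R)).
transitivity (\int[leb R n]_v Dg (0 *: delta_mx 0 i + vec v)).
  by apply: eq_Rintegral => v _; rewrite scale0r add0r.
by rewrite -v1 v2.
Qed.

Lemma ccontinuous_Cmeas f : ccontinuous f -> Cmeas (f \o @vec R n).
Proof. by move=> [c1 c2]; split; [exact: (continuous_vec_measurable c1)|exact: (continuous_vec_measurable c2)]. Qed.

Lemma fourierE f xi :
  fourier f xi = Jt (leb R n) (f \o @vec R n) (fun v => - vec v) xi.
Proof.
have -> : Jt (leb R n) (f \o @vec R n) (fun v => - vec v) xi =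
    Cint (leb R n) (fun v => f (vec v) * cis (- dotp (vec v) xi)).
  rewrite /Jt; congr Cint; apply/funext => v /=.
  by rewrite dotpC -scaleN1r dotpZl mulN1r.
by [].
Qed.

(** The partial derivative of f(x) e^(-i x.xi) has integral 0. *)
Lemma fourier_partial f i xi : rapid f -> ccontinuous f ->
  rapid (partial i f) -> ccontinuous (partial i f) ->
  (forall x, cderivable f x i) ->
  fourier (partial i f) xi = 'i * (xi 0 i)%:C * fourier f xi.
Proof.
move=> rf cf rp cp df.
have fi := rapid_integrable rf (ccontinuous_Cmeas cf).
have pi_ := rapid_integrable rp (ccontinuous_Cmeas cp).
have Jf := Jt_integrable xi fi rvN; have Jp := Jt_integrable xi pi_ rvN.
pose e x := cis (dotp xi (- x)).
pose g x := f x * e x.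
pose Dg x := partial i f x * e x + (- ('i * (xi 0 i)%:C)) * (f x * e x).
have dcis x : is_derive x (delta_mx 0 i) (fun y => cos (dotp xi (- y))) (xi 0 i * sin (dotp xi (- x))) /\
    is_derive x (delta_mx 0 i) (fun y => sin (dotp xi (- y))) (- xi 0 i * cos (dotp xi (- x))).
  have [d1 d2] := @is_derive_cisM R 1 (- xi 0 i) (dotp xi (- x)) 0.
  have E h : dotp xi (- (h *: delta_mx 0 i + x)) = h * - xi 0 i + dotp xi (- x).
    rewrite opprD dotpC dotpDl -scaleNr dotpZl dotp_delta [dotp (- x) _]dotpC; ring.
  split; apply: is_derive_line.
    rewrite (_ : (fun h => _) = (fun h => re (1 * cis (h * - xi 0 i + dotp xi (- x))))).
      apply: is_derive_eq d1 _; rewrite mul0r add0r mulr1 mulrC.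
      rewrite reM mulrC /=; ring.
    by apply/funext => h; rewrite E mul1r.
  rewrite (_ : (fun h => _) = (fun h => im (1 * cis (h * - xi 0 i + dotp xi (- x))))).
    apply: is_derive_eq d2 _; rewrite mul0r add0r mulr1 mulrC.
    rewrite imM mulrC /=; ring.
  by apply/funext => h; rewrite E mul1r.
have dgr x : is_derive x (delta_mx 0 i) (fun y => re (g y)) (re (Dg x)).
  have [d1 d2] := df x; have [c1 c2] := dcis x.
  have a1 := derivableP d1; have a2 := derivableP d2.
  rewrite (_ : (fun y => _) = (fun y => re (f y) * cos (dotp xi (- y))) \- (fun y => im (f y) * sin (dotp xi (- y)))); last first.
    by apply/funext => y; rewrite /g reM.
  have h := is_deriveB (is_deriveM a1 c1) (is_deriveM a2 c2).
  apply: is_derive_eq h _; rewrite /GRing.scale /= /Dg /partial /e /cis.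
  by rewrite !(reD,reM,imM,imD,reN,imN) /=; ring.
have dgi x : is_derive x (delta_mx 0 i) (fun y => im (g y)) (im (Dg x)).
  have [d1 d2] := df x; have [c1 c2] := dcis x.
  have a1 := derivableP d1; have a2 := derivableP d2.
  rewrite (_ : (fun y => _) = (fun y => re (f y) * sin (dotp xi (- y))) \+ (fun y => im (f y) * cos (dotp xi (- y)))); last first.
    by apply/funext => y; rewrite /g imM.
  have h := is_deriveD (is_deriveM a1 c2) (is_deriveM a2 c1).
  apply: is_derive_eq h _; rewrite /GRing.scale /= /Dg /partial /e /cis.
  by rewrite !(reD,reM,imM,imD,reN,imN) /=; ring.
have ne x : normc (e x) = 1 by exact: normc_cis.
have rg : rapid g.
  by apply: (@rapid_le _ _ f g 1 0 rf) => x; rewrite ComplexField.Normc.normcM ne expr0 !mulr1 mul1r.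
have rDg : rapid Dg.
  apply: rapidD.
    by apply: (@rapid_le _ _ _ _ 1 0 rp) => x; rewrite ComplexField.Normc.normcM ne expr0 !mulr1 mul1r.
  apply: (@rapid_le _ _ g _ `|xi 0 i| 0 rg) => x.
  rewrite !ComplexField.Normc.normcM normcN ComplexField.Normc.normcM normc_i mul1r normc_rc expr0 mulr1.
  by rewrite -ComplexField.Normc.normcM.
have [M M0 gM] := rg (2 * n)%N; have [M' M0' gM'] := rDg (2 * n)%N.
have mg := Cintegrable_meas Jf.
have key : Cint (leb R n) (fun v => Dg (vec v)) = 0.
  have le1 (h : 'rV[R]_n -> R) (H : 'rV[R]_n -> C) (K : R) x : `|h x| <= normc (H x) ->
      bracket x ^+ (2 * n) * normc (H x) <= K -> K <= M + M' ->
      bracket x ^+ (2 * n) * `|h x| <= M + M'.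
    move=> h1 h2 h3; apply: le_trans h3; apply: le_trans h2.
    by apply: ler_wpM2l => //; rewrite exprn_ge0// ltW// bracket_gt0.
  have l1 : M <= M + M' by rewrite lerDl.
  have l2 : M' <= M + M' by rewrite lerDr.
  apply: eqC => /=.
    apply: (@Rintegral_partial0 (fun x => re (g x)) (fun x => re (Dg x)) i (M + M')) => //.
    + exact: mg.1.
    + by move=> x; apply: (@le1 (fun x => re (g x)) g M x) => //; exact: re_le_normc.
    + by move=> x; apply: (@le1 (fun x => re (Dg x)) Dg M' x) => //; exact: re_le_normc.
  apply: (@Rintegral_partial0 (fun x => im (g x)) (fun x => im (Dg x)) i (M + M')) => //.
  + exact: mg.2.
  + by move=> x; apply: (@le1 (fun x => im (g x)) g M x) => //; exact: im_le_normc.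
  + by move=> x; apply: (@le1 (fun x => im (Dg x)) Dg M' x) => //; exact: im_le_normc.
rewrite !fourierE /Jt; apply/eqP; rewrite -subr_eq0 -mulNr.
rewrite -(CintZl _ Jf) -(CintD Jp (CintegrableZl _ Jf)); apply/eqP.
exact: key.
Qed.

(** What the Fourier transform needs from [schwartz], for every derivative
    separately. *)
Definition schwartz_like f :=
  (forall s : seq 'I_n, [/\ rapid (partials s f), ccontinuous (partials s f) &
    forall x i, cderivable (partials s f) x i]).

Lemma schwartz_schwartz_like f : schwartz f -> schwartz_like f.
Proof.
move=> sf s; split; first exact: schwartz_rapid.
  by have [/(_ (size s))[h _] _] := sf; exact: h.
by move=> x i; have [/(_ (size s).+1)[_ h] _] := sf; exact: h.
Qed.

Lemma fourier_bounded f : rapid f -> ccontinuous f ->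
  exists2 M : R, 0 <= M & forall xi, normc (fourier f xi) <= M.
Proof.
move=> rf cf; have fi := rapid_integrable rf (ccontinuous_Cmeas cf).
exists (2 * \int[leb R n]_v normc (f (vec v))).
  by rewrite mulr_ge0//; apply: Rintegral_ge0 => v _; exact: normc_ge0.
by move=> xi; rewrite fourierE; exact: Jt_bound.
Qed.

Lemma fourier_continuous f : rapid f -> ccontinuous f -> ccontinuous (fourier f).
Proof.
move=> rf cf; have fi := rapid_integrable rf (ccontinuous_Cmeas cf).
have -> : fourier f = Jt (leb R n) (f \o @vec R n) (fun v => - vec v).
  by apply/funext => xi; rewrite fourierE.
exact: Jt_continuous.
Qed.

(** Two derivatives in direction i multiply the transform by -xi_i^2; adding
    over i gains a factor <xi>^2. *)
Lemma fourier_rapid f : schwartz_like f -> rapid (fourier f).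
Proof.
move=> sf.
have H (N : nat) : forall s : seq 'I_n, exists2 M : R, 0 <= M &
    forall xi, bracket xi ^+ (2 * N) * normc (fourier (partials s f) xi) <= M.
  elim: N => [|N IH] s.
    have [rs cs _] := sf s; have [M M0 h] := fourier_bounded rs cs; exists M => // xi.
    by rewrite muln0 expr0 mul1r.
  have [M M0 h] := IH s.
  have [K hK] : {K : 'I_n -> R & forall i, 0 <= K i /\
      forall xi, bracket xi ^+ (2 * N) * normc (fourier (partials [:: i, i & s] f) xi) <= K i}.
    apply: (choice (P := fun i K => 0 <= K /\ forall xi,
      bracket xi ^+ (2 * N) * normc (fourier (partials [:: i, i & s] f) xi) <= K)) => i.
    by have [K K0 hK] := IH [:: i, i & s]; exists K.
  exists (M + \sum_i K i).
    by rewrite addr_ge0// sumr_ge0// => i _; have [] := hK i.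
  move=> xi.
  have E i : fourier (partials [:: i, i & s] f) xi = (- (xi 0 i ^+ 2))%:C * fourier (partials s f) xi.
    have [r0 c0 d0] := sf s; have [r1 c1 d1] := sf (i :: s); have [r2 c2 _] := sf [:: i, i & s].
    rewrite /= (fourier_partial _ r1 c1 r2 c2 (d1^~ i)) (fourier_partial _ r0 c0 r1 c1 (d0^~ i)).
    by rewrite mulrA; congr (_ * _); apply: eqC; rewrite !(reM, imM) /=; ring.
  rewrite mulnS addnC exprD bracket_sqr enorm_sqr -mulrA mulrDl mul1r mulrDr.
  apply: lerD; first exact: h.
  rewrite /dotp mulr_suml mulr_sumr; apply: ler_sum => i _.
  have [_] := hK i => /(_ xi); rewrite E ComplexField.Normc.normcM normc_rc normrN.
  by rewrite ger0_norm ?sqr_ge0// expr2.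
move=> N; have [M M0 h] := H N [::]; exists M => // xi.
apply: le_trans (h xi); apply: ler_wpM2r; first exact: normc_ge0.
by apply: ler_weXn2l; [exact: bracket_ge1|rewrite mul2n -addnn leq_addr].
Qed.

Lemma fourier_inversion f x : schwartz_like f -> inv_fourier (fourier f) x = f x.
Proof.
move=> sf; have [rf cf _] := sf [::].
have fi := rapid_integrable rf (ccontinuous_Cmeas cf).
have cF := fourier_continuous rf cf.
have Fi := rapid_integrable (fourier_rapid sf) (ccontinuous_Cmeas cF).
have [M M0 fM] := rapid_bounded rf.
have s2 : (-1 : R) ^+ 2 = 1 by rewrite sqrrN expr1n.
have E y : Cint (leb R n) (fun v => f (vec v) * cis (-1 * dotp y (vec v))) = fourier f y.
  rewrite fourierE /Jt; congr Cint; apply/funext => v /=.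
  by rewrite [dotp y (- _)]dotpC -(scaleN1r (vec v)) dotpZl dotpC.
have := @Cint_inversion R n f (-1) M x s2 fi fM (cf.1 x) (cf.2 x).
rewrite (_ : (fun y => Cint (leb R n) (fun v => f (vec v) * cis (-1 * dotp y (vec v)))) = fourier f); last exact/funext.
move=> /(_ Fi) h.
have -> : inv_fourier (fourier f) x = ((2 * pi) ^- n)%:C *
   Cint (leb R n) (fun v => fourier f (vec v) * cis (dotp x (vec v))) by [].
have -> : Cint (leb R n) (fun v => fourier f (vec v) * cis (dotp x (vec v))) =
    ((2 * pi) ^+ n)%:C * f x.
  rewrite -h; congr Cint; apply/funext => v.
  by rewrite E mulN1r opprK dotpC.
rewrite mulrA.
suff -> : ((2 * pi) ^- n)%:C * ((2 * pi) ^+ n)%:C = 1 :> C by rewrite mul1r.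
have p0 : (2 * pi) ^+ n != 0 :> R by rewrite expf_neq0// mulf_neq0 ?gt_eqF ?pi_gt0.
by apply: eqC; rewrite !(reM, imM) /= !(mulr0, mul0r, subr0, addr0)// mulVf.
Qed.
End SchwartzFourier.

(** * Finite speed of propagation *)

Section Continuity.
Context {R : realType} {V : topologicalType}.
Implicit Types f g : V -> R.

Lemma cM f g : continuous f -> continuous g -> continuous (fun x => f x * g x).
Proof. by move=> cf cg x; exact: (continuousM (cf x) (cg x)). Qed.

Lemma cD f g : continuous f -> continuous g -> continuous (fun x => f x + g x).
Proof. by move=> cf cg x; exact: (continuousD (cf x) (cg x)). Qed.

Lemma cC (a : R) : continuous (fun _ : V => a).
Proof. by move=> x; exact: cst_continuous. Qed.

Lemma cCM (a : R) f : continuous f -> continuous (fun x => a * f x).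
Proof. by move=> cf; apply: cM => //; exact: cC. Qed.

Lemma cX f k : continuous f -> continuous (fun x => f x ^+ k).
Proof.
move=> cf; elim: k => [|k IH]; first by under eq_fun do rewrite expr0; exact: cC.
by under eq_fun do rewrite exprS; exact: cM.
Qed.

Lemma c_comp (h : R -> R) f : continuous h -> continuous f -> continuous (fun x => h (f x)).
Proof. by move=> ch cf x; apply: (@continuous_comp _ _ _ f h); [exact: cf|exact: ch]. Qed.
End Continuity.

Section Clairaut.
Context {R : realType} {V : normedModType R}.
Variables (f Du Dv Duv Dvu : V -> R) (u v : V).
Hypotheses (du : forall x, is_derive x u f (Du x)) (dv : forall x, is_derive x v f (Dv x))
  (duv : forall x, is_derive x v Du (Duv x)) (dvu : forall x, is_derive x u Dv (Dvu x)).

Lemma MVT_line (g Dg : V -> R) (w p : V) (h : R) : 0 < h ->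
  (forall x, is_derive x w g (Dg x)) ->
  exists2 c, 0 < c < h & g (h *: w + p) - g p = h * Dg (c *: w + p).
Proof.
move=> h0 dg.
have d1 (t : R) : is_derive t (1 : R) (fun s => g (s *: w + p)) (Dg (t *: w + p)).
  by apply: is_derive_line_at.
have [|c] := @MVT R (fun s : R => g (s *: w + p)) (fun s => Dg (s *: w + p)) 0 h h0.
  exact/continuous_subspaceT/(is_derive_continuous d1).
rewrite in_itv /= => c01; rewrite scale0r add0r subr0 mulrC => e; by exists c.
Qed.

Definition diff2 (u' v' p : V) (h : R) :=
  f (h *: u' + (h *: v' + p)) - f (h *: v' + p) - (f (h *: u' + p) - f p).

(** The mean value theorem, once in direction u and once in direction v. *)
Lemma second_difference (p : V) (h : R) : 0 < h ->
  exists2 q, `|p - q| <= h * (`|u| + `|v|) & diff2 u v p h = h * h * Duv q.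
Proof.
move=> h0.
have dg x : is_derive x u (fun x => f (x + h *: v) - f x) (Du (x + h *: v) - Du x).
  apply: is_deriveB; apply: is_derive_line.
  have := is_derive_line_inv (du (x + h *: v)).
  by rewrite (_ : (fun s : R => f (s *: u + (x + h *: v))) = (fun s => f (s *: u + x + h *: v)))//; apply/funext => s; rewrite addrA.
have [c ch e] := MVT_line p h0 dg.
have [c' ch' e'] := MVT_line (c *: u + p) h0 duv.
exists (c' *: v + (c *: u + p)).
  have -> : p - (c' *: v + (c *: u + p)) = - (c *: u + c' *: v).
    by rewrite addrA [_ *: v + _]addrC [_ + p]addrC opprD addrA subrr add0r.
  rewrite normrN mulrDr; apply: (le_trans (ler_normD _ _)); rewrite !normrZ.
  move/andP: ch => [c0 ch]; move/andP: ch' => [c0' ch'].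
  by apply: lerD; apply: ler_wpM2r => //; rewrite ger0_norm ltW.
rewrite -mulrA -e' -[_ *: v + (c *: u + p)]addrC -e /diff2.
have -> : h *: u + p + h *: v = h *: u + (h *: v + p) by rewrite -addrA [p + _]addrC.
by rewrite [p + h *: v]addrC; ring.
Qed.
End Clairaut.

Lemma diff2C (R : realType) (V : normedModType R) (f : V -> R) u v p h :
  diff2 f u v p h = diff2 f v u p h.
Proof. by rewrite /diff2 addrCA; ring. Qed.

(** Both mixed derivatives are limits of one symmetric second difference. *)
Lemma clairaut (R : realType) (V : normedModType R) (f Du Dv Duv Dvu : V -> R) (u v : V) :
  (forall x, is_derive x u f (Du x)) -> (forall x, is_derive x v f (Dv x)) ->
  (forall x, is_derive x v Du (Duv x)) -> (forall x, is_derive x u Dv (Dvu x)) ->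
  continuous Duv -> continuous Dvu -> forall p, Duv p = Dvu p.
Proof.
move=> du dv duv dvu cuv cvu p; apply/eqP/negPn/negP => ne.
pose e := `|Duv p - Dvu p| / 2.
have e0 : 0 < e by rewrite divr_gt0// normr_gt0 subr_eq0.
have /cvgrPdist_lt/(_ _ e0)/nbhs_ballP[d1 /= d10 h1] := cuv p.
have /cvgrPdist_lt/(_ _ e0)/nbhs_ballP[d2 /= d20 h2] := cvu p.
pose d := Num.min d1 d2; have d0 : 0 < d by rewrite lt_min d10.
have dd1 : d <= d1 by rewrite ge_min lexx.
have dd2 : d <= d2 by rewrite ge_min lexx orbT.
pose L := `|u| + `|v| + 1; have L0 : 0 < L by rewrite ltr_wpDl// addr_ge0.
pose h := d / L; have h0 : 0 < h by rewrite divr_gt0.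
have hd : h * (`|u| + `|v|) < d.
  rewrite /h mulrAC ltr_pdivrMr// ltr_pM2l//; rewrite /L; lra.
have [q pq E] := second_difference du duv p h0.
have [q' pq' E'] := second_difference dv dvu p h0.
have {}pq : `|p - q| < d by exact: le_lt_trans hd.
have {}pq' : `|p - q'| < d by apply: (le_lt_trans pq'); rewrite [`|v| + _]addrC.
have b1 : `|Duv p - Duv q| < e by apply: h1; rewrite -ball_normE /=; exact: lt_le_trans dd1.
have b2 : `|Dvu p - Dvu q'| < e by apply: h2; rewrite -ball_normE /=; exact: lt_le_trans dd2.
have Eq : Duv q = Dvu q'.
  have hh : h * h != 0 by rewrite mulf_neq0// gt_eqF.
  by apply: (mulfI hh); rewrite -E -E' diff2C.
have : `|Duv p - Dvu p| < e + e.
  have -> : Duv p - Dvu p = (Duv p - Duv q) - (Dvu p - Dvu q') by rewrite Eq; ring.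
  by apply: (le_lt_trans (ler_normB _ _)); exact: ltrD.
by rewrite /e -splitr ltxx.
Qed.

Section Uniqueness.
Context {R : realType}.

(** A C^1 cutoff, positive exactly for s > 0. *)
Definition sqpos (s : R) := Num.max s 0 ^+ 2.

Lemma sqpos_derive (s : R) : is_derive s (1 : R) sqpos (2 * Num.max s 0).
Proof.
have key (h : R) : `|sqpos (h + s) - sqpos s - 2 * Num.max s 0 * h| <= h ^+ 2.
  rewrite /sqpos ler_norml.
  have [a|a] := leP s 0; have [b|b] := leP (h + s) 0; apply/andP; split; nra.
have cv : (fun h => h^-1 *: ((sqpos \o shift s) (h *: (1 : R)) - sqpos s)) @ 0^' --> 2 * Num.max s 0.
  apply/cvgrPdist_le => e e0; near=> h.
  have hn : h != 0 by near: h; exact: nbhs_dnbhs_neq.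
  have -> : 2 * Num.max s 0 - h^-1 *: ((sqpos \o shift s) (h *: (1 : R)) - sqpos s) =
     - h^-1 * (sqpos (h + s) - sqpos s - 2 * Num.max s 0 * h).
    by rewrite /= /GRing.scale /= mulr1; field.
  rewrite normrM normrN normfV ler_pdivrMl ?normr_gt0//.
  apply: (le_trans (key h)); rewrite -(real_normK (num_real h)) expr2.
  apply: ler_wpM2l => //; near: h.
  apply: nbhs_dnbhs; exists e => //= h /=; rewrite sub0r normrN; exact: ltW.
by apply: DeriveDef; [apply/cvg_ex; exists (2 * Num.max s 0)|exact: cvg_lim cv].
Unshelve. all: by end_near. Qed.

Lemma sqpos_ge0 s : 0 <= sqpos s. Proof. exact: sqr_ge0. Qed.

Lemma sqpos_continuous : continuous sqpos.
Proof. exact: is_derive_continuous sqpos_derive. Qed.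

Lemma pos_continuous : continuous (fun s : R => Num.max s 0).
Proof.
move=> s; suff : {for s, continuous (fun s : R => Num.max s 0)} by [].
by apply: (@continuous_max _ _ (fun s : R => s) (fun=> 0)); [exact: cvg_id|exact: cst_continuous].
Qed.

Lemma is_derive_japanese (a h : R) :
  is_derive h (1 : R) (fun h => Num.sqrt (1 + (h + a) ^+ 2)) ((h + a) / Num.sqrt (1 + (h + a) ^+ 2)).
Proof.
have d1 : is_derive h (1 : R) (fun h => 1 + (h + a) * (h + a)) (2 * (h + a)).
  have d0 := @is_deriveD _ _ _ id (cst a) h (1 : R) _ _ (is_derive_id _ _) (is_derive_cst _ _ _).
  have d2 := is_deriveD (is_derive_cst (1 : R) h (1 : R)) (is_deriveM d0 d0).
  by apply: is_derive_eq d2 _; rewrite (_ : (id + cst a) h = h + a)// /GRing.scale /=; ring.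
have p0 : 0 < 1 + (h + a) * (h + a) by rewrite -expr2 oneDsq_gt0.
have d2 := @is_derive1_comp _ Num.sqrt _ h _ _ (is_derive1_sqrt p0) d1.
rewrite (_ : (fun h => _) = (Num.sqrt \o (fun h => 1 + (h + a) * (h + a)))); last first.
  by apply/funext => y; rewrite /= expr2.
apply: is_derive_eq d2 _; rewrite expr2.
have s0 : Num.sqrt (1 + (h + a) * (h + a)) != 0 by rewrite gt_eqF// sqrtr_gt0.
by field.
Qed.

Lemma event_time n (h t : R) (x : 'rV[R]_n) :
  event (h + t) x = h *: delta_mx 0 ord0 + event t x.
Proof.
apply/rowP; apply: ord_event_ind => [|j]; rewrite [RHS]mxE [X in _ = X + _]mxE.
  by rewrite !event0 mxE eqxx mulr1.
by rewrite !event_rshift mxE /= mulr0 add0r.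
Qed.

Lemma event_space n (h t : R) (x : 'rV[R]_n) j :
  event t (h *: delta_mx 0 j + x) = h *: delta_mx 0 (rshift 1 j) + event t x.
Proof.
apply/rowP; apply: ord_event_ind => [|k]; rewrite [RHS]mxE [X in _ = X + _]mxE.
  by rewrite !event0 mxE /= mulr0 add0r.
by rewrite !event_rshift !mxE (inj_eq (@rshift_inj _ _)).
Qed.

Lemma continuous_rv (U : topologicalType) k (f : U -> 'rV[R]_k) :
  (forall i, continuous (fun x => f x 0 i)) -> continuous f.
Proof.
move=> cf x A [B nB BA].
have h : \forall y \near x, forall i j, B i j (f y i j).
  apply: filter_forall => i; apply: filter_forall => j.
  by move: (nB i j); rewrite (ord1 i) => nBj; exact: (cf j x _ nBj).
by apply: filterS h => y By; exact: BA.
Qed.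

Lemma event_continuous n (t : R) : continuous (@event R n t).
Proof.
apply: continuous_rv; apply: ord_event_ind => [|j].
  by under eq_fun do rewrite event0; exact: cC.
by under eq_fun do rewrite event_rshift; exact: coord_continuous.
Qed.

Lemma event_split n (p : 'rV[R]_(1 + n)) : p = event (time p) (Defs.space p).
Proof.
apply/rowP; apply: ord_event_ind => [|k]; first by rewrite event0.
by rewrite event_rshift mxE.
Qed.

(** The Poisson kernel is bounded, so the Poisson means of g vanish with its
    integral, while they converge to a multiple of g x0. *)
Lemma continuous_integral0 n (g : 'rV[R]_n -> R) (M : R) (x0 : 'rV[R]_n) :
  continuous g -> (forall x, 0 <= g x) -> (forall x, `|g x| <= M) ->
  (leb R n).-integrable setT (fun v => (g (vec v))%:E) ->
  \int[leb R n]_v g (vec v) = 0 -> g x0 = 0.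
Proof.
move=> cg g0 gM gi ig.
have mg : measurable_fun setT (g \o @vec R n) by exact: continuous_vec_measurable.
have lim := approx_identity mg gM (cg x0).
have z m : \int[leb R n]_v (g (vec v) * K (dseq m) (vec v - x0)) = 0.
  have d0 := @dseq_gt0 R m.
  pose c := \prod_(i < n) (2 / dseq m) : R.
  have Kc (p : 'rV[R]_n) : K (dseq m) p <= c.
    apply: ler_prod => i _; rewrite divr_ge0 ?mulr_ge0 ?addr_ge0 ?sqr_ge0 ?(ltW d0)//=.
    rewrite ler_pdivrMr; last by rewrite ltr_pwDl ?exprn_gt0// sqr_ge0.
    rewrite mulrAC ler_pdivlMr//; have := sqr_ge0 (p 0 i); nra.
  have [Ki _] := Rintegral_K_scale x0 d0 mg gM.
  have gci := integrableZl measurableT c gi.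
  apply/eqP; rewrite eq_le; apply/andP; split; last first.
    by apply: Rintegral_ge0 => v _; rewrite mulr_ge0// K_ge0.
  rewrite -[leRHS](mulr0 c) -ig -(RintegralZl _ measurableT gi).
  apply: le_Rintegral => // v _; rewrite mulrC; exact: ler_wpM2r.
have {}lim : (0 : R) @[_ --> \oo] --> (2 * pi) ^+ n * g x0.
  by move: lim; under eq_fun do rewrite z.
have e : (2 * pi) ^+ n * g x0 = 0.
  have c0 : (fun _ : nat => 0 : R) @ \oo --> (0 : R) by exact: cvg_cst.
  by rewrite -(cvg_lim (@Rhausdorff R) lim) (cvg_lim (@Rhausdorff R) c0).
move/eqP: e; rewrite mulf_eq0 expf_eq0 mulf_eq0 pnatr_eq0 (gt_eqF (pi_gt0 R)) /= andbF /=.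
by move/eqP.
Qed.

Section energy.
Variables (n : nat) (w : 'rV[R]_(1 + n) -> R) (D : 'I_(1 + n) -> 'rV[R]_(1 + n) -> R)
  (DD : 'I_(1 + n) -> 'I_(1 + n) -> 'rV[R]_(1 + n) -> R).
Local Notation sp j := (rshift 1 j).
Local Notation de a := (delta_mx 0 a : 'rV[R]_(1 + n)).
Hypotheses (dw : forall a x, is_derive x (de a) w (D a x))
  (dD : forall a b x, is_derive x (de b) (D a) (DD a b x))
  (cDa : forall a, continuous (D a)) (cDD : forall a b, continuous (DD a b))
  (wave : forall x, DD ord0 ord0 x = \sum_j DD (sp j) (sp j) x)
  (w0 : forall x, w (event 0 x) = 0) (D0 : forall x, D ord0 (event 0 x) = 0).

Let sym a b p : DD a b p = DD b a p.
Proof. by apply: (@clairaut R _ w (D a) (D b) (DD a b) (DD b a) (de a) (de b)). Qed.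

Variable A : R.

Definition japanese (a : R) := Num.sqrt (1 + a ^+ 2).

Lemma japanese_gt0 a : 0 < japanese a.
Proof. by rewrite sqrtr_gt0 oneDsq_gt0. Qed.

Lemma abs_le_japanese a : `|a| <= japanese a.
Proof. by rewrite -sqrtr_sqr ler_wsqrtr// lerDr. Qed.

(** Positive exactly in a truncated backward cone. The functions
    [japanese x_j], smooth substitutes for |x_j|, make the cutoff C^1, and the
    speed n lets the flux be absorbed one direction at a time. *)
Definition cone (p : 'rV[R]_(1 + n)) := A - n%:R * p 0 ord0 - \sum_j japanese (p 0 (sp j)).

Let dcone (a : 'I_(1 + n)) (p : 'rV[R]_(1 + n)) : R :=
  if a == ord0 then - n%:R else - (p 0 a / japanese (p 0 a)).

Let cone_derive a p : is_derive p (de a) cone (dcone a p).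
Proof.
apply: is_derive_line; rewrite /dcone; move: a; apply: ord_event_ind => [|j].
  rewrite eqxx.
  rewrite (_ : (fun h => _) = (fun h => - n%:R * h + cone p)); last first.
    apply/funext => h; rewrite /cone !mxE !eqxx mulr1.
    rewrite (eq_bigr (fun j => japanese (p 0 (sp j)))); first by ring.
    by move=> j _; rewrite !mxE /= mulr0 add0r.
  have d1 := is_deriveD (is_derive_linear (- n%:R) (0 : R)) (is_derive_cst (cone p) (0 : R) (1 : R)).
  by apply: is_derive_eq d1 _; rewrite addr0.
have ne : (sp j == ord0 :> 'I_(1 + n)) = false by [].
rewrite ne; set a := p 0 (sp j).
rewrite (_ : (fun h => _) = (fun h => (cone p + japanese a) - Num.sqrt (1 + (h + a) ^+ 2))); last first.
  apply/funext => h; rewrite /cone !mxE /= mulr0 add0r.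
  rewrite (bigD1 j)//= [in RHS](bigD1 j)//= !mxE !eqxx mulr1 -/a.
  rewrite (eq_bigr (fun j => japanese (p 0 (sp j)))); first by rewrite /japanese; ring.
  by move=> k kj; rewrite !mxE (inj_eq (@rshift_inj _ _)) (negbTE kj) /= mulr0 add0r.
have d1 := is_deriveB (is_derive_cst (cone p + japanese a) (0 : R) (1 : R)) (is_derive_japanese a 0).
by apply: is_derive_eq d1 _; rewrite !add0r.
Qed.

Let cone_continuous : continuous cone.
Proof.
have cc i : continuous (fun p : 'rV[R]_(1 + n) => p 0 i) by exact: coord_continuous.
rewrite /cone; under eq_fun do rewrite -mulNr -sumrN.
apply: cD; first by apply: cD; [exact: cC|exact: cCM].
apply: continuous_sumR => j.
under eq_fun do rewrite -mulN1r.
apply: cCM; apply: c_comp; last exact: cc.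
apply: (c_comp (h := Num.sqrt)); first exact: sqrt_continuous.
by apply: cD; [exact: cC|apply: cX; move=> x; exact: cvg_id].
Qed.

Let dcone_continuous a : continuous (dcone a).
Proof.
have cc i : continuous (fun p : 'rV[R]_(1 + n) => p 0 i) by exact: coord_continuous.
rewrite /dcone; case: eqVneq => _; first exact: cC.
under eq_fun do rewrite -mulN1r.
move=> p; suff : {for p, continuous (fun p : 'rV[R]_(1 + n) => -1 * (p 0 a * (japanese (p 0 a))^-1))} by [].
apply: continuousM; first exact: cst_continuous.
apply: continuousM; first exact: cc.
apply: continuousV; first by rewrite gt_eqF// japanese_gt0.
apply: (@continuous_comp _ _ _ (fun p : 'rV[R]_(1 + n) => 1 + (p 0 a) ^+ 2) Num.sqrt); last exact: sqrt_continuous.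
by apply: cD; [exact: cC|apply: cX; exact: cc].
Qed.

Let Kw p := sqpos (cone p).
Let dKw a p := 2 * Num.max (cone p) 0 * dcone a p.

Let Kw_derive a p : is_derive p (de a) Kw (dKw a p).
Proof.
apply: is_derive_line; rewrite /dKw.
have d1 := is_derive_line_inv (cone_derive a p).
have d2 := @is_derive1_comp _ sqpos _ 0 _ _ (sqpos_derive _) d1.
by apply: is_derive_eq d2 _; rewrite scale0r add0r.
Qed.

Let Kw_continuous : continuous Kw.
Proof. by apply: c_comp cone_continuous; exact: sqpos_continuous. Qed.

Let dKw_continuous a : continuous (dKw a).
Proof.
apply: cM => //; apply: cCM.
by apply: (c_comp (h := fun s => Num.max s 0)) cone_continuous; exact: pos_continuous.
Qed.

Definition in_cone (F : 'rV[R]_(1 + n) -> R) :=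
  continuous F /\ forall p, cone p <= 0 -> F p = 0.

Let in_coneM (F G : 'rV[R]_(1 + n) -> R) : continuous F -> in_cone G -> in_cone (fun p => F p * G p).
Proof. by move=> cF [cG G0]; split; [exact: cM|move=> p /G0 ->; rewrite mulr0]. Qed.

Let in_coneD (F G : 'rV[R]_(1 + n) -> R) : in_cone F -> in_cone G -> in_cone (fun p => F p + G p).
Proof. by move=> [cF F0] [cG G0]; split; [exact: cD|move=> p h; rewrite F0// G0// addr0]. Qed.

Let in_cone_Kw : in_cone Kw.
Proof. by split=> // p h; rewrite /Kw /sqpos max_r// expr0n. Qed.

Let in_cone_dKw a : in_cone (dKw a).
Proof. by split=> // p h; rewrite /dKw max_r// mulr0 mul0r. Qed.

Let in_cone_dom F : in_cone F -> forall T : R, exists2 M, 0 <= M &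
  forall t x, `|t| <= T -> bracket x ^+ (2 * n) * `|F (event t x)| <= M.
Proof.
move=> [cF F0] T.
pose Bd := Num.max 0 (Num.max T (A + n%:R * T)).
have B0 : 0 <= Bd by rewrite le_max lexx.
have BT : T <= Bd by rewrite !le_max lexx orbT.
have BA : A + n%:R * T <= Bd by rewrite !le_max lexx !orbT.
pose Q := [set p : 'rV[R]_(1 + n) | forall i, `[- Bd, Bd]%classic (p ord0 i)].
have cQ : compact Q by apply: (@rV_compact _ _ (fun=> `[- Bd, Bd]%classic)) => i; exact: segment_compact.
pose G p := bracket (Defs.space p) ^+ (2 * n) * `|F p|.
have cG : continuous G.
  apply: cM.
    apply: cX; move=> p; apply: continuous_comp; last exact: bracket_continuous.
    exact: continuous_rsubmx.
  by move=> p; apply: continuous_comp; [exact: cF|exact: norm_continuous].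
have Q0 : Q !=set0.
  by exists 0 => i /=; rewrite mxE in_itv /= oppr_le0 B0.
have [c cQc Gc] := compact_EVT_max Q0 cQ (continuous_subspaceT cG).
have Gp p : 0 <= G p by rewrite mulr_ge0// exprn_ge0// ltW// bracket_gt0.
exists (G c) => // t x tT.
have [h|h] := leP (cone (event t x)) 0; first by rewrite F0// normr0 mulr0.
have -> : bracket x ^+ (2 * n) * `|F (event t x)| = G (event t x).
  by rewrite /G /Defs.space /event row_mxKr.
apply: Gc; rewrite inE => i /=; rewrite in_itv /= -ler_norml.
move: i; apply: ord_event_ind => [|j]; first by rewrite event0; exact: le_trans BT.
rewrite event_rshift; apply: le_trans BA.
move: h; rewrite /cone event0; set S := \sum_j _ => h.
have xS : `|x 0 j| <= S.
  rewrite /S (bigD1 j)//= event_rshift; apply: (le_trans (abs_le_japanese _)).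
  by rewrite lerDl; apply: sumr_ge0 => k _; rewrite ltW// japanese_gt0.
have nt : - (n%:R * t) <= n%:R * T.
  rewrite -mulrN ler_wpM2l//; move: tT; rewrite ler_norml => /andP[]; lra.
lra.
Qed.

Let slice_cont (F : 'rV[R]_(1 + n) -> R) t : in_cone F -> continuous (fun x => F (event t x)).
Proof.
move=> [cF _] x; apply: (@continuous_comp _ _ _ (fun x => event t x) F); last exact: cF.
exact: event_continuous.
Qed.

Let in_cone_integrable F t : in_cone F ->
  (leb R n).-integrable setT (fun v => (F (event t (vec v)))%:E).
Proof.
move=> iF; have [M M0 h] := in_cone_dom iF `|t|.
apply: (le_integrable measurableT _ _ (@integrable_dom R n M)).
  apply/measurable_EFinP.
  apply: (@continuous_vec_measurable R n (fun x => F (event t x))); exact: slice_cont.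
move=> v _; rewrite lee_fin; apply: le_trans (ler_norm _).
by apply: bracket_dom => //; exact: h.
Qed.

(* energy density, its time derivative, energy flux and its divergence *)
Let en p := 2^-1 * (D ord0 p * D ord0 p + \sum_j D (sp j) p * D (sp j) p).
Let den p := D ord0 p * DD ord0 ord0 p + \sum_j D (sp j) p * DD (sp j) ord0 p.
Let flux j p := D ord0 p * D (sp j) p.
Let dflux j p := DD ord0 (sp j) p * D (sp j) p + D ord0 p * DD (sp j) (sp j) p.

Let en_derive p : is_derive p (de ord0) en (den p).
Proof.
have h0 := is_deriveM (dD ord0 ord0 p) (dD ord0 ord0 p).
have hj : is_derive p (de ord0) (\sum_j (D (sp j) * D (sp j))) (\sum_j (D (sp j) p *: DD (sp j) ord0 p + D (sp j) p *: DD (sp j) ord0 p)).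
  by apply: is_derive_sum => j; exact: is_deriveM.
have h := @is_deriveZ _ _ _ _ (2^-1 : R) _ _ _ (is_deriveD h0 hj).
rewrite (_ : en = 2^-1 \*: (D ord0 * D ord0 + \sum_j (D (sp j) * D (sp j)))); last first.
  apply/funext => q; rewrite /en /GRing.scale /=; congr (_ * (_ + _)).
  by rewrite fct_sumE.
apply: is_derive_eq h _; rewrite /GRing.scale /= /den mulrDr; congr (_ + _); first by field.
by rewrite mulr_sumr; apply: eq_bigr => j _; field.
Qed.

Let flux_derive j p : is_derive p (de (sp j)) (flux j) (dflux j p).
Proof.
have h := is_deriveM (dD ord0 (sp j) p) (dD (sp j) (sp j) p).
by apply: is_derive_eq h _; rewrite /GRing.scale /= /dflux addrC mulrC.
Qed.

Let en_cont : continuous en.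
Proof. by apply: cCM; apply: cD; [exact: cM|apply: continuous_sumR => j; exact: cM]. Qed.

Let den_cont : continuous den.
Proof. by apply: cD; [exact: cM|apply: continuous_sumR => j; exact: cM]. Qed.

Let flux_cont j : continuous (flux j). Proof. exact: cM. Qed.

Let dflux_cont j : continuous (dflux j). Proof. by apply: cD; exact: cM. Qed.

Let G0 p := en p * Kw p.
Let H0 p := den p * Kw p + en p * dKw ord0 p.
Let G j p := flux j p * Kw p.
Let H j p := dflux j p * Kw p + flux j p * dKw (sp j) p.

Let G0i : in_cone G0. Proof. exact: in_coneM. Qed.
Let H0i : in_cone H0. Proof. by apply: in_coneD; exact: in_coneM. Qed.
Let Gi j : in_cone (G j). Proof. exact: in_coneM. Qed.
Let Hi j : in_cone (H j). Proof. by apply: in_coneD; exact: in_coneM. Qed.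

Let G0_derive p : is_derive p (de ord0) G0 (H0 p).
Proof.
have h := is_deriveM (en_derive p) (Kw_derive ord0 p).
by apply: is_derive_eq h _; rewrite /GRing.scale /= /H0 addrC [Kw p * _]mulrC.
Qed.

Let G_derive j p : is_derive p (de (sp j)) (G j) (H j p).
Proof.
have h := is_deriveM (flux_derive j p) (Kw_derive (sp j) p).
by apply: is_derive_eq h _; rewrite /GRing.scale /= /H addrC [Kw p * _]mulrC.
Qed.

Let H_int t j : \int[leb R n]_v H j (event t (vec v)) = 0.
Proof.
have [M M0 h] := in_cone_dom (Gi j) `|t|; have [M' M0' h'] := in_cone_dom (Hi j) `|t|.
apply: (@Rintegral_partial0 R n (fun x => G j (event t x)) (fun x => H j (event t x)) j (M + M')).
- move=> x; apply: is_derive_line.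
  have := is_derive_line_inv (G_derive j (event t x)).
  by under eq_fun do rewrite -event_space.
- apply: (@continuous_vec_measurable R n (fun x => G j (event t x))); exact: slice_cont.
- by move=> x; apply: (le_trans (h t x _)) => //; rewrite lerDl.
- by move=> x; apply: (le_trans (h' t x _)) => //; rewrite lerDr.
Qed.

(* the flux in direction j is at most the energy density, and the lateral
   boundary of the cone moves inwards at speed n: the flux through it is
   outgoing *)
Let dissipation p : H0 p <= \sum_j H j p.
Proof.
have c0 : 0 <= 2 * Num.max (cone p) 0 by rewrite mulr_ge0// le_max lexx orbT.
have -> : H0 p = (\sum_j dflux j p) * Kw p - 2 * Num.max (cone p) 0 * (n%:R * en p).
  rewrite /H0 /dKw /dcone eqxx; have -> : den p = \sum_j dflux j p.
    rewrite /den wave mulr_sumr -big_split; apply: eq_bigr => j _.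
    by rewrite /dflux (sym ord0) addrC [D _ _ * DD _ ord0 p]mulrC.
  by ring.
have -> : \sum_j H j p = (\sum_j dflux j p) * Kw p + \sum_j flux j p * dKw (sp j) p.
  by rewrite mulr_suml -big_split.
rewrite lerD2l.
have -> : n%:R * en p = \sum_(j < n) en p by rewrite sumr_const card_ord mulr_natl.
rewrite mulr_sumr -sumrN; apply: ler_sum => j _; rewrite /dKw /dcone /=.
set x := p 0 (sp j).
have jx : 0 < japanese x by exact: japanese_gt0.
have c1 : `|x / japanese x| <= 1.
  by rewrite normrM normfV (gtr0_norm jx) ler_pdivrMr// mul1r abs_le_japanese.
have fe : `|flux j p| <= en p.
  rewrite /flux /en (bigD1 j)//=; set S := \sum_(_ | _) _.
  have S0 : 0 <= S by apply: sumr_ge0 => k _; rewrite -expr2 sqr_ge0.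
  have := sqr_ge0 (D ord0 p - D (sp j) p); have := sqr_ge0 (D ord0 p + D (sp j) p).
  by rewrite ler_norml => h1 h2; apply/andP; split; nra.
have -> : flux j p * (2 * Num.max (cone p) 0 * - (x / japanese x)) =
    2 * Num.max (cone p) 0 * - (flux j p * (x / japanese x)) by ring.
rewrite -mulrN; apply: ler_wpM2l => //; rewrite lerN2.
apply: (le_trans (ler_norm _)); rewrite normrM.
by apply: le_trans fe; rewrite ler_piMr.
Qed.

Let Etot t := \int[leb R n]_v G0 (event t (vec v)).

Let dEtot t := \int[leb R n]_v H0 (event t (vec v)).

Let dEtot_le0 t : dEtot t <= 0.
Proof.
have sE : \int[leb R n]_v (\sum_j H j (event t (vec v))) = 0.
  transitivity (re (\sum_j Cint (leb R n) (fun v => (H j (event t (vec v)))%:C))).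
    rewrite -Cint_sum /=; last first.
      move=> j; split; first exact: in_cone_integrable (Hi j).
      by under eq_fun do rewrite im_rc; exact: integrable0.
    by apply: eq_Rintegral => v _; rewrite re_sum.
  by rewrite re_sum; apply: big1 => j _; rewrite /= H_int.
rewrite -sE; apply: le_Rintegral => //.
- exact: in_cone_integrable H0i.
- have h : (leb R n).-integrable setT (fun v => (\sum_j (H j (event t (vec v)))%:E)%E).
    by apply: integrable_sum => // j _; exact: in_cone_integrable (Hi j).
  by have := h; apply: eq_integrable => // v _; rewrite /= sumEFin.
Qed.

Let Etot_derive t : is_derive t (1 : R) Etot (dEtot t).
Proof.
have [M M0 h] := in_cone_dom H0i (`|t| + 1).
apply: (@Rintegral_is_derive R _ _ (leb R n) (fun t v => G0 (event t (vec v)))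
  (fun t v => H0 (event t (vec v))) (fun v => M * \prod_i powweight 1 (vec v 0 i))).
- by move=> s; exact: in_cone_integrable G0i.
- move=> s v.
  have := is_derive_line_at (z := event 0 (vec v)) (t := s) (G0_derive _) => hd.
  have {hd} := hd.
  by under eq_fun do rewrite -event_time addr0; rewrite -event_time addr0.
- exact: integrable_dom.
- move=> s v st; apply: bracket_dom => //; apply: h.
  rewrite -[s](subrK t) addrC; apply: (le_trans (ler_normD _ _)).
  by rewrite lerD2l ltW.
Qed.

Let G0_ge0 p : 0 <= G0 p.
Proof.
rewrite mulr_ge0 ?sqpos_ge0// mulr_ge0 ?invr_ge0// addr_ge0 -?expr2 ?sqr_ge0//.
by apply: sumr_ge0 => j _; rewrite -expr2 sqr_ge0.
Qed.

Let en0 x : en (event 0 x) = 0.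
Proof.
rewrite /en D0 mul0r add0r big1 ?mulr0// => j _.
suff -> : D (sp j) (event 0 x) = 0 by rewrite mul0r.
have h := is_derive_line_inv (dw (sp j) (event 0 x)).
have e : (fun h : R => w (h *: de (sp j) + event 0 x)) = cst 0.
  by apply/funext => k; rewrite -event_space w0.
rewrite e in h.
have v1 := @derive_val _ _ _ _ _ _ _ h.
by have v2 := @derive_val _ _ _ _ _ _ _ (is_derive_cst (0 : R) (0 : R) (1 : R)); rewrite -v1 v2.
Qed.

Let Etot0 t : 0 <= t -> Etot t = 0.
Proof.
move=> t0; have E0 : Etot 0 = 0.
  rewrite /Etot; under eq_Rintegral do rewrite /G0 en0 mul0r.
  by rewrite Rintegral_cst// mul0r.
apply/eqP; rewrite eq_le; apply/andP; split; last first.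
  by apply: Rintegral_ge0 => v _; exact: G0_ge0.
have [|c _] := @MVT_segment R Etot dEtot 0 t t0 (fun x _ => Etot_derive x).
  exact/continuous_subspaceT/(is_derive_continuous Etot_derive).
by rewrite E0 !subr0 => ->; apply: mulr_le0_ge0.
Qed.

(** The energy inside the cone is nonnegative, nonincreasing and initially 0. *)
Lemma cone_derivative0 t x : 0 <= t -> 0 < cone (event t x) -> D ord0 (event t x) = 0.
Proof.
move=> t0 c0.
have cG := @slice_cont G0 t G0i; have iG := @in_cone_integrable G0 t G0i.
have [M M0 h] := in_cone_dom G0i `|t|.
have g0 : G0 (event t x) = 0.
  apply: (@continuous_integral0 n (fun x => G0 (event t x)) M x) => //.
  - move=> y; rewrite -[leLHS]mul1r; apply: le_trans (h t y _) => //.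
    by apply: ler_wpM2r => //; rewrite exprn_ege1// bracket_ge1.
  - exact: Etot0.
have K0 : Kw (event t x) != 0 by rewrite /Kw /sqpos max_l ?expf_neq0 ?gt_eqF// ltW.
move/eqP: g0; rewrite mulf_eq0 (negbTE K0) orbF mulf_eq0 invr_eq0 pnatr_eq0 /=.
rewrite paddr_eq0 -?expr2 ?sqr_ge0//; last by apply: sumr_ge0 => j _; rewrite -expr2 sqr_ge0.
by rewrite sqrf_eq0 => /andP[/eqP].
Qed.
End energy.

(** Every point of the future lies inside some cone, so w is constant in time. *)
Theorem wave_uniqueness n (w : 'rV[R]_(1 + n) -> R) (D : 'I_(1 + n) -> 'rV[R]_(1 + n) -> R)
  (DD : 'I_(1 + n) -> 'I_(1 + n) -> 'rV[R]_(1 + n) -> R) :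
  (forall a x, is_derive x (delta_mx 0 a) w (D a x)) ->
  (forall a b x, is_derive x (delta_mx 0 b) (D a) (DD a b x)) ->
  (forall a, continuous (D a)) -> (forall a b, continuous (DD a b)) ->
  (forall x, DD ord0 ord0 x = \sum_j DD (rshift 1 j) (rshift 1 j) x) ->
  (forall x, w (event 0 x) = 0) -> (forall x, D ord0 (event 0 x) = 0) ->
  forall t x, 0 <= t -> w (event t x) = 0.
Proof.
move=> dw dD cD cDD wave w0 D0 t x t0.
have d0 s : 0 <= s -> D ord0 (event s x) = 0.
  move=> s0; pose A := n%:R * s + \sum_j japanese (x 0 j) + 1.
  apply: (@cone_derivative0 n w D DD dw dD cD cDD wave w0 D0 A) => //.
  rewrite /cone event0 (eq_bigr (fun j => japanese (x 0 j))); first by rewrite /A; lra.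
  by move=> j _; rewrite event_rshift.
have hd s : is_derive s (1 : R) (fun s => w (event s x)) (D ord0 (event s x)).
  have E h : h *: delta_mx 0 ord0 + event 0 x = event h x by rewrite -event_time addr0.
  rewrite -E; have := @is_derive_line_at _ _ w (event 0 x) (delta_mx 0 ord0) s (D ord0 (s *: delta_mx 0 ord0 + event 0 x)) (dw _ _).
  by under eq_fun do rewrite E.
have [|c] := @MVT_segment R (fun s => w (event s x)) (fun s => D ord0 (event s x)) 0 t t0 (fun s _ => hd s).
  exact/continuous_subspaceT/(is_derive_continuous hd).
by rewrite in_itv /= => /andP[c0 _]; rewrite w0 d0// mul0r subr0.
Qed.
End Uniqueness.

(** * Two incommensurable times *)

Section Diophantine.
Context {R : realType}.

Lemma sin_ge (u : R) : 0 <= u <= pi / 2 -> u / 3 <= sin u.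
Proof.
move=> /andP[u0 u2]; have p2 := @pihalf_lt2 R.
have [c] := @MVT_segment R sin cos 0 u u0 (fun x _ => is_derive_sin x)
  (continuous_subspaceT (@continuous_sin R)).
rewrite in_itv /= sin0 !subr0 => /andP[c0 cu] e.
have cosc : cos u <= cos c.
  by rewrite leNgt; apply/negP; rewrite ltr_cos ?in_itv /=; have := @pi_gt0 R; lra.
have su : u * cos u <= sin u by rewrite e mulrC ler_wpM2r.
have s0 : 0 <= sin u by apply: sin_ge0_pi; rewrite ?in_itv /= ?u0; have := @pi_gt0 R; lra.
have := cos2Dsin2 u; have [h|h] := leP 2^-1 (cos u) => hs; first by nra.
have c0' : 0 <= cos u by apply: cos_ge0_pihalf; apply/andP; split; lra.
nra.
Qed.

Lemma abs_sin_ge (u : R) : `|u| <= pi / 2 -> `|u| / 3 <= `|sin u|.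
Proof.
move=> u2; have [u0|u0] := leP 0 u.
  move: u2; rewrite (ger0_norm u0) => u2; apply: le_trans (ler_norm _).
  by apply: sin_ge; rewrite u0.
move: u2; rewrite (ltr0_norm u0) -normrN -sinN => u2; apply: le_trans (ler_norm _).
by apply: sin_ge; rewrite u2 andbT; lra.
Qed.

Lemma abs_sin_addpi (u : R) m : `|sin (u + m%:R * pi)| = `|sin u|.
Proof.
elim: m => [|m IH]; first by rewrite mul0r addr0.
by rewrite -natr1 mulrDl mul1r addrA sinDpi normrN.
Qed.

Lemma nearest_pi (x : R) : 0 <= x -> exists m : nat, `|x - m%:R * pi| <= pi / 2.
Proof.
move=> x0; have p0 := @pi_gt0 R; exists (Num.truncn (x / pi + 2^-1)).
have y0 : 0 <= x / pi + 2^-1 by rewrite addr_ge0 ?divr_ge0 ?(ltW p0).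
have /andP[h1 h2] := truncn_itv y0; set m := Num.truncn _ in h1 h2 *.
have xp : x / pi * pi = x by rewrite divfK// gt_eqF.
have h3 := ler_wpM2r (ltW p0) h1.
have h4 : (x / pi + 2^-1) * pi < m.+1%:R * pi by rewrite ltr_pM2r.
have e3 : (x / pi + 2^-1) * pi = x + pi / 2 by rewrite mulrDl xp [2^-1 * _]mulrC.
have e4 : m.+1%:R * pi = m%:R * pi + pi :> R by rewrite -natr1 mulrDl mul1r.
rewrite e3 in h3 h4; rewrite e4 in h4.
by rewrite ler_norml; apply/andP; split; lra.
Qed.

(** The 2-adic valuations of the two sides have different parities. *)
Lemma sqrt2_irrational (m m' : nat) : (0 < m)%N -> (2 * (m * m) != m' * m')%N.
Proof.
move=> m0; apply/eqP => e.
have m0' : (0 < m')%N.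
  by case: m' e => // /eqP; rewrite muln0 !muln_eq0 /= orbb eqn0Ngt m0.
have := congr1 (odd \o logn 2) e; rewrite /= !lognM ?muln_gt0 ?m0 ?m0'// logn_prime//=.
by rewrite !oddD !addbb.
Qed.

(** If r and sqrt 2 r were both very close to multiples m pi and m' pi, then
    sqrt 2 m would be very close to m'; but |sqrt 2 m - m'| is at least
    1 / (sqrt 2 m + m'), because 2 m^2 - m'^2 is a nonzero integer. *)
Lemma sin_sqrt2_ge (r : R) : 0 < r ->
  r / (90 * (1 + r) ^+ 2) <= `|sin r| + `|sin (Num.sqrt 2 * r)|.
Proof.
move=> r0; have p0 := @pi_gt0 R; have p2 := @pi_ge2 R.
have p4 : pi < 4 :> R by have := @pihalf_lt2 R; lra.
pose q : R := Num.sqrt 2.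
have q2 : q * q = 2 by rewrite -expr2 sqr_sqrtr.
have q0 : 0 <= q by exact: sqrtr_ge0.
have q1 : 1 <= q by nra.
have q15 : q <= 3 / 2 by nra.
have r1 : 0 < (1 + r) ^+ 2 by rewrite exprn_gt0//; lra.
have D1 : r / (90 * (1 + r) ^+ 2) * (90 * (1 + r) ^+ 2) = r.
  by rewrite divfK// mulf_neq0 ?gt_eqF.
set X := r / _ in D1 *.
have X0 : 0 <= X by rewrite /X divr_ge0 ?(ltW r0)// mulr_ge0 ?(ltW r1).
have [small|big] := leP r (pi / 2).
  have := @abs_sin_ge r; rewrite (gtr0_norm r0) => /(_ small) h.
  have := normr_ge0 (sin (q * r)).
  have : X * 90 <= r.
    rewrite -[leRHS]D1; apply: ler_wpM2l => //; nra.
  lra.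
have qr0 : 0 <= q * r by rewrite mulr_ge0// ltW.
have [m hm] := nearest_pi (ltW r0); have [m' hm'] := nearest_pi qr0.
have E1 := abs_sin_addpi (r - m%:R * pi) m; rewrite subrK in E1.
have E2 := abs_sin_addpi (q * r - m'%:R * pi) m'; rewrite subrK in E2.
rewrite E1 E2.
have := abs_sin_ge hm; have := abs_sin_ge hm'.
move: hm hm'; set u := r - _; set u' := _ - _ * pi => hm hm' h' h.
have m0 : (0 < m)%N.
  rewrite lt0n; apply/eqP => m0; move: hm; rewrite /u m0 mul0r subr0 gtr0_norm//; lra.
have ir : 1 <= `|q * m%:R - m'%:R| * (q * m%:R + m'%:R).
  have -> : `|q * m%:R - m'%:R| * (q * m%:R + m'%:R) =
      `|(q * m%:R - m'%:R) * (q * m%:R + m'%:R)|.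
    have s0 : 0 <= q * m%:R + m'%:R by rewrite addr_ge0// mulr_ge0.
    by rewrite normrM (ger0_norm s0).
  have -> : (q * m%:R - m'%:R) * (q * m%:R + m'%:R) = (2 * (m * m))%:R - (m' * m')%:R :> R.
    by rewrite !natrM; transitivity (q * q * m%:R * m%:R - m'%:R * m'%:R); [ring|rewrite q2; ring].
  have ne := sqrt2_irrational m' m0.
  have [lt|gt|eq] := ltngtP (2 * (m * m))%N (m' * m')%N.
  - rewrite distrC -natrB 1?ltnW// ger0_norm// ler1n subn_gt0//.
  - by rewrite -natrB 1?ltnW// ger0_norm// ler1n subn_gt0.
  - by rewrite eq eqxx in ne.
have Em : m%:R * pi = r - u by rewrite /u; ring.
have Em' : m'%:R * pi = q * r - u' by rewrite /u'; ring.
have hu : `|u'| + q * `|u| >= `|q * m%:R - m'%:R| * pi.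
  have -> : `|q * m%:R - m'%:R| * pi = `|u' - q * u|.
    rewrite -[in LHS](gtr0_norm p0) -normrM mulrBl -mulrA Em Em'.
    by congr `|_|; ring.
  apply: (le_trans (ler_normB _ _)); rewrite normrM (ger0_norm q0); lra.
have bd : (q * m%:R + m'%:R) * pi <= 10 * r.
  rewrite mulrDl -mulrA Em Em'.
  move: hm hm'; rewrite !ler_norml => /andP[a1 a2] /andP[b1 b2]; nra.
have s0 : 0 <= q * m%:R + m'%:R by rewrite addr_ge0// mulr_ge0.
set Y := `|q * m%:R - m'%:R| in ir hu.
have Y0 : 0 <= Y by exact: normr_ge0.
have key : pi * pi <= (`|u'| + q * `|u|) * (10 * r).
  apply: (@le_trans _ _ (Y * pi * ((q * m%:R + m'%:R) * pi))).
    have -> : Y * pi * ((q * m%:R + m'%:R) * pi) = (Y * (q * m%:R + m'%:R)) * (pi * pi) by ring.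
    by rewrite ler_peMl// mulr_ge0// ltW.
  by apply: ler_pM => //; rewrite mulr_ge0// ltW.
have : X * (90 * r ^+ 2) <= r.
  rewrite -[leRHS]D1; apply: ler_wpM2l => //; nra.
have nu := normr_ge0 u; have nu' := normr_ge0 u'.
move=> hX.
have : 4 <= (3 / 2 * (`|u| + `|u'|)) * (10 * r).
  apply: (@le_trans _ _ (pi * pi)); first by nra.
  apply: (le_trans key); apply: ler_wpM2r; first by rewrite mulr_ge0// ltW.
  nra.
have : X * (90 * r) <= 1.
  rewrite -(ler_pM2r r0) mul1r; apply: le_trans hX; rewrite expr2; lra.
move=> a b.
have : X * (90 * r) * 4 <= (`|u| + `|u'|) * 15 * r by lra.
move=> c; have : X * 90 * 4 <= (`|u| + `|u'|) * 15.
  by rewrite -(ler_pM2r r0); lra.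
lra.
Qed.
End Diophantine.

(** * Half-waves and the formula of d'Alembert *)

Section Waves.
Context {R : realType}.
Local Notation C := R[i].
Variable n : nat.
Local Notation E := ('rV[R]_(1 + n)).
Local Notation sp j := (rshift 1 j : 'I_(1 + n)).

(** A real C^2 solution of the wave equation together with its derivatives, the
    form in which [wave_uniqueness] applies. *)
Definition wave2 (w : E -> R) (D : 'I_(1 + n) -> E -> R) (DD : 'I_(1 + n) -> 'I_(1 + n) -> E -> R) :=
  [/\ forall a x, is_derive x (delta_mx 0 a) w (D a x),
      forall a b x, is_derive x (delta_mx 0 b) (D a) (DD a b x),
      (forall a, continuous (D a)) /\ (forall a b, continuous (DD a b)) &
      forall x, DD ord0 ord0 x = \sum_j DD (sp j) (sp j) x].

Lemma wave2_lin w D DD w' D' DD' (k : R) : wave2 w D DD -> wave2 w' D' DD' ->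
  wave2 (fun p => w p + k * w' p) (fun a p => D a p + k * D' a p)
    (fun a b p => DD a b p + k * DD' a b p).
Proof.
have dl (f g : E -> R) (v x : E) (a b : R) : is_derive x v f a -> is_derive x v g b ->
    is_derive x v (fun p => f p + k * g p) (a + k * b).
  move=> df dg; have dk := @is_deriveZ _ _ _ _ k _ _ _ dg.
  exact: (is_deriveD df dk).
move=> [h1 h2 [h3 h4] h5] [h1' h2' [h3' h4'] h5']; split.
- by move=> a x; apply: dl.
- by move=> a b x; apply: dl.
- by split=> [a|a b]; apply: cD => //; exact: cCM.
- by move=> x; rewrite h5 h5' mulr_sumr -big_split.
Qed.

(** Time translation, and time reversal when s = -1. *)
Definition taff (t s : R) (p : E) : E := event (t + s * time p) (Defs.space p).

Lemma taff_event t s h (x : 'rV[R]_n) : taff t s (event h x) = event (t + s * h) x.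
Proof. by rewrite /taff /time event0 /Defs.space /event row_mxKr. Qed.

Lemma taff_line t s a (h : R) (p : E) : taff t s (h *: delta_mx 0 a + p) =
  ((if a == ord0 then s else 1) * h) *: delta_mx 0 a + taff t s p.
Proof.
apply/rowP => b; rewrite [RHS]mxE [X in _ = X + _]mxE.
move: b; apply: ord_event_ind => [|k]; rewrite /taff ?event0 ?event_rshift.
  have -> : (delta_mx 0 a : E) 0 ord0 = (a == ord0)%:R by rewrite mxE eqxx eq_sym.
  rewrite /time mxE [X in s * (X + _)]mxE.
  have -> : (delta_mx 0 a : E) 0 ord0 = (a == ord0)%:R by rewrite mxE eqxx eq_sym.
  by case: (a == ord0) => /=; rewrite ?mulr1n ?mulr0n; ring.
have -> : (delta_mx 0 a : E) 0 (sp k) = (a == sp k)%:R by rewrite mxE eqxx eq_sym.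
rewrite mxE mxE [X in X + _]mxE (_ : (delta_mx 0 a : E) 0 (sp k) = (a == sp k)%:R); last first.
  by rewrite mxE eqxx eq_sym.
rewrite [in RHS]mxE; have [->|ak] := eqVneq a (sp k); last by rewrite mulr0n; ring.
by rewrite /= mulr1n; ring.
Qed.

Lemma taff_continuous t s : continuous (taff t s).
Proof.
have cc i : continuous (fun p : E => p 0 i) by exact: coord_continuous.
apply: continuous_rv; apply: ord_event_ind => [|j].
  under eq_fun do rewrite /taff event0; apply: cD; [exact: cC|apply: cCM; exact: cc].
under eq_fun do rewrite /taff event_rshift mxE; exact: cc.
Qed.

Lemma wave2_affine w D DD (t s : R) : s ^+ 2 = 1 -> wave2 w D DD ->
  wave2 (fun p => w (taff t s p))
    (fun a p => (if a == ord0 then s else 1) * D a (taff t s p))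
    (fun a b p => (if a == ord0 then s else 1) * (if b == ord0 then s else 1) * DD a b (taff t s p)).
Proof.
move=> s2 [h1 h2 [h3 h4] h5].
have dl (f : E -> R) a d p : is_derive (taff t s p) (delta_mx 0 a) f d ->
    is_derive p (delta_mx 0 a) (fun p => f (taff t s p)) ((if a == ord0 then s else 1) * d).
  move=> df; apply: is_derive_line; under eq_fun do rewrite taff_line.
  set c := if _ then _ else _.
  have hl := is_derive_line_inv df.
  have hc := is_derive_linear c (0 : R).
  have hl' : is_derive (c * 0) (1 : R) (fun h : R => f (h *: delta_mx 0 a + taff t s p)) d by rewrite mulr0.
  have h := @is_derive1_comp _ (fun h : R => f (h *: delta_mx 0 a + taff t s p)) (fun h => c * h) 0 _ _ hl' hc.
  by apply: is_derive_eq h _; rewrite mulrC.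
have cT (f : E -> R) : continuous f -> continuous (fun p => f (taff t s p)).
  by move=> cf p; apply: (@continuous_comp _ _ _ (taff t s) f); [exact: taff_continuous|exact: cf].
split.
- by move=> a x; apply: dl.
- move=> a b x; have h := dl _ b _ x (h2 a b (taff t s x)).
  have hk := @is_deriveZ _ _ _ _ (if a == ord0 then s else 1) _ _ _ h.
  by apply: is_derive_eq hk _; rewrite /GRing.scale /= mulrA.
- by split=> [a|a b]; apply: cCM; exact: cT.
- by move=> x; rewrite eqxx -expr2 s2 mul1r h5; apply: eq_bigr => j _; rewrite !mul1r.
Qed.

Lemma cderivable_is_derive k (f : 'rV[R]_k -> C) x i : cderivable f x i ->
  is_derive x (delta_mx 0 i) (fun y => re (f y)) (re (partial i f x)) /\
  is_derive x (delta_mx 0 i) (fun y => im (f y)) (im (partial i f x)).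
Proof. by move=> [d1 d2]; split; exact: derivableP. Qed.

Lemma wave2_components (u : E -> C) : Cdiff 2 u -> (forall p, box u p = 0) ->
  wave2 (fun p => re (u p)) (fun a p => re (partial a u p)) (fun a b p => re (partial b (partial a u) p)) /\
  wave2 (fun p => im (u p)) (fun a p => im (partial a u p)) (fun a b p => im (partial b (partial a u) p)).
Proof.
move=> [cu du] bu.
have du1 a x : cderivable u x a := du [::] a x isT.
have du2 a b x : cderivable (partial a u) x b := du [:: a] b x isT.
have d1 a x := cderivable_is_derive (du1 a x); have d2 a b x := cderivable_is_derive (du2 a b x).
have c1 a : ccontinuous (partial a u) := cu [:: a] isT.
have c2 a b : ccontinuous (partial b (partial a u)) := cu [:: b; a] isT.
have wv x : partial ord0 (partial ord0 u) x = \sum_j partial (sp j) (partial (sp j) u) x.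
  by apply/eqP; have := bu x; rewrite /box /dt /dx => /eqP; rewrite addrC subr_eq0 eq_sym.
split; split.
- by move=> a x; exact: (d1 a x).1.
- by move=> a b x; exact: (d2 a b x).1.
- by split=> [a|a b]; [exact: (c1 a).1|exact: (c2 a b).1].
- by move=> x; rewrite wv re_sum.
- by move=> a x; exact: (d1 a x).2.
- by move=> a b x; exact: (d2 a b x).2.
- by split=> [a|a b]; [exact: (c1 a).2|exact: (c2 a b).2].
- by move=> x; rewrite wv im_sum.
Qed.

(** The light cone: the frequency of a half-wave is (s |x|, x), with s = 1
    or -1. *)
Definition halfP (s : R) (x : 'rV[R]_n) : E := event (s * enorm x) x.

Lemma halfP0 s x : halfP s x 0 ord0 = s * enorm x. Proof. exact: event0. Qed.
Lemma halfP_rshift s x j : halfP s x 0 (sp j) = x 0 j. Proof. exact: event_rshift. Qed.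

Lemma measurable_enorm_vec : measurable_fun setT (fun v : RT R n => enorm (vec v)).
Proof. exact: continuous_vec_measurable (@enorm_continuous R n). Qed.

Lemma rvmeas_halfP s : rvmeas (fun v : RT R n => halfP s (vec v)).
Proof.
apply: ord_event_ind => [|j].
  under eq_fun do rewrite halfP0; apply: measurable_funM; first exact: measurable_cst.
  exact: measurable_enorm_vec.
by under eq_fun do rewrite halfP_rshift; exact: measurable_vec_coord.
Qed.

Lemma halfP_le s x a : s ^+ 2 = 1 -> `|halfP s x 0 a| <= enorm x.
Proof.
move=> s2; have s1 : `|s| = 1.
  by apply/eqP; rewrite -(@eqrXn2 _ 2)// expr1n real_normK ?num_real// s2.
move: a; apply: ord_event_ind => [|j]; last by rewrite halfP_rshift coord_le_enorm.
by rewrite halfP0 normrM s1 mul1r ger0_norm// enorm_ge0.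
Qed.

(** Amplitudes for which every superposition below converges with all its
    derivatives. *)
Definition good (f : 'rV[R]_n -> C) := rapid f /\ Cmeas (f \o @vec R n).

Lemma good_integrable f : good f -> Cintegrable (leb R n) (f \o @vec R n).
Proof. by move=> [rf mf]; exact: rapid_integrable. Qed.

Lemma good_mul (f : 'rV[R]_n -> C) (k : 'rV[R]_n -> C) (c : R) N : good f ->
  Cmeas (k \o @vec R n) -> (forall x, normc (k x) <= c * bracket x ^+ N) ->
  good (fun x => k x * f x).
Proof.
move=> [rf mf] mk kb; split; last exact: CmeasM.
apply: (@rapid_le _ _ f _ c N rf) => x; rewrite ComplexField.Normc.normcM.
by apply: ler_wpM2r => //; exact: normc_ge0.
Qed.

Lemma good_halfP s a f : s ^+ 2 = 1 -> good f -> good (fun x => 'i * (halfP s x 0 a)%:C * f x).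
Proof.
move=> s2 gf; apply: (@good_mul _ (fun x => 'i * (halfP s x 0 a)%:C) 1 1 gf).
  by apply: CmeasM; [exact: Cmeas_cst|apply: Cmeas_rc; exact: rvmeas_halfP].
move=> x; rewrite ComplexField.Normc.normcM normc_i normc_rc !mul1r expr1.
by apply: (le_trans (halfP_le _ _ s2)); exact: enorm_le_bracket.
Qed.

Definition halfwave s (f : 'rV[R]_n -> C) := Jt (leb R n) (f \o @vec R n) (fun v => halfP s (vec v)).

Lemma wave2_halfwave s f : s ^+ 2 = 1 -> good f ->
  let f1 a := (fun x => 'i * (halfP s x 0 a)%:C * f x) in
  let f2 a b := (fun x => 'i * (halfP s x 0 b)%:C * f1 a x) in
  wave2 (fun p => re (halfwave s f p)) (fun a p => re (halfwave s (f1 a) p)) (fun a b p => re (halfwave s (f2 a b) p)) /\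
  wave2 (fun p => im (halfwave s f p)) (fun a p => im (halfwave s (f1 a) p)) (fun a b p => im (halfwave s (f2 a b) p)).
Proof.
move=> s2 gf f1 f2.
have g1 a : good (f1 a) by exact: good_halfP.
have g2 a b : good (f2 a b) by exact: good_halfP.
have i0 := good_integrable gf; have i1 a := good_integrable (g1 a).
have i2 a b := good_integrable (g2 a b).
have rP := rvmeas_halfP s.
have d1 a x := @Jt_is_derive R _ _ (leb R n) _ _ _ a x i0 rP (i1 a).
have d2 a b x := @Jt_is_derive R _ _ (leb R n) _ _ _ b x (i1 a) rP (i2 a b).
have c1 a := Jt_continuous (i1 a) rP; have c2 a b := Jt_continuous (i2 a b) rP.
have wv x : halfwave s (f2 ord0 ord0) x = \sum_j halfwave s (f2 (sp j) (sp j)) x.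
  rewrite /halfwave /Jt -Cint_sum.
    congr Cint; apply/funext => v /=; rewrite -mulr_suml; congr (_ * _).
    have ii (k : R) (z : C) : 'i * k%:C * ('i * k%:C * z) = (- k ^+ 2)%:C * z.
      by apply: eqC; rewrite !(reM,imM) /=; ring.
    rewrite /f2 /f1 ii halfP0 (eq_bigr (fun j => (- vec v 0 j ^+ 2)%:C * f (vec v))); last first.
      by move=> j _; rewrite halfP_rshift ii.
    rewrite -mulr_suml; congr (_ * _); apply: eqC; rewrite ?re_sum ?im_sum /=; last by rewrite big1.
    by rewrite exprMn s2 mul1r enorm_sqr sumrN; congr (- _); apply: eq_bigr => j _; rewrite expr2.
  by move=> j; exact: Jt_integrable.
split; split.
- by move=> a x; exact: (d1 a x).1.
- by move=> a b x; exact: (d2 a b x).1.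
- by split=> [a|a b]; [exact: (c1 a).1|exact: (c2 a b).1].
- by move=> x; rewrite wv re_sum.
- by move=> a x; exact: (d1 a x).2.
- by move=> a b x; exact: (d2 a b x).2.
- by split=> [a|a b]; [exact: (c1 a).2|exact: (c2 a b).2].
- by move=> x; rewrite wv im_sum.
Qed.

Lemma halfwave_event s f t x : halfwave s f (event t x) =
  Cint (leb R n) (fun v => f (vec v) * cis (t * (s * enorm (vec v)) + dotp x (vec v))).
Proof. by rewrite /halfwave /Jt; congr Cint; apply/funext => v; rewrite /= dotp_event halfP0 /halfP /Defs.space row_mxKr. Qed.

Definition coef : R := (2 * pi) ^- n.

Lemma coefK : coef * (2 * pi) ^+ n = 1.
Proof. by rewrite mulVf// expf_neq0// mulf_neq0// gt_eqF ?pi_gt0. Qed.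

Section dalembert.
Variable u : E -> C.
Hypotheses (u2 : Cdiff 2 u) (bu : forall p, box u p = 0)
  (su : forall t, schwartz (fun x => u (event t x))).

Definition slice t x := u (event t x).

Lemma slice_schwartz t : schwartz_like (slice t).
Proof. exact/schwartz_schwartz_like/su. Qed.

Lemma good_slice t : good (slice t).
Proof.
by have [rf cf _] := slice_schwartz t [::]; split => //; exact: ccontinuous_Cmeas.
Qed.

Lemma fourier_slice_continuous t : ccontinuous (fourier (slice t)).
Proof. by have [rf cf _] := slice_schwartz t [::]; exact: fourier_continuous. Qed.

Lemma good_fourier_slice t : good (fourier (slice t)).
Proof.
split; first exact: fourier_rapid (slice_schwartz t).
exact/ccontinuous_Cmeas/fourier_slice_continuous.
Qed.

Section fixed_time.
Variable t : R.
Let F := fourier (slice t).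
Let gF : good F := good_fourier_slice t.

Let N1 : (-1 : R) ^+ 2 = 1. Proof. by rewrite sqrrN expr1n. Qed.
Let P1 : (1 : R) ^+ 2 = 1. Proof. by rewrite expr1n. Qed.

Let hw0 s x : halfwave s F (event 0 x) = ((2 * pi) ^+ n)%:C * slice t x.
Proof.
rewrite halfwave_event -(fourier_inversion x (slice_schwartz t)).
rewrite [inv_fourier _ _](_ : _ = coef%:C * Cint (leb R n) (fun v => F (vec v) * cis (dotp x (vec v)))); last by [].
have -> : (fun v : RT R n => F (vec v) * cis (0 * (s * enorm (vec v)) + dotp x (vec v))) =
  (fun v => F (vec v) * cis (dotp x (vec v))).
  by apply/funext => v; rewrite mul0r add0r.
have e : ((2 * pi) ^+ n)%:C * coef%:C = 1 :> C.
  by apply: eqC; rewrite ?(reM, imM) /= ?(mulr0, mul0r, subr0, addr0)// mulrC coefK.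
by rewrite mulrA e mul1r.
Qed.

Let dhw0 x : halfwave 1 (fun x => 'i * (halfP 1 x 0 ord0)%:C * F x) (event 0 x) +
  halfwave (-1) (fun x => 'i * (halfP (-1) x 0 ord0)%:C * F x) (event 0 x) = 0.
Proof.
have i1 s : s ^+ 2 = 1 -> Cintegrable (leb R n) (fun v => 'i * (halfP s (vec v) 0 ord0)%:C * F (vec v) *
    cis (dotp (event 0 x) (halfP s (vec v)))).
  move=> s2; apply: (@Jt_integrable R _ _ (leb R n) _ ((fun x => 'i * (halfP s x 0 ord0)%:C * F x) \o @vec R n)).
    by apply: good_integrable; exact: good_halfP.
  exact: rvmeas_halfP.
rewrite /halfwave /Jt -(CintD (i1 1 P1) (i1 (-1) N1)).
rewrite (_ : (fun v => _) = (fun=> 0)); first by rewrite /Cint Rintegral_cst// mul0r.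
apply/funext => v; rewrite !dotp_event !mul0r !add0r !halfP0 /halfP /Defs.space !row_mxKr -!mulrDl.
by apply: eqC; rewrite !(reM,imM,reD,imD) /=; ring.
Qed.

Let w_zero (pr : C -> R) (D0 := fun (p : 'I_(1 + n)) q => pr (partial p u q)) :
  (forall x y : C, pr (x + y) = pr x + pr y) -> (forall x (k : R), pr (k%:C * x) = k * pr x) ->
  wave2 (fun p => pr (u p)) D0 (fun a b p => pr (partial b (partial a u) p)) ->
  (forall s, s ^+ 2 = 1 ->
    let f1 a := (fun x => 'i * (halfP s x 0 a)%:C * F x) in
    let f2 a b := (fun x => 'i * (halfP s x 0 b)%:C * f1 a x) in
    wave2 (fun p => pr (halfwave s F p)) (fun a p => pr (halfwave s (f1 a) p))
      (fun a b p => pr (halfwave s (f2 a b) p))) ->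
  forall h x, 0 <= h -> pr (slice (t + h) x + slice (t - h) x) =
    coef * pr (halfwave 1 F (event h x) + halfwave (-1) F (event h x)).
Proof.
move=> prD prZ wu wh h x h0.
have W := wave2_lin (- coef)
  (wave2_lin 1 (wave2_affine t P1 wu) (wave2_affine t N1 wu))
  (wave2_lin 1 (wh 1 P1) (wh (-1) N1)).
have [W1 W2 [W3 W4] W5] := W.
have U := fun a b => wave_uniqueness W1 W2 W3 W4 W5 a b x h0.
rewrite /= !taff_event in U.
rewrite !prD; apply/eqP; rewrite -subr_eq0 -mulNr; apply/eqP.
rewrite mul1r mulN1r !mul1r in U; apply: U.
- move=> y; rewrite !taff_event !mulr0 !addr0 !hw0 !prZ !mul1r.
  have := coefK; set c := (2 * pi) ^+ n => cK.
  have -> : - coef * (c * pr (slice t y) + c * pr (slice t y)) = - (coef * c) * (pr (slice t y) + pr (slice t y)) by ring.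
  by rewrite cK mulN1r subrr.
- move=> y; rewrite /D0 !taff_event !mulr0 !addr0 !mul1r -prD dhw0.
  have -> : pr 0 = 0 by rewrite -(mulr0 (0 : R)%:C) prZ mul0r.
  by rewrite mulr0 addr0 mulN1r subrr.
Qed.

(** As functions of (h, x) both sides solve the wave equation, and at h = 0 both
    equal 2 u(t, x) and have velocity 0. *)
Lemma dalembert_space h x : 0 <= h -> slice (t + h) x + slice (t - h) x =
  coef%:C * Cint (leb R n) (fun v => (2 * cos (h * enorm (vec v)))%:C * F (vec v) * cis (dotp x (vec v))).
Proof.
move=> h0; have [wr wi] := wave2_components u2 bu.
have hr s (s2 : s ^+ 2 = 1) := (wave2_halfwave s2 gF).1.
have hi s (s2 : s ^+ 2 = 1) := (wave2_halfwave s2 gF).2.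
have rcM (k : R) (y : C) : (re (k%:C * y) = k * re y) /\ (im (k%:C * y) = k * im y).
  by rewrite reM imM /= !mul0r subr0 addr0.
have r := w_zero (pr := fun z => re z) reD (fun x k => (rcM k x).1) wr hr x h0.
have i := w_zero (pr := fun z => im z) imD (fun x k => (rcM k x).2) wi hi x h0.
transitivity (coef%:C * (halfwave 1 F (event h x) + halfwave (-1) F (event h x))).
  by apply: eqC; rewrite ?(rcM _ _).1 ?(rcM _ _).2.
congr (_ * _).
have i1 s := @Jt_integrable R _ _ (leb R n) _ (F \o @vec R n) _ (event h x) (good_integrable gF) (rvmeas_halfP s).
rewrite /halfwave /Jt -(CintD (i1 1) (i1 (-1))).
congr Cint; apply/funext => v; rewrite /= !dotp_event !halfP0 /halfP /Defs.space !row_mxKr !cisD.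
have -> : (2 * cos (h * enorm (vec v)))%:C = cis (h * (1 * enorm (vec v))) + cis (h * (-1 * enorm (vec v))) :> C.
  by rewrite mul1r mulN1r mulrN; apply: eqC; rewrite /cis /= ?cosN ?sinN; ring.
by ring.
Qed.

(** The identity u(t + h) + u(t - h) = 2 cos(h |D|) u(t). It involves only the
    slices of u, which are Schwartz functions, and not the velocity u_t, whose
    decay in x is not known in advance. *)
Lemma dalembert h xi : 0 <= h ->
  fourier (slice (t + h)) xi + fourier (slice (t - h)) xi = (2 * cos (h * enorm xi))%:C * F xi.
Proof.
move=> h0; pose G x := (2 * cos (h * enorm x))%:C * F x.
have cF := fourier_slice_continuous t.
have ck : continuous (fun x : 'rV[R]_n => 2 * cos (h * enorm x)).
  apply: cCM; apply: c_comp; first exact: continuous_cos.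
  by apply: cCM; exact: enorm_continuous.
have cG : ccontinuous G.
  split.
    have -> : (fun x => re (G x)) = (fun x => 2 * cos (h * enorm x) * re (F x)).
      by apply/funext => x; rewrite /G reM /= mul0r subr0.
    by apply: cM => //; exact: cF.1.
  have -> : (fun x => im (G x)) = (fun x => 2 * cos (h * enorm x) * im (F x)).
    by apply/funext => x; rewrite /G imM /= mul0r addr0.
  by apply: cM => //; exact: cF.2.
have gG : good G.
  apply: (@good_mul _ (fun x => (2 * cos (h * enorm x))%:C) 2 0 gF).
    by apply: Cmeas_rc; exact: continuous_vec_measurable ck.
  by move=> x; rewrite normc_rc expr0 mulr1 normrM ger0_norm// ler_piMr// cos_norm_le1.
have Gi := good_integrable gG; have [M M0 GM] := rapid_bounded gG.1.
have hE x : Cint (leb R n) (fun v => G (vec v) * cis (1 * dotp x (vec v))) =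
    ((2 * pi) ^+ n)%:C * (slice (t + h) x + slice (t - h) x).
  rewrite dalembert_space// mulrA.
  have -> : ((2 * pi) ^+ n)%:C * coef%:C = 1 :> C.
    by apply: eqC; rewrite ?(reM, imM) /= ?(mulr0, mul0r, subr0, addr0)// mulrC coefK.
  by rewrite mul1r; congr Cint; apply/funext => v; rewrite mul1r.
have si s := good_integrable (good_slice s).
have := @Cint_inversion R n G 1 M xi P1 Gi GM (cG.1 xi) (cG.2 xi).
under [fun x : 'rV[R]_n => Cint _ _]eq_fun do rewrite hE.
have hi := CintegrableZl (((2 * pi) ^+ n)%:C) (CintegrableD (si (t + h)) (si (t - h))).
move=> /(_ hi); rewrite -/(G xi) => e.
have rn s := fourierE (slice s) xi.
have fi s : Cintegrable (leb R n) (fun v => slice s (vec v) * cis (- dotp (vec v) xi)).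
  have rvN : rvmeas (fun v : RT R n => - vec v).
    by move=> i; under eq_fun do rewrite mxE; apply: measurable_funN; exact: measurable_vec_coord.
  have J := @Jt_integrable R _ _ (leb R n) _ (slice s \o @vec R n) (fun v => - vec v) xi (si s) rvN.
  rewrite (_ : (fun v : RT R n => _) = (fun v => (slice s \o @vec R n) v * cis (dotp xi (- vec v))))//.
  by apply/funext => v; rewrite [dotp xi _]dotpC -(scaleN1r (vec v)) dotpZl mulN1r.
have c0 : ((2 * pi) ^+ n)%:C != 0 :> C.
  by rewrite eq_complex /= eqxx andbT expf_neq0// mulf_neq0// gt_eqF ?pi_gt0.
apply: (mulfI c0); rewrite -e.
have -> : fourier (slice (t + h)) xi + fourier (slice (t - h)) xi =
  Cint (leb R n) (fun v => slice (t + h) (vec v) * cis (- dotp (vec v) xi) +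
    slice (t - h) (vec v) * cis (- dotp (vec v) xi)).
  by rewrite (CintD (fi _) (fi _)).
rewrite -(CintZl _ (CintegrableD (fi _) (fi _))); congr Cint; apply/funext => v.
by rewrite hE mul1r; ring.
Qed.
End fixed_time.

End dalembert.

End Waves.

(** * Half-wave profiles and their energy *)

Section PointwiseContinuity.
Context {R : realType} {V : topologicalType}.
Local Notation C := R[i].

Definition ccont_at (f : V -> C) (x : V) :=
  {for x, continuous (fun y => re (f y))} /\ {for x, continuous (fun y => im (f y))}.

Lemma ccont_atD f g x : ccont_at f x -> ccont_at g x -> ccont_at (fun y => f y + g y) x.
Proof.
move=> [f1 f2] [g1 g2]; split.
  by rewrite (_ : (fun y => _) = (fun y => re (f y) + re (g y))); [exact: continuousD|apply/funext => y; rewrite reD].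
by rewrite (_ : (fun y => _) = (fun y => im (f y) + im (g y))); [exact: continuousD|apply/funext => y; rewrite imD].
Qed.

Lemma ccont_atM f g x : ccont_at f x -> ccont_at g x -> ccont_at (fun y => f y * g y) x.
Proof.
move=> [f1 f2] [g1 g2]; split.
  rewrite (_ : (fun y => _) = (fun y => re (f y) * re (g y) - im (f y) * im (g y))); last by apply/funext => y; rewrite reM.
  by apply: continuousB; exact: continuousM.
rewrite (_ : (fun y => _) = (fun y => re (f y) * im (g y) + im (f y) * re (g y))); last by apply/funext => y; rewrite imM.
by apply: continuousD; exact: continuousM.
Qed.

Lemma ccont_at_rc (f : V -> R) x : {for x, continuous f} -> ccont_at (fun y => (f y)%:C) x.
Proof. by move=> cf; split => //; exact: cst_continuous. Qed.

Lemma ccont_at_cst (k : C) x : ccont_at (fun=> k) x.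
Proof. by split; exact: cst_continuous. Qed.

Lemma ccont_at_cis (f : V -> R) x : {for x, continuous f} -> ccont_at (fun y => cis (f y)) x.
Proof.
move=> cf; split.
  by apply: (@continuous_comp _ _ _ f cos) => //; exact: continuous_cos.
by apply: (@continuous_comp _ _ _ f sin) => //; exact: continuous_sin.
Qed.
End PointwiseContinuity.

Lemma Cint_ae_eq (R : realType) d (T : measurableType d) (mu : {measure set T -> \bar R}) (f g : T -> R[i]) :
  Cmeas f -> Cmeas g -> {ae mu, forall x, f x = g x} -> Cint mu f = Cint mu g.
Proof.
move=> [f1 f2] [g1 g2] h; rewrite /Cint /Rintegral; congr (fine _ +i* fine _).
  apply: ae_eq_integral => //; try exact/measurable_EFinP.
  by apply: filterS h => x e _; rewrite e.
apply: ae_eq_integral => //; try exact/measurable_EFinP.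
by apply: filterS h => x e _; rewrite e.
Qed.

Section Spectral.
Context {R : realType}.
Local Notation C := R[i].
Local Notation normcM := ComplexField.Normc.normcM.
Variables (n : nat) (u : 'rV[R]_(1 + n) -> C).
Hypotheses (n0 : (0 < n)%N) (u2 : Cdiff 2 u) (bu : forall p, box u p = 0)
  (su : forall t, schwartz (fun x => u (event t x))).
Local Notation E := ('rV[R]_(1 + n)).
Local Notation sp j := (rshift 1 j : 'I_(1 + n)).

Let a t xi := fourier (slice u t) xi.
Let c t (xi : 'rV[R]_n) : C := (cos (t * enorm xi))%:C.
Let s t (xi : 'rV[R]_n) : C := (sin (t * enorm xi))%:C.
(* [dalembert] says that a satisfies the functional equation of the cosine in t;
   its odd part b then satisfies that of the sine *)
Let b t xi := a t xi - c t xi * a 0 xi.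

Let aE t h xi : a (t + h) xi + a (t - h) xi = 2 * c h xi * a t xi.
Proof.
have e k : 2 * c k xi = (2 * cos (k * enorm xi))%:C.
  by apply: eqC; rewrite !(reM,imM) /=; ring.
rewrite e; have [h0|h0] := leP 0 h; first exact: dalembert.
have := dalembert u2 bu su t xi (h := - h).
rewrite oppr_ge0 ltW// opprK mulNr cosN => /(_ isT) <-.
by rewrite addrC.
Qed.

Let rcD (x y : R) : (x + y)%:C = x%:C + y%:C :> C.
Proof. by apply: eqC; rewrite /= ?addr0. Qed.

Let rcM (x y : R) : (x * y)%:C = x%:C * y%:C :> C.
Proof. by apply: eqC; rewrite /= ?(mulr0, mul0r, subr0, addr0). Qed.

Let reZ (k : R) (z : C) : re (k%:C * z) = k * re z.
Proof. by rewrite reM /= mul0r subr0. Qed.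

Let imZ (k : R) (z : C) : im (k%:C * z) = k * im z.
Proof. by rewrite imM /= mul0r addr0. Qed.

Let cD2 t h xi : c (t + h) xi = c t xi * c h xi - s t xi * s h xi.
Proof.
rewrite /c /s mulrDl cosD -!rcM; apply: eqC; rewrite ?(reD,imD,reN,imN) /=; ring.
Qed.

Let c_opp t xi : c (- t) xi = c t xi. Proof. by rewrite /c mulNr cosN. Qed.
Let s_opp t xi : s (- t) xi = - s t xi.
Proof. by rewrite /s mulNr sinN; apply: eqC; rewrite /= ?oppr0. Qed.

Let two0 : 2 != 0 :> C. Proof. by rewrite pnatr_eq0. Qed.

Let bE t h xi : b (t + h) xi + b (t - h) xi = 2 * c h xi * b t xi.
Proof.
rewrite /b; have -> : a (t + h) xi - c (t + h) xi * a 0 xi + (a (t - h) xi - c (t - h) xi * a 0 xi) =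
   (a (t + h) xi + a (t - h) xi) - (c (t + h) xi + c (t - h) xi) * a 0 xi by ring.
rewrite aE !cD2 c_opp s_opp; ring.
Qed.

Let b_opp t xi : b (- t) xi = - b t xi.
Proof.
have := aE 0 t xi; rewrite add0r sub0r => h; apply/eqP; rewrite -subr_eq0 opprK /b c_opp.
have -> : a (- t) xi - c t xi * a 0 xi + (a t xi - c t xi * a 0 xi) =
  (a t xi + a (- t) xi) - 2 * c t xi * a 0 xi by ring.
by rewrite h subrr.
Qed.

Let bD t h xi : b (t + h) xi = c h xi * b t xi + c t xi * b h xi.
Proof.
apply: (mulfI two0).
have e1 := bE t h xi; have e2 := bE h t xi; rewrite (addrC h t) -(opprB t h) b_opp in e2.
have -> : 2 * b (t + h) xi = (b (t + h) xi + b (t - h) xi) + (b (t + h) xi - b (t - h) xi) by ring.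
by rewrite e1 e2; ring.
Qed.

(* b t / s t does not depend on t, in a form without division *)
Let b_exchange t h k xi : b t xi * s k xi * s h xi = b k xi * s t xi * s h xi.
Proof.
have e1 := bD (t + h) k xi; have e2 := bD t (h + k) xi; rewrite addrA in e2.
move: e2; rewrite e1 !bD !cD2 => /eqP; rewrite -subr_eq0 => /eqP e.
apply/eqP; rewrite -subr_eq0 -e; apply/eqP; ring.
Qed.

(* the common value of b t / s t, by least squares at the times 1 and sqrt 2,
   where the sines never vanish together *)
Let q : R := Num.sqrt 2.
Let den (xi : 'rV[R]_n) : R := sin (1 * enorm xi) ^+ 2 + sin (q * enorm xi) ^+ 2.
Let beta xi := ((den xi)^-1)%:C * (s 1 xi * b 1 xi + s q xi * b q xi).

Let den_gt0 xi : xi != 0 -> 0 < den xi.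
Proof.
move=> x0; have r0 : 0 < enorm xi by rewrite enorm_gt0.
have := sin_sqrt2_ge r0; rewrite -/q => h; rewrite /den mul1r.
have h0 : 0 < enorm xi / (90 * (1 + enorm xi) ^+ 2).
  by rewrite divr_gt0// mulr_gt0// exprn_gt0// ltr_pwDl// ltW.
rewrite lt_neqAle addr_ge0 ?sqr_ge0// andbT eq_sym paddr_eq0 ?sqr_ge0// !sqrf_eq0.
apply/negP => /andP[/eqP e1 /eqP e2]; move: h; rewrite e1 e2 normr0 addr0.
by rewrite leNgt h0.
Qed.

Let b_beta t xi : xi != 0 -> b t xi = s t xi * beta xi.
Proof.
move=> x0; have d0 := den_gt0 x0.
have dC : (den xi)%:C = s 1 xi * s 1 xi + s q xi * s q xi by rewrite /s -!rcM -rcD /den !expr2.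
have d1 : ((den xi)^-1)%:C * (den xi)%:C = 1 :> C by rewrite -rcM mulVf// gt_eqF.
rewrite -[LHS]mul1r -d1 dC /beta mulrCA -!mulrA; congr (_ * _).
have -> : (s 1 xi * s 1 xi + s q xi * s q xi) * b t xi =
  b t xi * s 1 xi * s 1 xi + b t xi * s q xi * s q xi by ring.
by rewrite (b_exchange t 1 1) (b_exchange t q q); ring.
Qed.

(** The transform of u_t at time 0. By [sin_sqrt2_ge] it is at most a power of
    <xi> times the transforms of slices of u, hence decays rapidly. *)
Definition sine_part xi : C := (enorm xi)%:C * beta xi.

(** The amplitude of a half-wave multiplied by 2 |xi|: this is the quantity
    whose L^2 norm the energy controls. *)
Definition half_profile (sg : R) xi : C := (enorm xi)%:C * a 0 xi - 'i * sg%:C * sine_part xi.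

Let ga t : good (a t) := good_fourier_slice su t.

Let mc t : measurable_fun setT (fun v : RT R n => cos (t * enorm (vec v))).
Proof.
apply: (measurableT_comp measurable_cos); apply: measurable_funM => //; exact: measurable_enorm_vec.
Qed.

Let gb t : good (b t).
Proof.
have gc : good (fun xi => - c t xi * a 0 xi).
  apply: (@good_mul _ _ _ (fun xi => - c t xi) 1 0 (ga 0)).
    split; first by apply: measurable_funN; exact: mc.
    by rewrite [X in measurable_fun _ X](_ : _ = fun=> 0); [exact: measurable_cst|apply/funext => v; exact: oppr0].
  by move=> xi; rewrite normcN normc_rc expr0 mulr1 cos_norm_le1.
have [r1 m1] := ga t; have [r2 m2] := gc; split.
  have := rapidD r1 r2; rewrite (_ : (fun x => _) = b t)//.
  by apply/funext => x; rewrite mulNr.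
have := CmeasD m1 m2; rewrite (_ : (fun x : RT R n => _ + _) = b t \o @vec R n)//.
by apply/funext => x; rewrite /= mulNr.
Qed.

Let beta_s k xi : normc (beta xi) * `|sin (k * enorm xi)| <= normc (b k xi).
Proof.
have [->|x0] := eqVneq xi 0.
  have e0 : enorm (0 : 'rV[R]_n) = 0 by apply/eqP; rewrite enorm_eq0.
  by rewrite e0 mulr0 sin0 normr0 mulr0 normc_ge0.
have -> : normc (b k xi) = normc (s k xi) * normc (beta xi) by rewrite (b_beta k x0); exact: normcM.
by rewrite /s normc_rc mulrC.
Qed.

Let sine_part_le xi : normc (sine_part xi) <= 360 * bracket xi ^+ 2 * (normc (b 1 xi) + normc (b q xi)).
Proof.
have [->|x0] := eqVneq xi 0.
  have e0 : enorm (0 : 'rV[R]_n) = 0 by apply/eqP; rewrite enorm_eq0.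
  rewrite /sine_part e0 mul0r ComplexField.Normc.normc0.
  apply: mulr_ge0; last by apply: addr_ge0; exact: normc_ge0.
  by apply: mulr_ge0; [exact: ler0n|apply: exprn_ge0; exact: ltW (bracket_gt0 _)].
have r0 : 0 < enorm xi by rewrite enorm_gt0.
have h1 := beta_s 1 xi; have hq := beta_s q xi.
have h := sin_sqrt2_ge r0; rewrite -/q in h; rewrite mul1r in h1.
have B1 := bracket_ge1 xi; have Br := enorm_le_bracket xi.
have g0 := normc_ge0 (beta xi).
have p0 : 0 < 90 * (1 + enorm xi) ^+ 2 by rewrite mulr_gt0// exprn_gt0// ltr_pwDl// ltW.
have -> : normc (sine_part xi) = enorm xi * normc (beta xi).
  by rewrite (normcM (enorm xi)%:C (beta xi)) normc_rc gtr0_norm.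
move: h; rewrite ler_pdivrMr// => h.
apply: (@le_trans _ _ ((`|sin (enorm xi)| + `|sin (q * enorm xi)|) * (90 * (1 + enorm xi) ^+ 2) * normc (beta xi))).
  exact: ler_wpM2r.
have -> : (`|sin (enorm xi)| + `|sin (q * enorm xi)|) * (90 * (1 + enorm xi) ^+ 2) * normc (beta xi) =
  (90 * (1 + enorm xi) ^+ 2) * (normc (beta xi) * `|sin (enorm xi)| + normc (beta xi) * `|sin (q * enorm xi)|) by ring.
apply: ler_pM; [exact: ltW| |nra|exact: lerD].
by rewrite addr_ge0// mulr_ge0.
Qed.

Let ms t : measurable_fun setT (fun v : RT R n => sin (t * enorm (vec v))).
Proof.
apply: (measurableT_comp measurable_sin); apply: measurable_funM => //; exact: measurable_enorm_vec.
Qed.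

Let mbeta : Cmeas (beta \o @vec R n).
Proof.
apply: CmeasM.
  apply: Cmeas_rc; apply: (measurableT_comp (@measurable_invr R)).
  by apply: measurable_funD; apply: measurable_funX; exact: ms.
by apply: CmeasD; apply: CmeasM; [apply: Cmeas_rc; exact: ms|exact: (gb _).2|apply: Cmeas_rc; exact: ms|exact: (gb _).2].
Qed.

Lemma good_sine_part : good sine_part.
Proof.
split; last by apply: CmeasM => //; apply: Cmeas_rc; exact: measurable_enorm_vec.
have rb : rapid (fun xi => (normc (b 1 xi) + normc (b q xi))%:C).
  have rn k : rapid (fun xi => (normc (b k xi))%:C).
    apply: (@rapid_le _ _ _ _ 1 0 (gb k).1) => x.
    by rewrite normc_rc ger0_norm ?normc_ge0// expr0 !mul1r.
  by under eq_fun do rewrite rcD; exact: rapidD.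
apply: (@rapid_le _ _ _ _ 360 2 rb) => x.
by rewrite normc_rc ger0_norm ?addr_ge0 ?normc_ge0// sine_part_le.
Qed.

Lemma good_half_profile sg : good (half_profile sg).
Proof.
have g1 : good (fun xi => (enorm xi)%:C * a 0 xi).
  apply: (@good_mul _ _ _ (fun xi => (enorm xi)%:C) 1 1 (ga 0)).
    by apply: Cmeas_rc; exact: measurable_enorm_vec.
  by move=> x; rewrite normc_rc ger0_norm ?enorm_ge0// mul1r expr1 enorm_le_bracket.
have g2 : good (fun xi => - ('i * sg%:C) * sine_part xi).
  apply: (@good_mul _ _ _ (fun=> - ('i * sg%:C)) `|sg| 0 good_sine_part).
    exact: Cmeas_cst.
  by move=> x; rewrite normcN normcM normc_i mul1r normc_rc expr0 mulr1.
split.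
  have := rapidD g1.1 g2.1; rewrite (_ : (fun x => _) = half_profile sg)//.
  by apply/funext => x; rewrite /half_profile mulNr.
have := CmeasD g1.2 g2.2; rewrite (_ : (fun x : RT R n => _ + _) = half_profile sg \o @vec R n)//.
by apply/funext => x; rewrite /half_profile /= mulNr.
Qed.

(** The cosine and the sine are half-sums of e^(it|xi|) and e^(-it|xi|). *)
Lemma half_profileE t xi : xi != 0 ->
  2 * ((enorm xi)%:C * a t xi) = half_profile 1 xi * cis (t * (1 * enorm xi)) +
     half_profile (-1) xi * cis (t * (-1 * enorm xi)).
Proof.
move=> x0; have e : a t xi = c t xi * a 0 xi + s t xi * beta xi by rewrite -b_beta// /b addrC subrK.
rewrite e /half_profile /sine_part mul1r mulN1r mulrN /cis cosN sinN.
have E1 : cos (t * enorm xi) +i* sin (t * enorm xi) = c t xi + 'i * s t xi.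
  by apply: eqC; rewrite /c /s !(reD,imD,reM,imM) /=; ring.
have E2 : cos (t * enorm xi) +i* - sin (t * enorm xi) = c t xi - 'i * s t xi.
  by apply: eqC; rewrite /c /s !(reD,imD,reN,imN,reM,imM) /=; ring.
have ii : 'i * 'i = -1 :> C by apply: eqC; rewrite !(reM,imM,reN,imN) /=; ring.
have N1 : (-1)%:C = -1 :> C by apply: eqC; rewrite /= ?oppr0.
have P1 : 1%:C = 1 :> C by [].
rewrite E1 E2 N1 P1; set A := a 0 xi; set B := beta xi; set r := (enorm xi)%:C.
set c' := c t xi; set s' := s t xi.
have -> : (r * A - 'i * 1 * (r * B)) * (c' + 'i * s') + (r * A - 'i * -1 * (r * B)) * (c' - 'i * s') =
  2 * (r * (c' * A)) - ('i * 'i) * (2 * (r * (s' * B))) by ring.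
by rewrite ii; ring.
Qed.

Let half_profile_cont sg xi : xi != 0 -> ccont_at (half_profile sg) xi.
Proof.
move=> x0; have ca t : ccont_at (a t) xi.
  by have [c1 c2] := fourier_slice_continuous su t; split; [exact: c1|exact: c2].
have cr : {for xi, continuous (@enorm R n)} by exact: enorm_continuous.
have crt t : {for xi, continuous (fun x : 'rV[R]_n => t * enorm x)}.
  by apply: continuousM; [exact: cst_continuous|exact: cr].
have cc t : {for xi, continuous (fun x : 'rV[R]_n => cos (t * enorm x))}.
  by apply: (@continuous_comp _ _ _ (fun x => t * enorm x) cos) => //; exact: continuous_cos.
have cs t : {for xi, continuous (fun x : 'rV[R]_n => sin (t * enorm x))}.
  by apply: (@continuous_comp _ _ _ (fun x => t * enorm x) sin) => //; exact: continuous_sin.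
have cb t : ccont_at (b t) xi.
  rewrite (_ : b t = fun x => a t x + (-1) * (c t x * a 0 x)); last first.
    by apply/funext => x; rewrite mulN1r.
  apply: ccont_atD => //; apply: ccont_atM; first exact: ccont_at_cst.
  by apply: ccont_atM => //; exact: ccont_at_rc.
have cbeta : ccont_at beta xi.
  apply: ccont_atM.
    apply: ccont_at_rc; apply: continuousV; first by rewrite gt_eqF// den_gt0.
    by rewrite /den; apply: continuousD; apply: (@continuousM _ _ _ _ xi); exact: cs.
  apply: ccont_atD; apply: ccont_atM => //; exact: ccont_at_rc.
rewrite (_ : half_profile sg = fun x => (enorm x)%:C * a 0 x + (- 'i * sg%:C) * ((enorm x)%:C * beta x)); last first.
  by apply/funext => x; rewrite /half_profile !mulNr.
apply: ccont_atD.
  by apply: ccont_atM => //; exact: ccont_at_rc.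
by apply: ccont_atM; [exact: ccont_at_cst|apply: ccont_atM => //; exact: ccont_at_rc].
Qed.

Section power.
Variable e : R.
Let B (xi : 'rV[R]_n) : C := (bracket xi `^ e)%:C.

Let mB : Cmeas (B \o @vec R n).
Proof. by apply: Cmeas_rc; exact: measurable_bracket_powR. Qed.

Lemma good_bracket f : good f -> good (fun xi => B xi * f xi).
Proof.
move=> gf; apply: (@good_mul _ _ _ B 1 (Num.truncn `|e|).+1 gf) => // x.
rewrite normc_rc ger0_norm ?powR_ge0// mul1r; apply: bracketX_powR.
by apply: (le_trans (ler_norm _)); rewrite ltW// truncnS_gt.
Qed.

(** The symbol of the derivative of index i divided by |xi|: the components of a
    null vector with unit spatial part. *)
Definition symb (sg : R) (i : 'I_(1 + n)) (xi : 'rV[R]_n) : R := halfP sg xi 0 i / enorm xi.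

Lemma symb_le1 sg i xi : sg ^+ 2 = 1 -> `|symb sg i xi| <= 1.
Proof.
move=> s2; rewrite normrM normfV (ger0_norm (enorm_ge0 _)).
have [z|nz] := eqVneq (enorm xi) 0; first by rewrite z invr0 mulr0.
by rewrite ler_pdivrMr ?mul1r ?halfP_le// lt_neqAle eq_sym nz enorm_ge0.
Qed.

Lemma measurable_symb sg i : measurable_fun setT (fun v : RT R n => symb sg i (vec v)).
Proof.
apply: measurable_funM; first exact: rvmeas_halfP.
by apply: (measurableT_comp (@measurable_invr R)); exact: measurable_enorm_vec.
Qed.

Definition amp sg i xi : C := B xi * ('i * (symb sg i xi)%:C * half_profile sg xi).

Lemma good_amp sg i : sg ^+ 2 = 1 -> good (amp sg i).
Proof.
move=> s2; apply: good_bracket.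
apply: (@good_mul _ _ _ (fun xi => 'i * (symb sg i xi)%:C) 1 0 (good_half_profile sg)).
  by apply: CmeasM; [exact: Cmeas_cst|apply: Cmeas_rc; exact: measurable_symb].
by move=> xi; rewrite normcM normc_i normc_rc mul1r expr0 mulr1 symb_le1.
Qed.

Let N1 : (-1 : R) ^+ 2 = 1. Proof. by rewrite sqrrN expr1n. Qed.
Let P1 : (1 : R) ^+ 2 = 1. Proof. by rewrite expr1n. Qed.

(** The wave <D>^e u. *)
Definition powwave (p : E) := multiplier (fun xi => bracket xi `^ e)
  (fun x => u (event (time p) x)) (Defs.space p).

Let powwave_event t x : powwave (event t x) =
  (coef n)%:C * Jt (leb R n) (fun v => B (vec v) * a t (vec v)) (@vec R n) x.
Proof. by rewrite /powwave /time event0 /Defs.space /event row_mxKr. Qed.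

Let rvv : @rvmeas R _ (RT R n) n (@vec R n).
Proof. by move=> i; exact: measurable_vec_coord. Qed.

Definition two_waves i (p : E) := halfwave 1 (amp 1 i) p + halfwave (-1) (amp (-1) i) p.

Let integrandE i t x v : amp 1 i (vec v) * cis (t * (1 * enorm (vec v)) + dotp x (vec v)) +
   amp (-1) i (vec v) * cis (t * (-1 * enorm (vec v)) + dotp x (vec v)) =
  (amp 1 i (vec v) * cis (t * (1 * enorm (vec v))) + amp (-1) i (vec v) * cis (t * (-1 * enorm (vec v)))) *
    cis (dotp x (vec v)).
Proof. by rewrite !cisD; ring. Qed.

Definition wave_amp i t xi := amp 1 i xi * cis (t * (1 * enorm xi)) + amp (-1) i xi * cis (t * (-1 * enorm xi)).

Lemma good_wave_amp i t : good (wave_amp i t).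
Proof.
have h sg : sg ^+ 2 = 1 -> good (fun xi => cis (t * (sg * enorm xi)) * amp sg i xi).
  move=> s2; apply: (@good_mul _ _ _ (fun xi => cis (t * (sg * enorm xi))) 1 0 (good_amp i s2)).
    apply: Cmeas_cis; apply: measurable_funM => //; apply: measurable_funM => //; exact: measurable_enorm_vec.
  by move=> xi; rewrite normc_cis mulr1.
have [r1 m1] := h _ P1; have [r2 m2] := h _ N1.
have e1 : wave_amp i t = (fun xi => cis (t * (1 * enorm xi)) * amp 1 i xi + cis (t * (-1 * enorm xi)) * amp (-1) i xi).
  by apply/funext => xi; rewrite /wave_amp ![amp _ _ _ * _]mulrC.
by rewrite e1; split; [exact: rapidD|exact: CmeasD].
Qed.

Lemma two_waves_event i t x : two_waves i (event t x) =
  Jt (leb R n) (wave_amp i t \o @vec R n) (@vec R n) x.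
Proof.
have ii sg (s2 : sg ^+ 2 = 1) := @Jt_integrable R _ _ (leb R n) _ _ _ (event t x) (good_integrable (good_amp i s2)) (rvmeas_halfP sg).
rewrite /two_waves /halfwave /Jt -(CintD (ii 1 P1) (ii (-1) N1)); congr Cint.
apply/funext => v; rewrite /= !dotp_event !halfP0 /halfP /Defs.space !row_mxKr.
exact: integrandE.
Qed.

Let halfC : ((2^-1 : R)%:C) * 2 = 1 :> C.
Proof. by apply: eqC; rewrite ?(reM,imM) /= ?(mulr0, mul0r, addr0, subr0); field. Qed.

Let profile_sum i t xi : xi != 0 -> i != ord0 ->
  wave_amp i t xi = 2 * (B xi * ('i * (halfP 1 xi 0 i)%:C * a t xi)).
Proof.
move=> x0 i0; have r0 : enorm xi != 0 by rewrite enorm_eq0.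
have hs sg : halfP sg xi 0 i = halfP 1 xi 0 i.
  by move: i i0; apply: ord_event_ind => // j _; rewrite !halfP_rshift.
rewrite /wave_amp /amp /symb (hs (-1)); set h := halfP _ _ _ _.
have -> : B xi * ('i * (h / enorm xi)%:C * half_profile 1 xi) * cis (t * (1 * enorm xi)) +
   B xi * ('i * (h / enorm xi)%:C * half_profile (-1) xi) * cis (t * (-1 * enorm xi)) =
   B xi * 'i * (h / enorm xi)%:C * (half_profile 1 xi * cis (t * (1 * enorm xi)) +
     half_profile (-1) xi * cis (t * (-1 * enorm xi))) by ring.
rewrite -half_profileE//; have -> : (h / enorm xi)%:C = h%:C * ((enorm xi)^-1)%:C by rewrite rcM.
have ri : ((enorm xi)^-1)%:C * (enorm xi)%:C = 1 :> C by rewrite -rcM mulVf.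
transitivity (2 * (B xi * ('i * h%:C * (((enorm xi)^-1)%:C * (enorm xi)%:C * a t xi)))); first by ring.
by rewrite ri mul1r.
Qed.

Let amp0 sg i : amp sg i 0 = 0.
Proof.
have e0 : enorm (0 : 'rV[R]_n) = 0 by apply/eqP; rewrite enorm_eq0.
by rewrite /amp /symb e0 invr0 mulr0 mulr0 mul0r mulr0.
Qed.

Lemma wave_amp0 i t : wave_amp i t 0 = 0.
Proof. by rewrite /wave_amp !amp0 !mul0r addr0. Qed.

Lemma partial_of_is_derive k (f : 'rV[R]_k -> C) x i (z : C) :
  is_derive x (delta_mx 0 i) (fun y => re (f y)) (re z) ->
  is_derive x (delta_mx 0 i) (fun y => im (f y)) (im z) -> partial i f x = z.
Proof.
move=> h1 h2; have v1 := @derive_val _ _ _ _ _ _ _ h1; have v2 := @derive_val _ _ _ _ _ _ _ h2.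
by rewrite /partial v1 v2; case: z {h1 h2 v1 v2}.
Qed.

Let space_partial j t x :
  partial (sp j) powwave (event t x) = (coef n / 2)%:C * two_waves (sp j) (event t x).
Proof.
have gA : good (fun xi : 'rV[R]_n => B xi * a t xi) by exact: good_bracket.
have gA' : good (fun xi : 'rV[R]_n => 'i * (xi 0 j)%:C * (B xi * a t xi)).
  apply: (@good_mul _ _ _ (fun xi : 'rV[R]_n => 'i * (xi 0 j)%:C) 1 1 gA).
    by apply: CmeasM; [exact: Cmeas_cst|apply: Cmeas_rc; exact: measurable_vec_coord].
  move=> xi; rewrite normcM normc_i normc_rc !mul1r expr1.
  exact: le_trans (coord_le_enorm _ _) (enorm_le_bracket _).
have [d1 d2] := @Jt_is_derive R _ _ (leb R n) _ ((fun xi : 'rV[R]_n => B xi * a t xi) \o @vec R n) _ j x (good_integrable gA) rvv (good_integrable gA').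
have eJ : Jt (leb R n) ((fun xi : 'rV[R]_n => 'i * (xi 0 j)%:C * (B xi * a t xi)) \o @vec R n) (@vec R n) x =
    (2^-1 : R)%:C * two_waves (sp j) (event t x).
  rewrite two_waves_event /Jt -CintZl.
    congr Cint; apply/funext => v /=.
    rewrite [RHS]mulrA; congr (_ * _).
    have [v0|v0] := eqVneq (vec v) 0; first by rewrite v0 wave_amp0 mulr0 mxE mulr0 mul0r.
    rewrite profile_sum// halfP_rshift mulrA halfC mul1r; ring.
  by apply: Jt_integrable => //; apply: good_integrable; exact: good_wave_amp.
have E2 h : powwave (h *: delta_mx 0 (sp j) + event t x) =
  (coef n)%:C * Jt (leb R n) ((fun xi : 'rV[R]_n => B xi * a t xi) \o @vec R n) (@vec R n) (h *: delta_mx 0 j + x).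
  by rewrite -event_space powwave_event.
have cf : (coef n / 2)%:C * two_waves (sp j) (event t x) = (coef n)%:C * ((2^-1 : R)%:C * two_waves (sp j) (event t x)).
  by rewrite rcM mulrA.
rewrite cf -eJ; apply: partial_of_is_derive; apply: is_derive_line.
  under eq_fun do rewrite E2 reZ.
  rewrite reZ.
  exact: (@is_deriveZ _ _ _ _ (coef n) _ _ _ (is_derive_line_inv d1)).
under eq_fun do rewrite E2 imZ.
rewrite imZ.
exact: (@is_deriveZ _ _ _ _ (coef n) _ _ _ (is_derive_line_inv d2)).
Qed.

Let time_partial t x :
  partial ord0 powwave (event t x) = (coef n / 2)%:C * two_waves ord0 (event t x).
Proof.
pose z1 (v : RT R n) := B (vec v) * a 0 (vec v) * cis (dotp x (vec v)).
pose z2 (v : RT R n) := B (vec v) * beta (vec v) * cis (dotp x (vec v)).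
pose F h (v : RT R n) := c h (vec v) * z1 v + s h (vec v) * z2 v.
pose F' h (v : RT R n) := - s h (vec v) * ((enorm (vec v))%:C * z1 v) + c h (vec v) * ((enorm (vec v))%:C * z2 v).
have mcis : Cmeas (fun v : RT R n => cis (dotp x (vec v))).
  by apply: Cmeas_cis; exact: measurable_dotp_vecr.
have mz1 : Cmeas z1 := CmeasM (CmeasM mB (ga 0).2) mcis.
have mz2 : Cmeas z2 := CmeasM (CmeasM mB mbeta) mcis.
have mcc h : Cmeas (fun v : RT R n => c h (vec v)) by apply: Cmeas_rc; exact: mc.
have mss h : Cmeas (fun v : RT R n => s h (vec v)) by apply: Cmeas_rc; exact: ms.
have mF h : Cmeas (F h) := CmeasD (CmeasM (mcc h) mz1) (CmeasM (mss h) mz2).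
have gBa h : good (fun xi => B xi * a h xi) by exact: good_bracket.
have iBa h := Cintegrable_normc (good_integrable (gBa h)).
have FE h v : vec v != 0 -> F h v = B (vec v) * a h (vec v) * cis (dotp x (vec v)).
  move=> v0; have -> : a h (vec v) = c h (vec v) * a 0 (vec v) + s h (vec v) * beta (vec v).
    by rewrite -b_beta// /b addrC subrK.
  by rewrite /F /z1 /z2; ring.
have iF h : Cintegrable (leb R n) (F h).
  have iG := integrableD measurableT (iBa h) (iBa 0).
  apply: (Cintegrable_le (mF h) (g := fun v => normc (B (vec v) * a h (vec v)) + normc (B (vec v) * a 0 (vec v)))).
    by have := iG; apply: eq_integrable.
  move=> v; have [v0|v0] := eqVneq (vec v) 0.
    have e0 : enorm (0 : 'rV[R]_n) = 0 by apply/eqP; rewrite enorm_eq0.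
    rewrite /F /z1 /c /s v0 e0 mulr0 sin0 cos0 mul1r mul0r addr0 normcM normc_cis mulr1.
    by rewrite lerDr normc_ge0.
  by rewrite FE// normcM normc_cis mulr1 lerDl normc_ge0.
have PF h : powwave (event h x) = (coef n)%:C * Cint (leb R n) (F h).
  rewrite powwave_event; congr (_ * _); apply: Cint_ae_eq; [exact: (CmeasM (gBa h).2 mcis)|exact: mF|].
  by apply: filterS (@lebesgue_point0 R n n0) => v v0; rewrite FE.
have dF h v : is_derive h (1 : R) (fun h => re (F h v)) (re (F' h v)) /\
    is_derive h (1 : R) (fun h => im (F h v)) (im (F' h v)).
  have dl (p k : R) : is_derive h (1 : R) (fun h => cos (h * enorm (vec v)) * p + sin (h * enorm (vec v)) * k)
      (- sin (h * enorm (vec v)) * (enorm (vec v) * p) + cos (h * enorm (vec v)) * (enorm (vec v) * k)).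
    have d1 := @is_deriveZ _ _ _ _ p _ _ _ (is_derive_cosM (enorm (vec v)) h).
    have d2 := @is_deriveZ _ _ _ _ k _ _ _ (is_derive_sinM (enorm (vec v)) h).
    have d3 := is_deriveD d1 d2.
    rewrite (_ : (fun h => _) = (p \*: (fun y => cos (enorm (vec v) * y))) + (k \*: (fun y => sin (enorm (vec v) * y)))).
      by apply: is_derive_eq d3 _; rewrite /GRing.scale /= ![h * _]mulrC; ring.
    by apply/funext => y; rewrite /GRing.scale /= ![y * _]mulrC [cos _ * _]mulrC [sin _ * _]mulrC.
  have er y : re (F y v) = cos (y * enorm (vec v)) * re (z1 v) + sin (y * enorm (vec v)) * re (z2 v).
    by rewrite /F /c /s reD !reZ.
  have ei y : im (F y v) = cos (y * enorm (vec v)) * im (z1 v) + sin (y * enorm (vec v)) * im (z2 v).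
    by rewrite /F /c /s imD !imZ.
  split.
    under eq_fun do rewrite er; apply: is_derive_eq (dl _ _) _.
    by rewrite /F' /c /s reD [in RHS]mulNr [in RHS]reN !reZ; ring.
  under eq_fun do rewrite ei; apply: is_derive_eq (dl _ _) _.
  by rewrite /F' /c /s imD [in RHS]mulNr [in RHS]imN !imZ; ring.
have g1 : good (fun xi => B xi * ((enorm xi)%:C * a 0 xi)).
  apply: good_bracket; apply: (@good_mul _ _ _ (fun xi => (enorm xi)%:C) 1 1 (ga 0)).
    by apply: Cmeas_rc; exact: measurable_enorm_vec.
  by move=> y; rewrite normc_rc ger0_norm ?enorm_ge0// mul1r expr1 enorm_le_bracket.
have g2 : good (fun xi => B xi * sine_part xi) by apply: good_bracket; exact: good_sine_part.
pose dom (v : RT R n) := normc (B (vec v) * ((enorm (vec v))%:C * a 0 (vec v))) + normc (B (vec v) * sine_part (vec v)).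
have idom : (leb R n).-integrable setT (EFin \o dom).
  have := integrableD measurableT (Cintegrable_normc (good_integrable g1)) (Cintegrable_normc (good_integrable g2)).
  by apply: eq_integrable.
have nb (k : R) (w : C) y : `|k| <= 1 -> normc (k%:C * (w * cis y)) <= normc w.
  by move=> k1; rewrite normcM normcM normc_cis mulr1 normc_rc ler_piMl ?normc_ge0.
have bF h v : normc (F' h v) <= dom v.
  have e1 : (enorm (vec v))%:C * z1 v = B (vec v) * ((enorm (vec v))%:C * a 0 (vec v)) * cis (dotp x (vec v)).
    by rewrite /z1; ring.
  have e2 : (enorm (vec v))%:C * z2 v = B (vec v) * sine_part (vec v) * cis (dotp x (vec v)).
    by rewrite /z2 /sine_part; ring.
  rewrite /F' e1 e2; apply: (le_trans (le_normcD _ _)); apply: lerD.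
    by rewrite mulNr normcN; apply: nb; exact: sin_norm_le1.
  by apply: nb; exact: cos_norm_le1.
have dr := @Rintegral_is_derive R _ _ (leb R n) (fun h v => re (F h v)) (fun h v => re (F' h v)) dom t
  (fun h => (iF h).1) (fun h v => (dF h v).1) idom (fun h v _ => le_trans (re_le_normc _) (bF h v)).
have di := @Rintegral_is_derive R _ _ (leb R n) (fun h v => im (F h v)) (fun h v => im (F' h v)) dom t
  (fun h => (iF h).2) (fun h v => (dF h v).2) idom (fun h v _ => le_trans (im_le_normc _) (bF h v)).
have eJ : Cint (leb R n) (F' t) = (2^-1 : R)%:C * two_waves ord0 (event t x).
  rewrite two_waves_event /Jt -CintZl.
    congr Cint; apply/funext => v /=.
    have [v0|v0] := eqVneq (vec v) 0.
      have e0 : enorm (0 : 'rV[R]_n) = 0 by apply/eqP; rewrite enorm_eq0.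
      by rewrite v0 wave_amp0 /F' v0 e0 !mul0r !mulr0 addr0.
    have r0 : enorm (vec v) != 0 by rewrite enorm_eq0.
    rewrite /wave_amp /amp /symb !halfP0 !mulfK// mul1r mulN1r mulrN /cis cosN sinN /half_profile.
    have E1 : cos (t * enorm (vec v)) +i* sin (t * enorm (vec v)) = c t (vec v) + 'i * s t (vec v).
      by apply: eqC; rewrite /c /s !(reD,imD,reM,imM) /=; ring.
    have E2 : cos (t * enorm (vec v)) +i* - sin (t * enorm (vec v)) = c t (vec v) - 'i * s t (vec v).
      by apply: eqC; rewrite /c /s !(reD,imD,reN,imN,reM,imM) /=; ring.
    have ii : 'i * 'i = -1 :> C by apply: eqC; rewrite !(reM,imM,reN,imN) /=; ring.
    have M1 : (-1)%:C = -1 :> C by apply: eqC; rewrite /= ?oppr0.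
    have Q1 : 1%:C = 1 :> C by [].
    rewrite E1 E2 M1 Q1 /F' /z1 /z2 -/(cis _) /sine_part.
    set A := a 0 _; set Be := beta _; set r := (enorm _)%:C; set b' := B _; set c' := c t _; set s' := s t _; set k := cis _.
    transitivity ((2^-1)%:C * 2 * (b' * (- s' * (r * A) + c' * (r * Be)) * k)).
      by rewrite halfC; ring.
    transitivity ((2^-1)%:C * (2 * b' * (- (- ('i * 'i) * s') * (r * A) + (- ('i * 'i)) * c' * (r * Be)) * k)).
      by rewrite ii; ring.
    by ring.
  by apply: Jt_integrable => //; apply: good_integrable; exact: good_wave_amp.
have E2 h : powwave (h *: delta_mx 0 ord0 + event t x) = (coef n)%:C * Cint (leb R n) (F (h *: (1 : R) + t)).
  by rewrite -event_time PF /GRing.scale /= mulr1.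
have cf : (coef n / 2)%:C * two_waves ord0 (event t x) = (coef n)%:C * ((2^-1 : R)%:C * two_waves ord0 (event t x)).
  by rewrite rcM mulrA.
rewrite cf -eJ; apply: partial_of_is_derive; apply: is_derive_line.
  under eq_fun do rewrite E2 reZ.
  rewrite reZ.
  exact: (@is_deriveZ _ _ _ _ (coef n) _ _ _ (is_derive_line_inv dr)).
under eq_fun do rewrite E2 imZ.
rewrite imZ.
exact: (@is_deriveZ _ _ _ _ (coef n) _ _ _ (is_derive_line_inv di)).
Qed.

(** Invert the Fourier transform of each slice, insert [half_profileE], and
    differentiate under the integral sign; the factor 1/|xi| left by
    [half_profileE] is absorbed by the derivative. *)
Theorem partial_powwave i p : partial i powwave p = (coef n / 2)%:C * two_waves i p.
Proof.
rewrite (event_split p); move: i; apply: ord_event_ind => [|j].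
  exact: time_partial.
exact: space_partial.
Qed.

Let wave_amp_cont i t xi : xi != 0 -> ccont_at (wave_amp i t) xi.
Proof.
move=> x0; have r0 : enorm xi != 0 by rewrite enorm_eq0.
have cr : {for xi, continuous (@enorm R n)} by exact: enorm_continuous.
have chalf sg : {for xi, continuous (fun x => halfP sg x 0 i)}.
  move: i; apply: ord_event_ind => [|j].
    rewrite (_ : (fun x => _) = (fun x => sg * enorm x)); last by apply/funext => x; rewrite halfP0.
    by apply: continuousM; [exact: cst_continuous|exact: cr].
  rewrite (_ : (fun x => _) = (fun x : 'rV[R]_n => x 0 j)); first exact: coord_continuous.
  by apply/funext => x; rewrite halfP_rshift.
have csymb sg : {for xi, continuous (symb sg i)}.
  by apply: continuousM; [exact: chalf|apply: continuousV; [exact: r0|exact: cr]].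
have cB : ccont_at B xi.
  apply: ccont_at_rc.
  rewrite (_ : (fun y => _) = (fun y : 'rV[R]_n => expR (e * ln (bracket y)))); last first.
    by apply/funext => y; rewrite /powR gt_eqF// bracket_gt0.
  apply: (@continuous_comp _ _ _ (fun y : 'rV[R]_n => e * ln (bracket y)) expR); last exact: continuous_expR.
  apply: continuousM; first exact: cst_continuous.
  apply: (@continuous_comp _ _ _ (@bracket R n) (@ln R)); first exact: bracket_continuous.
  by apply: continuous_ln; exact: bracket_gt0.
have camp sg : ccont_at (amp sg i) xi.
  apply: (ccont_atM cB); apply: ccont_atM; last exact: half_profile_cont.
  by apply: ccont_atM; [exact: ccont_at_cst|apply: ccont_at_rc; exact: csymb].
have ccis sg : ccont_at (fun x : 'rV[R]_n => cis (t * (sg * enorm x))) xi.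
  apply: ccont_at_cis; apply: continuousM; first exact: cst_continuous.
  by apply: continuousM; [exact: cst_continuous|exact: cr].
exact: (ccont_atD (ccont_atM (camp _) (ccis _)) (ccont_atM (camp _) (ccis _))).
Qed.

Definition pprofile sg xi : C := B xi * half_profile sg xi.

Lemma good_pprofile sg : good (pprofile sg).
Proof. by apply: good_bracket; exact: good_half_profile. Qed.

Lemma ampE sg i xi : amp sg i xi = 'i * (symb sg i xi)%:C * pprofile sg xi.
Proof. by rewrite /amp /pprofile; ring. Qed.

Let wave_amp_sqr t xi : xi != 0 -> \sum_i normc (wave_amp i t xi) ^+ 2 =
  2 * (normc (pprofile 1 xi) ^+ 2 + normc (pprofile (-1) xi) ^+ 2).
Proof.
move=> x0; have r0 : enorm xi != 0 by rewrite enorm_eq0.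
set x := pprofile 1 xi * cis (t * (1 * enorm xi)).
set y := pprofile (-1) xi * cis (t * (-1 * enorm xi)).
have nx : normc (pprofile 1 xi) = normc x by rewrite /x (normcM (pprofile 1 xi)) normc_cis mulr1.
have ny : normc (pprofile (-1) xi) = normc y by rewrite /y (normcM (pprofile (-1) xi)) normc_cis mulr1.
have wE i : wave_amp i t xi = 'i * ((symb 1 i xi)%:C * x + (symb (-1) i xi)%:C * y).
  by rewrite /wave_amp !ampE /x /y; ring.
have s0 sg : symb sg ord0 xi = sg by rewrite /symb halfP0 mulfK.
have sj sg j : symb sg (sp j) xi = xi 0 j / enorm xi by rewrite /symb halfP_rshift.
rewrite nx ny big_ord_recl wE !s0.
rewrite (eq_bigr (fun j => (xi 0 j / enorm xi) ^+ 2 * normc (x + y) ^+ 2)); last first.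
  move=> j _; rewrite lift0_rshift wE !sj -mulrDr (normcM 'i) normc_i mul1r (normcM (_)%:C (x + y)) normc_rc exprMn.
  by rewrite real_normK ?num_real.
rewrite -mulr_suml (_ : \sum_i (xi 0 i / enorm xi) ^+ 2 = 1); last first.
  rewrite (eq_bigr (fun i => xi 0 i * xi 0 i * (enorm xi ^+ 2)^-1)); last by move=> i _; rewrite expr_div_n expr2.
  by rewrite -mulr_suml -/(dotp xi xi) -enorm_sqr mulfV// expf_neq0.
rewrite (normcM 'i) normc_i !mul1r !normc_sqr !(reD,imD,reZ,imZ); ring.
Qed.

(** Up to factors of modulus one, the transform of the time derivative is the
    difference of the two profiles and the transform of the gradient is xi/|xi|
    times their sum. The parallelogram law and [plancherel_lower] conclude. *)
Lemma profile_energy t :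
  (\int[leb R n]_v (normc (pprofile 1 (vec v)) ^+ 2 + normc (pprofile (-1) (vec v)) ^+ 2)%:E <=
   (2 * (2 * pi) ^+ n)%:E * \int[leb R n]_v
     (\sum_(j < n) normc (dx j powwave (event t (vec v))) ^+ 2 +
      normc (dt powwave (event t (vec v))) ^+ 2)%:E)%E.
Proof.
set T : R := (2 * pi) ^+ n.
have T0 : 0 < T by rewrite exprn_gt0// mulr_gt0// pi_gt0.
have Tc : coef n * T = 1 by exact: coefK.
pose tw i (v : RT R n) := normc (two_waves i (event t (vec v))) ^+ 2.
pose wa i (v : RT R n) := normc (wave_amp i t (vec v)) ^+ 2.
have mtw i : measurable_fun setT (tw i).
  apply: measurable_funX; apply: Cmeas_normc.
  have [c1 c2] := Jt_continuous (good_integrable (good_wave_amp i t)) rvv.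
  have E3 : (fun v : RT R n => two_waves i (event t (vec v))) =
     Jt (leb R n) (wave_amp i t \o @vec R n) (@vec R n) \o @vec R n.
    by apply/funext => v; exact: two_waves_event.
  by rewrite E3; split; [exact: (continuous_vec_measurable c1)|exact: (continuous_vec_measurable c2)].
have mwa i : measurable_fun setT (wa i).
  by apply: measurable_funX; apply: Cmeas_normc; exact: (good_wave_amp i t).2.
have wa0 i v : 0 <= wa i v by exact: sqr_ge0.
have tw0 i v : 0 <= tw i v by exact: sqr_ge0.
have pl i : (\int[leb R n]_v (T * wa i v)%:E <= \int[leb R n]_v (tw i v)%:E)%E.
  have gw := good_wave_amp i t; have [M M0 wM] := rapid_bounded gw.1.
  have ac : {ae leb R n, forall v : RT R n, ccont_at (wave_amp i t) (vec v)}.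
    by apply: filterS (@lebesgue_point0 R n n0) => v v0; exact: wave_amp_cont.
  have := plancherel_lower (good_integrable gw) wM ac.
  have -> : (\int[leb R n]_z (normc (Jt (leb R n) (wave_amp i t \o @vec R n) (@vec R n) (vec z)) ^+ 2)%:E =
      \int[leb R n]_v (tw i v)%:E)%E.
    by apply: eq_integral => v _; rewrite /tw two_waves_event.
  apply: le_trans; rewrite -/T.
  have n2i : (leb R n).-integrable setT (fun v => (wa i v)%:E).
    have h := integrableZl measurableT M (Cintegrable_normc (good_integrable gw)).
    apply: (le_integrable measurableT _ _ h); first exact/measurable_EFinP.
    move=> v _; rewrite lee_fin ger0_norm ?wa0// ger0_norm ?mulr_ge0 ?normc_ge0//.
    by rewrite /wa expr2 ler_wpM2r ?normc_ge0.
  rewrite -(RintegralZl _ measurableT n2i) /Rintegral fineK//.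
  apply: integrable_fin_num => //; have := integrableZl measurableT T n2i.
  by apply: eq_integrable.
have sumE (f : 'I_(1 + n) -> RT R n -> R) : (forall i, measurable_fun setT (f i)) -> (forall i v, 0 <= f i v) ->
    (\sum_i \int[leb R n]_v (f i v)%:E = \int[leb R n]_v (\sum_i f i v)%:E)%E.
  move=> mf f0; rewrite -ge0_integral_sum//.
  - by apply: eq_integral => v _; rewrite sumEFin.
  - by move=> i; exact/measurable_EFinP.
  - by move=> i v _; rewrite lee_fin.
pose P (v : RT R n) := normc (pprofile 1 (vec v)) ^+ 2 + normc (pprofile (-1) (vec v)) ^+ 2.
pose S (v : RT R n) := \sum_(j < n) normc (dx j powwave (event t (vec v))) ^+ 2 +
      normc (dt powwave (event t (vec v))) ^+ 2.
have twE i v : tw i v = (2 * T) ^+ 2 * normc (partial i powwave (event t (vec v))) ^+ 2.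
  have -> : normc (partial i powwave (event t (vec v))) ^+ 2 = (coef n / 2) ^+ 2 * tw i v.
    by rewrite partial_powwave (normcM (coef n / 2)%:C) normc_rc exprMn real_normK ?num_real.
  rewrite mulrA.
  have -> : (2 * T) ^+ 2 * (coef n / 2) ^+ 2 = (coef n * T) ^+ 2 by field.
  by rewrite Tc expr1n mul1r.
have SE v : \sum_i tw i v = (2 * T) ^+ 2 * S v.
  rewrite big_ord_recl addrC mulrDr twE mulr_sumr; congr (_ + _).
  by apply: eq_bigr => j _; rewrite twE lift0_rshift.
have T20 : 0 < (2 * T) ^+ 2 by rewrite exprn_gt0// mulr_gt0.
have mS : measurable_fun setT S.
  have -> : S = (fun v => ((2 * T) ^+ 2)^-1 * \sum_i tw i v).
    by apply/funext => v; rewrite SE mulrA mulVf ?mul1r// gt_eqF.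
  by apply: measurable_funM => //; apply: measurable_sum => i.
have S0 v : 0 <= S v by rewrite addr_ge0 ?sqr_ge0//; apply: sumr_ge0 => j _; exact: sqr_ge0.
have mP : measurable_fun setT P.
  by apply: measurable_funD; apply: measurable_funX; apply: Cmeas_normc; exact: (good_pprofile _).2.
have P0 v : 0 <= P v by rewrite addr_ge0 ?sqr_ge0.
have key : (\int[leb R n]_v (2 * T * P v)%:E <= \int[leb R n]_v ((2 * T) ^+ 2 * S v)%:E)%E.
  have -> : (\int[leb R n]_v (2 * T * P v)%:E = \int[leb R n]_v (\sum_i T * wa i v)%:E)%E.
    apply: ae_eq_integral => //.
    - by apply/measurable_EFinP; exact: measurable_funM.
    - by apply/measurable_EFinP; apply: measurable_sum => i; exact: measurable_funM.
    apply: filterS (@lebesgue_point0 R n n0) => v v0 _.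
    by rewrite -mulr_sumr wave_amp_sqr// /P; congr (_%:E); ring.
  have -> : (\int[leb R n]_v ((2 * T) ^+ 2 * S v)%:E = \int[leb R n]_v (\sum_i tw i v)%:E)%E.
    by apply: eq_integral => v _; rewrite SE.
  rewrite -(sumE (fun i v => T * wa i v)); last 2 first.
  - by move=> i; exact: measurable_funM.
  - by move=> i v; rewrite mulr_ge0 ?(ltW T0).
  by rewrite -sumE//; apply: lee_sum => i _; exact: pl.
have T2 : 0 < 2 * T by rewrite mulr_gt0.
have mPE : measurable_fun setT (fun v => (P v)%:E) by exact/measurable_EFinP.
have mSE : measurable_fun setT (fun v => (S v)%:E) by exact/measurable_EFinP.
have PE0 v : setT v -> (0 <= (P v)%:E)%E by rewrite lee_fin.
have SE0 v : setT v -> (0 <= (S v)%:E)%E by rewrite lee_fin.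
move: key; under eq_integral do rewrite EFinM.
under [X in (_ <= X)%E]eq_integral do rewrite EFinM.
rewrite (ge0_integralZl_EFin (leb R n) measurableT PE0 mPE (ltW T2)).
rewrite (ge0_integralZl_EFin (leb R n) measurableT SE0 mSE (ltW T20)).
have -> : ((2 * T) ^+ 2)%:E = ((2 * T)%:E * (2 * T)%:E)%E by rewrite expr2 EFinM.
rewrite -muleA => h; rewrite -(@lee_pmul2l _ (2 * T)%:E)//.
Qed.

End power.

End Spectral.

(** * Null symbols and the bilinear estimate *)

Section NullSymbol.
Context {R : realType}.
Variable n : nat.
Local Notation sp j := (rshift 1 j : 'I_(1 + n)).

Definition null_contraction (V : zmodType) (Q : null_form n)
    (M : 'I_(1 + n) -> 'I_(1 + n) -> V) : V :=
  match Q with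
  | Q0 => M ord0 ord0 - \sum_(j < n) M (sp j) (sp j)
  | Qab a b => M a b - M b a
  end.

(** For Q_0 the contraction is s s' (1 - s s' x.y). For Q_(0j) it is, up to
    sign, a component of y - s s' x, of square norm 2 (1 - s s' x.y). For Q_(ij)
    its square is at most 1 - (x.y)^2, the squared area of the parallelogram on
    x and y. *)
Lemma unit_null_bound (x y : 'I_n -> R) (s s' : R) (Q : null_form n)
    (X := fun a : 'I_(1 + n) => oapp x s (unlift ord0 a))
    (Y := fun a : 'I_(1 + n) => oapp y s' (unlift ord0 a)) :
  s ^+ 2 = 1 -> s' ^+ 2 = 1 -> \sum_j x j ^+ 2 = 1 -> \sum_j y j ^+ 2 = 1 ->
  `|\sum_j x j * y j| <= 1 ->
  null_contraction Q (fun a b => X a * Y b) ^+ 2 <= 2 * (1 - s * s' * \sum_j x j * y j).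
Proof.
move=> s2 s2' x2 y2; set D := \sum_j _ => D1.
have X0 : X ord0 = s by rewrite /X unlift_none.
have Y0 : Y ord0 = s' by rewrite /Y unlift_none.
have spE j : sp j = lift ord0 j by exact/val_inj.
have Xj j : X (sp j) = x j by rewrite /X spE liftK.
have Yj j : Y (sp j) = y j by rewrite /Y spE liftK.
have ss : (s * s') ^+ 2 = 1 by rewrite exprMn s2 s2' mulr1.
have hd : `|s * s' * D| <= 1.
  by rewrite -(@ler_pXn2r _ 2) ?nnegrE// real_normK ?num_real// exprMn ss mul1r expr1n
    -(real_normK (num_real D)) expr_le1.
move: hd; rewrite ler_norml => /andP[d1 d2].
have dd : D ^+ 2 = (s * s' * D) ^+ 2 by rewrite exprMn ss mul1r.
set d := s * s' * D in d1 d2 dd *.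
have one_j (f : 'I_n -> R) j : (forall i, 0 <= f i) -> f j <= \sum_i f i.
  by move=> f0; rewrite (bigD1 j)//= lerDl sumr_ge0.
have mixed j : (s * y j - x j * s') ^+ 2 <= 2 * (1 - d).
  have := @one_j (fun j => (s * y j - x j * s') ^+ 2) j (fun i => sqr_ge0 _).
  rewrite (eq_bigr (fun j => y j ^+ 2 + x j ^+ 2 - 2 * (s * s') * (x j * y j))); last first.
    move=> i _; transitivity (s ^+ 2 * y i ^+ 2 + x i ^+ 2 * s' ^+ 2 - 2 * (s * s') * (x i * y i)); first by ring.
    by rewrite s2 s2'; ring.
  by rewrite sumrB big_split /= -mulr_sumr x2 y2 -/D -mulrA -/d => h; lra.
case: Q => [|a b] /=.
  rewrite X0 Y0 (eq_bigr (fun j => x j * y j)); last by move=> j _; rewrite Xj Yj.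
  rewrite -/D; have -> : (s * s' - D) ^+ 2 = (s * s') ^+ 2 - 2 * d + D ^+ 2 by rewrite /d; ring.
  by rewrite ss dd; nra.
have p0 : 0 <= 2 * (1 - d) by lra.
move: a b; apply: ord_event_ind => [|i]; apply: ord_event_ind => [|j].
- by rewrite subrr expr0n.
- by rewrite X0 Y0 Xj Yj.
- by rewrite X0 Y0 Xj Yj -sqrrN opprB.
rewrite !Xj !Yj; have [->|ij] := eqVneq i j; first by rewrite subrr expr0n.
pose v k := y k - D * x k.
have vE : \sum_k v k ^+ 2 = 1 - D ^+ 2.
  rewrite (eq_bigr (fun k => y k ^+ 2 - 2 * D * (x k * y k) + D ^+ 2 * x k ^+ 2)).
    by rewrite big_split sumrB /= -!mulr_sumr x2 y2 -/D; ring.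
  by move=> k _; rewrite /v; ring.
have two (f : 'I_n -> R) : (forall i, 0 <= f i) -> f i + f j <= \sum_k f k.
  move=> f0; rewrite (bigD1 i)//= (bigD1 j)//= 1?eq_sym// addrA lerDl.
  exact: sumr_ge0.
have hv := two (fun k => v k ^+ 2) (fun i => sqr_ge0 _); rewrite vE in hv.
have hx := two (fun k => x k ^+ 2) (fun i => sqr_ge0 _); rewrite x2 in hx.
have -> : x i * y j - x j * y i = x i * v j - x j * v i by rewrite /v; ring.
have cs : (x i * v j - x j * v i) ^+ 2 <= (x i ^+ 2 + x j ^+ 2) * (v i ^+ 2 + v j ^+ 2).
  by have := sqr_ge0 (x i * v i + x j * v j); nra.
apply: (le_trans cs); apply: (@le_trans _ _ (1 * (1 - D ^+ 2))).
  by apply: ler_pM => //; rewrite addr_ge0// sqr_ge0.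
by rewrite mul1r dd; nra.
Qed.

Lemma null_symbol_bound (Q : null_form n) (s s' : R) (xi eta : 'rV[R]_n) :
  s ^+ 2 = 1 -> s' ^+ 2 = 1 ->
  null_contraction Q (fun a b => symb s a xi * symb s' b eta) ^+ 2 <=
  2 * angle (s * s') 0 xi eta.
Proof.
move=> s2 s2'.
have ss1 : `|s * s'| = 1.
  by apply/eqP; rewrite -(@eqrXn2 _ 2)// expr1n real_normK ?num_real// exprMn s2 s2' mulr1.
have /andP[a0 _] := angle_bound 0 xi eta ss1.
have A0 : 0 <= 2 * angle (s * s') 0 xi eta by rewrite mulr_ge0.
have zero (f : 'I_(1 + n) -> 'I_(1 + n) -> R) : (forall a b, f a b = 0) -> null_contraction Q f ^+ 2 <= 2 * angle (s * s') 0 xi eta.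
  move=> f0; suff -> : null_contraction Q f = 0 by rewrite expr0n.
  by case: Q => [|a b] /=; rewrite !f0 ?subr0// big1// subr0.
have e0 : enorm (0 : 'rV[R]_n) = 0 by apply/eqP; rewrite enorm_eq0.
have [x0|x0] := eqVneq xi 0.
  by apply: zero => a b; rewrite /symb x0 e0 invr0 mulr0 mul0r.
have [y0|y0] := eqVneq eta 0.
  by apply: zero => a b; rewrite /symb y0 e0 invr0 !mulr0.
have rx : enorm xi != 0 by rewrite enorm_eq0.
have ry : enorm eta != 0 by rewrite enorm_eq0.
have sE (t : R) (x : 'rV[R]_n) a : enorm x != 0 ->
    symb t a x = oapp (fun j => x 0 j / enorm x) t (unlift ord0 a).
  move=> r0; move: a; apply: ord_event_ind => [|j]; first by rewrite unlift_none /symb halfP0 mulfK.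
  have -> : sp j = lift ord0 j by exact/val_inj.
  by rewrite liftK /symb (_ : lift ord0 j = sp j) ?halfP_rshift//; exact/val_inj.
have nE (x : 'rV[R]_n) : enorm x != 0 -> \sum_j (x 0 j / enorm x) ^+ 2 = 1.
  move=> r0; rewrite (eq_bigr (fun i => x 0 i * x 0 i * (enorm x ^+ 2)^-1)); last by move=> i _; rewrite expr_div_n expr2.
  by rewrite -mulr_suml -/(dotp x x) -enorm_sqr mulfV// expf_neq0.
have dE : \sum_j (xi 0 j / enorm xi) * (eta 0 j / enorm eta) = (enorm xi * enorm eta)^-1 * dotp xi eta.
  rewrite /dotp mulr_sumr; apply: eq_bigr => j _; rewrite invfM; ring.
have d1 : `|\sum_j (xi 0 j / enorm xi) * (eta 0 j / enorm eta)| <= 1.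
  rewrite dE normrM normfV [`|enorm xi * _|]ger0_norm ?mulr_ge0 ?enorm_ge0//.
  rewrite mulrC ler_pdivrMr; first by rewrite mul1r dotp_CS.
  by rewrite mulr_gt0// enorm_gt0.
have := @unit_null_bound (fun j => xi 0 j / enorm xi) (fun j => eta 0 j / enorm eta) s s' Q s2 s2' (nE _ rx) (nE _ ry) d1.
rewrite dE mulrA /angle enormd0.
apply: le_trans; rewrite le_eqVlt; apply/orP; left; apply/eqP; congr (_ ^+ 2).
congr null_contraction; apply/funext => a; apply/funext => b; rewrite !sE//.
Qed.
End NullSymbol.

Section Bilinear.
Context {R : realType}.
Local Notation C := R[i].
Local Notation normcM := ComplexField.Normc.normcM.
Variables (n : nat) (e : R).
Hypotheses (n0 : (0 < n)%N) (e0 : 0 < e).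
Local Notation T := (RT R n * RT R n)%type.
Local Notation mu := (prodm (leb R n) (leb R n)).

(** Width 1 in time, to see the slab; width tending to 0 in space, to let the
    weight disappear. *)
Definition anisotropic k (i : 'I_(1 + n)) : R := if i == ord0 then 1 else dseq k.

Lemma anisotropic_gt0 k i : 0 < anisotropic k i.
Proof. by rewrite /anisotropic; case: ifP => // _; exact: dseq_gt0. Qed.

Lemma poisK_anisotropic k t (x : 'rV[R]_n) :
  poisK (anisotropic k) (event t x) = 2 / (1 + t ^+ 2) * K (dseq k) x.
Proof.
rewrite /poisK big_ord_recl event0 /anisotropic eqxx mulr1 expr1n; congr (_ * _).
by apply: eq_bigr => j _; rewrite event_lift.
Qed.

Variables (s s' : R).
Hypotheses (s2 : s ^+ 2 = 1) (s2' : s' ^+ 2 = 1).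

Let s1 : `|s| = 1.
Proof. by apply/eqP; rewrite -(@eqrXn2 _ 2)// expr1n real_normK ?num_real// s2. Qed.
Let s1' : `|s'| = 1.
Proof. by apply/eqP; rewrite -(@eqrXn2 _ 2)// expr1n real_normK ?num_real// s2'. Qed.

(** The space-time frequency of a product of two half-waves. *)
Definition pairP (y : T) : 'rV[R]_(1 + n) := halfP s (vec y.1) + halfP s' (vec y.2).

Let bexp : R := (n%:R - 1) / 2 + e.

(** The factor c of [schur_test]: the size of the null symbol times the negative
    power of <xi> that the energy of <D>^((n-1)/2 + e) phi pays for. *)
Definition pair_weight (y : T) : R :=
  Num.sqrt (2 * angle (s * s') 0 (vec y.1) (vec y.2)) * bracket (vec y.1) `^ (- bexp).

Lemma rvmeas_pairP : rvmeas pairP.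
Proof.
move=> i; under eq_fun do rewrite /pairP mxE.
apply: measurable_funD.
  by apply: (measurableT_comp (@rvmeas_halfP R n s i)); exact: measurable_fst.
by apply: (measurableT_comp (@rvmeas_halfP R n s' i)); exact: measurable_snd.
Qed.

Let rv1 : rvmeas (fun y : T => vec y.1).
Proof. by move=> i; apply: (measurableT_comp (@measurable_vec_coord R n i)); exact: measurable_fst. Qed.
Let rv2 : rvmeas (fun y : T => vec y.2).
Proof. by move=> i; apply: (measurableT_comp (@measurable_vec_coord R n i)); exact: measurable_snd. Qed.

Let angle_ge0 (x y : 'rV[R]_n) : 0 <= angle (s * s') 0 x y.
Proof.
have ss1 : `|s * s'| = 1 by rewrite normrM s1 s1' mulr1.
by have /andP[] := @angle_bound R n _ 0 x y ss1.
Qed.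

Lemma measurable_pair_weight : measurable_fun setT pair_weight.
Proof.
have me1 : measurable_fun setT (fun y : T => enorm (vec y.1)).
  by apply: (measurableT_comp (@measurable_enorm_vec R n)); exact: measurable_fst.
have me2 : measurable_fun setT (fun y : T => enormd 0 (vec y.2)).
  under eq_fun do rewrite enormd0.
  by apply: (measurableT_comp (@measurable_enorm_vec R n)); exact: measurable_snd.
apply: measurable_funM; last first.
  by apply: (measurableT_comp (@measurable_bracket_powR R n (- bexp))); exact: measurable_fst.
apply: (measurableT_comp (continuous_measurable_fun (@sqrt_continuous R))).
apply: measurable_funM; first exact: measurable_cst.
apply: measurable_funB; first exact: measurable_cst.
apply: measurable_funM; last exact: measurable_dotp.
apply: measurable_funM; first exact: measurable_cst.
apply: (measurableT_comp (@measurable_invr R)).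
exact: measurable_funM.
Qed.

Lemma pair_weight_sqr y : pair_weight y ^+ 2 =
  2 * (angle (s * s') 0 (vec y.1) (vec y.2) * bracket (vec y.1) `^ (- (n%:R - 1 + 2 * e))).
Proof.
rewrite /pair_weight exprMn sqr_sqrtr ?mulr_ge0// -mulrA; congr (_ * (_ * _)).
by rewrite -powR_mulrn ?powR_ge0// -powRrM; congr (_ `^ _); rewrite /bexp; field.
Qed.

Definition bilinM : R := 2 * (2 * pi) ^+ n * rowM n e.

(** Substituting eta = z - xi, the kernel splits into the factor 2/(1 + ph^2) of
    [rowf] and a Poisson kernel in z of integral (2 pi)^n, and [row_bound] is
    uniform in z. *)
Lemma pair_row_bound k y0 :
  (\int[mu]_y (pair_weight y ^+ 2 * poisK (anisotropic k) (pairP y - pairP y0))%:E <= bilinM%:E)%E.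
Proof.
set tau := time (pairP y0); set zeta := Defs.space (pairP y0).
pose I0 (y : T) : R := pair_weight y ^+ 2 * poisK (anisotropic k) (pairP y - pairP y0).
have mint : measurable_fun setT I0.
  apply: measurable_funM; first by apply: measurable_funX; exact: measurable_pair_weight.
  apply: (measurable_comp_rv _ (measurable_poisK (anisotropic_gt0 k))) => i.
  under eq_fun do rewrite mxE [X in _ + X]mxE.
  by apply: measurable_funB; [exact: rvmeas_pairP|exact: measurable_cst].
have mintE := mint; move/measurable_EFinP: mintE => mintE.
have int0 (y : T) : (0 <= (EFin \o I0) y)%E.
  by rewrite /= lee_fin /I0 mulr_ge0 ?sqr_ge0// poisK_ge0//; exact: anisotropic_gt0.
rewrite [leLHS](@fubini_tonelli1 _ _ _ _ _ (leb R n) (leb R n) _ mintE int0) /fubini_F /=.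
have d0 := @dseq_gt0 R k.
pose F (p : T) : R := 2 * rowf e s s' tau (vec p.2) 0 (vec p.1) * K (dseq k) (vec p.2 - zeta).
(* the inner integral after the substitution eta = z - xi *)
have inner (x : RT R n) : (\int[leb R n]_y (pair_weight (x, y) ^+ 2 * poisK (anisotropic k) (pairP (x, y) - pairP y0))%:E =
    \int[leb R n]_z (F (x, z))%:E)%E.
  pose g (eta : 'rV[R]_n) : \bar R := (2 * (angle (s * s') 0 (vec x) eta * bracket (vec x) `^ (- (n%:R - 1 + 2 * e))) *
     poisK (anisotropic k) (halfP s (vec x) + halfP s' eta - pairP y0))%:E.
  have gE (y : RT R n) : (pair_weight (x, y) ^+ 2 * poisK (anisotropic k) (pairP (x, y) - pairP y0))%:E = g (vec y).
    by rewrite pair_weight_sqr.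
  under eq_integral do rewrite gE.
  have mg : measurable_fun setT (g \o @vec R n).
    have h : measurable_fun setT ((EFin \o I0) \o pair x).
      by apply: measurableT_comp => //; exact: pair1_measurable.
    by move: h; apply: eq_measurable_fun => y _; rewrite /= -gE.
  have g0 eta : (0 <= g eta)%E.
    rewrite lee_fin mulr_ge0//; last by apply: poisK_ge0; exact: anisotropic_gt0.
    by rewrite mulr_ge0// mulr_ge0 ?powR_ge0.
  have := ge0_integral_affine (- vec x) (oner_neq0 R) mg g0.
  rewrite normr1 expr1n invr1 mul1e => <-.
  apply: eq_integral => z _; rewrite /g /F scale1r /rowf; congr (_%:E).
  have -> : halfP s (vec x) + halfP s' (vec z - vec x) - pairP y0 =
      event (s * enorm (vec x) + s' * enorm (vec z - vec x) - tau) (vec z - zeta).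
    apply/rowP; apply: ord_event_ind => [|j]; rewrite ?event0 ?event_rshift mxE [X in X + _]mxE [X in _ + X = _]mxE.
      by rewrite !halfP0.
    rewrite !halfP_rshift /zeta /Defs.space !mxE; ring.
  by rewrite poisK_anisotropic !enormd0; ring.
under eq_integral do rewrite inner.
have mF : measurable_fun setT (EFin \o F).
  apply/measurable_EFinP.
  have me1 : measurable_fun setT (fun p : T => enorm (vec p.1)).
    by apply: (measurableT_comp (@measurable_enorm_vec R n)); exact: measurable_fst.
  have rd : rvmeas (fun p : T => vec p.2 - vec p.1).
    by move=> i; under eq_fun do rewrite mxE [X in _ + X]mxE; apply: measurable_funB; [exact: rv2|exact: rv1].
  have med : measurable_fun setT (fun p : T => enormd 0 (vec p.2 - vec p.1)).
    apply: (measurableT_comp (continuous_measurable_fun (@sqrt_continuous R))).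
    by apply: measurable_funD; [exact: measurable_cst|exact: measurable_dotp].
  apply: measurable_funM; first (apply: measurable_funM; first exact: measurable_cst).
    apply: measurable_funM; first apply: measurable_funM.
    - apply: measurable_funB; first exact: measurable_cst.
      apply: measurable_funM; last exact: measurable_dotp.
      apply: measurable_funM; first exact: measurable_cst.
      apply: (measurableT_comp (@measurable_invr R)).
      exact: measurable_funM.
    - by apply: (measurableT_comp (@measurable_bracket_powR R n _)); exact: measurable_fst.
    - apply: measurable_funM; first exact: measurable_cst.
      apply: (measurableT_comp (@measurable_invr R)).
      apply: measurable_funD; first exact: measurable_cst.
      apply: measurable_funX; apply: measurable_funB; last exact: measurable_cst.
      by apply: measurable_funD; apply: measurable_funM => //; exact: measurable_cst.
  apply: (measurable_comp_rv _ (measurable_poisK (fun=> d0))) => i.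
  under eq_fun do rewrite mxE [X in _ + X]mxE.
  by apply: measurable_funB; [exact: rv2|exact: measurable_cst].
have F0 p : (0 <= (EFin \o F) p)%E.
  rewrite lee_fin; apply: mulr_ge0; last exact: K_ge0.
  by rewrite mulr_ge0//; apply: rowf_ge0.
have -> : (\int[leb R n]_x \int[leb R n]_z (F (x, z))%:E = \int[leb R n]_z \int[leb R n]_x (F (x, z))%:E)%E.
  exact: (@fubini_tonelli _ _ _ _ _ (leb R n) (leb R n) _ mF F0).
have rM0 := rowM_ge0 n e.
have mK : measurable_fun setT (fun z : RT R n => (K (dseq k) (vec z - zeta))%:E).
  apply/measurable_EFinP; apply: (measurable_comp_rv _ (measurable_poisK (fun=> d0))) => i.
  under eq_fun do rewrite mxE [X in _ + X]mxE.
  by apply: measurable_funB; [exact: measurable_vec_coord|exact: measurable_cst].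
have K0 (z : RT R n) : setT z -> (0 <= (K (dseq k) (vec z - zeta))%:E)%E by rewrite lee_fin K_ge0.
have col (z : RT R n) : (\int[leb R n]_x (F (x, z))%:E <= (2 * rowM n e)%:E * (K (dseq k) (vec z - zeta))%:E)%E.
  have Kz : 0 <= 2 * K (dseq k) (vec z - zeta) by rewrite mulr_ge0// K_ge0.
  have mr : measurable_fun setT (fun x : RT R n => (rowf e s s' tau (vec z) 0 (vec x))%:E).
    by apply/measurable_EFinP; exact: measurable_rowf.
  have r0 (x : RT R n) : setT x -> (0 <= (rowf e s s' tau (vec z) 0 (vec x))%:E)%E.
    by rewrite lee_fin rowf_ge0.
  have -> : (\int[leb R n]_x (F (x, z))%:E = (2 * K (dseq k) (vec z - zeta))%:E * \int[leb R n]_x (rowf e s s' tau (vec z) 0 (vec x))%:E)%E.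
    rewrite -(ge0_integralZl_EFin (leb R n) measurableT r0 mr Kz).
    by apply: eq_integral => x _; rewrite /F -EFinM; congr (_%:E); rewrite /=; ring.
  have h := @row_bound R n e n0 e0 s s' tau (vec z) s1 s1'.
  apply: (@le_trans _ _ ((2 * K (dseq k) (vec z - zeta))%:E * (rowM n e)%:E)%E).
    by apply: lee_wpmul2l; [rewrite lee_fin|exact: h].
  by rewrite -!EFinM lee_fin; lra.
apply: (@le_trans _ _ (\int[leb R n]_z ((2 * rowM n e)%:E * (K (dseq k) (vec z - zeta))%:E))%E).
  apply: ge0_le_integral => //.
  - by move=> z _; apply: integral_ge0 => x _; exact: (F0 (x, z)).
  - by apply: (measurable_fun_fubini_tonelli_G (EFin \o F)).
  - by apply: emeasurable_funM => //; exact: measurable_cst.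
have M20 : 0 <= 2 * rowM n e by rewrite mulr_ge0.
rewrite (ge0_integralZl_EFin (leb R n) measurableT K0 mK M20).
have [k1 k2] := Rintegral_K zeta d0.
have -> : (\int[leb R n]_z (K (dseq k) (vec z - zeta))%:E = ((2 * pi) ^+ n)%:E)%E.
  by rewrite -k2 /Rintegral fineK//; exact: integrable_fin_num.
by rewrite -EFinM lee_fin /bilinM; lra.
Qed.

(** [schur_test] with the weight e^(-|t|) times a spatial weight that tends to
    1, then Fatou's lemma. *)
Lemma pair_bilinear_bound (f g : 'rV[R]_n -> C) (q : T -> R) : good f -> good g ->
  measurable_fun setT q -> (forall y, q y ^+ 2 <= 2 * angle (s * s') 0 (vec y.1) (vec y.2)) ->
  let A := fun y : T => (q y)%:C * (f (vec y.1) * g (vec y.2)) in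
  Cintegrable mu A /\
  (\int[leb R (1 + n)]_z (normc (Jt mu A pairP (vec z)) ^+ 2 * expR (- `|vec z 0 ord0|))%:E <=
   bilinM%:E * (\int[leb R n]_v ((bracket (vec v) `^ bexp * normc (f (vec v))) ^+ 2)%:E *
     \int[leb R n]_v (normc (g (vec v)) ^+ 2)%:E))%E.
Proof.
move=> gf gg mq qb A.
have fg := Cintegrable_prodM (good_integrable gf) (good_integrable gg).
have q2 y : `|q y| <= 2.
  have ss1 : `|s * s'| = 1 by rewrite normrM s1 s1' mulr1.
  have /andP[_ a2] := @angle_bound R n _ 0 (vec y.1) (vec y.2) ss1.
  rewrite -(@ler_pXn2r _ 2) ?nnegrE// real_normK ?num_real//.
  by apply: (le_trans (qb y)); rewrite expr2; lra.
have Ai : Cintegrable mu A.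
  apply: (@Cintegrable_mulbd _ _ _ _ _ (fun y => (q y)%:C) 2 fg); first exact: Cmeas_rc.
  by move=> y; rewrite normc_rc.
split => //.
pose Bf (v : RT R n) := bracket (vec v) `^ bexp * normc (f (vec v)).
pose Bg (v : RT R n) := normc (g (vec v)).
have mBf : measurable_fun setT Bf.
  by apply: measurable_funM; [exact: measurable_bracket_powR|exact: Cmeas_normc gf.2].
have mBg : measurable_fun setT Bg by exact: Cmeas_normc gg.2.
pose B (y : T) := Bf y.1 * Bg y.2.
have mB : measurable_fun setT B.
  apply: measurable_funM; first by apply: (measurableT_comp mBf); exact: measurable_fst.
  by apply: (measurableT_comp mBg); exact: measurable_snd.
have AB y : normc (A y) <= B y * pair_weight y.
  have -> : normc (A y) = `|q y| * (normc (f (vec y.1)) * normc (g (vec y.2))).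
    by rewrite /A (normcM (q y)%:C) normc_rc normcM.
  have -> : B y * pair_weight y = Num.sqrt (2 * angle (s * s') 0 (vec y.1) (vec y.2)) *
     (normc (f (vec y.1)) * normc (g (vec y.2))).
    have bb : bracket (vec y.1) `^ bexp * bracket (vec y.1) `^ (- bexp) = 1.
      by rewrite -powRD ?subrr ?powRr0// (gt_eqF (bracket_gt0 _)) implybT.
    rewrite /B /Bf /Bg /pair_weight.
    transitivity ((bracket (vec y.1) `^ bexp * bracket (vec y.1) `^ (- bexp)) * (Num.sqrt (2 * angle (s * s') 0 (vec y.1) (vec y.2)) *
     (normc (f (vec y.1)) * normc (g (vec y.2))))); first by ring.
    by rewrite bb mul1r.
  apply: ler_wpM2r; first by rewrite mulr_ge0 ?normc_ge0.
  by rewrite -sqrtr_sqr ler_wsqrtr.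
have bM0 : 0 <= bilinM.
  apply: mulr_ge0; last exact: rowM_ge0.
  by apply: mulr_ge0 => //; apply: exprn_ge0; apply: mulr_ge0 => //; exact: pi_ge0.
have mBf2 : measurable_fun setT (fun v => (Bf v ^+ 2)%:E) by apply/measurable_EFinP; exact: measurable_funX.
have mBg2 : measurable_fun setT (fun v => (Bg v ^+ 2)%:E) by apply/measurable_EFinP; exact: measurable_funX.
have prodE : (\int[mu]_y (B y ^+ 2)%:E = \int[leb R n]_v (Bf v ^+ 2)%:E * \int[leb R n]_v (Bg v ^+ 2)%:E)%E.
  pose B2 (y : T) : R := B y ^+ 2.
  have mB2 : measurable_fun setT (EFin \o B2) by apply/measurable_EFinP; exact: measurable_funX.
  have B20 y : (0 <= (EFin \o B2) y)%E by rewrite /= lee_fin sqr_ge0.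
  rewrite [LHS](@fubini_tonelli1 _ _ _ _ _ (leb R n) (leb R n) _ mB2 B20) /fubini_F /=.
  have g0 (v : RT R n) : setT v -> (0 <= (Bg v ^+ 2)%:E)%E by rewrite lee_fin sqr_ge0.
  have f0 (v : RT R n) : setT v -> (0 <= (Bf v ^+ 2)%:E)%E by rewrite lee_fin sqr_ge0.
  have Ig0 : (0 <= \int[leb R n]_v (Bg v ^+ 2)%:E)%E by exact: integral_ge0.
  rewrite -(ge0_integralZr (leb R n) measurableT mBf2 f0 Ig0).
  apply: eq_integral => x _.
  rewrite -(ge0_integralZl_EFin (leb R n) measurableT g0 mBg2 (sqr_ge0 (Bf x))).
  by apply: eq_integral => y _; rewrite /B2 /B exprMn EFinM.
rewrite -prodE.
apply: (@fatou_le _ _ _ (leb R (1 + n)) (fun k z => normc (Jt mu A pairP (vec z)) ^+ 2 * poisW (anisotropic k) (vec z))).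
- move=> k; apply: measurable_funM; last exact: measurable_poisW.
  apply: measurable_funX; apply: Cmeas_normc.
  have [c1 c2] := Jt_continuous Ai rvmeas_pairP.
  by split; [exact: (continuous_vec_measurable c1)|exact: (continuous_vec_measurable c2)].
- by move=> k z; rewrite mulr_ge0 ?sqr_ge0 ?poisW_ge0.
- move=> z; apply: cvgM; first exact: cvg_cst.
  have -> : (fun k => poisW (anisotropic k) (vec z)) = (fun k => expR (- `|vec z 0 ord0|) * W (dseq k) (Defs.space (vec z))).
    apply/funext => k; rewrite {1}(event_split (vec z)) /poisW big_ord_recl event0.
    rewrite /anisotropic eqxx mul1r; congr (_ * _).
    by apply: eq_bigr => j _; rewrite event_lift.
  rewrite -[X in _ --> X]mulr1; apply: cvgM; [exact: cvg_cst|exact: W_cvg].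
- move=> k.
  exact: (schur_test Ai rvmeas_pairP (anisotropic_gt0 k) mB measurable_pair_weight AB bM0 (pair_row_bound k)).
Qed.
End Bilinear.

(** * The null form estimate *)

Section Contraction.
Context {R : realType}.
Local Notation C := R[i].
Variable n : nat.
Local Notation sp j := (rshift 1 j : 'I_(1 + n)).

Lemma null_form_contraction (Q : null_form n) (f g : 'rV[R]_(1 + n) -> C) p :
  null_form_eval Q f g p = null_contraction Q (fun a b => partial a f p * partial b g p).
Proof. by case: Q. Qed.

Lemma null_contractionD (V : zmodType) (Q : null_form n) (M N : 'I_(1 + n) -> 'I_(1 + n) -> V) :
  null_contraction Q (fun a b => M a b + N a b) = null_contraction Q M + null_contraction Q N.
Proof.
case: Q => [|a b] /=; last by rewrite opprD addrACA.
by rewrite big_split /= opprD addrACA.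
Qed.

Lemma null_contractionZ (A : pzRingType) (Q : null_form n) (M : 'I_(1 + n) -> 'I_(1 + n) -> A) (k : A) :
  null_contraction Q (fun a b => k * M a b) = k * null_contraction Q M.
Proof. by case: Q => [|a b] /=; rewrite mulrBr// mulr_sumr. Qed.

Lemma Cint_null_contraction d (T : measurableType d) (mu : {measure set T -> \bar R})
    (Q : null_form n) (F : 'I_(1 + n) -> 'I_(1 + n) -> T -> C) :
  (forall a b, Cintegrable mu (F a b)) ->
  null_contraction Q (fun a b => Cint mu (F a b)) =
  Cint mu (fun y => null_contraction Q (fun a b => F a b y)).
Proof.
move=> iF; have sub (f g : T -> C) : Cintegrable mu f -> Cintegrable mu g ->
    Cint mu f - Cint mu g = Cint mu (fun y => f y - g y).
  move=> fi gi; rewrite -mulN1r -(CintZl _ gi) -(CintD fi (CintegrableZl _ gi)).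
  by congr Cint; apply/funext => y; rewrite mulN1r.
case: Q => [|a b] /=; last exact: sub.
rewrite -(Cint_sum (fun j => iF (sp j) (sp j))); apply: sub => //.
exact: Cintegrable_sum.
Qed.

Lemma null_contraction_rc (Q : null_form n) (M : 'I_(1 + n) -> 'I_(1 + n) -> R) :
  null_contraction Q (fun a b => (M a b)%:C : C) = (null_contraction Q M)%:C.
Proof.
apply: eqC; case: Q => [|a b]; rewrite ?(reD,imD,reN,imN,re_sum,im_sum) /= ?subr0 ?oppr0//.
by rewrite big1// subr0.
Qed.

Lemma normc_sqr_sum4 (a b c d : C) :
  normc (a + b + (c + d)) ^+ 2 <= 4 * (normc a ^+ 2 + normc b ^+ 2 + (normc c ^+ 2 + normc d ^+ 2)).
Proof.
rewrite !normc_sqr !(reD,imD).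
have sq4 (x y z w : R) : (x + y + (z + w)) ^+ 2 <= 4 * (x ^+ 2 + y ^+ 2 + (z ^+ 2 + w ^+ 2)).
  have := sqr_ge0 (x - y); have := sqr_ge0 (z - w); have := sqr_ge0 (x - z).
  have := sqr_ge0 (x - w); have := sqr_ge0 (y - z); have := sqr_ge0 (y - w); nra.
have h1 := sq4 (re a) (re b) (re c) (re d); have h2 := sq4 (im a) (im b) (im c) (im d).
lra.
Qed.

Lemma ge0_integral_sum4 d (T : measurableType d) (mu : {measure set T -> \bar R}) (f g h k : T -> \bar R) :
  (forall x, setT x -> (0 <= f x)%E) -> (forall x, setT x -> (0 <= g x)%E) ->
  (forall x, setT x -> (0 <= h x)%E) -> (forall x, setT x -> (0 <= k x)%E) ->
  measurable_fun setT f -> measurable_fun setT g -> measurable_fun setT h -> measurable_fun setT k ->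
  (\int[mu]_x (f x + g x + (h x + k x)) =
   \int[mu]_x f x + \int[mu]_x g x + (\int[mu]_x h x + \int[mu]_x k x))%E.
Proof.
move=> f0 g0 h0 k0 mf mg mh mk.
have fg0 x : setT x -> (0 <= f x + g x)%E by move=> xT; rewrite adde_ge0 ?f0 ?g0.
have hk0 x : setT x -> (0 <= h x + k x)%E by move=> xT; rewrite adde_ge0 ?h0 ?k0.
rewrite (ge0_integralD mu measurableT fg0 (emeasurable_funD mf mg) hk0 (emeasurable_funD mh mk)).
by rewrite !ge0_integralD.
Qed.

(** Bookkeeping of the four pairs of signs. *)
Lemma combine_pairs (k b c : R) (I J I' J' X X' Y Y' U V : \bar R) :
  0 <= k -> 0 <= b ->
  (0 <= X -> 0 <= X' -> 0 <= Y -> 0 <= Y' -> X + X' <= c%:E * U -> Y + Y' <= c%:E * V ->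
   I <= b%:E * (X * Y) -> J <= b%:E * (X * Y') ->
   I' <= b%:E * (X' * Y) -> J' <= b%:E * (X' * Y') ->
   k%:E * (I + J + (I' + J')) <= (k * b * c ^+ 2)%:E * (U * V))%E.
Proof.
move=> k0 b0 X0 X'0 Y0 Y'0 XU YV hI hJ hI' hJ'.
rewrite -[k * b * _]mulrA EFinM -muleA; apply: lee_wpmul2l; first by rewrite lee_fin.
apply: (@le_trans _ _ (b%:E * ((X + X') * (Y + Y')))%E); last first.
  rewrite EFinM -muleA; apply: lee_wpmul2l; first by rewrite lee_fin.
  have -> : ((c ^+ 2)%:E * (U * V) = (c%:E * U) * (c%:E * V))%E by rewrite expr2 EFinM muleACA.
  by apply: lee_pmul => //; apply: adde_ge0.
rewrite ge0_muleDl// !ge0_muleDr ?(adde_ge0, mule_ge0)//.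
by apply: leeD; apply: leeD.
Qed.

Lemma weight_absorb (c k w x a b a' b' : R) : 0 <= k -> 1 <= c * w ->
  x <= 4 * (a + b + (a' + b')) -> 0 <= a + b + (a' + b') ->
  k * x <= c * (4 * k) * (a * w + b * w + (a' * w + b' * w)).
Proof.
move=> k0 w1 xs s0; apply: (le_trans (ler_wpM2l k0 xs)).
rewrite (_ : _ * (_ + _ + _) = (c * w) * (k * (4 * (a + b + (a' + b'))))); last by ring.
by rewrite ler_peMl// mulr_ge0// mulr_ge0.
Qed.
End Contraction.

Section ScalarEstimate.
Context {R : realType}.
Local Notation C := R[i].
Local Notation normcM := ComplexField.Normc.normcM.
Variables (n : nat) (e : R).
Hypotheses (n0 : (0 < n)%N) (e0 : 0 < e).
Local Notation T := (RT R n * RT R n)%type.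
Local Notation mu := (prodm (leb R n) (leb R n)).
Let bexp : R := (n%:R - 1) / 2 + e.

Definition scalar_wave (u : 'rV[R]_(1 + n) -> C) :=
  [/\ Cdiff 2 u, forall p, box u p = 0 & forall t, schwartz (fun x => u (event t x))].

Lemma powwave0 u : scalar_wave u -> powwave u 0 = u.
Proof.
move=> [u2 bu su]; apply/funext => p; rewrite [in RHS](event_split p) /powwave /multiplier.
have -> : (fun xi : 'rV[R]_n => (bracket xi `^ 0)%:C * fourier (fun x => u (event (time p) x)) xi) =
    fourier (slice u (time p)).
  by apply/funext => xi; rewrite powRr0 mul1r.
exact: fourier_inversion (slice_schwartz su (time p)).
Qed.

Definition energy_density u t (v : RT R n) : R :=
  \sum_(j < n) normc (dx j u (event t (vec v))) ^+ 2 + normc (dt u (event t (vec v))) ^+ 2.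

Lemma energy_density_ge0 u t v : 0 <= energy_density u t v.
Proof. by rewrite addr_ge0 ?sqr_ge0//; apply: sumr_ge0 => j _; exact: sqr_ge0. Qed.

Lemma measurable_energy_density u k t : scalar_wave u ->
  measurable_fun setT (energy_density (powwave u k) t).
Proof.
move=> [u2 bu su].
have mp i : measurable_fun setT (fun v : RT R n => normc (partial i (powwave u k) (event t (vec v))) ^+ 2).
  apply: measurable_funX.
  rewrite (_ : (fun v : RT R n => _) = (fun v => `|coef n / 2| *
      normc (Jt (leb R n) (wave_amp u k i t \o @vec R n) (@vec R n) (vec v)))); last first.
    apply/funext => v; rewrite (partial_powwave n0 u2 bu su) (normcM (coef n / 2)%:C) normc_rc.
    by rewrite (two_waves_event u2 bu su).
  apply: measurable_funM; first exact: measurable_cst.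
  apply: Cmeas_normc.
  have rvv : @rvmeas R _ (RT R n) n (@vec R n) by move=> i'; exact: measurable_vec_coord.
  have [c1 c2] := Jt_continuous (good_integrable (good_wave_amp u2 bu su k i t)) rvv.
  by split; [exact: (continuous_vec_measurable c1)|exact: (continuous_vec_measurable c2)].
have ms : measurable_fun setT (fun v : RT R n => \sum_(j < n) normc (partial (rshift 1 j) (powwave u k) (event t (vec v))) ^+ 2).
  by apply: measurable_sum => j; exact: mp.
exact: measurable_funD ms (mp ord0).
Qed.

Section pair.
Variables (u v : 'rV[R]_(1 + n) -> C).
Hypotheses (wu : scalar_wave u) (wv : scalar_wave v).
Variable Q : null_form n.

(** The sign is i^2, from one derivative on each factor. *)
Definition pair_symbol (s s' : R) (y : T) : R :=
  - null_contraction Q (fun a b => symb s a (vec y.1) * symb s' b (vec y.2)).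

Definition pair_amp (s s' : R) (y : T) : C :=
  (pair_symbol s s' y)%:C * (pprofile u 0 s (vec y.1) * pprofile v 0 s' (vec y.2)).

Let N1 : (-1 : R) ^+ 2 = 1. Proof. by rewrite sqrrN expr1n. Qed.
Let P1 : (1 : R) ^+ 2 = 1. Proof. by rewrite expr1n. Qed.

Let halfwave_product (s s' : R) p : s ^+ 2 = 1 -> s' ^+ 2 = 1 ->
  null_contraction Q (fun a b => halfwave s (amp u 0 s a) p * halfwave s' (amp v 0 s' b) p) =
  Jt mu (pair_amp s s') (pairP s s') p.
Proof.
move=> s2 s2'; have [u2 bu su] := wu; have [v2 bv sv] := wv.
have iu a := @Jt_integrable R _ _ (leb R n) _ _ _ p (good_integrable (good_amp u2 bu su 0 a s2)) (rvmeas_halfP s).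
have iv b := @Jt_integrable R _ _ (leb R n) _ _ _ p (good_integrable (good_amp v2 bv sv 0 b s2')) (rvmeas_halfP s').
pose F a b (y : T) := (amp u 0 s a (vec y.1) * cis (dotp p (halfP s (vec y.1)))) *
  (amp v 0 s' b (vec y.2) * cis (dotp p (halfP s' (vec y.2)))).
have iF a b : Cintegrable mu (F a b) by exact: (Cintegrable_prodM (iu a) (iv b)).
transitivity (null_contraction Q (fun a b => Cint mu (F a b))).
  congr null_contraction; apply/funext => a; apply/funext => b.
  by rewrite /halfwave /Jt; symmetry; exact: (Cint_prodM (iu a) (iv b)).
rewrite (Cint_null_contraction _ iF) /Jt; congr Cint; apply/funext => y.
have -> : cis (dotp p (pairP s s' y)) = cis (dotp p (halfP s (vec y.1))) * cis (dotp p (halfP s' (vec y.2))) :> C.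
  by rewrite -cisD /pairP dotpC dotpDl !(dotpC _ p).
set c1 := cis _; set c2 := cis _; set f := pprofile u 0 s (vec y.1); set g := pprofile v 0 s' (vec y.2).
have -> : (fun a b => F a b y) = (fun a b => (- (f * g * c1 * c2)) * (symb s a (vec y.1) * symb s' b (vec y.2))%:C).
  apply/funext => a; apply/funext => b; rewrite /F !ampE -/f -/g -/c1 -/c2.
  have rcM (x z : R) : (x * z)%:C = x%:C * z%:C :> C.
    by apply: eqC; rewrite /= ?(mulr0, mul0r, subr0, addr0).
  have ii : 'i * 'i = -1 :> C by apply: eqC; rewrite !(reM,imM,reN,imN) /=; ring.
  rewrite rcM; set x := (_ a _)%:C; set z := (_ b _)%:C.
  transitivity (('i * 'i) * (f * g * c1 * c2) * (x * z)); first by ring.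
  by rewrite ii mulN1r.
rewrite null_contractionZ null_contraction_rc /pair_amp /pair_symbol -/f -/g.
have -> : (- null_contraction Q (fun a b => symb s a (vec y.1) * symb s' b (vec y.2)))%:C =
   - (null_contraction Q (fun a b => symb s a (vec y.1) * symb s' b (vec y.2)))%:C :> C.
  by apply: eqC; rewrite /= ?oppr0.
by rewrite /=; ring.
Qed.

Lemma null_form_pairs p : null_form_eval Q u v p = ((coef n / 2) ^+ 2)%:C *
  (Jt mu (pair_amp 1 1) (pairP 1 1) p + Jt mu (pair_amp 1 (-1)) (pairP 1 (-1)) p +
   (Jt mu (pair_amp (-1) 1) (pairP (-1) 1) p + Jt mu (pair_amp (-1) (-1)) (pairP (-1) (-1)) p)).
Proof.
have [u2 bu su] := wu; have [v2 bv sv] := wv.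
rewrite null_form_contraction -!halfwave_product//.
have -> : (fun a b => partial a u p * partial b v p) =
    (fun a b => ((coef n / 2) ^+ 2)%:C * (two_waves u 0 a p * two_waves v 0 b p)).
  apply/funext => a; apply/funext => b.
  rewrite -{1}(powwave0 wu) -{1}(powwave0 wv) (partial_powwave n0 u2 bu su) (partial_powwave n0 v2 bv sv).
  have -> : ((coef n / 2) ^+ 2)%:C = (coef n / 2)%:C * (coef n / 2)%:C :> C.
    by apply: eqC; rewrite ?(reM,imM) /= ?(mulr0, mul0r, subr0, addr0) ?expr2.
  by rewrite mulrACA.
rewrite null_contractionZ; congr (_ * _).
pose H s s' a b := halfwave s (amp u 0 s a) p * halfwave s' (amp v 0 s' b) p.
rewrite -[RHS]/(null_contraction Q (H 1 1) + null_contraction Q (H 1 (-1)) +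
  (null_contraction Q (H (-1) 1) + null_contraction Q (H (-1) (-1)))).
transitivity (null_contraction Q (fun a b => (H 1 1 a b + H 1 (-1) a b) + (H (-1) 1 a b + H (-1) (-1) a b))).
  by congr null_contraction; apply/funext => a; apply/funext => b; rewrite /two_waves mulrDl 2!mulrDr.
rewrite (null_contractionD Q (fun a b => H 1 1 a b + H 1 (-1) a b)).
by rewrite (null_contractionD Q (H 1 1)) (null_contractionD Q (H (-1) 1)).
Qed.

Let measurable_pair_symbol (s s' : R) : measurable_fun setT (pair_symbol s s').
Proof.
have m a b : measurable_fun setT (fun y : T => symb s a (vec y.1) * symb s' b (vec y.2)).
  apply: measurable_funM.
    by apply: (measurableT_comp (@measurable_symb R n s a)); exact: measurable_fst.
  by apply: (measurableT_comp (@measurable_symb R n s' b)); exact: measurable_snd.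
rewrite /pair_symbol; apply: measurable_funN; case: Q => [|a b] /=.
  have ms : measurable_fun setT (fun y : T => \sum_(j < n) symb s (rshift 1 j) (vec y.1) * symb s' (rshift 1 j) (vec y.2)).
    by apply: measurable_sum => j; exact: m.
  exact: measurable_funB (m _ _) ms.
exact: measurable_funB (m _ _) (m _ _).
Qed.

Let X s := (\int[leb R n]_x (normc (pprofile u bexp s (vec x)) ^+ 2)%:E)%E.
Let Y s := (\int[leb R n]_x (normc (pprofile v 0 s (vec x)) ^+ 2)%:E)%E.

Let pair_bound (s s' : R) : s ^+ 2 = 1 -> s' ^+ 2 = 1 -> Cintegrable mu (pair_amp s s') /\
  (\int[leb R (1 + n)]_z (normc (Jt mu (pair_amp s s') (pairP s s') (vec z)) ^+ 2 * expR (- `|vec z 0 ord0|))%:E <=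
   (bilinM n e)%:E * (X s * Y s'))%E.
Proof.
move=> s2 s2'; have [u2 bu su] := wu; have [v2 bv sv] := wv.
have qb (y : T) : pair_symbol s s' y ^+ 2 <= 2 * angle (s * s') 0 (vec y.1) (vec y.2).
  by rewrite /pair_symbol sqrrN; exact: null_symbol_bound.
have [h1 h2] := pair_bilinear_bound n0 e0 s2 s2' (good_pprofile u2 bu su 0 s) (good_pprofile v2 bv sv 0 s')
  (measurable_pair_symbol s s') qb.
split; first exact: h1.
apply: (le_trans h2); rewrite le_eqVlt; apply/orP; left; apply/eqP.
congr (_ * (_ * _))%E; apply: eq_integral => x _; congr ((_ ^+ 2)%:E).
rewrite /pprofile (normcM (_ `^ 0)%:C) (normcM (_ `^ bexp)%:C) !normc_rc powRr0 normr1 mul1r.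
by rewrite ger0_norm ?powR_ge0.
Qed.

(** The slab costs a factor e, the sum over four pairs of signs a factor 4, the
    normalisation of [null_form_pairs] a power of coef n / 2, and each energy a
    factor from [profile_energy]. *)
Definition slabM : R := expR 1 * (4 * (coef n / 2) ^+ 4) * bilinM n e * (2 * (2 * pi) ^+ n) ^+ 2.

Let bilinM_ge0 : 0 <= bilinM n e.
Proof.
apply: mulr_ge0; last exact: rowM_ge0.
by apply: mulr_ge0 => //; apply: exprn_ge0; apply: mulr_ge0 => //; exact: pi_ge0.
Qed.

Lemma slabM_ge0 : 0 <= slabM.
Proof.
apply: mulr_ge0; last exact: sqr_ge0.
apply: mulr_ge0 => //; apply: mulr_ge0; first exact: expR_ge0.
by apply: mulr_ge0 => //; rewrite exprn_even_ge0.
Qed.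

Lemma measurable_slab : measurable (@slab R n).
Proof.
have m0 := @measurable_vec_coord R (1 + n) ord0.
have := m0 measurableT _ (measurable_itv `[(0 : R), 1]); rewrite setTI.
by rewrite (_ : _ @^-1` _ = @slab R n).
Qed.

Let J s s' (z : RT R (1 + n)) := Jt mu (pair_amp s s') (pairP s s') (vec z).

Let mJ s s' : s ^+ 2 = 1 -> s' ^+ 2 = 1 -> Cmeas (J s s').
Proof.
move=> s2 s2'; have [i1 _] := pair_bound s2 s2'.
have [c1 c2] := Jt_continuous i1 (rvmeas_pairP s s').
by split; [exact: (continuous_vec_measurable c1)|exact: (continuous_vec_measurable c2)].
Qed.

Let nullE z : null_form_eval Q u v (vec z) =
  ((coef n / 2) ^+ 2)%:C * (J 1 1 z + J 1 (-1) z + (J (-1) 1 z + J (-1) (-1) z)).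
Proof. exact: null_form_pairs. Qed.

Lemma measurable_null_form : measurable_fun setT (fun z : RT R (1 + n) => normc (null_form_eval Q u v (vec z)) ^+ 2).
Proof.
apply: measurable_funX; apply: Cmeas_normc.
rewrite (_ : (fun z : RT R (1 + n) => _) = (fun z => ((coef n / 2) ^+ 2)%:C * (J 1 1 z + J 1 (-1) z + (J (-1) 1 z + J (-1) (-1) z)))).
  apply: CmeasM; first exact: Cmeas_cst.
  exact: (CmeasD (CmeasD (mJ P1 P1) (mJ P1 N1)) (CmeasD (mJ N1 P1) (mJ N1 N1))).
by apply/funext => z; exact: nullE.
Qed.

Lemma scalar_null_estimate t1 t2 :
  (\int[leb R (1 + n)]_(z in @slab R n) (normc (null_form_eval Q u v (vec z)) ^+ 2)%:E <=
   slabM%:E * (\int[leb R n]_x (energy_density (powwave u bexp) t1 x)%:E *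
     \int[leb R n]_x (energy_density v t2 x)%:E))%E.
Proof.
have [u2 bu su] := wu; have [v2 bv sv] := wv.
pose h s s' z := normc (J s s' z) ^+ 2 * expR (- `|vec z 0 ord0|).
have h0 s s' z : 0 <= h s s' z by rewrite mulr_ge0 ?sqr_ge0 ?expR_ge0.
have mexp : measurable_fun setT (fun z : RT R (1 + n) => expR (- `|vec z 0 ord0|)).
  apply: (measurableT_comp (@measurable_expR R)); apply: measurable_funN.
  by apply: (measurableT_comp (@normr_measurable R setT)); exact: measurable_vec_coord.
have mh s s' : s ^+ 2 = 1 -> s' ^+ 2 = 1 -> measurable_fun setT (fun z => (h s s' z)%:E).
  move=> s2 s2'; apply/measurable_EFinP; apply: measurable_funM => //.
  by apply: measurable_funX; apply: Cmeas_normc; exact: mJ.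
have hE0 s s' z : setT z -> (0 <= (h s s' z)%:E)%E by rewrite lee_fin.
pose C0 : R := expR 1 * (4 * (coef n / 2) ^+ 4).
have C00 : 0 <= C0.
  by apply: mulr_ge0; [exact: expR_ge0|apply: mulr_ge0 => //; rewrite exprn_even_ge0].
pose H z : \bar R := ((h 1 1 z)%:E + (h 1 (-1) z)%:E + ((h (-1) 1 z)%:E + (h (-1) (-1) z)%:E))%E.
have H0 z : setT z -> (0 <= H z)%E.
  by move=> _; rewrite /H -!EFinD lee_fin; apply: addr_ge0; apply: addr_ge0.
have mH1 := emeasurable_funD (mh 1 1 P1 P1) (mh 1 (-1) P1 N1).
have mH2 := emeasurable_funD (mh (-1) 1 N1 P1) (mh (-1) (-1) N1 N1).
have mH : measurable_fun setT H by exact: emeasurable_funD mH1 mH2.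
have pw : (\int[leb R (1 + n)]_(z in @slab R n) (normc (null_form_eval Q u v (vec z)) ^+ 2)%:E <=
    \int[leb R (1 + n)]_z (C0%:E * H z))%E.
  rewrite integral_mkcond; apply: ge0_le_integral => //.
  - by move=> z _; rewrite /patch; case: ifP => // _; rewrite lee_fin sqr_ge0.
  - apply/(measurable_restrictT _ measurable_slab); apply: measurable_funTS.
    by apply/measurable_EFinP; exact: measurable_null_form.
  - by apply: emeasurable_funM => //; exact: measurable_cst.
  move=> z _; rewrite /patch; case: ifPn => zs; last by apply: mule_ge0; [rewrite lee_fin|exact: H0].
  rewrite /H -!EFinD -EFinM lee_fin nullE (normcM ((coef n / 2) ^+ 2)%:C) normc_rc.
  rewrite exprMn real_normK ?num_real// -exprM -[(2 * 2)%N]/4%N.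
  (* on the slab the weight e^(-|t|) is at least 1/e *)
  have t01 : 1 <= expR 1 * expR (- `|vec z 0 ord0|).
    have /andP[t0 t1'] : 0 <= vec z 0 ord0 <= 1 by move: zs; rewrite inE.
    rewrite -expRD -[leLHS](@expR0 R) ler_expR ger0_norm//; lra.
  have n4 := normc_sqr_sum4 (J 1 1 z) (J 1 (-1) z) (J (-1) 1 z) (J (-1) (-1) z).
  have S0 : 0 <= normc (J 1 1 z) ^+ 2 + normc (J 1 (-1) z) ^+ 2 + (normc (J (-1) 1 z) ^+ 2 + normc (J (-1) (-1) z) ^+ 2).
    by apply: addr_ge0; apply: addr_ge0; exact: sqr_ge0.
  have c40 : 0 <= (coef n / 2) ^+ 4 :> R by rewrite exprn_even_ge0.
  exact (weight_absorb c40 t01 n4 S0).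
apply: (le_trans pw); rewrite (ge0_integralZl_EFin _ measurableT H0 mH C00).
have IH : (\int[leb R (1 + n)]_z H z = \int[leb R (1 + n)]_z (h 1 1 z)%:E + \int[leb R (1 + n)]_z (h 1 (-1) z)%:E +
   (\int[leb R (1 + n)]_z (h (-1) 1 z)%:E + \int[leb R (1 + n)]_z (h (-1) (-1) z)%:E))%E.
  exact (ge0_integral_sum4 _ (hE0 _ _) (hE0 _ _) (hE0 _ _) (hE0 _ _)
    (mh _ _ P1 P1) (mh _ _ P1 N1) (mh _ _ N1 P1) (mh _ _ N1 N1)).
rewrite IH.
have X0 s : (0 <= X s)%E by apply: integral_ge0 => x _; rewrite lee_fin sqr_ge0.
have Y0 s : (0 <= Y s)%E by apply: integral_ge0 => x _; rewrite lee_fin sqr_ge0.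
have sumX : (X 1 + X (-1) <= (2 * (2 * pi) ^+ n)%:E * \int[leb R n]_x (energy_density (powwave u bexp) t1 x)%:E)%E.
  apply: le_trans (profile_energy n0 u2 bu su bexp t1).
  have m sg : measurable_fun setT (fun x : RT R n => (normc (pprofile u bexp sg (vec x)) ^+ 2)%:E).
    by apply/measurable_EFinP; apply: measurable_funX; apply: Cmeas_normc; exact: (good_pprofile u2 bu su _ _).2.
  have p0 sg (x : RT R n) : setT x -> (0 <= (normc (pprofile u bexp sg (vec x)) ^+ 2)%:E)%E by rewrite lee_fin sqr_ge0.
  by rewrite /X -(ge0_integralD _ measurableT (p0 _) (m _) (p0 _) (m _)).
have sumY : (Y 1 + Y (-1) <= (2 * (2 * pi) ^+ n)%:E * \int[leb R n]_x (energy_density v t2 x)%:E)%E.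
  have pe := profile_energy n0 v2 bv sv 0 t2; rewrite (powwave0 wv) in pe.
  apply: le_trans pe.
  have m sg : measurable_fun setT (fun x : RT R n => (normc (pprofile v 0 sg (vec x)) ^+ 2)%:E).
    by apply/measurable_EFinP; apply: measurable_funX; apply: Cmeas_normc; exact: (good_pprofile v2 bv sv _ _).2.
  have p0 sg (x : RT R n) : setT x -> (0 <= (normc (pprofile v 0 sg (vec x)) ^+ 2)%:E)%E by rewrite lee_fin sqr_ge0.
  by rewrite /Y -(ge0_integralD _ measurableT (p0 _) (m _) (p0 _) (m _)).
set EU := (\int[leb R n]_x (energy_density (powwave u bexp) t1 x)%:E)%E in sumX *.
set EV := (\int[leb R n]_x (energy_density v t2 x)%:E)%E in sumY *.
have EU0 : (0 <= EU)%E by apply: integral_ge0 => x _; rewrite lee_fin energy_density_ge0.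
have EV0 : (0 <= EV)%E by apply: integral_ge0 => x _; rewrite lee_fin energy_density_ge0.
exact (combine_pairs C00 bilinM_ge0 (X0 1) (X0 (-1)) (Y0 1) (Y0 (-1)) sumX sumY
  (pair_bound P1 P1).2 (pair_bound P1 N1).2 (pair_bound N1 P1).2 (pair_bound N1 N1).2).
Qed.

End pair.

End ScalarEstimate.

Lemma ge0_integral_sum_fin (R : realType) d (T : measurableType d) (mu : {measure set T -> \bar R})
    (D : set T) m (f : 'I_m -> T -> R) : measurable D ->
  (forall i, measurable_fun setT (f i)) -> (forall i x, 0 <= f i x) ->
  (\int[mu]_(x in D) (\sum_i f i x)%:E = \sum_i \int[mu]_(x in D) (f i x)%:E)%E.
Proof.
move=> mD mf f0; rewrite -ge0_integral_sum//.
- by apply: eq_integral => x _; rewrite sumEFin.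
- by move=> i; apply/measurable_EFinP; exact: measurable_funTS.
- by move=> i x _; rewrite lee_fin.
Qed.

Lemma energyE (R : realType) n m (phi : @vfield R n m) t :
  (forall k, measurable_fun setT (energy_density (phi k) t)) ->
  (\sum_(k < m) \int[leb R n]_x (energy_density (phi k) t x)%:E = 2%:E * energy phi t)%E.
Proof.
move=> mphi; rewrite /energy muleA -EFinM mulfV ?pnatr_eq0// mul1e.
rewrite -(ge0_integral_sum_fin (leb R n) measurableT mphi)// => k x.
exact: energy_density_ge0.
Qed.

Lemma energy_ge0 (R : realType) n m (phi : @vfield R n m) t : (0 <= energy phi t)%E.
Proof.
rewrite /energy mule_ge0 ?lee_fin ?invr_ge0//; apply: integral_ge0 => x _.
by rewrite lee_fin; apply: sumr_ge0 => k _; exact: energy_density_ge0.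
Qed.

(* The energy of a free wave does not depend on time, so both energies are
   read at arbitrary times. *)
Theorem corollary1p3 (R : realType) (n : nat) (eps : R) (m1 m2 : nat) :
  (2 <= n)%N -> 0 < eps ->
  exists2 C : R, 0 < C &
    forall (Q : null_form n) (phi : @vfield R n m1) (psi : @vfield R n m2),
      free_wave phi -> free_wave psi ->
      forall s t : R,
        (null_form_L2 Q phi psi <=
           C%:E
           * energy (bracketD ((n%:R - 1) / 2 + eps) phi) s `^ 2^-1
           * energy psi t `^ 2^-1)%E.
Proof.
move=> n2 eps0; have n0 : (0 < n)%N by exact: leq_trans n2.
pose K : R := slabM n eps; have K0 : 0 <= K by exact: slabM_ge0.
pose b : R := (n%:R - 1) / 2 + eps.
(* the 4 comes from the factor 1/2 in each energy; adding 1 makes the constant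
   positive *)
pose C1 : R := K * 4 + 1; have C10 : 0 < C1 by rewrite ltr_wpDl// mulr_ge0.
exists (C1 `^ 2^-1); first exact: powR_gt0.
move=> Q phi psi wphi wpsi s t; rewrite -/b.
have wu j : scalar_wave (phi j) by have [] := wphi j.
have wv k : scalar_wave (psi k) by have [] := wpsi k.
have EU0 := energy_ge0 (bracketD b phi) s; have EV0 := energy_ge0 psi t.
pose f j k (z : RT R (1 + n)) := normc (null_form_eval Q (phi j) (psi k) (vec z)) ^+ 2.
have f0 j k z : 0 <= f j k z by exact: sqr_ge0.
have mf j k : measurable_fun setT (f j k) by exact: (measurable_null_form n0 eps0 (wu j) (wv k) Q).
have mslab := @measurable_slab R n.
have main : (\int[leb R (1 + n)]_(z in @slab R n) (\sum_j \sum_k f j k z)%:E <=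
    C1%:E * (energy (bracketD b phi) s * energy psi t))%E.
  have mfj j : measurable_fun setT (fun z => \sum_k f j k z) by apply: measurable_sum => k; exact: mf.
  rewrite (ge0_integral_sum_fin _ mslab mfj); last by move=> j z; apply: sumr_ge0.
  under eq_bigr do rewrite (ge0_integral_sum_fin _ mslab (mf _))//.
  pose EU j := (\int[leb R n]_x (energy_density (bracketD b phi j) s x)%:E)%E.
  pose EV k := (\int[leb R n]_x (energy_density (psi k) t x)%:E)%E.
  have EUj0 j : (0 <= EU j)%E by apply: integral_ge0 => x _; rewrite lee_fin energy_density_ge0.
  have EVk0 k : (0 <= EV k)%E by apply: integral_ge0 => x _; rewrite lee_fin energy_density_ge0.
  apply: (@le_trans _ _ (\sum_j \sum_k K%:E * (EU j * EV k))%E).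
    apply: lee_sum => j _; apply: lee_sum => k _.
    exact: (scalar_null_estimate n0 eps0 (wu j) (wv k) Q s t).
  have -> : (\sum_j \sum_k K%:E * (EU j * EV k) = K%:E * ((\sum_j EU j) * (\sum_k EV k)))%E.
    rewrite ge0_sume_distrl// ge0_sume_distrr; last first.
      by move=> j _; apply: mule_ge0 => //; apply: sume_ge0.
    apply: eq_bigr => j _; rewrite ge0_sume_distrr// ge0_sume_distrr// => k _.
    exact: mule_ge0.
  have -> : (\sum_j EU j = 2%:E * energy (bracketD b phi) s)%E.
    by apply: energyE => j; exact: (measurable_energy_density n0 b s (wu j)).
  have -> : (\sum_k EV k = 2%:E * energy psi t)%E.
    apply: energyE => k; rewrite -(powwave0 (wv k)).
    exact: (measurable_energy_density n0 0 t (wv k)).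
  have -> : (2%:E * energy (bracketD b phi) s * (2%:E * energy psi t) =
      4%:E * (energy (bracketD b phi) s * energy psi t))%E.
    by rewrite muleACA; congr (_ * _)%E; rewrite -EFinM; congr (_%:E); ring.
  have KC : (K%:E * 4%:E <= C1%:E)%E by rewrite -EFinM lee_fin /C1; lra.
  rewrite muleA; apply: lee_wpmul2r KC; exact: mule_ge0.
have I0 : (0 <= \int[leb R (1 + n)]_(z in @slab R n) (\sum_j \sum_k f j k z)%:E)%E.
  apply: integral_ge0 => z _; rewrite lee_fin; apply: sumr_ge0 => j _; exact: sumr_ge0.
have h2 : 0 <= 2^-1 :> R by rewrite invr_ge0.
rewrite /null_form_L2.
have R0 : (0 <= C1%:E * (energy (bracketD b phi) s * energy psi t))%E.
  by apply: mule_ge0; [rewrite lee_fin ltW|exact: mule_ge0].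
have iI : (\int[leb R (1 + n)]_(z in @slab R n) (\sum_j \sum_k f j k z)%:E)%E \in `[0%E, +oo%E] by rewrite in_itv /= I0 leey.
have iR : (C1%:E * (energy (bracketD b phi) s * energy psi t))%E \in `[0%E, +oo%E] by rewrite in_itv /= R0 leey.
apply: (le_trans (gt0_ler_poweR h2 iI iR main)).
rewrite poweRM ?lee_fin ?(ltW C10)//; last exact: mule_ge0.
by rewrite poweRM// poweR_EFin muleA.
Qed.
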